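(* Let $p(\cdot),q(\cdot)\in\mathcal{P}_0(\mathbb{R}^n)\cap C^{\log}(\mathbb{R}^n)$ and $s(\cdot)\in C^{\log}(\mathbb{R}^n)$. Let $\{a_{\nu,m}\}_{\nu\in\mathbb{N}_0,m\in\mathbb{Z}^n}$ be a family of smooth atoms for $B^{s(\cdot)}_{p(\cdot),q(\cdot)}(\mathbb{R}^n)$. If $\lambda=\{\lambda_{\nu,m}\}_{(\nu,m)\in\mathbb{N}_0\times\mathbb{Z}^n}\in b^{s(\cdot)}_{p(\cdot),q(\cdot)}$, then $$\left\|\sum_{\nu\in\mathbb{N}_0}\sum_{m\in\mathbb{Z}^n}\lambda_{\nu,m}a_{\nu,m}\right\|_{B^{s(\cdot)}_{p(\cdot),q(\cdot)}}\lesssim\|\lambda\|_{b^{s(\cdot)}_{p(\cdot),q(\cdot)}},$$ where the sum is taken in $\mathcal{S}'(\mathbb{R}^n)$ and the implicit constant does not depend on $\lambda$.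
   Context: For measurable $g$ on $\mathbb{R}^n$, $g^-$ and $g^+$ denote its essential infimum and supremum. $\mathcal{P}_0(\mathbb{R}^n)$ is the set of measurable $p:\mathbb{R}^n\to(0,\infty)$ with $0<p^-\le p^+<\infty$. $C^{\log}(\mathbb{R}^n)$ is the set of $p:\mathbb{R}^n\to\mathbb{R}$ for which there are $C_{\log}(p)>0$ and $p_\infty\in\mathbb{R}$ with $|p(x)-p(y)|\le C_{\log}(p)/\log(e+|x-y|^{-1})$ ($x\neq y$) and $|p(x)-p_\infty|\le C_{\log}(p)/\log(e+|x|)$. $\|f\|_{L^{p(\cdot)}}=\inf\{\lambda>0:\int(|f(x)|/\lambda)^{p(x)}dx\le1\}$. For sequences $\{f_j\}_{j\ge0}$ of measurable functions, $\|\{f_j\}\|_{\ell^{q(\cdot)}(L^{p(\cdot)})}=\inf\{\mu>0:\sum_{j=0}^\infty\||f_j/\mu|^{q(\cdot)}\|_{L^{p(\cdot)/q(\cdot)}}\le1\}$. $\Phi(\mathbb{R}^n)$ is the collection of systems $\{\theta_j\}_{j\ge0}\subset\mathcal{S}(\mathbb{R}^n)$ with $\operatorname{supp}\theta_0\subset\{|x|\le2\}$, $\operatorname{supp}\theta_j\subset\{2^{j-1}\le|x|\le2^{j+1}\}$ ($j\ge1$), $\sup_{j,x}2^{j|\alpha|}|D^\alpha\theta_j(x)|<\infty$ for every multi-index $\alpha$, and $\sum_j\theta_j\equiv1$. $\theta(D)f=\mathcal{F}^{-1}[\theta\cdot\mathcal{F}f]$. Fix $\theta\in\Phi(\mathbb{R}^n)$;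 $B^{s(\cdot)}_{p(\cdot),q(\cdot)}(\mathbb{R}^n)$ is the set of $f\in\mathcal{S}'(\mathbb{R}^n)$ with $\|f\|_{B^{s(\cdot)}_{p(\cdot),q(\cdot)}}=\|\{2^{js(\cdot)}\theta_j(D)f\}_{j\ge0}\|_{\ell^{q(\cdot)}(L^{p(\cdot)})}<\infty$. $Q_{\nu,m}=\prod_{i=1}^n[2^{-\nu}m_i,2^{-\nu}(m_i+1))$ with characteristic function $\chi_{\nu,m}$. $b^{s(\cdot)}_{p(\cdot),q(\cdot)}$ is the set of complex sequences $\lambda$ with $\|\lambda\|_{b^{s(\cdot)}_{p(\cdot),q(\cdot)}}=\|\{2^{\nu s(\cdot)}\sum_m\lambda_{\nu,m}\chi_{\nu,m}\}_{\nu\ge0}\|_{\ell^{q(\cdot)}(L^{p(\cdot)})}<\infty$. Atoms: fix $\gamma>1$. For $K\in\mathbb{N}_0$, $L\in\mathbb{Z}$, a function $a\in C^K(\mathbb{R}^n)$ is a $[K,L]$-atom centered at $Q_{\nu,m}$ if $\operatorname{supp}a\subset\gamma Q_{\nu,m}$, $\|\partial^\alpha a\|_\infty\le2^{\nu|\alpha|}$ for $|\alpha|\le K$, and, when $\nu\ge1$, $\int x^\beta a(x)dx=0$ for $|\beta|\le L$ (no moment condition if $L\le-1$, and none for $\nu=0$). For $L:\mathbb{R}^n\to\mathbb{R}$, $\{a_{\nu,m}\}$ is a family of $[K,L]$ smooth atoms if each $a_{\nu,m}$ is a $[K,\lfloor L^-_{Q_{\nu,m}}\rfloor]$-atom centered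 at $Q_{\nu,m}$, where $L^-_{Q_{\nu,m}}=\operatorname{ess\,inf}_{x\in Q_{\nu,m}}L(x)$. It is a family of smooth atoms for $B^{s(\cdot)}_{p(\cdot),q(\cdot)}(\mathbb{R}^n)$ if it is a family of $[K,L+\epsilon]$ smooth atoms for some constant $\epsilon>0$, some $K>s^+$, and $L(\cdot)=\sigma_{p(\cdot)}-s(\cdot)$, where $\sigma_{p(\cdot)}=n\left(\frac1{\min(1,p(\cdot))}-1\right)$. For such a family and $\lambda\in b^{s(\cdot)}_{p(\cdot),q(\cdot)}$ the sum $\sum_\nu\sum_m\lambda_{\nu,m}a_{\nu,m}$ converges in $\mathcal{S}'(\mathbb{R}^n)$. *)

(* Defs.v *)
From HB Require Import structures.
From mathcomp Require Import all_boot all_order all_algebra finmap.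
From mathcomp Require Import all_classical all_reals all_analysis.
From mathcomp Require Import complex.
From mathcomp Require Import ess_sup_inf.
From mathcomp.analysis Require Import showcase.summability.
Set Implicit Arguments.
Unset Strict Implicit.
Unset Printing Implicit Defensive.
Import Order.TTheory GRing.Theory Num.Theory.
Import numFieldNormedType.Exports.
Local Open Scope classical_set_scope.
Local Open Scope ring_scope.

(* R^n carries the product (= Borel) sigma-algebra. Lebesgue-measurable exponents
   are not needed: log-Hoelder continuous functions are Borel. *)
Section rV_measurable.
Context {R : realType} (n : nat).

Let coord (i : 'I_n) (x : 'rV[R]_n) : measurableTypeR R := x ord0 i.

Let rV_set0 : g_sigma_preimage coord set0.
Proof. exact: sigma_algebra0. Qed.

Let rV_setC A : g_sigma_preimage coord A -> g_sigma_preimage coord (~` A).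
Proof. exact: sigma_algebraC. Qed.

Let rV_bigcup (F : (set 'rV[R]_n)^nat) :
  (forall i, g_sigma_preimage coord (F i)) ->
  g_sigma_preimage coord (\bigcup_i (F i)).
Proof. exact: sigma_algebra_bigcup. Qed.

HB.instance Definition _ := @isMeasurable.Build default_measure_display
  'rV[R]_n (g_sigma_preimage coord) rV_set0 rV_setC rV_bigcup.

Lemma measurable_coord (i : 'I_n) :
  measurable_fun setT (fun x : 'rV[R]_n => x ord0 i : measurableTypeR R).
Proof.
move=> _ Y mY; rewrite setTI; apply: sub_sigma_algebra => /=.
rewrite -bigcup_seq/=; exists i => /=; first by rewrite mem_index_enum.
by exists Y => //; rewrite setTI.
Qed.

Lemma measurable_fun_rV d (T : measurableType d) (f : T -> 'rV[R]_n) :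
  (forall i, measurable_fun setT (fun t => f t ord0 i : measurableTypeR R)) ->
  measurable_fun setT f.
Proof.
move=> mf.
have sub : g_sigma_preimage (fun i t => coord i (f t)) `<=` measurable.
  apply: smallest_sub; first exact: sigma_algebra_measurable.
  rewrite -bigcup_seq; apply: bigcup_sub => i _ A [B mB <-]; exact: mf.
move=> _ A mA; rewrite setTI; apply: sub.
by rewrite (g_sigma_preimage_comp coord f); exists A => //; rewrite setTI.
Qed.

End rV_measurable.

Section lebesgue_step.
Context {R : realType} (n : nat).

Definition rVcons (z : measurableTypeR R * 'rV[R]_n) : 'rV[R]_n.+1 :=
  \row_i oapp (z.2 ord0) z.1 (unlift ord0 i).

Definition rVuncons (x : 'rV[R]_n.+1) : measurableTypeR R * 'rV[R]_n :=
  (x ord0 ord0, \row_i x ord0 (lift ord0 i)).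

Lemma rVconsK : cancel rVcons rVuncons.
Proof.
case=> a v; rewrite /rVuncons mxE unlift_none /=; congr pair.
by apply/rowP => i; rewrite !mxE liftK.
Qed.

Lemma rVunconsK : cancel rVuncons rVcons.
Proof.
by move=> x; apply/rowP => i; rewrite mxE; case: unliftP => [j ->|->] /=;
  rewrite ?mxE.
Qed.

Lemma measurable_rVcons : measurable_fun setT rVcons.
Proof.
apply: measurable_fun_rV => i.
case: (unliftP ord0 i) => [j ->|->].
  rewrite (_ : (fun _ => _) =
    (fun x : 'rV[R]_n => x ord0 j : measurableTypeR R) \o snd).
    exact: measurableT_comp (measurable_coord j) measurable_snd.
  by apply/funext => z; rewrite mxE liftK.
rewrite (_ : (fun _ => _) = fst); first exact: measurable_fst.
by apply/funext => z; rewrite mxE unlift_none.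
Qed.

Lemma measurable_rVuncons : measurable_fun setT rVuncons.
Proof.
apply: measurable_fun_pair; first exact: measurable_coord.
apply: measurable_fun_rV => i.
rewrite (_ : (fun _ => _) =
    (fun x : 'rV[R]_n.+1 => x ord0 (lift ord0 i) : measurableTypeR R)).
  exact: measurable_coord.
by apply/funext => z; rewrite mxE.
Qed.

HB.instance Definition _ :=
  isMeasurableFun.Build _ _ _ _ rVcons measurable_rVcons.

Variable m : {sigma_finite_measure set 'rV[R]_n -> \bar R}.

Definition lebesgue_rV_step : set 'rV[R]_n.+1 -> \bar R :=
  pushforward (lebesgue_measure \x m)%E rVcons.

Let step0 : lebesgue_rV_step set0 = 0%E.
Proof. exact: measure0. Qed.

Let step_ge0 A : (0 <= lebesgue_rV_step A)%E.
Proof. exact: measure_ge0. Qed.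

Let step_sigma_additive : semi_sigma_additive lebesgue_rV_step.
Proof. exact: measure_semi_sigma_additive. Qed.

HB.instance Definition _ := isMeasure.Build _ _ _ lebesgue_rV_step
  step0 step_ge0 step_sigma_additive.

Let step_sigma_finite : sigma_finite setT lebesgue_rV_step.
Proof.
have /sigma_finiteP[F [TF ndF Foo]] :=
  sigma_finiteT [the {sigma_finite_measure set _ -> \bar R} of @lebesgue_measure R].
have /sigma_finiteP[G [TG ndG Goo]] := sigma_finiteT m.
exists (fun k => rVuncons @^-1` (F k `*` G k)).
  rewrite -preimage_bigcup (_ : \bigcup_k _ = setT) ?preimage_setT//.
  apply/seteqP; split => // -[a v] _.
  have [i _ Fi] : (\bigcup_k F k) a by rewrite -TF.
  have [j _ Gj] : (\bigcup_k G k) v by rewrite -TG.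
  exists (maxn i j) => //; split.
    by move: a Fi; exact/subsetPset/ndF/leq_maxl.
  by move: v Gj; exact/subsetPset/ndG/leq_maxr.
move=> k; have [mFk Fk] := Foo k; have [mGk Gk] := Goo k; split.
  rewrite -[X in measurable X]setTI; apply: measurable_rVuncons => //.
  exact: measurableX.
rewrite /lebesgue_rV_step /pushforward -comp_preimage.
rewrite (_ : _ \o _ = id); last by apply/funext => z; exact: rVconsK.
rewrite preimage_id [ltLHS]product_measure1E//.
by apply: lte_mul_pinfty; rewrite ?ge0_fin_numE.
Qed.

HB.instance Definition _ :=
  Measure_isSigmaFinite.Build _ _ _ lebesgue_rV_step step_sigma_finite.

End lebesgue_step.

Section lebesgue_rV0.
Context {R : realType}.

Definition lebesgue_rV0 : set 'rV[R]_0 -> \bar R := \d_(0 : 'rV[R]_0).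

HB.instance Definition _ := Measure.on lebesgue_rV0.

Let rV0_sigma_finite : sigma_finite setT lebesgue_rV0.
Proof.
apply: fin_num_fun_sigma_finite; first by rewrite measure0.
by move=> A _; rewrite /lebesgue_rV0 /dirac.
Qed.

HB.instance Definition _ :=
  Measure_isSigmaFinite.Build _ _ _ lebesgue_rV0 rV0_sigma_finite.

End lebesgue_rV0.

Fixpoint lebesgue_rV {R : realType} (n : nat) :
    {sigma_finite_measure set 'rV[R]_n -> \bar R} :=
  match n with
  | 0 => [the {sigma_finite_measure set _ -> \bar R} of lebesgue_rV0]
  | k.+1 => [the {sigma_finite_measure set _ -> \bar R} of
               lebesgue_rV_step (lebesgue_rV k)]
  end.

Lemma measurable_box {R : realType} (n : nat) (A : 'I_n -> set R) :
  (forall i, measurable (A i)) ->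
  measurable [set x : 'rV[R]_n | forall i, A i (x ord0 i)].
Proof.
move=> mA.
have -> : [set x : 'rV[R]_n | forall i, A i (x ord0 i)] =
    \bigcap_(i in [set: 'I_n])
      ((fun x : 'rV[R]_n => x ord0 i : measurableTypeR R) @^-1` A i).
  by apply/seteqP; split => x /= H i; [move=> _|]; exact: H.
apply: fin_bigcap_measurable => // i _.
by rewrite -[X in measurable X]setTI; apply: measurable_coord => //; exact: mA.
Qed.

(* The defining property of n-dimensional Lebesgue measure. *)
Lemma lebesgue_rV_box {R : realType} (n : nat) (A : 'I_n -> set R) :
  (forall i, measurable (A i)) ->
  lebesgue_rV n [set x : 'rV[R]_n | forall i, A i (x ord0 i)] =
  (\prod_(i < n) lebesgue_measure (A i : set (measurableTypeR R)))%E.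
Proof.
elim: n A => [|n IH] A mA.
  by rewrite big_ord0 /= /lebesgue_rV0 diracE mem_set // => -[].
rewrite /= /lebesgue_rV_step /pushforward big_ord_recl -IH; last first.
  by move=> i; exact: mA.
rewrite -product_measure1E; [|exact: mA|]; last first.
  by apply: (measurable_box (A := fun i => A (lift ord0 i))) => i; exact: mA.
rewrite (_ : rVcons (n:=n) @^-1` _ = A ord0 `*`
  [set x : 'rV[R]_n | forall i, A (lift ord0 i) (x ord0 i)]) //.
apply/seteqP; split => -[b v] /= H.
  split; first by have := H ord0; rewrite mxE unlift_none.
  by move=> i; have := H (lift ord0 i); rewrite mxE liftK.
by move=> i; rewrite mxE; case: unliftP => [j ->|->] /=; case: H.
Qed.

Section complex_functions.
Context {R : realType} {n : nat}.
Implicit Types f : 'rV[R]_n -> R[i].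

Local Notation mu := (lebesgue_rV n : {measure set 'rV[R]_n -> \bar R}).

(* `|z| on R[i] is itself complex valued, hence the real-valued modulus. *)
Definition cmod (z : R[i]) : R := ComplexField.Normc.normc z.

Definition expi (t : R) : R[i] := (cos t +i* sin t)%C.

Definition enorm (x : 'rV[R]_n) : R := Num.sqrt (\sum_i x ord0 i ^+ 2).

Definition dot (x y : 'rV[R]_n) : R := \sum_i x ord0 i * y ord0 i.

Definition cmeasurable f :=
  measurable_fun setT (fun x => complex.Re (f x)) /\
  measurable_fun setT (fun x => complex.Im (f x)).

Definition cintegrable f :=
  mu.-integrable setT (fun x => (complex.Re (f x))%:E) /\
  mu.-integrable setT (fun x => (complex.Im (f x))%:E).

Definition cintegral f : R[i] :=
  ((\int[mu]_x complex.Re (f x)) +i* (\int[mu]_x complex.Im (f x)))%C.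

(* R[i] has no canonical normed R-module structure: continuity, derivatives and
   integrals of complex functions are taken on real and imaginary parts. *)
Definition ccontinuous f :=
  continuous (fun x => complex.Re (f x)) /\
  continuous (fun x => complex.Im (f x)).

Definition pderivable (i : 'I_n) f :=
  forall x, derivable (fun y => complex.Re (f y)) x (delta_mx ord0 i) /\
            derivable (fun y => complex.Im (f y)) x (delta_mx ord0 i).

Definition pderiv (i : 'I_n) f : 'rV[R]_n -> R[i] := fun x =>
  ('D_(delta_mx ord0 i) (fun y => complex.Re (f y)) x +i*
   'D_(delta_mx ord0 i) (fun y => complex.Im (f y)) x)%C.

Definition pderivs (w : seq 'I_n) f := foldr pderiv f w.

(* [pderivs w f] ranges over all mixed partial derivatives, in any order. *)
Definition Ck (K : nat) f := forall w : seq 'I_n, (size w <= K)%N ->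
  ccontinuous (pderivs w f) /\
  ((size w < K)%N -> forall i, pderivable i (pderivs w f)).

Definition mdeg (al : 'I_n -> nat) : nat := (\sum_i al i)%N.

Definition monom (al : 'I_n -> nat) (x : 'rV[R]_n) : R :=
  \prod_i x ord0 i ^+ al i.

Definition mderiv (al : 'I_n -> nat) f :=
  pderivs (flatten [seq nseq (al i) i | i <- enum 'I_n]) f.

Definition csupport f : set 'rV[R]_n := closure [set x | f x != 0].

End complex_functions.

Section tempered_distributions.
Context {R : realType} {n : nat}.
Implicit Types (phi theta : 'rV[R]_n -> R[i]) (T : ('rV[R]_n -> R[i]) -> R[i]).

Definition schwartz_seminorm (al be : 'I_n -> nat) phi : \bar R :=
  ereal_sup [set (`|monom al x| * cmod (mderiv be phi x))%:E | x in setT].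

Definition schwartz phi := (forall K, Ck K phi) /\
  forall al be, (schwartz_seminorm al be phi < +oo)%E.

(* A distribution is a functional on all functions of which only the values on
   Schwartz functions matter. The topology of the Schwartz space is metrizable,
   hence sequential continuity below. *)
Definition tempered T :=
  (forall (c : R[i]) phi psi, schwartz phi -> schwartz psi ->
     T (fun x => c * phi x + psi x) = c * T phi + T psi) /\
  (forall (u : nat -> 'rV[R]_n -> R[i]) phi,
     (forall k, schwartz (u k)) -> schwartz phi ->
     (forall al be, schwartz_seminorm al be (fun x => u k x - phi x)
        @[k --> \oo] --> 0%E) ->
     cmod (T (u k) - T phi) @[k --> \oo] --> (0 : R)).

Definition fourier phi : 'rV[R]_n -> R[i] := fun xi =>
  ((2 * pi) `^ (- (n%:R / 2)))%:C%C *
  cintegral (fun x => expi (- dot x xi) * phi x).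

Definition ifourier phi : 'rV[R]_n -> R[i] := fun x =>
  ((2 * pi) `^ (- (n%:R / 2)))%:C%C *
  cintegral (fun xi => expi (dot x xi) * phi xi).

(* Operations on distributions, by transposition. *)
Definition dfourier T : ('rV[R]_n -> R[i]) -> R[i] :=
  fun phi => T (fourier phi).

Definition difourier T : ('rV[R]_n -> R[i]) -> R[i] :=
  fun phi => T (ifourier phi).

Definition dmul theta T : ('rV[R]_n -> R[i]) -> R[i] :=
  fun phi => T (fun x => theta x * phi x).

(* theta(D) T = F^-1 [theta . F T] *)
Definition multiplier theta T := difourier (dmul theta (dfourier T)).

Definition dist_of_fun (g : 'rV[R]_n -> R[i]) : ('rV[R]_n -> R[i]) -> R[i] :=
  fun phi => cintegral (fun x => g x * phi x).

Definition represents (g : 'rV[R]_n -> R[i]) T :=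
  cmeasurable g /\
  forall phi, schwartz phi ->
    cintegrable (fun x => g x * phi x) /\ T phi = dist_of_fun g phi.

(* The sum over nu of the sums over m, each taken in the space of tempered
   distributions (weak-* convergence); the sum over m is unordered. *)
Definition double_sum (u : nat -> 'rV[int]_n -> ('rV[R]_n -> R[i]) -> R[i]) T :=
  exists g : nat -> ('rV[R]_n -> R[i]) -> R[i],
  [/\ forall nu, tempered (g nu),
      forall nu phi, schwartz phi ->
        (fun A : {fset 'rV[int]_n} => cmod (\sum_(m <- A) u nu m phi - g nu phi))
          @ totally --> (0 : R) &
      forall phi, schwartz phi ->
        cmod (\sum_(nu < N) g nu phi - T phi) @[N --> \oo] --> (0 : R)].

End tempered_distributions.

Section variable_exponents.
Context {R : realType} {n : nat}.
Implicit Types p q s : 'rV[R]_n -> R.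

Local Notation mu := (lebesgue_rV n : {measure set 'rV[R]_n -> \bar R}).

Definition P0 p := [/\ measurable_fun setT p, forall x, 0 < p x,
  (0 < ess_inf mu (EFin \o p))%E & (ess_sup mu (EFin \o p) < +oo)%E].

Definition Clog p := exists C poo : R, [/\ 0 < C,
  forall x y, x != y ->
    `|p x - p y| <= C / ln (expR 1 + (enorm (x - y))^-1) &
  forall x, `|p x - poo| <= C / ln (expR 1 + enorm x)].

(* Infima of the empty set are +oo. *)
Definition vLp_norm p (f : 'rV[R]_n -> R[i]) : \bar R :=
  ereal_inf [set l%:E | l in [set l : R | 0 < l /\
    (\int[mu]_x ((cmod (f x) / l) `^ p x)%:E <= 1)%E]].

Definition lqLp_norm q p (f : nat -> 'rV[R]_n -> R[i]) : \bar R :=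
  ereal_inf [set l%:E | l in [set l : R | 0 < l /\
    (\sum_(0 <= j <oo) vLp_norm (fun x => (p x / q x)%R)
       (fun x => ((cmod (f j x) / l) `^ q x)%R%:C%C) <= 1)%E]].

End variable_exponents.

Section besov.
Context {R : realType} {n : nat}.
Implicit Types (p q s : 'rV[R]_n -> R) (theta : nat -> 'rV[R]_n -> R[i]).

Definition Phi theta :=
  [/\ forall j, schwartz (theta j),
      csupport (theta 0%N) `<=` [set x | enorm x <= 2],
      forall j, csupport (theta j.+1) `<=`
        [set x | 2 ^+ j <= enorm x <= 2 ^+ j.+2],
      forall al, exists C : R, forall j x,
        2 ^+ (j * mdeg al) * cmod (mderiv al (theta j) x) <= C &
      forall x, cmod (\sum_(j < N) theta j x - 1) @[N --> \oo] --> (0 : R)].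

(* Each distribution theta_j(D)f is identified with a function representing it; two such
   functions agree almost everywhere, so the infimum ranges over one value (or
   over none). *)
Definition besov_norm theta s p q (f : ('rV[R]_n -> R[i]) -> R[i]) : \bar R :=
  ereal_inf
    [set lqLp_norm q p (fun j x => (2 `^ (j%:R * s x))%:C%C * g j x) |
      g in [set g : nat -> 'rV[R]_n -> R[i] |
        forall j, represents (g j) (multiplier (theta j) f)]].

Definition cube (nu : nat) (m : 'rV[int]_n) : set 'rV[R]_n :=
  [set x | forall i, 2 ^- nu * (m ord0 i)%:~R <= x ord0 i
                     < 2 ^- nu * ((m ord0 i)%:~R + 1)].

Lemma measurable_cube nu m : measurable (cube nu m).
Proof.
rewrite (_ : cube nu m = [set x | forall i, [set` `[2 ^- nu * (m ord0 i)%:~R,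
    2 ^- nu * ((m ord0 i)%:~R + 1)[%R] (x ord0 i)]).
  by apply: (measurable_box (A := fun i => [set` _])) => i.
by apply/seteqP; split => x H i; have := H i; rewrite /= in_itv.
Qed.

(* The cubes of generation nu partition R^n, so the sum has finite support. *)
Definition b_norm s p q (lam : nat -> 'rV[int]_n -> R[i]) : \bar R :=
  lqLp_norm q p (fun nu x => (2 `^ (nu%:R * s x))%:C%C *
    \sum_(m \in [set: 'rV[int]_n]) (lam nu m * (\1_(cube nu m) x)%:C%C)).

Definition dilated_cube (gamma : R) (nu : nat) (m : 'rV[int]_n) :
    set 'rV[R]_n :=
  let c := \row_i (2 ^- nu * ((m ord0 i)%:~R + 2^-1)) in
  [set c + gamma *: (x - c) | x in cube nu m].

Definition is_atom (gamma : R) (K : nat) (L : int) (nu : nat)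
    (m : 'rV[int]_n) (a : 'rV[R]_n -> R[i]) :=
  [/\ Ck K a,
      csupport a `<=` dilated_cube gamma nu m,
      forall al, (mdeg al <= K)%N ->
        forall x, cmod (mderiv al a x) <= 2 ^+ (nu * mdeg al) &
      (0 < nu)%N -> forall be, (mdeg be)%:Z <= L ->
        cintegral (fun x => (monom be x)%:C%C * a x) = 0].

(* On bounded-below L the value is finite; this is the case for the L used in
   [besov_atoms], since log-Hoelder functions are bounded. *)
Definition ess_inf_cube (L : 'rV[R]_n -> R) nu m : \bar R :=
  ess_inf (mrestr (lebesgue_rV n) (measurable_cube nu m)) (EFin \o L).

Definition smooth_atoms (gamma : R) (K : nat) (L : 'rV[R]_n -> R)
    (a : nat -> 'rV[int]_n -> 'rV[R]_n -> R[i]) :=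
  forall nu m,
    is_atom gamma K (Num.floor (fine (ess_inf_cube L nu m))) nu m (a nu m).

Definition sigma p (x : 'rV[R]_n) : R := n%:R * ((Num.min 1 (p x))^-1 - 1).

Definition besov_atoms (gamma : R) s p
    (a : nat -> 'rV[int]_n -> 'rV[R]_n -> R[i]) :=
  exists (K : nat) (eps : R), [/\ 0 < eps,
    (ess_sup (lebesgue_rV n) (EFin \o s) < K%:R%:E)%E &
    smooth_atoms gamma K (fun x => sigma p x - s x + eps) a].

Definition atomic_series (lam : nat -> 'rV[int]_n -> R[i])
    (a : nat -> 'rV[int]_n -> 'rV[R]_n -> R[i]) nu m :=
  dist_of_fun (fun x => lam nu m * a nu m x).

End besov.

(* Main.v *)
From HB Require Import structures.
Require Import Defs.
From mathcomp Require Import all_boot all_order all_algebra finmap.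
From mathcomp Require Import all_classical all_reals all_analysis.
From mathcomp Require Import complex measurable_realfun ess_sup_inf ring lra zify.
From mathcomp.analysis Require Import showcase.summability.
Import Order.TTheory GRing.Theory Num.Theory.
Import numFieldNormedType.Exports.
Set Implicit Arguments.
Unset Strict Implicit.
Unset Printing Implicit Defensive.
Local Open Scope classical_set_scope.
Local Open Scope ring_scope.

(* If j <= nu, the vanishing moments of an atom a_(nu,m) and the smoothness of the kernel of
   theta_j(D) give |theta_j(D) a_(nu,m)| <= C 2^(-(nu-j)(n+N)), where the moments of degree < N
   vanish; if j > nu, moving K derivatives onto the atom gives C 2^(-(j-nu)K). Both bounds decay
   polynomially off the cube at scale min(j,nu). On the cube, N >= sigma_p - s + eps up to
   O(1/nu) by log-Hoelder continuity, and K > s.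

   Let t_nu be the norm of |f_nu|^q in L^(p/q) for the nu-th term f_nu of lambda (plus 2^-nu),
   and F_nu = (t_nu^(-1/q) |f_nu|)^p, so that int F_nu <= 1. Let U_(j,nu) be the mean of F_nu
   against a polynomially decaying kernel of width 2^-min(j,nu). Log-Hoelder continuity moves
   exponents between points at polynomial cost, which the decay off the cubes absorbs, so that
   no maximal function is needed: for T_j = sum_nu 2^(-delta|j-nu|) U_(j,nu) and exponentially
   weighted averages tau_j of the t_nu, up to constants,
     2^(js) tau_j^(-1/q) sum_(nu,m) |lambda_(nu,m)| |theta_j(D) a_(nu,m)| <= T_j^(1/p),
   with int T_j <= 1 and sum_j tau_j <= 1, which is the norm estimate. The same bounds make all
   series converge absolutely. *)

(** The obstacle is that s, p and q vary from cube to cube, so no inequality with one fixed exponent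
    applies to a sum over cubes. In each cube a point y is chosen at which F_nu is at most slightly
    above its mean; the estimate is made with the exponents at y, which are then moved to x. Moving
    an exponent of v > 0 at scale 2^-i has polynomial cost only while |ln v| is at most a multiple
    of 1 + i + ln(1 + |x|), and this dictates the form of several quantities. The summand 2^-nu
    keeps ln t_nu of order nu, and makes t_nu strictly larger than the norm, so that the modular at
    t_nu is at most 1. The averages U receive an extra integrable weight at x, which keeps them
    above a power of 1 + |x|. The t_nu of different scales are unrelated; tau_j dominates c z^|j-nu|
    t_nu with z so close to 1 that replacing t_nu by tau_j costs half of the factor 2^(-eps|j-nu|)
    gained from moments and smoothness. The other half makes the sum over nu converge. The sums over
    m and over nu both rest on the pointwise inequality [split_power]. *)

(** * Dyadic cubes, the sup norm and Lebesgue measure on R^n *)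

Section geometry.
Context {R : realType} {n : nat}.
Implicit Types (x y c : 'rV[R]_n) (m : 'rV[int]_n).

Local Notation mu := (lebesgue_rV n : {measure set 'rV[R]_n -> \bar R}).

Lemma rV_norm_leP x (r : R) : 0 <= r ->
  `|x| <= r <-> forall i, `|x ord0 i| <= r.
Proof.
move=> r0; split=> [|H].
  rewrite [X in X <= r]mx_normrE => H i.
  apply: le_trans H.
  exact: (le_bigmax _ (fun ij : 'I_1 * 'I_n => `|x ij.1 ij.2|) (ord0, i)).
by rewrite [X in X <= r]mx_normrE; apply/bigmax_leP; split => // -[j i] _ /=; rewrite (ord1 j).
Qed.

Lemma coord_le_norm x i : `|x ord0 i| <= `|x|.
Proof. by move: i; apply/rV_norm_leP. Qed.

Lemma enorm_ge0 x : 0 <= enorm x.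
Proof. exact: sqrtr_ge0. Qed.

Lemma norm_le_enorm x : `|x| <= enorm x.
Proof.
apply/rV_norm_leP; first exact: enorm_ge0.
move=> i; rewrite -sqrtr_sqr ler_sqrt; last first.
  by apply: sumr_ge0 => k _; exact: sqr_ge0.
rewrite (bigD1 i)//= lerDl; apply: sumr_ge0 => k _; exact: sqr_ge0.
Qed.

Lemma enorm_le_norm x : enorm x <= n%:R * `|x|.
Proof.
rewrite -[leRHS]ger0_norm ?mulr_ge0// -sqrtr_sqr ler_sqrt ?sqr_ge0//.
apply: (@le_trans _ _ (\sum_(i < n) `|x| ^+ 2)).
  apply: ler_sum => i _; rewrite -real_normK ?num_real//.
  by rewrite lerXn2r ?nnegrE// coord_le_norm.
rewrite sumr_const card_ord exprMn -[in leLHS]mulr_natl ler_wpM2r ?sqr_ge0//.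
by rewrite -natrX ler_nat; case: (n) => // k; rewrite leq_pmulr.
Qed.

Definition cube_index (nu : nat) x : 'rV[int]_n :=
  \row_i Num.floor (2 ^+ nu * x ord0 i).

Lemma cubeE nu m x : cube nu m x <-> m = cube_index nu x.
Proof.
have p2 : (0 : R) < 2 ^+ nu by rewrite exprn_gt0.
have E (m' : 'rV[int]_n) i : (2 ^- nu * (m' ord0 i)%:~R <= x ord0 i < 2 ^- nu * ((m' ord0 i)%:~R + 1))
    = (Num.floor (2 ^+ nu * x ord0 i) == m' ord0 i).
  by rewrite floor_eq intrD1 ler_pdivrMl// ltr_pdivlMl.
split => [H|->].
  by apply/rowP => i; have := H i; rewrite E mxE => /eqP.
by move=> i; rewrite E mxE.
Qed.

Lemma cube_dist nu m x y : cube nu m x -> cube nu m y -> `|x - y| <= 2 ^- nu.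
Proof.
have p2 : (0 : R) < 2 ^- nu by rewrite invr_gt0 exprn_gt0.
move=> Hx Hy; apply/rV_norm_leP => [|i]; first exact: ltW.
rewrite !mxE; have /andP[a b] := Hx i; have /andP[c d] := Hy i.
rewrite ler_norml; move: a b c d; set u := 2 ^- nu * _.
by rewrite mulrDr mulr1 -/u; set v := 2 ^- nu => *; apply/andP; split; lra.
Qed.

(** The sigma-algebra is generated by the coordinates, so its relation to the topology has to be
    established: an open set is the union of the dyadic cubes inside it, and there are countably
    many of these. *)
Lemma open_measurable_rV (U : set 'rV[R]_n) : open U -> measurable U.
Proof.
move=> oU.
pose good (z : nat * 'rV[int]_n) := cube z.1 z.2 `<=` U.
have -> : U = \bigcup_(z : nat * 'rV[int]_n)
    (if `[< good z >] then cube z.1 z.2 else set0).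
  apply/seteqP; split => [x Ux|x [z _]].
    have /nbhs_ballP[e e0 be] : nbhs x U by exact: open_nbhs_nbhs.
    have [k ke] : exists k, 2 ^- k < e :> R.
      have [k _ Hk] := near_infty_natSinv_expn_lt (PosNum e0).
      by exists k; have := Hk k (leqnn k); rewrite /= div1r.
    exists (k, cube_index k x) => //.
    have cx : cube k (cube_index k x) x by apply/cubeE.
    rewrite asboolT // => y cy; apply: be.
    rewrite -ball_normE /ball_ /=; apply: le_lt_trans ke; exact: cube_dist cx cy.
  by case: asboolP => // gz /gz.
apply: countable_bigcupT_measurable => [|z]; last first.
  by case: asboolP => // _; exact: measurable_cube.
exact: countableP.
Qed.

Lemma continuous_measurable_rV (f : 'rV[R]_n -> R) :
  continuous f -> measurable_fun setT f.
Proof.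
move=> cf; apply: (measurability _ (RGenOpens.measurableE R)).
move=> _ [_ [a [b ->] <-]]; rewrite setTI; apply: open_measurable_rV.
by apply: open_comp => // x _; exact: cf.
Qed.

Lemma lebesgue_cube nu m : mu (cube nu m) = (2 ^- (nu * n))%:E.
Proof.
rewrite (_ : cube nu m = [set x : 'rV[R]_n | forall i, [set` `[2 ^- nu * (m ord0 i)%:~R,
    2 ^- nu * ((m ord0 i)%:~R + 1)[%R] (x ord0 i)]); last first.
  by apply/seteqP; split => x H i; have := H i; rewrite /= in_itv.
rewrite [LHS](lebesgue_rV_box (A := fun i => [set` `[2 ^- nu * (m ord0 i)%:~R,
    2 ^- nu * ((m ord0 i)%:~R + 1)[%R])); last by move=> i.
have p2 : (0 : R) < 2 ^- nu by rewrite invr_gt0 exprn_gt0.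
rewrite (eq_bigr (fun=> (2 ^- nu)%:E)) => [|i _]; last first.
  rewrite lebesgue_measure_itv/= lte_fin ltr_pM2l// ltrDl ltr01 -EFinB.
  by congr EFin; rewrite -mulrBr addrC addKr mulr1.
by rewrite prodEFin prodr_const card_ord exprM exprVn.
Qed.

Lemma lebesgue_closed_ball c (r : R) : 0 <= r ->
  mu [set x : 'rV[R]_n | `|x - c| <= r] = ((2 * r) ^+ n)%:E.
Proof.
move=> r0.
rewrite (_ : [set x : 'rV[R]_n | _] = [set x : 'rV[R]_n | forall i, [set` `[c ord0 i - r,
    c ord0 i + r]%R] (x ord0 i)]); last first.
  apply/seteqP; split => x /=.
    move/(rV_norm_leP _ r0) => H i; have := H i; rewrite !mxE ler_norml in_itv/=.
    by move=> /andP[? ?]; apply/andP; split; lra.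
  move=> H; apply/rV_norm_leP => // i; have := H i; rewrite !mxE ler_norml in_itv/=.
  by move=> /andP[? ?]; apply/andP; split; lra.
rewrite [LHS](lebesgue_rV_box (A := fun i => [set` `[c ord0 i - r, c ord0 i + r]%R])) //.
rewrite (eq_bigr (fun=> (2 * r)%:E)) => [|i _].
  by rewrite prodEFin prodr_const card_ord.
rewrite lebesgue_measure_itv/= lte_fin.
case: ifPn => [_|]; first by rewrite -EFinB; congr EFin; lra.
by rewrite -leNgt => ?; congr EFin; lra.
Qed.

Lemma measurable_closed_ball_rV c (r : R) : measurable [set x : 'rV[R]_n | `|x - c| <= r].
Proof.
have [r0|r0] := leP 0 r; last first.
  rewrite (_ : [set x | _] = set0)//; apply/seteqP; split => // x /= H.
  by have := le_lt_trans H r0; rewrite normr_lt0.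
rewrite (_ : [set x : 'rV[R]_n | _] = [set x : 'rV[R]_n | forall i, [set` `[c ord0 i - r,
    c ord0 i + r]%R] (x ord0 i)]).
  exact: (measurable_box (A := fun i => [set` `[c ord0 i - r, c ord0 i + r]%R])).
apply/seteqP; split => x /=.
  move/(rV_norm_leP _ r0) => H i; have := H i; rewrite !mxE ler_norml in_itv/=.
  by move=> /andP[? ?]; apply/andP; split; lra.
move=> H; apply/rV_norm_leP => // i; have := H i; rewrite !mxE ler_norml in_itv/=.
by move=> /andP[? ?]; apply/andP; split; lra.
Qed.

End geometry.

(** * Translation invariance *)

Section translation.
Context {R : realType}.

Lemma lebesgue_measure_translate (h : R) (A : set (measurableTypeR R)) :
  measurable A ->
  lebesgue_measure ((fun x => x + h) @^-1` A : set (measurableTypeR R)) =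
  lebesgue_measure A.
Proof.
move=> mA.
have mh : measurable_fun setT (fun x : measurableTypeR R => x + h : measurableTypeR R).
  exact: measurable_funD.
pose m1 := [the measure _ _ of @pushforward _ _ (measurableTypeR R) (measurableTypeR R) R
  lebesgue_measure (fun x => x + h)].
have := @lebesgue_measure_unique R (m1 mh) _ A mA.
move=> /(_ _)/esym; apply=> _ [[a b] _ <-] /=.
rewrite /pushforward /=.
rewrite (_ : _ @^-1` _ = `](a - h), (b - h)]%classic); last first.
  by apply/seteqP; split => x /=; rewrite !in_itv/= => /andP[? ?]; apply/andP; split; lra.
rewrite !lebesgue_measure_itv /= !lte_fin ltrD2r.
by case: ifP => // _; rewrite -!EFinB; congr EFin; lra.
Qed.

Context {n : nat}.
Local Notation mu := (lebesgue_rV n : {measure set 'rV[R]_n -> \bar R}).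

Lemma measurable_translate (h : 'rV[R]_n) :
  measurable_fun setT (fun x : 'rV[R]_n => x + h).
Proof.
apply: measurable_fun_rV => i.
rewrite (_ : (fun _ => _) = (fun x : 'rV[R]_n => x ord0 i + h ord0 i)); last first.
  by apply/funext => x; rewrite mxE.
by apply: measurable_funD => //; exact: measurable_coord.
Qed.

(** Both measures agree on boxes, a pi-system generating the sigma-algebra, and are finite on the
    cubes [g k], which exhaust the space. *)
Lemma lebesgue_rV_translate (h : 'rV[R]_n) (A : set 'rV[R]_n) : measurable A ->
  mu ((fun x => x + h) @^-1` A) = mu A.
Proof.
pose G := [set B : set 'rV[R]_n | exists2 C : 'I_n -> set (measurableTypeR R),
  (forall i, measurable (C i)) & B = [set x | forall i, C i (x ord0 i)]].
pose g k := [set x : 'rV[R]_n | forall i, (`[- k%:R, k%:R]%classic : set R) (x ord0 i)].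
pose m1 := [the measure _ _ of pushforward mu (fun x : 'rV[R]_n => x + h)].
apply: (@measure_unique _ _ _ G g _ _ _ _ (m1 (measurable_translate h)) mu).
- apply/seteqP; split.
    apply: smallest_sub; first exact: smallest_sigma_algebra.
    move=> B; rewrite -bigcup_seq => -[i _ [C mC <-]]; rewrite setTI.
    apply: sub_sigma_algebra; exists (fun j => if j == i then C else setT).
      by move=> j; case: ifP.
    apply/seteqP; split => x /= H; last by have := H i; rewrite eqxx.
    by move=> j; case: eqP => // ->.
  apply: smallest_sub; first exact: sigma_algebra_measurable.
  by move=> _ [C mC ->]; exact: measurable_box.
- move=> _ _ [C mC ->] [D mD ->]; exists (fun i => C i `&` D i).
    by move=> i; exact: measurableI.
  by apply/seteqP; split => x /=; [move=> [a b] i; split|move=> H; split => i; have [] := H i].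
- by move=> k; exists (fun=> `[- k%:R, k%:R]%classic).
- apply/seteqP; split => // x _.
  exists (Num.truncn `|x|).+1 => // i; rewrite /= in_itv/= -ler_norml.
  apply: (le_trans (coord_le_norm x i)); apply: ltW; exact: truncnS_gt.
- move=> _ [C mC ->]; rewrite /= /pushforward.
  transitivity (mu [set x : 'rV[R]_n | forall i,
      ((fun t => t + h ord0 i) @^-1` (C i) : set (measurableTypeR R)) (x ord0 i)]).
    by congr (mu _); apply/seteqP; split => x /= H i; have := H i; rewrite !mxE.
  rewrite [LHS](lebesgue_rV_box (A := fun i => (fun t => t + h ord0 i) @^-1` (C i))).
    rewrite [RHS](lebesgue_rV_box (A := C)) //; apply: eq_bigr => i _.
    exact: lebesgue_measure_translate.
  move=> i; rewrite -[X in measurable X]setTI.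
  have : measurable_fun setT (fun x : measurableTypeR R => x + h ord0 i : measurableTypeR R).
    exact: measurable_funD.
  by apply.
- move=> k; rewrite /= /pushforward.
  have -> : (fun x : 'rV[R]_n => x + h) @^-1` (g k) = [set x | `|x - (- h)| <= k%:R].
    apply/seteqP; split => x /=; rewrite opprK.
      move=> H; apply/rV_norm_leP => // i; have := H i.
      by rewrite /= in_itv/= ler_norml.
    by move=> /rV_norm_leP-/(_ (ler0n _ _)) H i; rewrite /= in_itv/= -ler_norml.
  by rewrite lebesgue_closed_ball ?ltry.
Qed.

Lemma integral_translate (h : 'rV[R]_n) (f : 'rV[R]_n -> R) :
  mu.-integrable setT (EFin \o f) ->
  mu.-integrable setT (EFin \o (fun x => f (x + h))) /\
  \int[mu]_x f (x + h) = \int[mu]_x f x.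
Proof.
move=> intf; pose ph := fun x : 'rV[R]_n => x + h.
pose m1' := [the measure _ _ of pushforward mu ph].
pose m1 := m1' (measurable_translate h).
have mf : measurable_fun setT (EFin \o f) by exact: measurable_int intf.
have eqm (A : set 'rV[R]_n) : measurable A -> A `<=` setT -> m1 A = mu A.
  by move=> mA _; exact: lebesgue_rV_translate.
have int2 : mu.-integrable setT (EFin \o (fun x => f (x + h))).
  apply/integrableP; split.
    by apply: (measurableT_comp (f := EFin \o f)) => //; exact: measurable_translate.
  move/integrableP : intf => [_]; apply: le_lt_trans.
  rewrite [leRHS](_ : _ = \int[m1]_x `|(f x)%:E|)%E; last first.
    by apply: (eq_measure_integral m1) => A mA sA; rewrite eqm.
  rewrite (ge0_integral_pushforward (measurable_translate h)) //.
  exact: measurableT_comp.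
split => //; rewrite /Rintegral; congr fine.
rewrite [RHS](_ : _ = \int[m1]_x (f x)%:E)%E; last first.
    by apply: (eq_measure_integral m1) => A mA sA; rewrite eqm.
by rewrite (integral_pushforward (measurable_translate h)).
Qed.

End translation.

(** * Complex-valued functions and their Fourier transforms *)

Section complex_basics.
Context {R : realType}.
Implicit Types (z w : R[i]).
Local Notation Re := complex.Re.
Local Notation Im := complex.Im.

Lemma cReD z w : Re (z + w) = Re z + Re w. Proof. by case: z; case: w. Qed.
Lemma cImD z w : Im (z + w) = Im z + Im w. Proof. by case: z; case: w. Qed.
Lemma cReN z : Re (- z) = - Re z. Proof. by case: z. Qed.
Lemma cImN z : Im (- z) = - Im z. Proof. by case: z. Qed.
Lemma cReB z w : Re (z - w) = Re z - Re w. Proof. by rewrite cReD cReN. Qed.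
Lemma cImB z w : Im (z - w) = Im z - Im w. Proof. by rewrite cImD cImN. Qed.
Lemma cReM z w : Re (z * w) = Re z * Re w - Im z * Im w.
Proof. by case: z; case: w. Qed.
Lemma cImM z w : Im (z * w) = Re z * Im w + Im z * Re w.
Proof. by case: z; case: w. Qed.

Lemma complex_eqP z w : Re z = Re w -> Im z = Im w -> z = w.
Proof. by case: z => a b; case: w => c d /= -> ->. Qed.

Lemma cmod_ge0 z : 0 <= cmod z.
Proof. by case: z => a b; exact: sqrtr_ge0. Qed.
Lemma cmodM z w : cmod (z * w) = cmod z * cmod w.
Proof. exact: ComplexField.Normc.normcM. Qed.
Lemma cmodD z w : cmod (z + w) <= cmod z + cmod w.
Proof. exact: le_normcD. Qed.
Lemma cmodN z : cmod (- z) = cmod z.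
Proof. exact: normcN. Qed.
Lemma cmodB z w : cmod (z - w) <= cmod z + cmod w.
Proof. by rewrite (le_trans (cmodD _ _))// cmodN. Qed.
Lemma cmod0 : cmod (0 : R[i]) = 0.
Proof. exact: ComplexField.Normc.normc0. Qed.
Lemma cmod1 : cmod (1 : R[i]) = 1.
Proof. exact: ComplexField.Normc.normc1. Qed.
Lemma cmod_eq0 z : cmod z = 0 -> z = 0.
Proof. exact: ComplexField.Normc.eq0_normc. Qed.
Lemma cmodX z k : cmod (z ^+ k) = cmod z ^+ k.
Proof. by elim: k => [|k IH]; rewrite ?expr0 ?cmod1// !exprS cmodM IH. Qed.
Lemma cmod_real (x : R) : cmod x%:C%C = `|x|.
Proof. by rewrite /cmod /= expr0n/= addr0 sqrtr_sqr. Qed.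

Lemma cmod_i : cmod ('i%C : R[i]) = 1.
Proof. by rewrite /cmod /= expr0n/= add0r expr1n sqrtr1. Qed.
Lemma cmod_expi (t : R) : cmod (expi t) = 1.
Proof. by rewrite /cmod /= cos2Dsin2 sqrtr1. Qed.
Lemma cmod_sum I (r : seq I) (P : pred I) (F : I -> R[i]) :
  cmod (\sum_(i <- r | P i) F i) <= \sum_(i <- r | P i) cmod (F i).
Proof.
elim/big_rec2: _ => [|i x y _ H]; first by rewrite cmod0.
by apply: le_trans (cmodD _ _) _; rewrite lerD2l.
Qed.
Lemma Re_le_cmod z : `|Re z| <= cmod z.
Proof.
case: z => a b; rewrite /cmod /= -sqrtr_sqr ler_sqrt ?lerDl ?sqr_ge0//.
by rewrite addr_ge0// sqr_ge0.
Qed.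
Lemma Im_le_cmod z : `|Im z| <= cmod z.
Proof.
case: z => a b; rewrite /cmod /= -sqrtr_sqr ler_sqrt ?lerDr ?sqr_ge0//.
by rewrite addr_ge0// sqr_ge0.
Qed.
Lemma cmod_le z : cmod z <= `|Re z| + `|Im z|.
Proof.
have := cmodD (Re z)%:C%C ('i%C * (Im z)%:C%C).
by rewrite -complexE cmodM cmod_i mul1r !cmod_real.
Qed.

Lemma expiD (s t : R) : expi (s + t) = expi s * expi t.
Proof.
by apply: complex_eqP; rewrite ?cReM ?cImM /= ?cosD ?sinD// addrC.
Qed.
Lemma expi0 : expi (0 : R) = 1.
Proof. by apply: complex_eqP => /=; rewrite ?cos0 ?sin0. Qed.

Definition ccvg (u : nat -> R[i]) z :=
  (Re (u k) @[k --> \oo] --> Re z) /\ (Im (u k) @[k --> \oo] --> Im z).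

Lemma ccvg_cmod u z : ccvg u z <-> cmod (u k - z) @[k --> \oo] --> (0 : R).
Proof.
split=> [[cR cI]|H].
  apply: (@squeeze_cvgr _ _ _ _ (fun=> 0)
    (fun k => `|Re (u k) - Re z| + `|Im (u k) - Im z|)).
  - by apply: nearW => k; rewrite cmod_ge0/= (le_trans (cmod_le _))// cReB cImB.
  - exact: cvg_cst.
  - rewrite -[X in _ --> X]addr0; apply: cvgD.
      by rewrite -[X in _ --> X](@normr0 R R); apply: cvg_norm;
        rewrite -(subrr (Re z)); apply: cvgB => //; exact: cvg_cst.
    by rewrite -[X in _ --> X](@normr0 R R); apply: cvg_norm;
      rewrite -(subrr (Im z)); apply: cvgB => //; exact: cvg_cst.
have aux (f : R[i] -> R) : (forall a b, f (a - b) = f a - f b) ->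
    (forall a, `|f a| <= cmod a) -> f (u k) @[k --> \oo] --> f z.
  move=> fB fl; apply/cvgrPdist_lt => e e0.
  move/cvgrPdist_lt : H => /(_ e e0); apply: filterS => k.
  rewrite sub0r normrN ger0_norm ?cmod_ge0// distrC -fB; apply: le_lt_trans.
  exact: fl.
by split; apply: aux => // *; [exact: cReB|exact: Re_le_cmod|exact: cImB|exact: Im_le_cmod].
Qed.

End complex_basics.

Section complex_measurable.
Context {R : realType} d {T : measurableType d}.
Implicit Types f g : T -> R[i].
Local Notation Re := complex.Re.
Local Notation Im := complex.Im.

Definition cmeas f :=
  measurable_fun setT (fun x => Re (f x)) /\ measurable_fun setT (fun x => Im (f x)).

Lemma cmeas_cst z : cmeas (fun=> z).
Proof. by split; exact: measurable_cst. Qed.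
Lemma cmeasD f g : cmeas f -> cmeas g -> cmeas (fun x => f x + g x).
Proof.
move=> [? ?] [? ?]; split; under eq_fun do rewrite ?cReD ?cImD;
  exact: measurable_funD.
Qed.
Lemma cmeasM f g : cmeas f -> cmeas g -> cmeas (fun x => f x * g x).
Proof.
move=> [? ?] [? ?]; split; under eq_fun do rewrite ?cReM ?cImM.
  by apply: measurable_funB; exact: measurable_funM.
by apply: measurable_funD; exact: measurable_funM.
Qed.
Lemma cmeas_sum I (r : seq I) (F : I -> T -> R[i]) :
  (forall i, cmeas (F i)) -> cmeas (fun x => \sum_(i <- r) F i x).
Proof.
move=> mF; elim: r => [|i r IH].
  by under eq_fun do rewrite big_nil; exact: cmeas_cst.
by under eq_fun do rewrite big_cons; exact: cmeasD.
Qed.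
Lemma cmeas_real (f : T -> R) : measurable_fun setT f -> cmeas (fun x => (f x)%:C%C).
Proof. by move=> mf; split => //=; exact: measurable_cst. Qed.
Lemma measurable_cmod f : cmeas f -> measurable_fun setT (fun x => cmod (f x)).
Proof.
move=> [mR mI].
have -> : (fun x => cmod (f x)) =
    (fun x => Num.sqrt (Re (f x) ^+ 2 + Im (f x) ^+ 2)).
  by apply/funext => x; case: (f x).
apply: (measurableT_comp (f := @Num.sqrt R)).
  exact: continuous_measurable_fun (@sqrt_continuous R).
by apply: measurable_funD; exact: measurable_funX.
Qed.
Lemma cmeas_expi (f : T -> R) : measurable_fun setT f -> cmeas (fun x => expi (f x)).
Proof.
move=> mf; split => /=.
  apply: (measurableT_comp (f := @cos R)) => //.
  exact: continuous_measurable_fun (@continuous_cos R).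
apply: (measurableT_comp (f := @sin R)) => //.
exact: continuous_measurable_fun (@continuous_sin R).
Qed.
Lemma cmeas_cvg (F : nat -> T -> R[i]) f : (forall k, cmeas (F k)) ->
  (forall x, ccvg (F ^~ x) (f x)) -> cmeas f.
Proof.
move=> mF cF; split.
  by apply: (measurable_fun_cvg (h := fun k x => Re (F k x))) => [k|x _];
    [have [] := mF k|have [] := cF x].
by apply: (measurable_fun_cvg (h := fun k x => Im (F k x))) => [k|x _];
    [have [] := mF k|have [] := cF x].
Qed.

End complex_measurable.

Arguments cmeas {R d T} f.

Lemma cmeas_comp (R : realType) d1 d2 (T1 : measurableType d1) (T2 : measurableType d2)
  (f : T2 -> R[i]) (h : T1 -> T2) :
  cmeas f -> measurable_fun setT h -> cmeas (fun x => f (h x)).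
Proof.
by move=> [mR mI] mh; split;
  [exact: (measurableT_comp mR)|exact: (measurableT_comp mI)].
Qed.

Section complex_integral.
Context {R : realType} {n : nat}.
Implicit Types (f g : 'rV[R]_n -> R[i]) (A : 'rV[R]_n -> R).
Local Notation Re := complex.Re.
Local Notation Im := complex.Im.
Local Notation mu := (lebesgue_rV n : {measure set 'rV[R]_n -> \bar R}).
Local Notation rintegrable A := (mu.-integrable setT (EFin \o A)).

Lemma ccontinuous_cmeas f : ccontinuous f -> cmeas f.
Proof. by move=> [? ?]; split; exact: continuous_measurable_rV. Qed.

Lemma rintegrable_le A B : measurable_fun setT A -> rintegrable B ->
  (forall x, `|A x| <= B x) -> rintegrable A.
Proof.
move=> mA iB AB; apply: le_integrable iB => //=; first exact/measurable_EFinP.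
by move=> x _; rewrite lee_fin (le_trans (AB x))// ler_norm.
Qed.

Lemma rintegrable_ge0 A : measurable_fun setT A -> (forall x, 0 <= A x) ->
  (\int[mu]_x (A x)%:E < +oo)%E -> rintegrable A.
Proof.
move=> mA A0 H; apply/integrableP; split; first exact/measurable_EFinP.
by under eq_integral do rewrite /= ger0_norm//.
Qed.

Lemma EFin_Rintegral A : rintegrable A -> (\int[mu]_x (A x)%:E)%E = (\int[mu]_x A x)%:E.
Proof. by move=> iA; rewrite fineK//; exact: integrable_fin_num. Qed.

Lemma cintegrableP f : cintegrable f <-> cmeas f /\ rintegrable (fun x => cmod (f x)).
Proof.
split=> [[iR iI]|[mf iC]].
  have mf : cmeas f by split; apply/measurable_EFinP; exact: measurable_int iR || exact: measurable_int iI.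
  split => //; apply: (@rintegrable_le _ (fun x => `|Re (f x)| + `|Im (f x)|)).
  - exact: measurable_cmod.
  - rewrite (_ : _ \o _ = ((fun x => (`|Re (f x)|%R)%:E) \+ (fun x => (`|Im (f x)|%R)%:E))%E) //.
    by apply: integrableD => //; [exact: (integrable_norm iR)|exact: (integrable_norm iI)].
  - by move=> x; rewrite ger0_norm ?cmod_ge0// cmod_le.
case: mf => mR mI; split.
  exact: (rintegrable_le mR iC (fun x => Re_le_cmod _)).
exact: (rintegrable_le mI iC (fun x => Im_le_cmod _)).
Qed.

Lemma cintegrable_le f A : cmeas f -> rintegrable A -> (forall x, cmod (f x) <= A x) ->
  cintegrable f.
Proof.
move=> mf iA fA; apply/cintegrableP; split => //; apply: rintegrable_le iA _.
  exact: measurable_cmod.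
by move=> x; rewrite ger0_norm ?cmod_ge0.
Qed.

(** The factor 2 comes from estimating real and imaginary parts separately. *)
Lemma cmod_cintegral f A : cmeas f -> rintegrable A -> (forall x, cmod (f x) <= A x) ->
  cmod (cintegral f) <= 2 * \int[mu]_x A x.
Proof.
move=> mf iA fA; have [iR iI] := cintegrable_le mf iA fA.
apply: le_trans (cmod_le _) _; rewrite mulr_natl mulr2n /=; apply: lerD.
  apply: le_trans (le_normr_Rintegral _ iR) _ => //.
  apply: le_Rintegral => //; first exact: (integrable_norm iR).
  by move=> x _; exact: le_trans (Re_le_cmod _) _.
apply: le_trans (le_normr_Rintegral _ iI) _ => //.
apply: le_Rintegral => //; first exact: (integrable_norm iI).
by move=> x _; exact: le_trans (Im_le_cmod _) _.
Qed.

Lemma cintegrableD f g : cintegrable f -> cintegrable g ->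
  cintegrable (fun x => f x + g x).
Proof.
move=> [a b] [c e]; split; under eq_fun do rewrite ?cReD ?cImD EFinD;
  exact: integrableD.
Qed.

Lemma cintegralD f g : cintegrable f -> cintegrable g ->
  cintegral (fun x => f x + g x) = cintegral f + cintegral g.
Proof.
move=> [a b] [c e]; apply: complex_eqP; rewrite ?cReD ?cImD /=.
  by under eq_Rintegral do rewrite cReD; rewrite RintegralD.
by under eq_Rintegral do rewrite cImD; rewrite RintegralD.
Qed.

Lemma cintegrableZ z f : cintegrable f -> cintegrable (fun x => z * f x).
Proof.
move=> /cintegrableP[mf iC]; apply/cintegrableP; split.
  by apply: cmeasM => //; exact: cmeas_cst.
under [X in _.-integrable _ X]eq_fun do rewrite /= cmodM EFinM.
exact: integrableZl.
Qed.

Lemma cintegralZ z f : cintegrable f ->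
  cintegral (fun x => z * f x) = z * cintegral f.
Proof.
move=> [a b]; have aZ (r : R) : rintegrable (fun x => r * Re (f x)).
  by under [X in _.-integrable _ X]eq_fun do rewrite /= EFinM; exact: integrableZl.
have bZ (r : R) : rintegrable (fun x => r * Im (f x)).
  by under [X in _.-integrable _ X]eq_fun do rewrite /= EFinM; exact: integrableZl.
apply: complex_eqP; rewrite ?cReM ?cImM /=.
  under eq_Rintegral do rewrite cReM.
  by rewrite RintegralB// !RintegralZl.
under eq_Rintegral do rewrite cImM.
by rewrite RintegralD// !RintegralZl.
Qed.

Lemma cintegral_sum I (r : seq I) (F : I -> 'rV[R]_n -> R[i]) :
  (forall i, cintegrable (F i)) ->
  cintegrable (fun x => \sum_(i <- r) F i x) /\
  cintegral (fun x => \sum_(i <- r) F i x) = \sum_(i <- r) cintegral (F i).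
Proof.
move=> iF; elim: r => [|i r [IH1 IH2]].
  under eq_fun do rewrite big_nil; rewrite big_nil; split.
    by split; exact: integrable0.
  by apply: complex_eqP => /=; rewrite Rintegral_cst//= mul0r.
under eq_fun do rewrite big_cons; rewrite big_cons; split.
  exact: cintegrableD.
by rewrite cintegralD// IH2.
Qed.

Lemma cdominated (F : nat -> 'rV[R]_n -> R[i]) f A :
  (forall k, cmeas (F k)) -> (forall x, ccvg (F ^~ x) (f x)) ->
  rintegrable A -> (forall k x, cmod (F k x) <= A x) ->
  cintegrable f /\ ccvg (fun k => cintegral (F k)) (cintegral f).
Proof.
move=> mF cF iA FA; have mf := cmeas_cvg mF cF.
have key (g : R[i] -> R) : (forall k, measurable_fun setT (fun x => g (F k x))) ->
    measurable_fun setT (fun x => g (f x)) ->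
    (forall x, g (F k x) @[k --> \oo] --> g (f x)) -> (forall z, `|g z| <= cmod z) ->
    rintegrable (fun x => g (f x)) /\
    (\int[mu]_x g (F k x) @[k --> \oo] --> \int[mu]_x g (f x)).
  move=> mg mgf cg gle.
  have /(_ _ _ _ _ _)[] := @dominated_convergence _ _ R mu setT measurableT
    (fun k x => (g (F k x))%:E) (fun x => (g (f x))%:E) (EFin \o A).
  - by move=> k; exact/measurable_EFinP.
  - exact/measurable_EFinP.
  - by apply: nearW => x _; apply: cvg_EFin; [exact: nearW|exact: cg].
  - by [].
  - apply: nearW => x k _; rewrite lee_fin.
    exact: le_trans (gle _) (FA _ _).
  move=> ig _ cvg; split => //.
  apply: fine_cvg; rewrite fineK//; exact: integrable_fin_num.
have [mR mI] := mf.
have [i1 c1] := key (@complex.Re R) (fun k => (mF k).1) mR (fun x => (cF x).1) (@Re_le_cmod R).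
have [i2 c2] := key (@complex.Im R) (fun k => (mF k).2) mI (fun x => (cF x).2) (@Im_le_cmod R).
by split; split.
Qed.

(** The product majorant makes the real and imaginary parts integrable on the product space, by
    Tonelli. *)
Lemma cfubini (F : 'rV[R]_n -> 'rV[R]_n -> R[i]) A B :
  cmeas (fun z : 'rV[R]_n * 'rV[R]_n => F z.1 z.2) -> rintegrable A -> rintegrable B ->
  (forall x y, cmod (F x y) <= A x * B y) ->
  [/\ cmeas (fun x => cintegral (F x)), cmeas (fun y => cintegral (F ^~ y)) &
    cintegral (fun x => cintegral (F x)) = cintegral (fun y => cintegral (F ^~ y))].
Proof.
move=> mF iA iB FAB; have [mR mI] := mF.
have key (g : R[i] -> R) :
    measurable_fun setT (fun z : 'rV[R]_n * 'rV[R]_n => g (F z.1 z.2)) ->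
    (forall z, `|g z| <= cmod z) ->
    [/\ measurable_fun setT (fun x => \int[mu]_y g (F x y)),
     measurable_fun setT (fun y => \int[mu]_x g (F x y)) &
     \int[mu]_x (\int[mu]_y g (F x y)) = \int[mu]_y (\int[mu]_x g (F x y))].
  move=> mg gle.
  have ig : (lebesgue_rV n \x lebesgue_rV n)%E.-integrable setT
      (EFin \o (fun z : 'rV[R]_n * 'rV[R]_n => g (F z.1 z.2))).
    apply/integrable12ltyP => /=; first exact/measurable_EFinP.
    have iA' := integrable_norm iA; have iB' := integrable_norm iB.
    apply: (@le_lt_trans _ _ (\int[mu]_x (`|A x| * \int[mu]_y `|B y|)%:E)%E).
      apply: ge0_le_integral => //.
      - by move=> x _; exact: integral_ge0.
      - apply: (@measurable_fun_fubini_tonelli_F _ _ _ _ _ (lebesgue_rV n)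
          (fun z => `|(g (F z.1 z.2))%:E|%E)) => //.
        by apply: measurableT_comp => //; exact/measurable_EFinP.
      - apply/measurable_EFinP; apply: measurable_funM => //.
        by have /measurable_EFinP := measurable_int _ iA'.
      move=> x _; rewrite EFinM -EFin_Rintegral// -ge0_integralZl//; last first.
        exact: measurable_int iB'.
      apply: ge0_le_integral => //.
      - apply: measurableT_comp => //; apply/measurable_EFinP.
        apply: measurableT_comp => //.
        apply: measurableT_comp => //.
        exact: (measurableT_comp mg (measurable_pair1 x)).
      - apply: emeasurable_funM; first exact: measurable_cst.
        exact: measurable_int iB'.
      move=> y _; rewrite lee_fin; apply: le_trans (gle _) _.
      by apply: le_trans (FAB _ _) _; rewrite -normrM ler_norm.
    under eq_integral do rewrite mulrC EFinM.
    rewrite ge0_integralZl//; last 2 first.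
    - by have /measurable_EFinP := measurable_int _ iA' => ?; exact/measurable_EFinP.
    - by rewrite lee_fin Rintegral_ge0.
    by rewrite EFin_Rintegral// -EFinM ltry.
  have mF1 : measurable_fun setT (fun x => \int[mu]_y g (F x y)).
    apply: (measurableT_comp (f := fine)); first exact: fine_measurable.
    exact: measurable_fubini_F ig.
  have mF2 : measurable_fun setT (fun y => \int[mu]_x g (F x y)).
    apply: (measurableT_comp (f := fine)); first exact: fine_measurable.
    exact: measurable_fubini_G ig.
  have f1 x : (\int[mu]_y (g (F x y))%:E)%E \is a fin_num.
    apply: integrable_fin_num => //.
    apply: (@rintegrable_le _ (fun y => `|A x| * `|B y|)).
    - exact: (measurableT_comp mg (measurable_pair1 x)).
    - under [X in _.-integrable _ X]eq_fun do rewrite /= EFinM.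
      exact: (integrableZl measurableT _ (integrable_norm iB)).
    by move=> y; apply: le_trans (gle _) _; apply: le_trans (FAB _ _) _; rewrite -normrM ler_norm.
  have f2 y : (\int[mu]_x (g (F x y))%:E)%E \is a fin_num.
    apply: integrable_fin_num => //.
    apply: (@rintegrable_le _ (fun x => `|B y| * `|A x|)).
    - exact: (measurableT_comp mg (measurable_pair2 y)).
    - under [X in _.-integrable _ X]eq_fun do rewrite /= EFinM.
      exact: (integrableZl measurableT _ (integrable_norm iA)).
    by move=> x; apply: le_trans (gle _) _; apply: le_trans (FAB _ _) _; rewrite mulrC -normrM ler_norm.
  split; [exact: mF1|exact: mF2|].
  rewrite /Rintegral; congr fine.
  under eq_integral do rewrite fineK//.
  under [RHS]eq_integral do rewrite fineK//.
  exact: (Fubini ig).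
have [a1 b1 c1] := key (@complex.Re R) mR (@Re_le_cmod R).
have [a2 b2 c2] := key (@complex.Im R) mI (@Im_le_cmod R).
split; [split; [exact: a1|exact: a2]|split; [exact: b1|exact: b2]|].
by apply: complex_eqP; [exact: c1|exact: c2].
Qed.

End complex_integral.

(** * Derivatives along the axes and integration by parts *)

Section line_derivative.
Context {R : realType} {n : nat}.
Local Notation Re := complex.Re.
Local Notation Im := complex.Im.
Local Notation mu := (lebesgue_rV n : {measure set 'rV[R]_n -> \bar R}).
Local Notation e_ i := (delta_mx ord0 i : 'rV[R]_n).
Implicit Types (f g F : 'rV[R]_n -> R[i]) (x z c : 'rV[R]_n) (i : 'I_n).

(** Restriction to the line through x gives access to the one-variable rules. The derivative is an
    argument of a relation, so that it can be exhibited as an explicit formula, and at single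
    points. *)
Definition pd_at i f f' x :=
  is_derive (0 : R) (1 : R) (fun t => Re (f (x + t *: e_ i))) (Re (f' x)) /\
  is_derive (0 : R) (1 : R) (fun t => Im (f (x + t *: e_ i))) (Im (f' x)).

Definition pd i f f' := forall x, pd_at i f f' x.

Lemma is_derive_line (g : 'rV[R]_n -> R) x v : derivable g x v ->
  is_derive (0 : R) (1 : R) (fun t => g (x + t *: v)) ('D_v g x).
Proof.
have E : (fun h : R => h^-1 *: (((fun t => g (x + t *: v)) \o shift 0) (h *: 1)
      - g (x + 0 *: v))) =
    (fun h : R => h^-1 *: ((g \o shift x) (h *: v) - g x)).
  apply/funext => h /=; rewrite addr0 scale0r addr0 [h *: 1]mulr1.
  by rewrite (addrC x).
by move=> dg; apply: DeriveDef; rewrite /derivable /derive E.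
Qed.

Lemma pderivable_pd i f : pderivable i f -> pd i f (pderiv i f).
Proof.
move=> H x; have [dR dI] := H x.
by split; [exact: (is_derive_line dR)|exact: (is_derive_line dI)].
Qed.

Lemma is_derive_translate (G : R -> R) t a : is_derive (0 : R) (1 : R) (fun s => G (t + s)) a ->
  is_derive t (1 : R) G a.
Proof.
have E : (fun h : R => h^-1 *: ((G \o shift t) (h *: 1) - G t)) =
    (fun h : R => h^-1 *: (((fun s => G (t + s)) \o shift 0) (h *: 1) - G (t + 0))).
  by apply/funext => h /=; rewrite !addr0 [t + _]addrC.
by case=> d1 d2; apply: DeriveDef; rewrite /derivable /derive E.
Qed.

Lemma pd_line i f f' : pd i f f' -> forall x t,
  is_derive t (1 : R) (fun t => Re (f (x + t *: e_ i))) (Re (f' (x + t *: e_ i))) /\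
  is_derive t (1 : R) (fun t => Im (f (x + t *: e_ i))) (Im (f' (x + t *: e_ i))).
Proof.
move=> H x t; have [a b] := H (x + t *: e_ i).
by split; apply: is_derive_translate; under eq_fun do rewrite scalerDl addrA.
Qed.

Lemma pd_ext i f g f' g' : f =1 g -> f' =1 g' -> pd i f f' -> pd i g g'.
Proof. by move=> /funext -> /funext ->. Qed.

Lemma pd_cst i (a : R[i]) : pd i (fun=> a) (fun=> 0).
Proof. by move=> x; split => /=; exact: is_derive_cst. Qed.

Lemma pdD_at i f g f' g' x : pd_at i f f' x -> pd_at i g g' x ->
  pd_at i (fun x => f x + g x) (fun x => f' x + g' x) x.
Proof.
move=> [a b] [u v]; split.
  by under eq_fun do rewrite cReD; rewrite cReD; exact: is_deriveD.
by under eq_fun do rewrite cImD; rewrite cImD; exact: is_deriveD.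
Qed.

Lemma pdM_at i f g f' g' x : pd_at i f f' x -> pd_at i g g' x ->
  pd_at i (fun x => f x * g x) (fun x => f' x * g x + f x * g' x) x.
Proof.
move=> [a b] [u v]; split.
  under eq_fun do rewrite cReM.
  apply: is_derive_eq; rewrite /= !scale0r !addr0 cReD !cReM /GRing.scale /=; ring.
under eq_fun do rewrite cImM.
apply: is_derive_eq; rewrite /= !scale0r !addr0 cImD !cImM /GRing.scale /=; ring.
Qed.

Lemma pdM i f g f' g' : pd i f f' -> pd i g g' ->
  pd i (fun x => f x * g x) (fun x => f' x * g x + f x * g' x).
Proof. by move=> df dg x; exact: pdM_at. Qed.

Lemma complex_invE (w : R[i]) :
  w^-1 = (Re w / (Re w ^+ 2 + Im w ^+ 2) +i* - (Im w / (Re w ^+ 2 + Im w ^+ 2)))%C.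
Proof. by case: w. Qed.

Lemma pdV_at i f f' x : f x != 0 -> pd_at i f f' x ->
  pd_at i (fun x => (f x)^-1) (fun x => - (f' x * ((f x)^-1 * (f x)^-1))) x.
Proof.
move=> fx0 [a b].
have d0 : Re (f (x + 0 *: e_ i)) ^+ 2 + Im (f (x + 0 *: e_ i)) ^+ 2 != 0.
  rewrite scale0r addr0; apply: contra fx0.
  rewrite paddr_eq0 ?sqr_ge0// !sqrf_eq0 => /andP[/eqP u /eqP v].
  by apply/eqP/complex_eqP.
have d1 : Re (f x) ^+ 2 + Im (f x) ^+ 2 != 0 by move: d0; rewrite scale0r addr0.
split; under eq_fun do rewrite complex_invE /=.
  apply: is_derive_eq; rewrite /= !scale0r !addr0 cReN !cReM !cImM !complex_invE.
  by rewrite /GRing.scale /=; field.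
apply: is_derive_eq; rewrite /= !scale0r !addr0 cImN !cImM !cReM !complex_invE.
by rewrite /GRing.scale /=; field.
Qed.

Lemma pd_at_zero i f f' x : (\forall t \near (0 : R), f (x + t *: e_ i) = 0) ->
  f' x = 0 -> pd_at i f f' x.
Proof.
move=> f0 f'0; rewrite /pd_at f'0; split.
  apply: (near_eq_is_derive (f := fun=> 0)); rewrite ?oner_neq0//.
    by near=> t; rewrite (near f0 t).
apply: (near_eq_is_derive (f := fun=> 0)); rewrite ?oner_neq0//.
by near=> t; rewrite (near f0 t).
Unshelve. all: by end_near. Qed.

Lemma dotDr z x y : dot z (x + y) = dot z x + dot z y.
Proof. by rewrite /dot -big_split; apply: eq_bigr => k _; rewrite mxE mulrDr. Qed.
Lemma dotDl x y z : dot (x + y) z = dot x z + dot y z.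
Proof. by rewrite /dot -big_split; apply: eq_bigr => k _; rewrite mxE mulrDl. Qed.
Lemma dotZr z (t : R) x : dot z (t *: x) = t * dot z x.
Proof. by rewrite /dot mulr_sumr; apply: eq_bigr => k _; rewrite mxE mulrCA. Qed.
Lemma dotC x z : dot x z = dot z x.
Proof. by apply: eq_bigr => k _; rewrite mulrC. Qed.
Lemma dotNl x z : dot (- x) z = - dot x z.
Proof. by rewrite /dot -sumrN; apply: eq_bigr => k _; rewrite mxE mulNr. Qed.
Lemma dotNr x z : dot x (- z) = - dot x z.
Proof. by rewrite dotC dotNl dotC. Qed.
Lemma dot_delta z i : dot z (e_ i) = z ord0 i.
Proof.
rewrite /dot (bigD1 i)//= mxE !eqxx mulr1 big1 ?addr0// => k ki.
by rewrite mxE (negbTE ki) andbF mulr0.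
Qed.
Lemma dot_le x z : `|dot x z| <= n%:R * (`|x| * `|z|).
Proof.
apply: le_trans (ler_norm_sum _ _ _) _.
apply: (@le_trans _ _ (\sum_(k < n) `|x| * `|z|)).
  by apply: ler_sum => k _; rewrite normrM ler_pM// coord_le_norm.
by rewrite sumr_const card_ord -[leLHS]mulr_natl.
Qed.
Lemma measurable_dot d (T : measurableType d) (h k : T -> 'rV[R]_n) :
  measurable_fun setT h -> measurable_fun setT k ->
  measurable_fun setT (fun t => dot (h t) (k t)).
Proof.
move=> mh mk; rewrite /dot; apply: measurable_sum => i.
apply: measurable_funM.
  exact: (measurableT_comp (measurable_coord i) mh).
exact: (measurableT_comp (measurable_coord i) mk).
Qed.

Lemma pd_comp_dot i (h h' : R -> R[i]) z (b : R) :
  (forall t : R, is_derive t (1 : R) (fun t => Re (h t)) (Re (h' t)) /\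
    is_derive t (1 : R) (fun t => Im (h t)) (Im (h' t))) ->
  pd i (fun x => h (dot z x + b)) (fun x => (z ord0 i)%:C%C * h' (dot z x + b)).
Proof.
move=> H x; set c := dot z x + b.
have E t : dot z (x + t *: e_ i) + b = t * z ord0 i + c.
  by rewrite dotDr dotZr dot_delta /c; ring.
have dl : is_derive (0 : R) (1 : R) (fun t : R => t * z ord0 i + c) (z ord0 i).
  by apply: is_derive_eq; rewrite /= /GRing.scale /=; ring.
have [a1 a2] := H c.
split; under eq_fun do rewrite E.
  have -> : Re ((z ord0 i)%:C%C * h' c) = Re (h' c) * z ord0 i.
    by rewrite cReM /= mul0r subr0 mulrC.
  by apply: (@is_derive1_comp _ (fun t => Re (h t)) (fun t : R => t * z ord0 i + c)) => //;
    rewrite mul0r add0r.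
have -> : Im ((z ord0 i)%:C%C * h' c) = Im (h' c) * z ord0 i.
  by rewrite cImM /= mul0r addr0 mulrC.
by apply: (@is_derive1_comp _ (fun t => Im (h t)) (fun t : R => t * z ord0 i + c)) => //;
  rewrite mul0r add0r.
Qed.

Lemma is_derive_expi (t : R) :
  is_derive t (1 : R) (fun t => Re (expi t)) (Re ('i%C * expi t)) /\
  is_derive t (1 : R) (fun t => Im (expi t)) (Im ('i%C * expi t)).
Proof.
split; rewrite ?cReM ?cImM /= !mul0r !mul1r ?add0r ?sub0r ?addr0.
  exact: is_derive_cos.
exact: is_derive_sin.
Qed.

Lemma pd_expi i z : pd i (fun x => expi (dot z x))
  (fun x => (z ord0 i)%:C%C * ('i%C * expi (dot z x))).
Proof.
have := @pd_comp_dot i (@expi R) (fun t => 'i%C * expi t) z 0 is_derive_expi.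
by apply: pd_ext => x; rewrite addr0.
Qed.

Lemma line_lipschitz (G G' : R -> R) (B : R) (s t : R) :
  (forall u, is_derive u (1 : R) G (G' u)) -> (forall u, `|G' u| <= B) ->
  `|G s - G t| <= B * `|s - t|.
Proof.
move=> dG bG.
wlog st : s t / t <= s.
  move=> H; have [/H//|/ltW/H] := leP t s.
  by rewrite distrC [in X in _ * X]distrC.
have cG : {within `[t, s], continuous G}.
  apply: derivable_within_continuous => u _; exact: (@ex_derive _ _ _ _ _ _ _ (dG u)).
have [u _ ->] := MVT_segment st (fun u _ => dG u) cG.
by rewrite normrM ler_wpM2r.
Qed.

Definition bsupp (B : R) c (r : R) F :=
  (forall x, cmod (F x) <= B) /\ (forall x, r < `|x - c| -> F x = 0).

Lemma integral_ball_cst (B : R) c (r : R) : 0 <= r ->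
  mu.-integrable setT (EFin \o (fun x => B * \1_[set x | `|x - c| <= r] x)) /\
  \int[mu]_x (B * \1_[set x | `|x - c| <= r] x) = B * (2 * r) ^+ n.
Proof.
move=> r0; have mA := measurable_closed_ball_rV c r.
have i1 : mu.-integrable setT (EFin \o (\1_[set x | `|x - c| <= r] : 'rV[R]_n -> R)).
  apply/integrableP; split; first exact/measurable_EFinP/measurable_indic.
  under eq_integral do rewrite /= ger0_norm//.
  by rewrite integral_indic// setIT lebesgue_closed_ball ?ltry.
split.
  by under [X in _.-integrable _ X]eq_fun do rewrite /= EFinM; exact: integrableZl.
rewrite RintegralZl// /Rintegral integral_indic// setIT.
by rewrite lebesgue_closed_ball.
Qed.

Lemma bsupp_le B c r F : 0 <= r -> bsupp B c r F ->
  forall x, cmod (F x) <= B * \1_[set x | `|x - c| <= r] x.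
Proof.
move=> r0 [bF sF] x; rewrite indicE; have [xr|xr] := leP `|x - c| r.
  by rewrite mem_set// mulr1.
rewrite sF// cmod0 memNset ?mulr0//= => H.
by have := le_lt_trans H xr; rewrite ltxx.
Qed.

Lemma bsupp_cintegrable B c r F : 0 <= r -> cmeas F -> bsupp B c r F ->
  cintegrable F /\ cmod (cintegral F) <= 2 * (B * (2 * r) ^+ n).
Proof.
move=> r0 mF bF; have [i1 e1] := integral_ball_cst B c r0.
split; first exact: cintegrable_le mF i1 (bsupp_le r0 bF).
by rewrite -e1; exact: cmod_cintegral mF i1 (bsupp_le r0 bF).
Qed.

Lemma bsupp_rintegrable B c r F : 0 <= r -> cmeas F -> bsupp B c r F ->
  mu.-integrable setT (EFin \o (fun x => cmod (F x))).
Proof. by move=> r0 mF bF; have [/cintegrableP[]] := bsupp_cintegrable r0 mF bF. Qed.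

(** By translation invariance the difference quotients with step 1/(k+1) have integral zero. The
    mean value theorem bounds them by B, and since the steps are at most 1 they vanish outside the
    ball of radius r + 1, so dominated convergence applies. *)
Lemma integral_deriv0 i (g g' : 'rV[R]_n -> R) (B c0 r : R) c : 0 <= r ->
  (forall x, is_derive (0 : R) (1 : R) (fun t => g (x + t *: e_ i)) (g' x)) ->
  measurable_fun setT g -> measurable_fun setT g' ->
  (forall x, `|g x| <= c0) -> (forall x, `|g' x| <= B) ->
  (forall x, r < `|x - c| -> g x = 0) ->
  \int[mu]_x g' x = 0.
Proof.
move=> r0 dg mg mg' bg bg' sg.
have dgl x t : is_derive t (1 : R) (fun t => g (x + t *: e_ i)) (g' (x + t *: e_ i)).
  by apply: is_derive_translate; under eq_fun do rewrite scalerDl addrA; exact: dg.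
pose h k x := k.+1%:R * (g (x + k.+1%:R^-1 *: e_ i) - g x).
have ig : mu.-integrable setT (EFin \o g).
  have [i1 _] := integral_ball_cst c0 c r0.
  apply: rintegrable_le i1 _ => // x; rewrite indicE; have [xr|xr] := leP `|x - c| r.
    by rewrite mem_set// mulr1.
  rewrite sg// normr0 memNset ?mulr0//= => H.
  by have := le_lt_trans H xr; rewrite ltxx.
have igt k := integral_translate (k.+1%:R^-1 *: e_ i) ig.
have ih k : \int[mu]_x h k x = 0.
  have [i1 e1] := igt k; rewrite /h RintegralZl//; last first.
    under [X in _.-integrable _ X]eq_fun do rewrite /= EFinB.
    exact: integrableB.
  by rewrite RintegralB// e1 subrr mulr0.
have ne : `|e_ i| <= 1.
  apply/rV_norm_leP => // j; rewrite mxE eqxx /=; case: (j == i) => //=.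
    by rewrite normr1.
  by rewrite normr0.
have hb k x : `|h k x| <= B * \1_[set x | `|x - c| <= r + 1] x.
  rewrite indicE; have [xr|xr] := leP `|x - c| (r + 1).
    rewrite mem_set// mulr1 /h normrM ger0_norm//.
    have := @line_lipschitz (fun t => g (x + t *: e_ i)) _ B k.+1%:R^-1 0
      (dgl x) (fun u => bg' _).
    rewrite subr0 scale0r addr0 (ger0_norm (_ : 0 <= k.+1%:R^-1))// => H.
    by rewrite -ler_pdivlMl// mulrC.
  have g0 : g x = 0 by apply: sg; lra.
  rewrite memNset ?mulr0; last by move=> H; have := le_lt_trans H xr; rewrite ltxx.
  rewrite /h g0 subr0 sg ?mulr0 ?normr0//.
  have : `|x - c| <= `|x + k.+1%:R^-1 *: e_ i - c| + `|k.+1%:R^-1 *: e_ i|.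
    rewrite (_ : x - c = x + k.+1%:R^-1 *: e_ i - c - k.+1%:R^-1 *: e_ i).
      exact: ler_normB.
    by apply/rowP => j; rewrite !mxE; ring.
  have : `|k.+1%:R^-1 *: e_ i| <= 1.
    rewrite normrZ ger0_norm//; apply: le_trans (ler_wpM2l _ ne) _ => //.
    by rewrite mulr1 invf_le1// ler1n.
  lra.
have mh k : measurable_fun setT (h k).
  apply: measurable_funM => //; apply: measurable_funB => //.
  exact: (measurableT_comp mg (measurable_translate _)).
have ch x : h k x @[k --> \oo] --> g' x.
  have [d1 d2] := dg x.
  have cv : (fun k : nat => k.+1%:R^-1 : R) @ \oo --> (0 : R)^'.
    move=> A HA; have : \forall k \near \oo, (fun y : R => y != 0 -> A y) (k.+1%:R^-1).
      exact: (@cvg_harmonic R _ HA).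
    by apply: filterS => k; apply; rewrite invr_eq0 pnatr_eq0.
  rewrite -d2; apply: cvg_trans (cvg_comp _ _ cv d1); apply: near_eq_cvg; apply: nearW => k.
  rewrite /h /= addr0 invrK scale0r addr0 /GRing.scale /= mulr1.
  by [].
have r1 : 0 <= r + 1 by lra.
have [i1 _] := integral_ball_cst B c r1.
have /(_ _ _ _ _ _)[] := @dominated_convergence _ _ R mu setT measurableT
    (fun k x => (h k x)%:E) (EFin \o g') (EFin \o (fun x => B * \1_[set x | `|x - c| <= r + 1] x)).
- by move=> k; exact/measurable_EFinP.
- exact/measurable_EFinP.
- by apply: nearW => x _; apply: cvg_EFin; [exact: nearW|exact: ch].
- exact: i1.
- by apply: nearW => x k _; rewrite lee_fin.
move=> ig' _ cv; rewrite /Rintegral.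
suff -> : (\int[mu]_x (g' x)%:E = 0)%E by [].
rewrite -(cvg_lim _ cv)//; apply: lim_near_cst => //; apply: nearW => k /=.
rewrite EFin_Rintegral ?ih//.
have [i1' e1] := igt k; rewrite /h.
under [X in _.-integrable _ X]eq_fun do rewrite /= EFinM EFinB.
by apply: integrableZl => //; exact: integrableB.
Qed.

Lemma cintegral_pd0 i F F' (B B' : R) c r : 0 <= r -> cmeas F -> cmeas F' ->
  pd i F F' -> bsupp B c r F -> bsupp B' c r F' -> cintegral F' = 0.
Proof.
move=> r0 [mR mI] [mR' mI'] dF [bF sF] [bF' sF'].
apply: complex_eqP => /=.
  apply: (@integral_deriv0 i (fun x => Re (F x)) _ B' B r c) => //.
  - by move=> x; have [] := dF x.
  - by move=> x; exact: le_trans (Re_le_cmod _) _.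
  - by move=> x; exact: le_trans (Re_le_cmod _) _.
  - by move=> x /sF ->.
apply: (@integral_deriv0 i (fun x => Im (F x)) _ B' B r c) => //.
- by move=> x; have [] := dF x.
- by move=> x; exact: le_trans (Im_le_cmod _) _.
- by move=> x; exact: le_trans (Im_le_cmod _) _.
- by move=> x /sF ->.
Qed.

(** The inverse Fourier transform without normalising constant; the Fourier transform itself is
    [FT F (- z)], up to a constant. *)
Definition FT F z := cintegral (fun x => expi (dot z x) * F x).

Lemma cmeas_expi_dot z F : cmeas F -> cmeas (fun x => expi (dot z x) * F x).
Proof.
move=> mF; apply: cmeasM => //; apply: cmeas_expi.
by apply: measurable_dot => //; exact: measurable_cst.
Qed.

Lemma bsupp_expi z B c r F : bsupp B c r F -> bsupp B c r (fun x => expi (dot z x) * F x).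
Proof.
move=> [bF sF]; split => x; first by rewrite cmodM cmod_expi mul1r.
by move=> /sF ->; rewrite mulr0.
Qed.

Lemma FT_le B c r F : 0 <= r -> cmeas F -> bsupp B c r F ->
  forall z, cmod (FT F z) <= 2 * (B * (2 * r) ^+ n).
Proof.
move=> r0 mF bF z.
by have [] := bsupp_cintegrable r0 (cmeas_expi_dot z mF) (bsupp_expi z bF).
Qed.

(** Integration by parts: the derivative of [expi (dot z x) * F x] along the i-th axis has integral
    zero. *)
Lemma FT_pd i F F' (B B' : R) c r : 0 <= r -> cmeas F -> cmeas F' ->
  pd i F F' -> bsupp B c r F -> bsupp B' c r F' ->
  forall z, (z ord0 i)%:C%C * FT F z = 'i%C * FT F' z.
Proof.
move=> r0 mF mF' dF bF bF' z.
have dP := pdM (pd_expi i z) dF.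
have i1 := (bsupp_cintegrable r0 (cmeas_expi_dot z mF) (bsupp_expi z bF)).1.
have i2 := (bsupp_cintegrable r0 (cmeas_expi_dot z mF') (bsupp_expi z bF')).1.
have E x : (z ord0 i)%:C%C * ('i%C * expi (dot z x)) * F x + expi (dot z x) * F' x =
   ((z ord0 i)%:C%C * 'i%C) * (expi (dot z x) * F x) + expi (dot z x) * F' x.
  by rewrite !mulrA.
have H : (z ord0 i)%:C%C * 'i%C * FT F z + FT F' z = 0.
  rewrite /FT -cintegralZ// -cintegralD//; last exact: cintegrableZ.
  have [b1 s1] := bsupp_expi z bF; have [b2 s2] := bsupp_expi z bF'.
  apply: (@cintegral_pd0 i (fun x => expi (dot z x) * F x) _ B
    (cmod ((z ord0 i)%:C%C * 'i%C) * B + B') c r) => //.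
  - exact: cmeas_expi_dot.
  - apply: cmeasD; last exact: cmeas_expi_dot.
    by apply: cmeasM; [exact: cmeas_cst|exact: cmeas_expi_dot].
  - exact: pd_ext dP.
  split => x; last by move=> xr; rewrite s1// s2// mulr0 addr0.
  apply: le_trans (cmodD _ _) _; apply: lerD => //.
  by rewrite cmodM ler_wpM2l ?cmod_ge0.
have -> : 'i%C * FT F' z = - 'i%C * ((z ord0 i)%:C%C * 'i%C * FT F z).
  by move/eqP : H; rewrite addr_eq0 => /eqP ->; rewrite mulrNN.
have -> : - 'i%C * ((z ord0 i)%:C%C * 'i%C * FT F z) =
  - ('i%C * 'i%C) * ((z ord0 i)%:C%C * FT F z) by ring.
by rewrite -expr2 sqr_i opprK mul1r.
Qed.

Definition tower i c (r : R) (M : nat) (F : nat -> 'rV[R]_n -> R[i]) :=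
  [/\ forall l, (l <= M)%N -> cmeas (F l),
      forall l, (l < M)%N -> pd i (F l) (F l.+1) &
      forall l, (l <= M)%N -> exists B, bsupp B c r (F l)].

Lemma FT_tower i c r M (F : nat -> 'rV[R]_n -> R[i]) : 0 <= r -> tower i c r M F -> forall z,
  (z ord0 i)%:C%C ^+ M * FT (F 0%N) z = 'i%C ^+ M * FT (F M) z.
Proof.
move=> r0; elim: M => [|M IH] [mF dF bF] z; first by rewrite !expr0 !mul1r.
rewrite exprS -mulrA IH; last first.
  by split => [l lM|l lM|l lM]; [apply: mF|apply: dF|apply: bF]; rewrite ltnW.
have [B HB] := bF M (leqnSn M); have [B' HB'] := bF M.+1 (leqnn _).
rewrite mulrCA (FT_pd r0 (mF M (leqnSn _)) (mF M.+1 (leqnn _)) (dF M (leqnn _)) HB HB').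
by rewrite mulrA -exprSr.
Qed.

End line_derivative.

(** * Symbol classes and the decay of their Fourier transforms *)

Section symbols.
Context {R : realType} {n : nat} (i : 'I_n) {J : Type}.
Variables (rho : J -> R) (D : J -> set 'rV[R]_n).
Hypothesis rho_gt0 : forall k, 0 < rho k.
Local Notation e_ i := (delta_mx ord0 i : 'rV[R]_n).
Implicit Types (f g : J -> 'rV[R]_n -> R[i]) (W : J -> R).

(* Families of functions with M derivatives along the i-th axis on the sets D k,
   the l-th one being bounded by W k * rho k ^- l uniformly in k. *)
Fixpoint sym (M : nat) W f : Prop :=
  [/\ exists2 B, 0 <= B & forall k x, D k x -> cmod (f k x) <= B * W k,
      forall k, cmeas (f k) &
      if M is M'.+1 then exists2 f', forall k x, D k x -> pd_at i (f k) (f' k) x &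
        sym M' (fun k => W k / rho k) f'
      else True].

(** Symbols supported in [D k]. Here the derivative exists on all of R^n, as integration by parts
    requires, whereas a [sym] family is controlled on [D k] only and serves as a multiplier. *)
Fixpoint symV (M : nat) W f : Prop :=
  [/\ exists2 B, 0 <= B & forall k x, D k x -> cmod (f k x) <= B * W k,
      forall k, cmeas (f k), (forall k x, ~ D k x -> f k x = 0) &
      if M is M'.+1 then exists2 f', forall k, pd i (f k) (f' k) &
        symV M' (fun k => W k / rho k) f'
      else True].

Lemma symV_bound M W f : symV M W f ->
  exists2 B, 0 <= B & forall k x, D k x -> cmod (f k x) <= B * W k.
Proof. by case: M => [|M] []. Qed.
Lemma symV_cmeas M W f : symV M W f -> forall k, cmeas (f k).
Proof. by case: M => [|M] []. Qed.
Lemma symV_out M W f : symV M W f -> forall k x, ~ D k x -> f k x = 0.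
Proof. by case: M => [|M] []. Qed.

Lemma sym_weaken M W f : sym M.+1 W f -> sym M W f.
Proof.
elim: M W f => [|M IH] W f [bf mf [f' df sf]]; first by split.
by split => //; exists f' => //; exact: IH.
Qed.
Lemma symV_weaken M W f : symV M.+1 W f -> symV M W f.
Proof.
elim: M W f => [|M IH] W f [bf mf vf [f' df sf]]; first by split.
by split => //; exists f' => //; exact: IH.
Qed.

Lemma sym_weight M W W' f (c : R) : 0 <= c -> (forall k, W k <= c * W' k) ->
  sym M W f -> sym M W' f.
Proof.
move=> c0; elim: M W W' f => [|M IH] W W' f WW [[B B0 bf] mf H]; split => //.
- exists (B * c); first exact: mulr_ge0.
  by move=> k x Dx; apply: le_trans (bf _ _ Dx) _; rewrite -mulrA ler_wpM2l.
- exists (B * c); first exact: mulr_ge0.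
  by move=> k x Dx; apply: le_trans (bf _ _ Dx) _; rewrite -mulrA ler_wpM2l.
case: H => f' df sf; exists f' => //; apply: IH sf => k.
by rewrite mulrA ler_wpM2r// invr_ge0 ltW.
Qed.

Lemma sym_ext M W W' f : (forall k, W k = W' k) -> sym M W f -> sym M W' f.
Proof. by move=> WW; apply: (@sym_weight _ _ _ _ 1) => // k; rewrite mul1r WW. Qed.

Lemma symD M W f g : sym M W f -> sym M W g -> sym M W (fun k x => f k x + g k x).
Proof.
elim: M W f g => [|M IH] W f g [[B B0 bf] mf H] [[B' B0' bg] mg H']; split.
1,4: exists (B + B'); [exact: addr_ge0|move=> k x Dx; rewrite mulrDl;
  by apply: le_trans (cmodD _ _) _; apply: lerD; [exact: bf|exact: bg]].
1,3: by move=> k; exact: cmeasD.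
1: by [].
case: H => f' df sf; case: H' => g' dg sg.
exists (fun k x => f' k x + g' k x); last exact: IH.
by move=> k x Dx; apply: pdD_at; [exact: df|exact: dg].
Qed.

Lemma symVD M W f g : symV M W f -> symV M W g -> symV M W (fun k x => f k x + g k x).
Proof.
elim: M W f g => [|M IH] W f g [[B B0 bf] mf vf H] [[B' B0' bg] mg vg H']; split.
1,5: exists (B + B'); [exact: addr_ge0|move=> k x Dx; rewrite mulrDl;
  by apply: le_trans (cmodD _ _) _; apply: lerD; [exact: bf|exact: bg]].
1,4: by move=> k; exact: cmeasD.
1,3: by move=> k x Dx; rewrite vf// vg// addr0.
1: by [].
case: H => f' df sf; case: H' => g' dg sg.
exists (fun k x => f' k x + g' k x); last exact: IH.
by move=> k x; apply: pdD_at; [exact: df|exact: dg].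
Qed.

Lemma bound_mul W W' f g B B' : 0 <= B -> 0 <= B' ->
  (forall k x, D k x -> cmod (f k x) <= B * W k) ->
  (forall k x, D k x -> cmod (g k x) <= B' * W' k) ->
  forall k x, D k x -> cmod (f k x * g k x) <= B * B' * (W k * W' k).
Proof.
move=> B0 B0' bf bg k x Dx; rewrite cmodM mulrACA.
by apply: ler_pM; rewrite ?cmod_ge0//; [exact: bf|exact: bg].
Qed.

Lemma symM M W W' f g : sym M W f -> sym M W' g ->
  sym M (fun k => W k * W' k) (fun k x => f k x * g k x).
Proof.
elim: M W W' f g => [|M IH] W W' f g sf sg.
  have [[B B0 bf] mf _] := sf; have [[B' B0' bg] mg _] := sg; split => //.
    by exists (B * B'); [exact: mulr_ge0|exact: bound_mul].
  by move=> k; exact: cmeasM.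
have [[B B0 bf] mf [f' df sf']] := sf; have [[B' B0' bg] mg [g' dg sg']] := sg.
split.
- by exists (B * B'); [exact: mulr_ge0|exact: bound_mul].
- by move=> k; exact: cmeasM.
exists (fun k x => f' k x * g k x + f k x * g' k x).
  by move=> k x Dx; apply: pdM_at; [exact: df|exact: dg].
apply: symD.
  by apply: sym_ext (IH _ _ _ _ sf' (sym_weaken sg)) => k; rewrite mulrAC.
by apply: sym_ext (IH _ _ _ _ (sym_weaken sf) sg') => k; rewrite mulrA.
Qed.

Hypothesis D_closed : forall k x, ~ D k x ->
  \forall t \near (0 : R), ~ D k (x + t *: e_ i).

Lemma symV_weight M W W' f (c : R) : 0 <= c -> (forall k, W k <= c * W' k) ->
  symV M W f -> symV M W' f.
Proof.
move=> c0; elim: M W W' f => [|M IH] W W' f WW [[B B0 bf] mf vf H]; split => //.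
- exists (B * c); first exact: mulr_ge0.
  by move=> k x Dx; apply: le_trans (bf _ _ Dx) _; rewrite -mulrA ler_wpM2l.
- exists (B * c); first exact: mulr_ge0.
  by move=> k x Dx; apply: le_trans (bf _ _ Dx) _; rewrite -mulrA ler_wpM2l.
case: H => f' df sf; exists f' => //; apply: IH sf => k.
by rewrite mulrA ler_wpM2r// invr_ge0 ltW.
Qed.

Lemma symV_ext M W W' f : (forall k, W k = W' k) -> symV M W f -> symV M W' f.
Proof. by move=> WW; apply: (@symV_weight _ _ _ _ 1) => // k; rewrite mul1r WW. Qed.

(* Off D k the product rule holds because f k vanishes near the point. *)
Lemma symVM M W W' f g : symV M W f -> sym M W' g ->
  symV M (fun k => W k * W' k) (fun k x => f k x * g k x).
Proof.
elim: M W W' f g => [|M IH] W W' f g sf sg.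
  have [[B B0 bf] mf vf _] := sf; have [[B' B0' bg] mg _] := sg; split => //.
  - by exists (B * B'); [exact: mulr_ge0|exact: bound_mul].
  - by move=> k; exact: cmeasM.
  - by move=> k x /vf ->; rewrite mul0r.
have [[B B0 bf] mf vf [f' df sf']] := sf; have [[B' B0' bg] mg [g' dg sg']] := sg.
split.
- by exists (B * B'); [exact: mulr_ge0|exact: bound_mul].
- by move=> k; exact: cmeasM.
- by move=> k x /vf ->; rewrite mul0r.
exists (fun k x => f' k x * g k x + f k x * g' k x).
  move=> k x; have [Dx|nDx] := pselect (D k x).
    by apply: pdM_at; [exact: df|exact: dg].
  apply: pd_at_zero; last by rewrite (symV_out sf')// (vf _ _ nDx) !mul0r addr0.
  by apply: filterS (D_closed nDx) => t nD; rewrite vf// mul0r.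
apply: symVD.
  by apply: symV_ext (IH _ _ _ _ sf' (sym_weaken sg)) => k; rewrite mulrAC.
by apply: symV_ext (IH _ _ _ _ (symV_weaken sf) sg') => k; rewrite mulrA.
Qed.

Lemma sym_cst M (a : J -> R[i]) : sym M (fun k => cmod (a k)) (fun k _ => a k).
Proof.
elim: M a => [|M IH] a; split.
1,4: by exists 1 => // k x _; rewrite mul1r.
1,3: by move=> k; exact: cmeas_cst.
1: by [].
exists (fun _ _ => 0); first by move=> k x _; exact: pd_cst.
apply: (@sym_weight _ _ _ _ 0) (IH (fun=> 0)) => // k.
by rewrite cmod0 mul0r.
Qed.

Lemma sym_coord M i' : (exists2 B, 0 <= B & forall k x, D k x -> `|x| <= B * rho k) ->
  sym M rho (fun _ x => (x ord0 i')%:C%C).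
Proof.
move=> [B B0 DB].
have b0 : exists2 B, 0 <= B & forall k x, D k x -> cmod (x ord0 i')%:C%C <= B * rho k.
  exists B => // k x Dx; rewrite cmod_real; apply: le_trans (DB _ _ Dx).
  exact: coord_le_norm.
have mm : forall k : J, cmeas (fun x : 'rV[R]_n => (x ord0 i')%:C%C).
  by move=> _; apply: cmeas_real; exact: measurable_coord.
case: M => [|M]; split => //.
exists (fun _ _ => (e_ i ord0 i')%:C%C).
  move=> k x _; split => /=; last exact: is_derive_cst.
  under eq_fun do rewrite !mxE.
  by apply: is_derive_eq; rewrite /GRing.scale /= !mxE; ring.
apply: (@sym_weight _ _ _ _ 1) (sym_cst M (fun=> (e_ i ord0 i')%:C%C)) => // k.
rewrite divff ?gt_eqF// mulr1 cmod_real mxE eqxx /=.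
by case: (i' == i); rewrite ?normr1 ?normr0.
Qed.

Lemma symX M W f l : sym M W f -> sym M (fun k => W k ^+ l) (fun k x => f k x ^+ l).
Proof.
move=> sf; elim: l => [|l IH].
  apply: (@sym_weight _ _ _ _ 1) (sym_cst M (fun=> 1)) => // k.
  by rewrite cmod1 expr0 mulr1.
apply: sym_ext (fun k => esym (exprS _ _)) _.
under [X in sym _ _ X]eq_fun => k do under eq_fun do rewrite exprS.
exact: symM.
Qed.

Lemma sym_sum M W I (r : seq I) (F : I -> J -> 'rV[R]_n -> R[i]) :
  (forall k, 0 <= W k) -> (forall l, sym M W (F l)) ->
  sym M W (fun k x => \sum_(l <- r) F l k x).
Proof.
move=> W0 sF; elim: r => [|l r IH].
  apply: (@sym_weight _ _ _ _ 0) (_ : sym M (fun=> 0) _) => //.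
    by move=> k; rewrite mul0r.
  under [X in sym _ _ X]eq_fun => k do under eq_fun do rewrite big_nil.
  by apply: sym_ext (sym_cst M (fun=> 0)) => k; rewrite cmod0.
under [X in sym _ _ X]eq_fun => k do under eq_fun do rewrite big_cons.
exact: symD.
Qed.

(** The derivative of 1/f is -f' (1/f)^2, so induction on M applies; the lower bound for |f| on
    [D k] gives the size of 1/f. *)
Lemma symV_inv M W f (c : R) : 0 < c -> (forall k, 0 < W k) ->
  (forall M, sym M W f) -> (forall k, cmeas (fun x => (f k x)^-1)) ->
  (forall k x, D k x -> c * W k <= cmod (f k x)) ->
  sym M (fun k => (W k)^-1) (fun k x => (f k x)^-1).
Proof.
move=> c0 W0 sf mv lf.
have fn0 k x : D k x -> f k x != 0.
  move=> Dx; apply/eqP => f0; have := lf _ _ Dx; rewrite f0 cmod0 leNgt.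
  by rewrite mulr_gt0.
have b : exists2 B, 0 <= B & forall k x, D k x -> cmod (f k x)^-1 <= B * (W k)^-1.
  exists c^-1; first by rewrite invr_ge0 ltW.
  move=> k x Dx; rewrite -invfM [cmod _]ComplexField.Normc.normcV.
  rewrite lef_pV2 ?posrE ?mulr_gt0//; last by rewrite (lt_le_trans _ (lf _ _ Dx))// mulr_gt0.
  exact: lf.
elim: M => [|M IH]; split => //.
have [_ _ [f' df sf']] := sf M.+1.
exists (fun k x => - (f' k x * ((f k x)^-1 * (f k x)^-1))).
  by move=> k x Dx; apply: pdV_at; [exact: fn0|exact: df].
under [X in sym _ _ X]eq_fun => k do under eq_fun do rewrite -mulN1r.
have := symM (sym_cst M (fun=> -1)) (symM sf' (symM IH IH)).
apply: sym_ext => k; rewrite cmodN cmod1 mul1r.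
have := W0 k; have := rho_gt0 k; move=> r0 w0; field; by rewrite !gt_eqF.
Qed.

(** Each integration by parts gains a factor 1/rho, and integrating the last derivative over a ball
    of radius A rho costs rho^n. *)
Lemma symV_FT M W f (A : R) : (forall k, 0 <= W k) -> 0 <= A ->
  (forall k x, D k x -> `|x| <= A * rho k) ->
  symV M W f -> exists2 B : R, 0 <= B & forall k (z : 'rV[R]_n),
    `|z ord0 i| ^+ M * cmod (FT (f k) z) <= B * (W k * rho k ^+ n / rho k ^+ M).
Proof.
move=> W0 A0 DA; elim: M W f W0 => [|M IH] W f W0 sf.
  have [[B B0 bf] mf vf _] := sf.
  exists (2 * B * (2 * A) ^+ n); first by rewrite !mulr_ge0// exprn_ge0// mulr_ge0.
  move=> k z; rewrite expr0 mul1r expr0 divr1.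
  apply: le_trans (@FT_le _ _ (B * W k) 0 (A * rho k) _ _ (mf k) _ z) _.
  - by rewrite mulr_ge0// ltW.
  - split => x; last first.
      rewrite subr0 => xA; apply: vf => Dx; have := DA _ _ Dx.
      by rewrite leNgt xA.
    have [Dx|nDx] := pselect (D k x); first exact: bf.
    by rewrite vf// cmod0 mulr_ge0.
  by rewrite !exprMn le_eqVlt; apply/orP; left; apply/eqP; ring.
have [[B B0 bf] mf vf [f' df sf']] := sf.
have W0' k : 0 <= W k / rho k by rewrite divr_ge0// ltW.
have [B1 B10 H1] := IH _ _ W0' sf'; have [[B2 B20 bf'] ] : [/\ exists2 B, 0 <= B &
    forall k x, D k x -> cmod (f' k x) <= B * (W k / rho k), True & True].
  by split => //; exact: symV_bound sf'.
move=> _ _; exists B1 => // k z.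
have E : (z ord0 i)%:C%C * FT (f k) z = 'i%C * FT (f' k) z.
  have bs (C : R) (g : 'rV[R]_n -> R[i]) : (forall x, D k x -> cmod (g x) <= C) -> 0 <= C ->
      (forall x, ~ D k x -> g x = 0) -> bsupp C 0 (A * rho k) g.
    move=> bg C0 vg; split => x; last first.
      by rewrite subr0 => xA; apply: vg => /DA; rewrite leNgt xA.
    have [Dx|nDx] := pselect (D k x); first exact: bg.
    by rewrite vg// cmod0.
  apply: (@FT_pd _ _ i _ _ (B * W k) (B2 * (W k / rho k)) 0 (A * rho k)) => //.
  - by rewrite mulr_ge0// ltW.
  - exact: symV_cmeas sf' k.
  - by apply: bs; [exact: bf|exact: mulr_ge0|exact: vf].
  - by apply: bs; [exact: bf'|exact: mulr_ge0|exact: symV_out sf' k].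
move/(congr1 (@cmod R)) : E; rewrite !cmodM cmod_i mul1r cmod_real => E.
rewrite exprSr -mulrA E; apply: le_trans (H1 k z) _.
rewrite le_eqVlt; apply/orP; left; apply/eqP; congr (_ * _).
by rewrite exprS invfM; ring.
Qed.

End symbols.

(** * Nonnegative sums over countable index sets *)

Section countable_sums.
Context {R : realType} {I : countType}.
Implicit Types a : I -> \bar R.

(** The enumeration turns an unordered sum into a series, for which monotone convergence and
    linearity are available; numbers that encode no index contribute 0. *)
Lemma esum_pickle a : (forall k, 0 <= a k)%E ->
  \esum_(k in [set: I]) a k = (\sum_(0 <= u <oo) oapp a 0%E (@pickle_inv I u))%E.
Proof.
move=> a0; rewrite nneseries_esumT; last by move=> u; case: pickle_inv => [k|] //=.
have -> : \esum_(k in [set: I]) a k = \esum_(u in [set choice.pickle k | k in [set: I]]) oapp a 0%E (@pickle_inv I u).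
  rewrite (@reindex_esum R I nat setT [set choice.pickle k | k in [set: I]] choice.pickle).
    by apply: eq_esum => k _; rewrite pickleK_inv.
  by split; [move=> k _; exists k|move=> j k _ _ /(pcan_inj (@pickleK_inv I))|].
rewrite esum_mkcond; apply: eq_esum => u _; case: ifPn => // /negP nu.
case E : (@pickle_inv I u) => [k|] //=; exfalso; apply: nu.
rewrite inE; exists k => //; have := @pickle_invK I u.
by rewrite E.
Qed.

Lemma integral_esum d (T : measurableType d) (mu : {measure set T -> \bar R})
  (f : I -> T -> \bar R) :
  (forall k, measurable_fun setT (f k)) -> (forall k x, 0 <= f k x)%E ->
  measurable_fun setT (fun x => \esum_(k in [set: I]) f k x) /\
  (\int[mu]_x (\esum_(k in [set: I]) f k x) = \esum_(k in [set: I]) (\int[mu]_x f k x))%E.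
Proof.
move=> mf f0.
have E x : (\esum_(k in [set: I]) f k x =
    \sum_(0 <= u <oo) oapp (f ^~ x) 0 (@pickle_inv I u))%E by exact: esum_pickle.
have mg u : measurable_fun setT (fun x => oapp (f ^~ x) 0%E (@pickle_inv I u)).
  by case: pickle_inv => [k|] /=; [exact: mf|exact: measurable_cst].
split.
  under eq_fun do rewrite E.
  by apply: (@ge0_emeasurable_sum _ _ _ _ _ xpredT) => // u x _ _; case: pickle_inv => [k|] //=.
under eq_integral do rewrite E.
rewrite integral_nneseries//; last by move=> u x _; case: pickle_inv => [k|] //=.
rewrite esum_pickle; last by move=> k; exact: integral_ge0.
apply: eq_eseriesr => u _; case: pickle_inv => //=; exact: integral0.
Qed.

Lemma esum_single a k0 : (forall k, 0 <= a k)%E -> (forall k, k != k0 -> a k = 0%E) ->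
  \esum_(k in [set: I]) a k = a k0.
Proof.
move=> a0 H; rewrite -[RHS]esum_set1//.
rewrite [RHS]esum_mkcond; apply: eq_esum => k _; case: ifPn => // /negP nk.
by apply: H; apply/eqP => kk; apply: nk; rewrite inE kk.
Qed.

Lemma esum_le (a : I -> R) (B : R) :
  (forall s : seq I, uniq s -> \sum_(k <- s) a k <= B) ->
  (\esum_(k in [set: I]) (a k)%:E <= B%:E)%E.
Proof.
move=> H; apply: ge_ereal_sup => _ [X [fX _] <-].
rewrite fsbig_finite//= sumEFin lee_fin; apply: H; exact: fset_uniq.
Qed.

Lemma le_esum_seq (a : I -> R) (s : seq I) : uniq s -> (forall k, 0 <= a k) ->
  ((\sum_(k <- s) a k)%:E <= \esum_(k in [set: I]) (a k)%:E)%E.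
Proof.
move=> us a0; rewrite -sumEFin (fsbig_seq _ (fun k => (a k)%:E) us).
apply: esum_ge; exists [set` s] => //; split => //; exact: finite_seq.
Qed.

Lemma esumZ (c : R) a : 0 <= c -> (forall k, 0 <= a k)%E ->
  (\esum_(k in [set: I]) (c%:E * a k) = c%:E * \esum_(k in [set: I]) a k)%E.
Proof.
move=> c0 a0; rewrite !esum_pickle//; last by move=> k; rewrite mule_ge0.
rewrite -nneseriesZl//; last by move=> u _; case: pickle_inv => [k|] //=.
by apply: eq_eseriesr => u _; case: pickle_inv => //=; rewrite mule0.
Qed.

End countable_sums.

Lemma measurable_inv_ge0 (R : realType) d (T : measurableType d) (f : T -> R) :
  (forall x, 0 <= f x) -> measurable_fun setT f -> measurable_fun setT (fun x => (f x)^-1).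
Proof.
move=> f0 mf; have -> : (fun x => (f x)^-1) = (fun x => f x `^ (- 1)).
  by apply/funext => x; rewrite powR_inv1.
exact: (measurableT_comp (measurable_powR _) mf).
Qed.

(** * A weight that is summable over the lattice and integrable *)

Section lattice.
Context {R : realType} {n : nat}.
Local Notation mu := (lebesgue_rV n : {measure set 'rV[R]_n -> \bar R}).
Implicit Types (x y z : 'rV[R]_n) (k m : 'rV[int]_n).

Definition latt k : 'rV[R]_n := \row_l (k ord0 l)%:~R.

(** A product over the coordinates, so that lattice sums factor into one-dimensional ones; by
    [decay_Wt] it dominates the radial weight of order 2n. *)
Definition Wt z : R := \prod_l (1 + `|z ord0 l|) ^- 2.

Lemma Wt_gt0 z : 0 < Wt z.
Proof. by apply: prodr_gt0 => l _; rewrite invr_gt0 exprn_gt0// ltr_pwDl. Qed.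

Lemma Wt_ge0 z : 0 <= Wt z. Proof. exact/ltW/Wt_gt0. Qed.

Lemma Wt_le1 z : Wt z <= 1.
Proof.
apply: prodr_ile1 => l _; rewrite invr_ge0 exprn_ge0 ?addr_ge0//=.
by rewrite invf_le1 ?exprn_gt0 ?ltr_pwDl// exprn_ege1// lerDl.
Qed.

(** A change of a coordinate by at most 1 changes [1 + |z_l|] by a factor of at most 2, hence each
    factor of the weight by at most 4. *)
Lemma Wt_near x y : (forall l, `|x ord0 l - y ord0 l| <= 1) -> Wt x <= 4 ^+ n * Wt y.
Proof.
move=> H; rewrite /Wt -[n in 4 ^+ n]card_ord -prodr_const -big_split/=.
apply: ler_prod => l _; have p (u : R) : 0 < 1 + `|u| by rewrite ltr_pwDl.
rewrite invr_ge0 exprn_ge0 ?(ltW (p _))//=.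
rewrite ler_pdivlMr ?exprn_gt0// mulrC ler_pdivrMr ?exprn_gt0//.
rewrite (_ : 4 = 2 ^+ 2); last by rewrite -natrX.
rewrite -exprMn lerXn2r ?nnegrE ?mulr_ge0 ?(ltW (p _))//.
have := H l; have := ler_normB (x ord0 l) (x ord0 l - y ord0 l).
rewrite (_ : x ord0 l - (x ord0 l - y ord0 l) = y ord0 l); last by ring.
by have := normr_ge0 (x ord0 l); lra.
Qed.

Lemma decay_Wt z : (1 + `|z|) ^- (2 * n) <= Wt z.
Proof.
rewrite /Wt prodfV exprM -[X in _ ^+ X]card_ord -prodr_const.
rewrite lef_pV2 ?posrE; last 2 first.
- by apply: prodr_gt0 => l _; rewrite exprn_gt0// ltr_pwDl.
- by apply: prodr_gt0 => l _; rewrite exprn_gt0// ltr_pwDl.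
apply: ler_prod => l _; rewrite exprn_ge0 ?addr_ge0//=.
by rewrite lerXn2r ?nnegrE ?addr_ge0// lerD2l coord_le_norm.
Qed.

Lemma sum_int_decay (N : nat) :
  \sum_(t < (2 * N).+1) (1 + `|(t%:Z - N%:Z)%:~R : R|) ^- 2 <= 4.
Proof.
(* The stronger bound 3 - 2/(N+1) is stable under induction: the two new terms 2/(N+2)^2 are at most
   2/(N+1) - 2/(N+2). *)
apply: (@le_trans _ _ (3 - 2 / N.+1%:R)); last first.
  have : (0 : R) <= 2 / N.+1%:R by rewrite divr_ge0.
  by move: (2 / _) => u u0; lra.
elim: N => [|N IH].
  by rewrite muln0 big_ord_recl big_ord0 subrr normr0 !addr0 expr1n invr1; lra.
rewrite mulnS big_ord_recl big_ord_recr /=.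
rewrite (eq_bigr (fun t : 'I_(2 * N).+1 => (1 + `|(t%:Z - N%:Z)%:~R : R|) ^- 2)); last first.
  by move=> t _; congr (((1 + `| _%:~R|) ^+ 2)^-1); rewrite /bump /=; lia.
have -> : `|((0%N : int) - N.+1%:Z)%:~R : R| = N.+1%:R.
  by rewrite sub0r mulrNz normrN ger0_norm.
have -> : `|((bump 0 (2 * N).+1 : int) - N.+1%:Z)%:~R : R| = N.+1%:R.
  rewrite (_ : (bump 0 (2 * N).+1 : int) - N.+1%:Z = N.+1%:Z); last by rewrite /bump /=; lia.
  by rewrite ger0_norm.
have -> : (1 + N.+1%:R : R) = N.+2%:R by rewrite -[1]/(1%:R) -natrD.
suff : 2 * N.+2%:R ^- 2 <= 2 / N.+1%:R - 2 / N.+2%:R :> R.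
  move=> H; apply: (le_trans (lerD (lexx _) (lerD IH (lexx _)))); move: H.
  by move: (2 / N.+1%:R) (2 / N.+2%:R) (N.+2%:R ^- 2) => v w z; lra.
have a0 : (0 : R) < N.+1%:R by rewrite ltr0n.
have -> : N.+2%:R = N.+1%:R + 1 :> R by rewrite -[in LHS]addn1 natrD.
move: (N.+1%:R : R) a0 => a a0.
have b0 : 0 < a + 1 by lra.
have -> : 2 / a - 2 / (a + 1) = 2 / (a * (a + 1)) by field; rewrite ?gt_eqF.
rewrite ler_wpM2l// lef_pV2 ?posrE ?exprn_gt0 ?mulr_gt0//.
rewrite expr2 ler_wpM2r ?ltW//; lra.
Qed.

(** A finite set of lattice points lies in a box, over which the sum of products is the product of
    one-dimensional sums. *)
Lemma sum_lattice (s : seq 'rV[int]_n) : uniq s -> \sum_(k <- s) Wt (latt k) <= 4 ^+ n.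
Proof.
move=> us.
pose N := (\max_(k <- s) \max_(l < n) absz (k ord0 l))%N.
have kN k l : k \in s -> (absz (k ord0 l) <= N)%N.
  move=> ks; apply: leq_trans (leq_bigmax_seq _ ks _) => //.
  exact: (@leq_bigmax _ (fun l => absz (k ord0 l)) l).
pose toZ (h : {ffun 'I_n -> 'I_(2 * N).+1}) : 'rV[int]_n := \row_l ((h l)%:Z - N%:Z).
have toZ_inj : injective toZ.
  move=> h h' /rowP E; apply/ffunP => l; apply/val_inj => /=.
  by have := E l; rewrite !mxE => /addIr [].
have sub : {subset s <= [seq toZ h | h <- enum {ffun 'I_n -> 'I_(2 * N).+1}]}.
  move=> k ks; apply/mapP; exists [ffun l => inord (absz (k ord0 l + N%:Z))].
    by rewrite mem_enum.
  apply/rowP => l; rewrite mxE ffunE; have := kN k l ks; move: (k ord0 l) => u uN.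
  rewrite inordK; lia.
apply: (@le_trans _ _ (\sum_(k <- [seq toZ h | h <- enum {ffun 'I_n -> 'I_(2 * N).+1}]) Wt (latt k))).
  have uT : uniq [seq toZ h | h <- enum {ffun 'I_n -> 'I_(2 * N).+1}].
    by rewrite map_inj_uniq// enum_uniq.
  rewrite [leRHS](bigID (mem s))/= -[X in _ <= X + _]big_filter.
  rewrite [X in _ <= X + _](perm_big s)/=; last first.
    apply: uniq_perm => //; first exact: filter_uniq.
    by move=> k; rewrite mem_filter; case: (boolP (k \in s)) => // /sub ->.
  by rewrite lerDl sumr_ge0// => k _; exact: Wt_ge0.
rewrite big_map big_enum /= /Wt.
under eq_bigr do under eq_bigr do rewrite !mxE.
rewrite -(bigA_distr_bigA (fun (l : 'I_n) (t : 'I_(2 * N).+1) =>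
  (1 + `|(t%:Z - N%:Z)%:~R : R|) ^- 2)).
rewrite -[n in 4 ^+ n]card_ord -prodr_const; apply: ler_prod => l _.
rewrite sum_int_decay andbT; apply: sumr_ge0 => t _.
by rewrite invr_ge0 exprn_ge0// addr_ge0.
Qed.

(** Replacing x by the corner of its unit cube costs 4^n, and the remaining lattice sum is at most
    4^n. *)
Lemma esum_Wt x : (\esum_(k in [set: 'rV[int]_n]) (Wt (x - latt k))%:E <= (16 ^+ n)%:E)%E.
Proof.
pose k0 := cube_index 0 x.
apply: esum_le => s us.
apply: (@le_trans _ _ (\sum_(k <- [seq k0 - k | k <- s]) 4 ^+ n * Wt (latt k))).
  rewrite big_map; apply: ler_sum => k _; apply: Wt_near => l.
  rewrite !mxE expr0 mul1r intrB.
  have /andP[] := floor_itv (x ord0 l); rewrite intrD1 => a b.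
  by rewrite (_ : _ - _ - _ = x ord0 l - (Num.floor (x ord0 l))%:~R); [rewrite ger0_norm; lra|ring].
rewrite -mulr_sumr (_ : 16 = 4 * 4); last by rewrite -natrM.
rewrite exprMn ler_wpM2l ?exprn_ge0//; apply: sum_lattice.
by rewrite map_inj_uniq// => k k' /addrI/oppr_inj.
Qed.

Lemma integral_cubes (nu : nat) (f : 'rV[R]_n -> \bar R) : measurable_fun setT f ->
  (forall x, 0 <= f x)%E ->
  (\int[mu]_x f x = \esum_(m in [set: 'rV[int]_n]) \int[mu]_(x in cube nu m) f x)%E.
Proof.
move=> mf f0.
have E x : f x = (\esum_(m in [set: 'rV[int]_n]) (f \_ (cube nu m)) x)%E.
  rewrite (@esum_single _ _ _ (cube_index nu x)).
  - by rewrite patchE mem_set//; apply/cubeE.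
  - by move=> m; rewrite patchE; case: ifP.
  move=> m mx; rewrite patchE memNset// => /cubeE mE.
  by rewrite mE eqxx in mx.
under eq_integral do rewrite E.
have mc (m : 'rV[int]_n) : measurable_fun setT (f \_ (cube nu m)).
  apply/(measurable_restrictT _ (measurable_cube nu m)).
  exact: measurable_funS mf.
have c0 (m : 'rV[int]_n) x : (0 <= (f \_ (cube nu m)) x)%E by rewrite patchE; case: ifP.
have [_ ->] := integral_esum mu mc c0.
by apply: eq_esum => m _; rewrite [RHS]integral_mkcond.
Qed.

Lemma measurable_Wt (a : R) (b : 'rV[R]_n) : measurable_fun setT (fun x => Wt (a *: x + b)).
Proof.
apply: (@measurable_prod _ _ _ _ _ _ (fun (l : 'I_n) x => (1 + `|(a *: x + b) ord0 l|) ^- 2)) => l _.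
apply: measurable_inv_ge0; first by move=> x; rewrite exprn_ge0// addr_ge0.
apply: measurable_funX; apply: measurable_funD => //.
apply: measurableT_comp => //; under eq_fun do rewrite !mxE.
apply: measurable_funD => //; apply: measurable_funM => //; exact: measurable_coord.
Qed.

(** On each cube of side 2^-nu the weight is, up to 4^n, its value at the corner. The corners form a
    rescaled lattice, so [esum_Wt] gives the constant 64^n = 4^n 16^n. *)
Lemma integral_Wt (nu : nat) y :
  (\int[mu]_x (Wt (2 ^+ nu *: (x - y)))%:E <= (64 ^+ n * 2 ^- (nu * n))%:E)%E.
Proof.
have mW : measurable_fun setT (fun x => (Wt (2 ^+ nu *: (x - y)))%:E).
  apply/measurable_EFinP; under eq_fun do rewrite scalerBr.
  exact: measurable_Wt.
rewrite (integral_cubes nu)//; last by move=> x; rewrite lee_fin Wt_ge0.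
apply: (@le_trans _ _ (\esum_(k in [set: 'rV[int]_n])
    ((4 ^+ n * 2 ^- (nu * n))%:E * (Wt (2 ^+ nu *: y - latt k))%:E))%E).
  apply: le_esum => k _.
  apply: (@le_trans _ _ (\int[mu]_(x in cube nu k) (4 ^+ n * Wt (2 ^+ nu *: y - latt k))%:E)%E).
    apply: ge0_le_integral => //.
    - exact: measurable_cube.
    - by move=> x _; rewrite lee_fin Wt_ge0.
    - exact: measurable_funS mW.
    move=> x /cubeE kx; rewrite lee_fin.
    rewrite (_ : Wt (2 ^+ nu *: y - latt k) = Wt (latt k - 2 ^+ nu *: y)).
      apply: Wt_near => l; rewrite kx !mxE.
      have /andP[] := floor_itv (2 ^+ nu * x ord0 l); rewrite intrD1 => a b.
      rewrite (_ : _ - _ = 2 ^+ nu * x ord0 l - (Num.floor (2 ^+ nu * x ord0 l))%:~R); [rewrite ger0_norm; lra|ring].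
    by apply: eq_bigr => l _; rewrite !mxE distrC.
  rewrite integral_cst//; last exact: measurable_cube.
  rewrite [X in (_ * X)%E](lebesgue_cube nu k) -!EFinM lee_fin mulrAC.
  by [].
rewrite esumZ//; last by move=> k; rewrite lee_fin Wt_ge0.
apply: le_trans (lee_wpmul2l _ (esum_Wt _)) _; first by rewrite lee_fin mulr_ge0 ?exprn_ge0.
rewrite -EFinM lee_fin (_ : 64 = 4 * 16); last by rewrite -natrM.
by rewrite exprMn mulrAC.
Qed.

End lattice.

(** * Pure derivatives and decay in all directions *)

Section pure_derivatives.
Context {R : realType} {n : nat}.
Local Notation Re := complex.Re.
Local Notation Im := complex.Im.
Local Notation e_ i := (delta_mx ord0 i : 'rV[R]_n).
Implicit Types (f a : 'rV[R]_n -> R[i]) (x y z c v : 'rV[R]_n) (i : 'I_n).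

Lemma csupport_out f x : ~ csupport f x -> f x = 0.
Proof.
move=> nx; apply/eqP; apply: contra_notT nx => fx.
by apply: subset_closure.
Qed.

Lemma near_csupport f x : ~ csupport f x -> \forall y \near x, ~ csupport f y.
Proof.
move=> nx; have oU : open (~` csupport f) by apply: closed_openC; exact: closed_closure.
exact: open_nbhs_nbhs.
Qed.

Lemma line_near (P : set 'rV[R]_n) x v : (\forall y \near x, P y) ->
  \forall t \near (0 : R), P (x + t *: v).
Proof.
move=> nP.
have : (fun t : R => x + t *: v) @ (0 : R) --> x.
  rewrite -[X in _ --> X]addr0 -[X in _ --> x + X](scale0r v).
  by apply: cvgD; [exact: cvg_cst|apply: cvgZr_tmp; exact: cvg_id].
by move=> /(_ _ nP).
Qed.

Lemma pderivs_out w f x : ~ csupport f x -> pderivs w f x = 0.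
Proof.
elim: w x => [|i w IH] x nx; first exact: csupport_out.
have z0 (g : R[i] -> R) : g 0 = 0 -> 'D_(e_ i) (fun y => g (pderivs w f y)) x = 0.
  move=> g0; have : is_derive x (e_ i) (fun y => g (pderivs w f y)) 0.
    have cst0 : is_derive x (e_ i) (fun _ : 'rV[R]_n => 0 : R) 0 by exact: is_derive_cst.
    apply: near_eq_is_derive cst0.
    by apply: filterS (near_csupport nx) => y ny; rewrite IH// g0.
  by case.
by apply: complex_eqP => /=; rewrite z0.
Qed.

Definition pure i (l : nat) : 'I_n -> nat := fun i' => if i' == i then l else 0%N.

Lemma mdeg_pure i l : mdeg (pure i l) = l.
Proof.
rewrite /mdeg (bigD1 i)//= /pure eqxx big1 ?addn0// => j ji.
by rewrite (negbTE ji).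
Qed.

Lemma mderiv_pure i l f : mderiv (pure i l) f = pderivs (nseq l i) f.
Proof.
rewrite /mderiv; congr pderivs.
have H (s : seq 'I_n) : uniq s ->
    flatten [seq nseq (pure i l i') i' | i' <- s] = if i \in s then nseq l i else [::].
  elim: s => [|j s IH] //= /andP[js us]; rewrite IH// inE /pure (eq_sym i j).
  case: (eqVneq j i) => [ji|ji] //=; subst j.
  by rewrite (negbTE js) cats0.
by rewrite H ?enum_uniq// mem_enum.
Qed.

Lemma norm_attained (n_gt0 : (0 < n)%N) x : exists i, `|x| = `|x ord0 i|.
Proof.
have [x0|x0] := eqVneq `|x| 0.
  exists (Ordinal n_gt0); rewrite x0; move/eqP : x0; rewrite normr_eq0 => /eqP ->.
  by rewrite mxE normr0.
have [[a i] H] := @mx_norm_neq0 _ _ _ x x0.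
by exists i; rewrite [LHS]H /= (ord1 a).
Qed.

End pure_derivatives.

Section decay.
Context {R : realType} {n : nat} (n_gt0 : (0 < n)%N) {J : Type}.
Variables (rho : J -> R) (D : J -> set 'rV[R]_n).
Hypothesis rho_gt0 : forall k, 0 < rho k.

(** The sup norm of z is attained at some coordinate i, so derivatives along single axes suffice:
    the bounds with no and with M derivatives along e_i give boundedness and decay of order M. *)
Lemma symV_decay (W : J -> R) (f : J -> 'rV[R]_n -> R[i]) (A : R) (M : nat) :
  (forall k, 0 <= W k) -> 0 <= A -> (forall k x, D k x -> `|x| <= A * rho k) ->
  (forall i M, symV i rho D M W f) ->
  exists2 B, 0 <= B & forall k (z : 'rV[R]_n),
    cmod (FT (f k) z) <= B * (W k * rho k ^+ n) * (1 + rho k * `|z|) ^- M.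
Proof.
move=> W0 A0 DA sf.
(* The constants are chosen as a function of i, so that they can be summed over the axes. *)
have H (i : 'I_n) M' : {B : R | 0 <= B & forall k (z : 'rV[R]_n),
    `|z ord0 i| ^+ M' * cmod (FT (f k) z) <= B * (W k * rho k ^+ n / rho k ^+ M')}.
  exact: cid2 (symV_FT rho_gt0 W0 A0 DA (sf i M')).
pose B i M' := s2val (H i M').
have B0 i M' : 0 <= B i M' := s2valP (H i M').
have HB i M' := s2valP' (H i M').
pose Bs := \sum_i (B i 0%N + B i M).
have Bs0 : 0 <= Bs by apply: sumr_ge0 => i _; exact: addr_ge0.
exists (2 ^+ M * Bs); first by rewrite mulr_ge0// exprn_ge0.
move=> k z; set w := W k * rho k ^+ n.
have w0 : 0 <= w by rewrite mulr_ge0// exprn_ge0// ltW.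
have u0 : 0 <= rho k * `|z| by rewrite mulr_ge0// ltW.
rewrite ler_pdivlMr ?exprn_gt0//; last by rewrite ltr_pwDl.
have [i Hi] := norm_attained n_gt0 z.
have BB : B i 0%N + B i M <= Bs.
  by rewrite /Bs (bigD1 i)//= lerDl sumr_ge0// => j _; exact: addr_ge0.
have h0 : cmod (FT (f k) z) <= B i 0%N * w.
  by have := HB i 0%N k z; rewrite !expr0 mul1r divr1.
have h1 : (rho k * `|z|) ^+ M * cmod (FT (f k) z) <= B i M * w.
  rewrite exprMn Hi -mulrA; apply: le_trans (ler_wpM2l _ (HB i M k z)) _.
    by rewrite exprn_ge0// ltW.
  rewrite -/w [w / _]mulrC mulrCA [X in _ * X]mulrA divff ?mul1r//.
  by rewrite expf_neq0// gt_eqF.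
have h2 : (1 + rho k * `|z|) ^+ M <= 2 ^+ M * (1 + (rho k * `|z|) ^+ M).
  move: (rho k * `|z|) u0 => u u0.
  have [u1|u1] := leP u 1.
    apply: (@le_trans _ _ (2 ^+ M)); first by rewrite lerXn2r ?nnegrE ?addr_ge0//; lra.
    by rewrite ler_peMr ?exprn_ge0// lerDl exprn_ge0.
  apply: (@le_trans _ _ ((2 * u) ^+ M)).
    by rewrite lerXn2r ?nnegrE ?addr_ge0 ?mulr_ge0//; lra.
  by rewrite exprMn ler_wpM2l ?exprn_ge0// lerDr.
apply: le_trans (ler_wpM2l (cmod_ge0 _) h2) _.
rewrite mulrCA -!mulrA ler_wpM2l ?exprn_ge0//.
rewrite mulrDr mulr1 [_ * _ ^+ M]mulrC.
apply: le_trans (lerD h0 h1) _; rewrite -mulrDl; exact: ler_wpM2r.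
Qed.

End decay.

(** * The Taylor remainder of the exponential and vanishing moments *)

Section exp_tail.
Context {R : realType}.
Local Notation Re := complex.Re.
Local Notation Im := complex.Im.

Definition cder (h h' : R -> R[i]) := forall t : R,
  is_derive t (1 : R) (fun t => Re (h t)) (Re (h' t)) /\
  is_derive t (1 : R) (fun t => Im (h t)) (Im (h' t)).

(* etail N t is e^{it} minus its Taylor polynomial of degree N - 1. *)
Fixpoint etail (N : nat) (t : R) : R[i] :=
  if N is N'.+1 then etail N' t - ('i%C ^+ N' / N'`!%:R) * (t ^+ N')%:C%C else expi t.

Lemma cder_term (a : R[i]) N : cder (fun t => a * (t ^+ N)%:C%C)
  (fun t => (a * N%:R) * (t ^+ N.-1)%:C%C).
Proof.
move=> t.
have -> : a * N%:R = a * (N%:R : R)%:C%C by rewrite rmorph_nat.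
have dX : is_derive t (1 : R) (fun x : R => x ^+ N) (N%:R * t ^+ N.-1).
  apply: DeriveDef; first exact: exprn_derivable.
  by rewrite exp_derive /GRing.scale /= mulr1.
split; rewrite !(cReM, cImM) /=; under eq_fun do rewrite ?(cReM, cImM) /=.
  under eq_fun do rewrite mulr0 subr0.
  apply: is_derive_eq; rewrite /GRing.scale /=; ring.
under eq_fun do rewrite mulr0 add0r.
apply: is_derive_eq; rewrite /GRing.scale /=; ring.
Qed.

Lemma cderB h h' g g' : cder h h' -> cder g g' ->
  cder (fun t => h t - g t) (fun t => h' t - g' t).
Proof.
move=> dh dg t; have [a b] := dh t; have [u v] := dg t; split.
  by under eq_fun do rewrite cReB; rewrite cReB; exact: is_deriveB.
by under eq_fun do rewrite cImB; rewrite cImB; exact: is_deriveB.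
Qed.

Lemma cder_etail N : cder (etail N) (fun t => 'i%C * etail N.-1 t).
Proof.
elim: N => [|N IH] /=; first exact: is_derive_expi.
have := cderB IH (cder_term ('i%C ^+ N / N`!%:R) N).
case: N IH => [|N] IH; congr cder; apply/funext => t /=.
  by rewrite mulr0 mul0r subr0.
rewrite mulrBr; congr (_ - _); rewrite mulrA; congr (_ * _).
rewrite factS natrM exprS invfM.
have F0 : N.+1%:R != 0 :> R[i] by rewrite pnatr_eq0.
have F1 : N`!%:R != 0 :> R[i] by rewrite pnatr_eq0 -lt0n fact_gt0.
by rewrite -[LHS]mulrA [_ / _ * _]mulrAC mulVf// mul1r mulrA.
Qed.

Lemma etail0 N : etail N.+1 0 = 0.
Proof.
elim: N => [|N IH]; last by rewrite /= -/(etail N.+1 0) IH expr0n /= mulr0 subr0.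
by rewrite /= expi0 expr0 fact0 divr1 mul1r subrr.
Qed.

Lemma line_lipschitz_loc (G G' : R -> R) (B : R) (s : R) :
  (forall u, is_derive u (1 : R) G (G' u)) -> (forall u, `|u| <= `|s| -> `|G' u| <= B) ->
  `|G s - G 0| <= B * `|s|.
Proof.
move=> dG bG.
have cG a b : {within `[a, b], continuous G}.
  apply: derivable_within_continuous => u _; exact: (@ex_derive _ _ _ _ _ _ _ (dG u)).
have [s0|s0] := leP 0 s.
  have [u] := MVT_segment s0 (fun u _ => dG u) (cG 0 s).
  rewrite in_itv/= => /andP[u0 us] ->.
  rewrite normrM subr0 ler_wpM2r//; apply: bG.
  by rewrite !ger0_norm.
have [u] := MVT_segment (ltW s0) (fun u _ => dG u) (cG s 0).
rewrite in_itv/= => /andP[us u0] E.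
rewrite distrC E normrM sub0r normrN ler_wpM2r//; apply: bG.
by rewrite !ler0_norm ?lerN2// ltW.
Qed.

(** The remainder vanishes at 0 and its derivative is ['i * etail N]. Each integration costs a
    factor 2, one for the real and one for the imaginary part. *)
Lemma etail_le N t : cmod (etail N t) <= 2 ^+ N * `|t| ^+ N.
Proof.
elim: N t => [|N IH] t; first by rewrite [etail 0 t]/(expi t) cmod_expi !expr0 mulr1.
have b u : `|u| <= `|t| -> cmod ('i%C * etail N u) <= 2 ^+ N * `|t| ^+ N.
  move=> ut; rewrite cmodM cmod_i mul1r; apply: le_trans (IH u) _.
  by rewrite ler_wpM2l ?exprn_ge0// lerXn2r ?nnegrE.
have dE := cder_etail N.+1.
apply: le_trans (cmod_le _) _.
have h1 := @line_lipschitz_loc (fun t => Re (etail N.+1 t)) _ _ t (fun u => (dE u).1)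
  (fun u ut => le_trans (Re_le_cmod _) (b u ut)).
have h2 := @line_lipschitz_loc (fun t => Im (etail N.+1 t)) _ _ t (fun u => (dE u).2)
  (fun u ut => le_trans (Im_le_cmod _) (b u ut)).
move: h1 h2; rewrite etail0 /= !subr0 => h1 h2.
apply: le_trans (lerD h1 h2) _.
by rewrite !exprSr le_eqVlt; apply/orP; left; apply/eqP; ring.
Qed.

Lemma etail_continuous N : continuous (fun t => Re (etail N t)) /\
  continuous (fun t => Im (etail N t)).
Proof.
split=> t; apply: differentiable_continuous; apply/derivable1_diffP.
  by have [[H _] _] := cder_etail N t.
by have [_ [H _]] := cder_etail N t.
Qed.

Lemma cmeas_etail N d (T : measurableType d) (h : T -> R) :
  measurable_fun setT h -> cmeas (fun t => etail N (h t)).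
Proof.
move=> mh; have [c1 c2] := etail_continuous N.
by split; [exact: (measurableT_comp (continuous_measurable_fun c1))|
  exact: (measurableT_comp (continuous_measurable_fun c2))].
Qed.

End exp_tail.

Section polynomials.
Context {R : realType} {n : nat}.
Implicit Types (P Q : 'rV[R]_n -> R) (c w : 'rV[R]_n) (a : 'rV[R]_n -> R[i]).

Definition polyfun (d : nat) P := exists2 s : seq (R * ('I_n -> nat)),
  all (fun t => mdeg t.2 <= d)%N s & forall x, P x = \sum_(t <- s) t.1 * monom t.2 x.

Lemma polyfunS d d' P : (d <= d')%N -> polyfun d P -> polyfun d' P.
Proof.
move=> dd [s sd Ps]; exists s => //; apply: sub_all sd => t /leq_trans; exact.
Qed.

Lemma polyfun_ext d P Q : P =1 Q -> polyfun d P -> polyfun d Q.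
Proof. by move=> /funext ->. Qed.

Lemma polyfun_cst d (a : R) : polyfun d (fun=> a).
Proof.
exists [:: (a, fun=> 0%N)]; first by rewrite /= /mdeg big1.
by move=> x; rewrite big_seq1 /monom /= big1 ?mulr1.
Qed.

Lemma polyfunD d P Q : polyfun d P -> polyfun d Q -> polyfun d (fun x => P x + Q x).
Proof.
move=> [s sd Ps] [t td Qt]; exists (s ++ t); first by rewrite all_cat sd td.
by move=> x; rewrite big_cat /= -Ps -Qt.
Qed.

Lemma polyfunZ d (k : R) P : polyfun d P -> polyfun d (fun x => k * P x).
Proof.
move=> [s sd Ps]; exists [seq (k * t.1, t.2) | t <- s].
  by rewrite all_map; apply: sub_all sd.
by move=> x; rewrite Ps mulr_sumr big_map; apply: eq_bigr => t _; rewrite mulrA.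
Qed.

Lemma polyfun_coord d i P : polyfun d P -> polyfun d.+1 (fun x => x ord0 i * P x).
Proof.
move=> [s sd Ps].
exists [seq (t.1, fun k => (t.2 k + (k == i))%N) | t <- s].
  rewrite all_map; apply: sub_all sd => t /= td.
  rewrite /mdeg big_split/= [X in (_ + X)%N](_ : _ = 1%N) ?addn1//.
  by rewrite (bigD1 i)//= eqxx big1// => k ki; rewrite (negbTE ki).
move=> x; rewrite Ps mulr_sumr big_map; apply: eq_bigr => t _ /=.
rewrite mulrCA; congr (_ * _); rewrite /monom.
under [RHS]eq_bigr do rewrite exprD.
rewrite big_split/= mulrC; congr (_ * _).
by rewrite (bigD1 i)//= eqxx expr1 big1 ?mulr1// => k ki; rewrite (negbTE ki) expr0.
Qed.

Lemma polyfun_sum d (F : 'I_n -> 'rV[R]_n -> R) : (forall k, polyfun d (F k)) ->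
  polyfun d (fun x => \sum_k F k x).
Proof.
move=> H; elim: (index_enum 'I_n) => [|k r IH].
  by apply: polyfun_ext (polyfun_cst d 0) => x; rewrite big_nil.
by apply: polyfun_ext (polyfunD (H k) IH) => x; rewrite big_cons.
Qed.

Lemma polyfun_affine d i (b : R) P : polyfun d P -> polyfun d.+1 (fun x => (x ord0 i + b) * P x).
Proof.
move=> pP; have := polyfunD (polyfun_coord i pP) (polyfunS (leqnSn d) (polyfunZ b pP)).
by apply: polyfun_ext => x; rewrite mulrDl.
Qed.

Lemma polyfun_dot d w c P : polyfun d P -> polyfun d.+1 (fun x => dot w (x - c) * P x).
Proof.
move=> pP; have := polyfun_sum (fun k => polyfunZ (w ord0 k) (polyfun_affine k (- c ord0 k) pP)).
by apply: polyfun_ext => x; rewrite /dot mulr_suml; apply: eq_bigr => k _; rewrite !mxE mulrA.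
Qed.

Lemma polyfun_dotX d w c : polyfun d (fun x => dot w (x - c) ^+ d).
Proof.
elim: d => [|d IH]; first exact: polyfun_cst.
by apply: polyfun_ext (polyfun_dot w c IH) => x; rewrite exprS.
Qed.

Lemma monom_cintegrable be a (B r : R) c : 0 <= r -> cmeas a -> bsupp B c r a ->
  cintegrable (fun x => (monom be x)%:C%C * a x).
Proof.
move=> r0 ma [ba sa].
have B0 : 0 <= B by apply: le_trans (ba 0); exact: cmod_ge0.
suff H : bsupp ((\prod_k (`|c| + r) ^+ be k) * B) c r (fun x => (monom be x)%:C%C * a x).
  apply: (bsupp_cintegrable r0 _ H).1.
  apply: cmeasM => //; apply: cmeas_real; rewrite /monom.
  apply: (@measurable_prod _ _ _ _ _ _ (fun (l : 'I_n) (x : 'rV[R]_n) => x ord0 l ^+ be l)) => l _.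
  by apply: measurable_funX; exact: measurable_coord.
split => x; last by move=> /sa ->; rewrite mulr0.
have [xr|xr] := leP `|x - c| r; last first.
  by rewrite sa// mulr0 cmod0 mulr_ge0// prodr_ge0// => k _; rewrite exprn_ge0// addr_ge0.
rewrite cmodM cmod_real; apply: ler_pM => //; first exact: cmod_ge0.
rewrite /monom normr_prod; apply: ler_prod => k _; rewrite normr_ge0/= normrX.
rewrite lerXn2r ?nnegrE ?addr_ge0//; apply: le_trans (coord_le_norm x k) _.
by rewrite -(subrK c x) [leRHS]addrC (le_trans (ler_normD _ _))// lerD2r.
Qed.

Lemma polyfun_killed N d P a (B r : R) c : 0 <= r -> cmeas a -> bsupp B c r a ->
  (forall be, (mdeg be < N)%N -> cintegral (fun x => (monom be x)%:C%C * a x) = 0) ->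
  (d < N)%N -> polyfun d P ->
  cintegrable (fun x => (P x)%:C%C * a x) /\ cintegral (fun x => (P x)%:C%C * a x) = 0.
Proof.
move=> r0 ma ba ka dN [s sd Ps].
have E : (fun x => (P x)%:C%C * a x) =
    (fun x => \sum_(t <- s) (t.1)%:C%C * ((monom t.2 x)%:C%C * a x)).
  apply/funext => x; rewrite Ps rmorph_sum mulr_suml; apply: eq_bigr => t _.
  by rewrite rmorphM mulrA.
have i1 t : cintegrable (fun x => (t.1)%:C%C * ((monom t.2 x)%:C%C * a x)).
  by apply: cintegrableZ; exact: monom_cintegrable ba.
rewrite E; have [h1 ->] := cintegral_sum s i1; split => //.
rewrite big_seq big1// => t ts; rewrite cintegralZ; last exact: monom_cintegrable ba.
by rewrite ka ?mulr0//; move/allP : sd => /(_ _ ts) td; exact: leq_ltn_trans td dN.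
Qed.

Lemma etail_bsupp k a w (B r : R) c : 0 <= r -> bsupp B c r a ->
  bsupp (2 ^+ k * (n%:R * (`|w| * r)) ^+ k * B) c r (fun x => etail k (dot w (x - c)) * a x).
Proof.
move=> r0 [bB sB]; have B0 : 0 <= B by apply: le_trans (bB 0); exact: cmod_ge0.
split => x; last by move=> /sB ->; rewrite mulr0.
have [xr|xr] := leP `|x - c| r; last first.
  rewrite sB// mulr0 cmod0 mulr_ge0// mulr_ge0 ?exprn_ge0// mulr_ge0//.
  by rewrite mulr_ge0.
rewrite cmodM; apply: ler_pM; rewrite ?cmod_ge0//.
apply: le_trans (etail_le _ _) _; rewrite ler_wpM2l ?exprn_ge0//.
rewrite lerXn2r ?nnegrE ?mulr_ge0//; apply: le_trans (dot_le _ _) _.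
by rewrite ler_wpM2l// ler_wpM2l.
Qed.

Lemma etail_cintegrable k a w (B r : R) c : 0 <= r -> cmeas a -> bsupp B c r a ->
  cintegrable (fun x => etail k (dot w (x - c)) * a x).
Proof.
move=> r0 ma ba; apply: (bsupp_cintegrable r0 _ (etail_bsupp k w r0 ba)).1.
apply: cmeasM => //; apply: cmeas_etail; apply: (@measurable_dot _ _ _ _ (fun=> w)) => //.
exact: (@measurable_translate _ _ (- c)).
Qed.

(** After factoring out the phase at c, the Taylor polynomial of [expi (dot w (x - c))] is removed
    one degree at a time: its term of degree k < N is a polynomial in x, which a annihilates. *)
Lemma cintegral_etail N a w (B r : R) c : 0 <= r -> cmeas a -> bsupp B c r a ->
  (forall be, (mdeg be < N)%N -> cintegral (fun x => (monom be x)%:C%C * a x) = 0) ->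
  FT a w = expi (dot w c) * cintegral (fun x => etail N (dot w (x - c)) * a x).
Proof.
move=> r0 ma ba ka; have ie k := etail_cintegrable k w r0 ma ba.
have -> : FT a w = expi (dot w c) * cintegral (fun x => etail 0 (dot w (x - c)) * a x).
  rewrite -cintegralZ; last exact: (ie 0%N).
  congr cintegral; apply/funext => x; rewrite mulrA [etail 0 _]/(expi _) -expiD.
  by rewrite dotDr dotNr addrCA subrr addr0.
congr (_ * _).
suff H k : (k <= N)%N -> cintegral (fun x => etail 0 (dot w (x - c)) * a x) =
    cintegral (fun x => etail k (dot w (x - c)) * a x) by exact: H.
elim: k => [//|k IH] kN; rewrite IH 1?ltnW//.
have [i1 e1] := polyfun_killed r0 ma ba ka kN (polyfun_dotX k w c).
pose F x := - ('i%C ^+ k / k`!%:R) * ((dot w (x - c) ^+ k)%:C%C * a x).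
have -> : (fun x => etail k.+1 (dot w (x - c)) * a x) =
    (fun x => etail k (dot w (x - c)) * a x + F x).
  by apply/funext => x; rewrite /= /F; ring.
rewrite cintegralD//; last exact: cintegrableZ.
by rewrite /F cintegralZ// e1 mulr0 addr0.
Qed.

End polynomials.

(** * The resolution of unity as a symbol family *)

Section theta_family.
Context {R : realType} {n : nat} (n_gt0 : (0 < n)%N).
Variable theta : nat -> 'rV[R]_n -> R[i].
Hypothesis theta_Phi : Phi theta.
Implicit Types (x y z c v : 'rV[R]_n) (a : 'rV[R]_n -> R[i]).

Lemma theta_supp_le j x : csupport (theta j) x -> `|x| <= 2 * 2 ^+ j.
Proof.
have [_ s0 s1 _ _] := theta_Phi; move=> H; apply: le_trans (norm_le_enorm x) _.
case: j H => [/s0|j /s1 /andP[_]]; first by rewrite expr0 mulr1.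
by rewrite -exprS.
Qed.

Lemma theta_supp_ge j x : csupport (theta j.+1) x -> 2 ^+ j <= n%:R * `|x|.
Proof.
have [_ _ s1 _ _] := theta_Phi => /s1 /andP[H _].
exact: le_trans H (enorm_le_norm x).
Qed.

Lemma theta_Ck K j : Ck K (theta j).
Proof. by have [H _ _ _ _] := theta_Phi; have [] := H j. Qed.

Lemma theta_cmeas j : cmeas (theta j).
Proof. by have [H _] := @theta_Ck 0 j [::] isT; exact: ccontinuous_cmeas. Qed.

Lemma theta_bsupp : exists2 B, 0 <= B & forall j, bsupp B 0 (2 * 2 ^+ j) (theta j).
Proof.
have [_ _ _ H _] := theta_Phi; have [B HB] := H (fun=> 0%N).
have m0 : mdeg (fun _ : 'I_n => 0%N) = 0%N by rewrite /mdeg big1.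
have d0 f : mderiv (fun _ : 'I_n => 0%N) f = f.
  rewrite /mderiv; elim: (enum 'I_n) => //.
have B' j x : cmod (theta j x) <= B.
  by have := HB j x; rewrite m0 muln0 expr0 mul1r d0.
exists B; first by apply: le_trans (B' 0%N 0); exact: cmod_ge0.
move=> j; split => // x; rewrite subr0 => xj; apply: csupport_out => /theta_supp_le.
by rewrite leNgt xj.
Qed.

Section select.
Context {J : Type} (sel : J -> nat).
Let rho k : R := 2 ^+ sel k.
Let D k : set 'rV[R]_n := csupport (theta (sel k)).

Lemma theta_rho_gt0 k : 0 < rho k. Proof. exact: exprn_gt0. Qed.

Lemma theta_D_closed i k x : ~ D k x ->
  \forall t \near (0 : R), ~ D k (x + t *: delta_mx ord0 i).
Proof. by move=> /near_csupport; exact: line_near. Qed.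

(** The reindexing by [sel] serves two families: one with the displacement from the centre of an
    atom as a further parameter, and one that leaves out theta_0. *)
Lemma theta_symV i M : symV i rho D M (fun=> 1) (fun k => theta (sel k)).
Proof.
(* Stated for the l-th derivative, so that the derivative required by [symV] is again an
   instance. *)
suff H l : symV i rho D M (fun k => rho k ^- l) (fun k => pderivs (nseq l i) (theta (sel k))).
  have := H 0%N; congr symV; by apply/funext => k; rewrite expr0 invr1.
elim: M l => [|M IH] l; split.
1,5: have [_ _ _ H _] := theta_Phi; have [B HB] := H (pure i l);
  exists (Num.max 0 B); [by rewrite le_max lexx|move=> k x _; rewrite ler_pdivlMr;
    [|exact: exprn_gt0 (theta_rho_gt0 k)]];
  have := HB (sel k) x; rewrite mdeg_pure mderiv_pure exprM mulrC => /le_trans; apply;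
  by rewrite le_max lexx orbT.
1,4: by move=> k; have [H _] := @theta_Ck l (sel k) (nseq l i) (eq_leq (size_nseq _ _));
  exact: ccontinuous_cmeas.
1,3: by move=> k x; exact: pderivs_out.
1: by [].
exists (fun k => pderivs (nseq l.+1 i) (theta (sel k))).
  move=> k; have sz : size (nseq l i) = l by rewrite size_nseq.
  have [|_ H] := @theta_Ck l.+1 (sel k) (nseq l i); first by rewrite sz.
  by apply: pderivable_pd; apply: H; rewrite sz.
have := IH l.+1; congr symV; by apply/funext => k; rewrite exprSr invfM.
Qed.

End select.

End theta_family.

(** * Littlewood-Paley pieces of atoms *)

Section convolution.
Context {R : realType} {n : nat} (n_gt0 : (0 < n)%N).
Local Notation mu := (lebesgue_rV n : {measure set 'rV[R]_n -> \bar R}).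
Implicit Types (x y z c xi : 'rV[R]_n) (a th v : 'rV[R]_n -> R[i]).

(* Up to a constant, the convolution of a with the kernel of th(D). *)
Definition atom_conv th a y := FT (fun xi => th xi * FT a (- xi)) y.

Lemma measurable_oppr : measurable_fun setT (fun x : 'rV[R]_n => - x).
Proof.
apply: measurable_fun_rV => i; under eq_fun do rewrite mxE.
by apply: measurable_funN; exact: measurable_coord.
Qed.

Lemma measurable_subl c : measurable_fun setT (fun x : 'rV[R]_n => c - x).
Proof.
under eq_fun do rewrite addrC.
exact: (measurableT_comp (measurable_translate c) measurable_oppr).
Qed.

Lemma cintegrable_expi z v : cintegrable v -> cintegrable (fun x => expi (dot z x) * v x).
Proof.
move=> /cintegrableP[mv iv]; apply/cintegrableP; split; first exact: cmeas_expi_dot.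
by under [X in _.-integrable _ X]eq_fun do rewrite /= cmodM cmod_expi mul1r.
Qed.

(** Fubini: applying the multiplier u to v is convolving v with the kernel [FT u]. *)
Lemma FT_swap (u v : 'rV[R]_n -> R[i]) y :
  cmeas u -> mu.-integrable setT (EFin \o (fun x => cmod (u x))) ->
  cmeas v -> mu.-integrable setT (EFin \o (fun x => cmod (v x))) ->
  [/\ cmeas (fun x => v x * FT u (y - x)),
    cintegrable (fun xi => expi (dot y xi) * (u xi * FT v (- xi))) &
    FT (fun xi => u xi * FT v (- xi)) y = cintegral (fun x => v x * FT u (y - x))].
Proof.
move=> mu_ iu mv iv.
pose F xi x := expi (dot y xi) * (u xi * (expi (dot (- xi) x) * v x)).
have m1 : cmeas (fun z : 'rV[R]_n * 'rV[R]_n => expi (dot y z.1)).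
  by apply: cmeas_expi; apply: measurable_dot.
have m2 : cmeas (fun z : 'rV[R]_n * 'rV[R]_n => expi (dot (- z.1) z.2)).
  apply: cmeas_expi; apply: measurable_dot => //.
  exact: (measurableT_comp measurable_oppr measurable_fst).
have mF : cmeas (fun z : 'rV[R]_n * 'rV[R]_n => F z.1 z.2).
  apply: cmeasM => //; apply: cmeasM; first exact: (cmeas_comp mu_ measurable_fst).
  by apply: cmeasM => //; exact: (cmeas_comp mv measurable_snd).
have bF xi x : cmod (F xi x) <= cmod (u xi) * cmod (v x).
  by rewrite /F !cmodM !cmod_expi !mul1r.
have iv' : cintegrable v by apply/cintegrableP.
have iu' : cintegrable u by apply/cintegrableP.
have [m4 m3 E] := cfubini mF iu iv bF.
have E2 : (fun x => v x * FT u (y - x)) = (fun x => cintegral (F ^~ x)).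
  apply/funext => x; rewrite /FT -(cintegralZ (v x) (cintegrable_expi (y - x) iu')).
  congr cintegral; apply/funext => xi; rewrite /F dotDl !dotNl (dotC x xi) expiD; ring.
have E3 : (fun xi => expi (dot y xi) * (u xi * FT v (- xi))) = (fun xi => cintegral (F xi)).
  apply/funext => xi; have i1 := cintegrable_expi (- xi) iv'.
  by rewrite -(cintegralZ (u xi) i1) -(cintegralZ _ (cintegrableZ (u xi) i1)).
rewrite E2; split; first exact: m3; last by rewrite -E -E3.
rewrite E3; apply: (@cintegrable_le _ _ _ (fun xi => 2 * (\int[mu]_x cmod (v x)) * cmod (u xi))).
- exact: m4.
- by under [X in _.-integrable _ X]eq_fun do rewrite /= EFinM; exact: integrableZl.
move=> xi; rewrite -[cintegral _]/((fun xi => cintegral (F xi)) xi) -E3 !cmodM cmod_expi mul1r mulrC.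
have b1 x : cmod (expi (dot (- xi) x) * v x) <= cmod (v x) by rewrite cmodM cmod_expi mul1r.
have H := cmod_cintegral (cmeas_expi_dot (- xi) mv) iv b1.
by rewrite ler_wpM2r ?cmod_ge0.
Qed.

Variable theta : nat -> 'rV[R]_n -> R[i].
Hypothesis theta_Phi : Phi theta.

(** On the support of theta_j the phase is of size 2^j 2^-nu, which gives the power N. A derivative
    lowers the order by one and produces a coordinate of v, of size 2^-nu = (2^j 2^-nu) / 2^j, so
    the symbol scaling is preserved. *)
Lemma etail_sym (gam : R) (N : nat) (J : Type) (sel : J -> nat) (nu : J -> nat)
  (v : J -> 'rV[R]_n) i M : 0 <= gam ->
  (forall k, (sel k <= nu k)%N) -> (forall k, `|v k| <= gam * 2 ^- nu k) ->
  sym i (fun k => 2 ^+ sel k) (fun k => csupport (theta (sel k))) M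
    (fun k => (2 ^+ sel k * 2 ^- nu k) ^+ N)
    (fun k xi => etail N (dot (- v k) xi)).
Proof.
move=> g0 jn vb.
have p2 m : (0 : R) < 2 ^+ m by rewrite exprn_gt0.
have bnd N' : exists2 B, 0 <= B & forall k x, csupport (theta (sel k)) x ->
    cmod (etail N' (dot (- v k) x)) <= B * (2 ^+ sel k * 2 ^- nu k) ^+ N'.
  exists (2 ^+ N' * (n%:R * gam * 2) ^+ N').
    by rewrite mulr_ge0 ?exprn_ge0// !mulr_ge0.
  move=> k x /(theta_supp_le theta_Phi) xb; apply: le_trans (etail_le _ _) _.
  rewrite -[leRHS]mulrA ler_wpM2l ?exprn_ge0// -exprMn.
  rewrite lerXn2r ?nnegrE//; first by rewrite !mulr_ge0// ?invr_ge0 ltW.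
  apply: le_trans (dot_le _ _) _; rewrite normrN -!mulrA ler_wpM2l//.
  apply: le_trans (ler_pM _ _ (vb k) xb) _ => //.
  by rewrite le_eqVlt; apply/orP; left; apply/eqP; ring.
have mm N' k : cmeas (fun xi => etail N' (dot (- v k) xi)).
  by apply: cmeas_etail; apply: measurable_dot.
elim: M N => [|M IH] N; split => //.
exists (fun k xi => ((- v k) ord0 i)%:C%C * 'i%C * etail N.-1 (dot (- v k) xi)).
  move=> k x _; have := @pd_comp_dot _ _ i _ _ (- v k) 0 (@cder_etail R N) x.
  rewrite /pd_at addr0.
  under eq_fun do rewrite addr0; under [X in _ /\ is_derive _ _ X _ -> _]eq_fun do rewrite addr0.
  by rewrite -mulrA.
have := symM (fun k => p2 (sel k)) (sym_cst i (fun k : J => csupport (theta (sel k))) (fun k => p2 (sel k)) M (fun k => ((- v k) ord0 i)%:C%C * 'i%C)) (IH N.-1).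
apply: (@sym_weight _ _ _ _ _ _ _ _ _ _ _ gam) => // k.
rewrite cmodM cmod_i mulr1 cmod_real.
have vi : `|(- v k) ord0 i| <= gam * 2 ^- nu k.
  by apply: le_trans (coord_le_norm _ _) _; rewrite normrN.
have w0 : 0 <= 2 ^+ sel k * 2 ^- nu k :> R by rewrite mulr_ge0// ?invr_ge0 ltW.
apply: le_trans (ler_wpM2r _ vi) _; first by rewrite exprn_ge0.
(* At order 0 a derivative lowers nothing; the factor 2^-nu is then at most 2^-j because j <= nu. *)
rewrite -mulrA ler_wpM2l//; case: N => [|N] /=.
  by rewrite !expr0 mulr1 mul1r lef_pV2 ?posrE// ler_eXn2l// ltr1n.
rewrite exprS -mulrA mulrAC -[leRHS]mulrA.
by rewrite [leRHS]mulrA divff ?mul1r// gt_eqF.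
Qed.

(** The moments replace the exponential in [FT a] by its remainder, and Fubini moves the xi-integral
    inside. For fixed displacement x - c it is the transform of the symbol theta_j times a
    remainder, decaying in y - c. The power N comes from the remainder; the power n from the height
    2^(jn) of the kernel times the volume 2^(-nu n) of the atom's support. *)
Lemma conv_moments (gam : R) (N M : nat) : 0 < gam -> exists2 C, 0 <= C &
  forall j nu c a y, (j <= nu)%N -> cmeas a -> bsupp 1 c (gam * 2 ^- nu) a ->
  (forall be, (mdeg be < N)%N -> cintegral (fun x => (monom be x)%:C%C * a x) = 0) ->
  cmod (atom_conv (theta j) a y) <=
    C * (2 ^+ j * 2 ^- nu) ^+ (n + N) * (1 + 2 ^+ j * `|y - c|) ^- M.
Proof.
move=> g0; have p2 m : (0 : R) < 2 ^+ m by rewrite exprn_gt0.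
(* Scales and displacements are collected in one index, so that the symbol calculus yields a
   constant uniform in j, nu and x. *)
pose J := {k : nat * nat * 'rV[R]_n | (k.1.1 <= k.1.2)%N && (`|k.2| <= gam * 2 ^- k.1.2)}.
pose sel (k : J) := (val k).1.1; pose nu (k : J) := (val k).1.2; pose v (k : J) := (val k).2.
have jn k : (sel k <= nu k)%N by have /andP[] := valP k.
have vb k : `|v k| <= gam * 2 ^- nu k by have /andP[] := valP k.
have rg k : (0 : R) < 2 ^+ sel k by [].
have sV i M' : symV i (fun k => 2 ^+ sel k) (fun k => csupport (theta (sel k))) M'
    (fun k => (2 ^+ sel k * 2 ^- nu k) ^+ N)
    (fun k xi => theta (sel k) xi * etail N (dot (- v k) xi)).
  have := symVM rg (theta_D_closed (sel := sel) i)
    (theta_symV theta_Phi sel i M') (etail_sym N i M' (ltW g0) jn vb).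
  by congr symV; apply/funext => k; rewrite mul1r.
have W0 k : (0 : R) <= (2 ^+ sel k * 2 ^- nu k) ^+ N.
  by rewrite exprn_ge0// mulr_ge0// ?invr_ge0 ltW.
have [B B0 HB] := symV_decay n_gt0 rg M W0 (ler0n _ 2)
  (fun k x => theta_supp_le theta_Phi (x:=x) (j:=sel k)) sV.
have [Bt Bt0 HBt] := theta_bsupp theta_Phi.
exists (2 * (B * (2 * gam) ^+ n)).
  by rewrite !mulr_ge0// exprn_ge0// mulr_ge0// ltW.
move=> j nu' c a y jnu ma ba ka.
have r0 : 0 <= gam * 2 ^- nu' by rewrite mulr_ge0// ?invr_ge0 ltW.
pose w := y - c.
pose F xi x := (expi (dot w xi) * theta j xi) * (etail N (dot (- (x - c)) xi) * a x).
have mth := theta_cmeas theta_Phi j.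
have mdot2 : measurable_fun setT (fun z : 'rV[R]_n * 'rV[R]_n => dot (- (z.2 - c)) z.1).
  apply: measurable_dot; last exact: measurable_fst.
  under eq_fun do rewrite opprB.
  exact: (measurableT_comp (measurable_subl c) measurable_snd).
have mF : cmeas (fun z : 'rV[R]_n * 'rV[R]_n => F z.1 z.2).
  apply: cmeasM; apply: cmeasM.
  - by apply: cmeas_expi; apply: measurable_dot.
  - exact: (cmeas_comp mth measurable_fst).
  - exact: cmeas_etail.
  - exact: (cmeas_comp ma measurable_snd).
pose C0 := 2 ^+ N * (n%:R * (gam * 2 ^- nu' * (2 * 2 ^+ j))) ^+ N.
have C00 : 0 <= C0.
  by rewrite mulr_ge0 ?exprn_ge0// !mulr_ge0// ltW.
have [bt st] := HBt j; have [b1 s1] := ba.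
have bF xi x : cmod (F xi x) <= (C0 * cmod (theta j xi)) * cmod (a x).
  rewrite /F !cmodM cmod_expi mul1r.
  have [xr|xr] := leP `|x - c| (gam * 2 ^- nu'); last by rewrite s1// cmod0 !mulr0.
  have [tr|tr] := leP `|xi - 0| (2 * 2 ^+ j); last by rewrite st// cmod0 !(mulr0, mul0r).
  rewrite mulrCA mulrA ler_wpM2r ?cmod_ge0// ler_wpM2r ?cmod_ge0//.
  apply: le_trans (etail_le _ _) _; rewrite ler_wpM2l ?exprn_ge0//.
  rewrite lerXn2r ?nnegrE ?normr_ge0//; first by rewrite !mulr_ge0// ltW.
  apply: le_trans (dot_le _ _) _; rewrite normrN ler_wpM2l//; apply: ler_pM => //.
  by move: tr; rewrite subr0.
have R0 : (0 : R) <= 2 * 2 ^+ j by rewrite mulr_ge0// ltW.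
have iA : mu.-integrable setT (EFin \o (fun xi => C0 * cmod (theta j xi))).
  under [X in _.-integrable _ X]eq_fun do rewrite /= EFinM.
  by apply: integrableZl => //; exact: bsupp_rintegrable R0 mth (HBt j).
have iB : mu.-integrable setT (EFin \o (fun x => cmod (a x))).
  exact: bsupp_rintegrable r0 ma ba.
have [_ mG E] := cfubini mF iA iB bF.
have GE : atom_conv (theta j) a y = cintegral (fun x => cintegral (F ^~ x)).
  rewrite -E /atom_conv {1}/FT; congr cintegral; apply/funext => xi.
  rewrite (cintegral_etail (N := N) _ r0 ma ba ka).
  have dE x : dot (- xi) (x - c) = dot (- (x - c)) xi by rewrite !dotNl dotC.
  have i1 : cintegrable (fun x => etail N (dot (- (x - c)) xi) * a x).
    by have := etail_cintegrable N (- xi) r0 ma ba; under eq_fun do rewrite dE.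
  under [in LHS]eq_fun do rewrite dE.
  rewrite /F (cintegralZ (expi (dot w xi) * theta j xi) i1) !mulrA; congr (_ * _).
  by rewrite mulrAC -expiD dotDl dotNl dotNl (dotC c).
have H : bsupp (B * ((2 ^+ j * 2 ^- nu') ^+ N * (2 ^+ j) ^+ n) * (1 + 2 ^+ j * `|y - c|) ^- M)
    c (gam * 2 ^- nu') (fun x => cintegral (F ^~ x)).
  have K0 : 0 <= B * ((2 ^+ j * 2 ^- nu') ^+ N * (2 ^+ j) ^+ n) * (1 + 2 ^+ j * `|y - c|) ^- M.
    by rewrite !mulr_ge0// ?exprn_ge0 ?invr_ge0 ?exprn_ge0 ?addr_ge0 ?mulr_ge0// ?invr_ge0 ltW.
  have key x : cintegral (F ^~ x) =
      a x * FT (fun xi => theta j xi * etail N (dot (- (x - c)) xi)) w.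
    have i1 : cintegrable (fun xi => theta j xi * etail N (dot (- (x - c)) xi)).
      have := etail_cintegrable N (- (x - c)) R0 mth (HBt j).
      by under eq_fun do rewrite subr0 mulrC.
    rewrite /FT -(cintegralZ (a x) (cintegrable_expi w i1)); congr cintegral.
    by apply/funext => xi; rewrite /F; ring.
  split => x; last by rewrite key => /s1 ->; rewrite mul0r.
  rewrite key cmodM; have [xr|xr] := leP `|x - c| (gam * 2 ^- nu'); last first.
    rewrite (s1 x xr) cmod0 mul0r; exact: K0.
  pose k0 : nat * nat * 'rV[R]_n := (j, nu', x - c).
  have kP : (k0.1.1 <= k0.1.2)%N && (`|k0.2| <= gam * 2 ^- k0.1.2) by rewrite /= jnu xr.
  have := HB (exist _ k0 kP) w; rewrite /sel /nu /v /= => H.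
  rewrite -[leRHS]mul1r; apply: ler_pM; rewrite ?cmod_ge0//.
rewrite GE; apply: le_trans (bsupp_cintegrable r0 mG H).2 _.
rewrite exprD !exprMn le_eqVlt; apply/orP; left; apply/eqP; ring.
Qed.

(* K derivatives at scale nu <= k: theta_(k+1) = sum_i xi_i^K u_i, and xi_i^K moves
   onto the atom. *)
Lemma conv_smooth (gam : R) (K M : nat) : 0 < gam -> exists2 C, 0 <= C &
  forall k nu c a y, (nu <= k)%N ->
  (forall i l, (l <= K)%N -> cmeas (pderivs (nseq l i) a) /\
     bsupp (2 ^+ (nu * l)) c (gam * 2 ^- nu) (pderivs (nseq l i) a)) ->
  (forall i l, (l < K)%N -> pd i (pderivs (nseq l i) a) (pderivs (nseq l.+1 i) a)) ->
  cmod (atom_conv (theta k.+1) a y) <=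
    C * (2 ^+ nu * 2 ^- k.+1) ^+ K * (1 + 2 ^+ nu * `|y - c|) ^- M.
Proof.
move=> g0; have p2 m : (0 : R) < 2 ^+ m by rewrite exprn_gt0.
(* The case j > nu excludes theta_0, whose support may contain the origin, where E vanishes if K >
   0. *)
pose sel (k : nat) := k.+1.
have rg k : (0 : R) < 2 ^+ sel k by [].
(* With u_i = theta x_i^K / E the identity theta = sum_i x_i^K u_i holds. The even exponent makes E
   nonnegative and comparable to |x|^(2K), hence to [W k] on the support. *)
pose E (x : 'rV[R]_n) := \sum_l (x ord0 l) ^+ (2 * K).
have El0 (x : 'rV[R]_n) l : 0 <= x ord0 l ^+ (2 * K) by rewrite exprM exprn_ge0// sqr_ge0.
have E0 x : 0 <= E x by apply: sumr_ge0.
pose W (k : nat) : R := (2 ^+ sel k) ^+ (2 * K).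
have W0 k : 0 < W k by rewrite exprn_gt0.
have D2 k x : csupport (theta (sel k)) x -> `|x| <= 2 * 2 ^+ sel k.
  exact: theta_supp_le.
have sE i M' : sym i (fun k => 2 ^+ sel k) (fun k => csupport (theta (sel k))) M' W
    (fun _ x => (E x)%:C%C).
  have -> : (fun (_ : nat) x => (E x)%:C%C) =
      (fun (_ : nat) (x : 'rV[R]_n) => \sum_l (x ord0 l)%:C%C ^+ (2 * K)).
    apply/funext => _; apply/funext => x; rewrite rmorph_sum; apply: eq_bigr => l _.
    by rewrite rmorphXn.
  apply: sym_sum => // [k|l]; first exact: ltW.
  apply: symX => //; apply: sym_coord => //; exists 2 => // k x; exact: D2.
have mEi (k : nat) : cmeas (fun x => ((E x)%:C%C)^-1).
  have -> : (fun x => ((E x)%:C%C)^-1) = (fun x => ((E x)^-1)%:C%C).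
    by apply/funext => x; rewrite fmorphV.
  apply: cmeas_real; apply: measurable_inv_ge0 => //.
  by apply: measurable_sum => l; apply: measurable_funX; exact: measurable_coord.
have nR : (0 : R) < n%:R by rewrite ltr0n.
have El k x : csupport (theta (sel k)) x -> (2 * n%:R) ^- (2 * K) * W k <= cmod (E x)%:C%C.
  move=> /(theta_supp_ge theta_Phi) H; rewrite cmod_real ger0_norm//.
  have [i Hi] := norm_attained n_gt0 x.
  apply: (@le_trans _ _ (x ord0 i ^+ (2 * K))); last first.
    by rewrite /E (bigD1 i)//= lerDl sumr_ge0.
  have -> : x ord0 i ^+ (2 * K) = `|x| ^+ (2 * K).
    by rewrite Hi !exprM real_normK ?num_real.
  have c0 : (0 : R) <= (2 * n%:R)^-1 * 2 ^+ sel k.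
    by rewrite mulr_ge0 ?invr_ge0 ?mulr_ge0// exprn_ge0.
  rewrite /W -exprVn -exprMn lerXn2r ?nnegrE//.
  by rewrite ler_pdivrMl ?mulr_gt0// /sel exprS -mulrA ler_pM2l.
have sEi i M' : sym i (fun k => 2 ^+ sel k) (fun k => csupport (theta (sel k))) M'
    (fun k => (W k)^-1) (fun _ x => ((E x)%:C%C)^-1).
  have cp : (0 : R) < (2 * n%:R) ^- (2 * K) by rewrite invr_gt0 exprn_gt0// mulr_gt0.
  have := symV_inv rg M' cp W0 (sE i) mEi El.
  exact.
pose u (i : 'I_n) k (x : 'rV[R]_n) := theta (sel k) x * ((E x)%:C%C)^-1 * (x ord0 i)%:C%C ^+ K.
pose V (k : nat) : R := (2 ^+ sel k) ^- K.
have sU l i M' : symV i (fun k => 2 ^+ sel k) (fun k => csupport (theta (sel k))) M' V (u l).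
  have s1 := symVM rg (theta_D_closed (sel := sel) i) (theta_symV theta_Phi sel i M') (sEi i M').
  have s2 : sym i (fun k => 2 ^+ sel k) (fun k => csupport (theta (sel k))) M'
      (fun k => (2 ^+ sel k) ^+ K) (fun _ x => (x ord0 l)%:C%C ^+ K).
    apply: symX => //; apply: sym_coord => //; exists 2 => // k x; exact: D2.
  have := symVM rg (theta_D_closed (sel := sel) i) s1 s2.
  congr symV; apply/funext => k; rewrite mul1r /V /W mulnC exprM expr2 invfM.
  by rewrite -mulrA mulVf ?mulr1// expf_neq0// gt_eqF.
have V0 k : 0 <= V k by rewrite /V invr_ge0 exprn_ge0// ltW.
(* Of the decay M + 2n, the part 2n is spent on integrating the kernel over x, and M is kept for the
   decay in y - c. *)
have HB' l : {B | 0 <= B & forall k z, cmod (FT (u l k) z) <=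
    B * (V k * (2 ^+ sel k) ^+ n) * (1 + 2 ^+ sel k * `|z|) ^- (M + 2 * n)}.
  exact: cid2 (symV_decay n_gt0 rg (M + 2 * n)%N V0 (ler0n _ 2) D2 (sU l)).
pose B l := s2val (HB' l).
have B0 l : 0 <= B l := s2valP (HB' l).
have HB l := s2valP' (HB' l).
exists (\sum_l (2 * (B l * (1 + gam) ^+ M * 64 ^+ n))).
  by apply: sumr_ge0 => l _; rewrite !mulr_ge0// exprn_ge0// addr_ge0// ltW.
move=> k nu c a y nuk Ha da.
have r0 : 0 <= gam * 2 ^- nu by rewrite mulr_ge0// ?invr_ge0 ltW.
(* The sign is due to the evaluation of [FT a] at -xi. *)
pose ka : R[i] := (-1) ^+ K * 'i%C ^+ K.
pose aK l := pderivs (nseq K l) a.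
have kE l xi : (xi ord0 l)%:C%C ^+ K * FT a (- xi) = ka * FT (aK l) (- xi).
  have tw : tower l c (gam * 2 ^- nu) K (fun m => pderivs (nseq m l) a).
    split=> m mK; [by have [] := Ha l m mK|exact: da|].
    by exists (2 ^+ (nu * m)); have [] := Ha l m mK.
  have := FT_tower r0 tw (- xi); rewrite mxE rmorphN /= exprNn => H.
  rewrite -(mul1r (_ ^+ K)) -[1](sqrr_sign _ K) expr2 -!mulrA; congr (_ * _).
  by rewrite mulrA H.
have mU l : cmeas (u l k) := symV_cmeas (sU l l 0%N) k.
have iU l : mu.-integrable setT (EFin \o (fun x => cmod (u l k x))).
  have [Bu Bu0 HBu] := symV_bound (sU l l 0%N).
  apply: (@bsupp_rintegrable _ _ (Bu * V k) 0 (2 * 2 ^+ sel k)) => //.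
  split => x; last first.
    rewrite subr0 => H; apply: (symV_out (sU l l 0%N)) => /D2.
    by rewrite leNgt H.
  have [Dx|nDx] := pselect (csupport (theta (sel k)) x); first exact: HBu.
  by rewrite (symV_out (sU l l 0%N))// cmod0 mulr_ge0.
have ma l : cmeas (aK l) by have [] := Ha l K (leqnn K).
have ba l : bsupp (2 ^+ (nu * K)) c (gam * 2 ^- nu) (aK l) by have [] := Ha l K (leqnn K).
have ia l := bsupp_rintegrable r0 (ma l) (ba l).
have sw l := FT_swap y (mU l) (iU l) (ma l) (ia l).
have GE : atom_conv (theta k.+1) a y =
    \sum_l ka * cintegral (fun x => aK l x * FT (u l k) (y - x)).
  transitivity (cintegral (fun xi => \sum_l ka * (expi (dot y xi) * (u l k xi * FT (aK l) (- xi))))).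
    rewrite /atom_conv {1}/FT; congr cintegral; apply/funext => xi.
    rewrite -mulr_sumr.
    have -> : ka * \sum_l expi (dot y xi) * (u l k xi * FT (aK l) (- xi)) =
       expi (dot y xi) * \sum_l u l k xi * (ka * FT (aK l) (- xi)).
      rewrite !mulr_sumr; apply: eq_bigr => l _; ring.
    congr (_ * _).
    under eq_bigr do rewrite -kE /u.
    have [Dx|nDx] := pselect (csupport (theta (sel k)) xi); last first.
      rewrite (csupport_out nDx) mul0r big1// => l _; by rewrite !mul0r.
    have En0 : (E xi)%:C%C != 0 :> R[i].
      apply/eqP => Ez; have := El k xi Dx; rewrite Ez cmod0 leNgt mulr_gt0//.
      by rewrite invr_gt0 exprn_gt0// mulr_gt0.
    transitivity (\sum_l (theta (sel k) xi * ((E xi)%:C%C)^-1 * FT a (- xi)) *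
        (xi ord0 l ^+ (2 * K))%:C%C).
      rewrite -mulr_sumr -rmorph_sum -/(E xi) /= -mulrA [FT _ _ * _]mulrC mulrA.
      by rewrite mulfVK.
    apply: eq_bigr => l _; rewrite rmorphXn mulnC exprM expr2 /=; ring.
  have [_ ->] := cintegral_sum (index_enum 'I_n) (fun l => cintegrableZ ka (let: And3 _ i _ := sw l in i)).
  apply: eq_bigr => l _; have [_ i1 e1] := sw l.
  by rewrite cintegralZ// -e1.
rewrite GE; apply: le_trans (cmod_sum _ _ _) _; rewrite -mulrA mulr_suml; apply: ler_sum => l _.
rewrite cmodM /ka cmodM !cmodX cmodN cmod1 cmod_i !expr1n !mul1r.
pose Cst := 2 ^+ (nu * K) * (B l * (V k * (2 ^+ sel k) ^+ n)) * ((1 + gam) ^+ M * (1 + 2 ^+ nu * `|y - c|) ^- M).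
have t0 : 0 <= 2 ^+ nu * `|y - c| by rewrite mulr_ge0// ltW.
have Cst0 : 0 <= Cst.
  rewrite /Cst !mulr_ge0 ?exprn_ge0// ?invr_ge0 ?exprn_ge0 ?addr_ge0// ltW//.
have [mG _ _] := sw l.
have bound x : cmod (aK l x * FT (u l k) (y - x)) <= Cst * Wt (2 ^+ sel k *: (x - y)).
  have [b1 s1] := ba l; have [xr|xr] := leP `|x - c| (gam * 2 ^- nu); last first.
    by rewrite s1// mul0r cmod0 mulr_ge0// Wt_ge0.
  rewrite cmodM /Cst -!mulrA; apply: ler_pM; rewrite ?cmod_ge0//.
  apply: le_trans (HB l k (y - x)) _; rewrite -!mulrA.
  apply: ler_wpM2l; first exact: B0. apply: ler_wpM2l; first exact: V0.
  apply: ler_wpM2l; first by rewrite exprn_ge0// ltW.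
  set s := 1 + 2 ^+ sel k * `|y - x|.
  have s0 : 1 <= s by rewrite lerDl mulr_ge0// ltW.
  have sp : 0 < s by lra.
  (* Decay about x at the fine scale is weakened to decay about c at scale 2^-nu; since |x - c| <=
     gam 2^-nu, this costs (1 + gam)^M. *)
  have h1 : s ^- M <= (1 + gam) ^+ M * (1 + 2 ^+ nu * `|y - c|) ^- M.
    have q0 : 0 < 1 + 2 ^+ nu * `|y - c| by lra.
    rewrite ler_pdivlMr ?exprn_gt0// mulrC ler_pdivrMr ?exprn_gt0// -exprMn.
    rewrite lerXn2r ?nnegrE ?mulr_ge0 ?(ltW q0) ?(ltW sp) ?addr_ge0 ?(ltW g0)//.
    have d1 : `|y - c| <= `|y - x| + `|x - c|.
      by rewrite -(subrKA x y); exact: ler_normD.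
    have d2 : 2 ^+ nu * `|y - c| <= 2 ^+ nu * `|y - x| + gam.
      apply: le_trans (ler_wpM2l (ltW (p2 nu)) d1) _; rewrite mulrDr lerD2l.
      by rewrite mulrC -ler_pdivlMr.
    have d3 : 2 ^+ nu * `|y - x| <= 2 ^+ sel k * `|y - x|.
      by rewrite ler_wpM2r// ler_weXn2l ?ler1n// leqW.
    have : gam <= gam * s by rewrite ler_peMr// ltW.
    by rewrite /s mulrDl mul1r; lra.
  have h2 : s ^- (2 * n) <= Wt (2 ^+ sel k *: (x - y)).
    apply: le_trans (decay_Wt _); rewrite normrZ distrC ger0_norm//.
  by rewrite exprD invfM [leRHS]mulrA; apply: ler_pM; rewrite ?invr_ge0 ?exprn_ge0 ?(ltW sp).
have iW : mu.-integrable setT (EFin \o (fun x => Cst * Wt (2 ^+ sel k *: (x - y)))).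
  under [X in _.-integrable _ X]eq_fun do rewrite /= EFinM.
  apply: integrableZl => //; apply: (rintegrable_ge0 (A := fun x => Wt (2 ^+ sel k *: (x - y)))).
  - by under eq_fun do rewrite scalerBr; exact: measurable_Wt.
  - by move=> x; exact: Wt_ge0.
  - by apply: le_lt_trans (integral_Wt _ _) _; rewrite ltry.
apply: le_trans (cmod_cintegral mG iW bound) _.
have iW1 : mu.-integrable setT (EFin \o (fun x => Wt (2 ^+ sel k *: (x - y)))).
  apply: rintegrable_ge0.
  - by under eq_fun do rewrite scalerBr; exact: measurable_Wt.
  - by move=> x; exact: Wt_ge0.
  - by apply: le_lt_trans (integral_Wt _ _) _; rewrite ltry.
rewrite RintegralZl//.
have IW : \int[mu]_x Wt (2 ^+ sel k *: (x - y)) <= 64 ^+ n * 2 ^- (sel k * n).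
  by rewrite -lee_fin -EFin_Rintegral//; exact: integral_Wt.
apply: le_trans (ler_wpM2l (ler0n _ 2) (ler_wpM2l Cst0 IW)) _.
rewrite /Cst /V (exprM _ (sel k) n) [(2 ^+ nu * _) ^+ K]exprMn exprVn -(exprM _ nu K).
have x0 : (2 ^+ sel k) ^+ n != 0 :> R by rewrite expf_neq0// gt_eqF.
rewrite -/(sel k) le_eqVlt; apply/orP; left; apply/eqP.
have -> : 2 * (2 ^+ (nu * K) * (B l * ((2 ^+ sel k) ^- K * (2 ^+ sel k) ^+ n)) *
   ((1 + gam) ^+ M / (1 + 2 ^+ nu * `|y - c|) ^+ M) * (64 ^+ n / (2 ^+ sel k) ^+ n)) =
   ((2 ^+ sel k) ^+ n / (2 ^+ sel k) ^+ n) * (2 * (2 ^+ (nu * K) * (B l * ((2 ^+ sel k) ^- K)) *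
   ((1 + gam) ^+ M / (1 + 2 ^+ nu * `|y - c|) ^+ M) * 64 ^+ n)) by ring.
rewrite divff// mul1r; ring.
Qed.

End convolution.

(** * Taylor's formula and pairings with test functions *)

Section taylor.
Context {R : realType} {n : nat}.
Local Notation Re := complex.Re.
Local Notation Im := complex.Im.
Local Notation e_ i := (delta_mx ord0 i : 'rV[R]_n).
Implicit Types (f a phi : 'rV[R]_n -> R[i]) (x y z c v : 'rV[R]_n) (i : 'I_n) (be : 'I_n -> nat).

(** When [G l] is the l-th derivative of [G 0], this is the remainder of [G 0] after its Taylor
    polynomial at 0 of degree k - 1. *)
Fixpoint line_tail (G : nat -> R -> R[i]) k t : R[i] :=
  if k is k'.+1 then line_tail G k' t - G k' 0 / k'`!%:R * (t ^+ k')%:C%C else G 0%N t.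

Lemma line_tailE G k t : line_tail G k t =
  G 0%N t - \sum_(l < k) (t ^+ l / l`!%:R)%:C%C * G l 0.
Proof.
elim: k => [|k IH]; first by rewrite big_ord0 subr0.
rewrite big_ord_recr /= IH opprD addrA; congr (_ - _).
rewrite [(_ / _)%:C%C]rmorphM /= fmorphV rmorph_nat; ring.
Qed.

Lemma cder_line_tail G k : (forall l, (l <= k)%N -> cder (G l) (G l.+1)) ->
  cder (line_tail G k.+1) (line_tail (fun l => G l.+1) k).
Proof.
elim: k => [|k IH] dG.
  have := cderB (dG 0%N isT) (cder_term (G 0%N 0 / 0`!%:R) 0).
  by congr cder; apply/funext => t /=; rewrite mulr0 mul0r subr0.
have := cderB (IH (fun l lk => dG l (leqW lk))) (cder_term (G k.+1 0 / k.+1`!%:R) k.+1).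
congr cder; apply/funext => t /=; congr (_ - _).
congr (_ * _); rewrite factS natrM.
have k0 : (k.+1%:R : R[i]) != 0 by rewrite pnatr_eq0.
have f0 : (k`!%:R : R[i]) != 0 by rewrite pnatr_eq0 -lt0n fact_gt0.
by rewrite invfM -[LHS]mulrA [_ / _ * _]mulrAC mulVf// mul1r.
Qed.

Lemma line_tail0 G k : line_tail G k.+1 0 = 0.
Proof.
elim: k => [|k IH]; last by rewrite /= -/(line_tail G k.+1 0) IH expr0n /= mulr0 subr0.
by rewrite /= expr0 fact0 divr1 mulr1 subrr.
Qed.

Lemma line_taylor G k (B t : R) : (forall l, (l < k)%N -> cder (G l) (G l.+1)) ->
  (forall u, `|u| <= `|t| -> cmod (G k u) <= B) ->
  cmod (line_tail G k t) <= 2 ^+ k * B * `|t| ^+ k.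
Proof.
elim: k G t => [|k IH] G t dG bG; first by rewrite !expr0 mul1r mulr1; exact: bG.
have B0 : 0 <= B by apply: le_trans (bG t (lexx _)); exact: cmod_ge0.
have b u : `|u| <= `|t| -> cmod (line_tail (fun l => G l.+1) k u) <= 2 ^+ k * B * `|t| ^+ k.
  move=> ut; apply: (le_trans (IH _ u _ _)) => [l lk|w wu|].
  - by apply: dG; rewrite ltnS.
  - by apply: bG; apply: le_trans wu ut.
  - by rewrite ler_wpM2l ?mulr_ge0 ?exprn_ge0// lerXn2r ?nnegrE.
have dE := @cder_line_tail G k (fun l lk => dG l lk).
apply: le_trans (cmod_le _) _.
have h1 := @line_lipschitz_loc _ (fun t => Re (line_tail G k.+1 t)) _ _ t (fun u => (dE u).1)
  (fun u ut => le_trans (Re_le_cmod _) (b u ut)).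
have h2 := @line_lipschitz_loc _ (fun t => Im (line_tail G k.+1 t)) _ _ t (fun u => (dE u).2)
  (fun u ut => le_trans (Im_le_cmod _) (b u ut)).
move: h1 h2; rewrite line_tail0 !subr0 => h1 h2.
apply: le_trans (lerD h1 h2) _.
by rewrite !exprSr le_eqVlt; apply/orP; left; apply/eqP; ring.
Qed.

Definition freeze c (s : seq 'I_n) x : 'rV[R]_n := \row_l if l \in s then x ord0 l else c ord0 l.

Definition bump be i m : 'I_n -> nat := fun l => if l == i then m else be l.

Lemma mdeg_bump be i m : be i = 0%N -> mdeg (bump be i m) = (mdeg be + m)%N.
Proof.
move=> b0; rewrite /mdeg (bigD1 i)//= [in RHS](bigD1 i)//= b0 add0n addnC.
rewrite /bump eqxx; congr addn; by apply: eq_bigr => l /negbTE ->.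
Qed.

(** In [mderiv] the derivatives along the earliest coordinates are applied last. As long as be
    vanishes up to i, derivatives along e_i can be put in front without interchanging any. *)
Lemma mderiv_bump be i m s s' f : enum 'I_n = rcons s i ++ s' ->
  (forall l, l \in rcons s i -> be l = 0%N) ->
  mderiv (bump be i m) f = pderivs (nseq m i) (mderiv be f).
Proof.
move=> E b0; rewrite /mderiv /pderivs -foldr_cat E !map_cat !flatten_cat.
congr (foldr pderiv f _).
have U : uniq (rcons s i ++ s') by rewrite -E enum_uniq.
have z (g : 'I_n -> nat) (t : seq 'I_n) : (forall l, l \in t -> g l = 0%N) ->
    flatten [seq nseq (g l) l | l <- t] = [::].
  elim: t => [//|l t IH] H /=; rewrite H ?mem_head//= IH// => l' lt.
  by apply: H; rewrite inE lt orbT.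
rewrite (z be)// -cats1 map_cat flatten_cat z; last first.
  move=> l ls; rewrite /bump; case: eqP => [li|_].
    by move: U; rewrite cat_uniq rcons_uniq -li ls.
  by apply: b0; rewrite mem_rcons inE ls orbT.
rewrite /= cats0 /bump eqxx; congr (_ ++ _); congr flatten.
apply/eq_in_map => l ls; case: eqP => [li|//].
by move: U; rewrite cat_uniq -li => /and3P[_ /hasP[]]; exists l => //=; rewrite mem_rcons mem_head.
Qed.

(* Taylor's formula one coordinate at a time, starting with the last one, so that only the
   derivatives [mderiv be phi] occur. *)
Lemma coord_taylor N s : exists2 A : R, 0 <= A & forall s' phi c (r S : R) be k,
  enum 'I_n = s ++ s' -> (forall l, l \in s -> be l = 0%N) -> (mdeg be + k.+1 = N)%N ->
  (forall K, Ck K phi) -> 0 <= S ->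
  (forall be' z, mdeg be' = N -> `|z - c| <= r -> cmod (mderiv be' phi z) <= S) ->
  exists P1 P2, [/\ polyfun k P1, polyfun k P2 & forall x, `|x - c| <= r ->
    cmod (mderiv be phi (freeze c s x) - ((P1 x)%:C%C + 'i%C * (P2 x)%:C%C)) <=
      A * S * `|x - c| ^+ k.+1].
Proof.
elim/last_ind: s => [|s i [A A0 IH]].
  exists 0 => // s' phi c r S be k E b0 dk Cphi S0 HS.
  exists (fun=> Re (mderiv be phi c)), (fun=> Im (mderiv be phi c)); split; try exact: polyfun_cst.
  move=> x xr; have -> : freeze c [::] x = c by apply/rowP => l; rewrite mxE.
  rewrite !mul0r [X in cmod X](_ : _ = 0) ?cmod0//.
  by apply: complex_eqP; rewrite ?cReB ?cImB ?cReD ?cImD ?cReM ?cImM /=; ring.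
(* The term 2^N bounds the remainder along the last line, and N A the errors of at most N
   coefficients. *)
exists (2 ^+ N + N%:R * A); first by rewrite addr_ge0 ?exprn_ge0// mulr_ge0.
move=> s' phi c r S be k E b0 dk Cphi S0 HS.
have bi : be i = 0%N by apply: b0; rewrite mem_rcons mem_head.
have U : uniq (rcons s i ++ s') by rewrite -E enum_uniq.
have is_ : i \notin s by move: U; rewrite cat_uniq rcons_uniq => /andP[/andP[]].
(* The coefficient of order l along e_i is a derivative evaluated on the remaining coordinates s;
   the induction hypothesis expands it to degree k - l, so the total degree stays at most k. *)
have /choice[P1 /choice[P2 HP]] : forall l : 'I_k.+1, exists P1 P2, [/\ polyfun (k - l) P1,
    polyfun (k - l) P2 & forall x, `|x - c| <= r ->
    cmod (mderiv (bump be i l) phi (freeze c s x) - ((P1 x)%:C%C + 'i%C * (P2 x)%:C%C)) <=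
      A * S * `|x - c| ^+ (k - l).+1].
  move=> l; apply: (IH (i :: s') phi c r S) => //.
  - by rewrite E cat_rcons.
  - move=> l' ls; rewrite /bump; case: eqP => [li|_]; first by rewrite -li ls in is_.
    by apply: b0; rewrite mem_rcons inE ls orbT.
  - rewrite mdeg_bump// -dk; have := ltn_ord l; lia.
pose Q (P : 'I_k.+1 -> 'rV[R]_n -> R) x :=
  \sum_(l < k.+1) (x ord0 i - c ord0 i) ^+ l / l`!%:R * P l x.
have pQ P : (forall l : 'I_k.+1, polyfun (k - l) (P l)) -> polyfun k (Q P).
  move=> HPl.
  suff : forall l : 'I_k.+1, polyfun k (fun x => (x ord0 i - c ord0 i) ^+ nat_of_ord l / l`!%:R * P l x).
    move=> {HPl} H.
    have /choice[g Hg] : forall l : 'I_k.+1, exists g : seq (R * ('I_n -> nat)),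
        all (fun t => mdeg t.2 <= k)%N g /\ forall x,
        (x ord0 i - c ord0 i) ^+ nat_of_ord l / l`!%:R * P l x = \sum_(t <- g) t.1 * monom t.2 x.
      by move=> l; have [s0 h1 h2] := H l; exists s0.
    exists (flatten [seq g l | l <- index_enum 'I_k.+1]).
      apply/allP => t /flattenP[_ /mapP[l _ ->]] tg; have [/allP h _] := Hg l; exact: h.
    move=> x; rewrite /Q big_flatten big_map; apply: eq_bigr => l _; exact: (Hg l).2.
  move=> l; have lk : ((k - l) + l = k)%N by rewrite subnK// -ltnS.
  have : forall m, polyfun (k - l + m) (fun x => (x ord0 i - c ord0 i) ^+ m * P l x).
    elim => [|m IHm].
      by rewrite addn0; apply: polyfun_ext (HPl l) => x; rewrite expr0 mul1r.
    rewrite addnS; apply: polyfun_ext (polyfun_affine i (- c ord0 i) IHm) => x.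
    by rewrite exprS mulrA.
  move=> /(_ l); rewrite lk => H; apply: polyfun_ext (polyfunZ (l`!%:R)^-1 H) => x; ring.
exists (Q P1), (Q P2); split.
- by apply: pQ => l; have [] := HP l.
- by apply: pQ => l; have [] := HP l.
move=> x xr; set t := x ord0 i - c ord0 i; pose y := freeze c s x.
have tx : `|t| <= `|x - c| by have := coord_le_norm (x - c) i; rewrite !mxE.
have fE : freeze c (rcons s i) x = y + t *: e_ i.
  apply/rowP => l; rewrite !mxE mem_rcons inE eqxx /=.
  case: (eqVneq l i) => [->|li] /=; last by rewrite mulr0 addr0.
  by rewrite (negbTE is_) mulr1 addrC subrK.
have yc u : `|u| <= `|t| -> `|y + u *: e_ i - c| <= `|x - c|.
  move=> ut; apply/rV_norm_leP => // l; rewrite !mxE eqxx /=.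
  case: (eqVneq l i) => [->|li] /=.
    by rewrite (negbTE is_) mulr1 addrC addKr (le_trans ut).
  rewrite mulr0 addr0; case: ifP => _; last by rewrite subrr normr0.
  by have := coord_le_norm (x - c) l; rewrite !mxE.
pose G l u := pderivs (nseq l i) (mderiv be phi) (y + u *: e_ i).
have dG l : cder (G l) (G l.+1).
  move=> u; pose w := nseq l i ++ flatten [seq nseq (be i') i' | i' <- enum 'I_n].
  have [|_ H] := Cphi (size w).+1 w; first exact: leqnSn.
  have := pd_line (pderivable_pd (H (leqnn _) i)) y u.
  by rewrite /w /pderivs foldr_cat.
have tk : cmod (line_tail G k.+1 t) <= 2 ^+ k.+1 * S * `|t| ^+ k.+1.
  apply: line_taylor => [l _|u ut]; first exact: dG.
  rewrite /G -(mderiv_bump _ _ E b0); apply: HS; first by rewrite mdeg_bump.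
  exact: le_trans (yc u ut) xr.
rewrite fE -/(G 0%N t).
have -> : G 0%N t - ((Q P1 x)%:C%C + 'i%C * (Q P2 x)%:C%C) = line_tail G k.+1 t +
    \sum_(l < k.+1) (t ^+ l / l`!%:R)%:C%C * (G l 0 - ((P1 l x)%:C%C + 'i%C * (P2 l x)%:C%C)).
  rewrite line_tailE -[RHS]addrA; congr (_ + _).
  set X := (X in - X + _); have -> : \sum_(l < k.+1) (t ^+ l / l`!%:R)%:C%C *
     (G l 0 - ((P1 l x)%:C%C + 'i%C * (P2 l x)%:C%C)) =
     X - \sum_(l < k.+1) (t ^+ l / l`!%:R)%:C%C * ((P1 l x)%:C%C + 'i%C * (P2 l x)%:C%C).
    by rewrite /X -sumrB; apply: eq_bigr => l _; rewrite mulrBr.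
  rewrite addKr; congr (- _).
  rewrite /Q !rmorph_sum mulr_sumr -big_split; apply: eq_bigr => l _ /=.
  by rewrite -/t !rmorphM mulrDr; congr (_ + _); rewrite mulrCA.
have D0 := normr_ge0 (x - c).
apply: le_trans (cmodD _ _) _; rewrite mulrDl mulrDl; apply: lerD.
  apply: le_trans tk _; apply: ler_pM => //; rewrite ?mulr_ge0 ?exprn_ge0//.
    by rewrite ler_wpM2r// ler_weXn2l ?ler1n// -dk leq_addl.
  by rewrite lerXn2r ?nnegrE.
apply: le_trans (cmod_sum _ _ _) _.
apply: (@le_trans _ _ (\sum_(l < k.+1) A * S * `|x - c| ^+ k.+1)); last first.
  rewrite sumr_const card_ord -[leLHS]mulr_natl -!mulrA ler_wpM2r ?mulr_ge0 ?exprn_ge0//.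
  by rewrite ler_nat -dk leq_addl.
apply: ler_sum => l _; rewrite cmodM cmod_real.
have -> : `|x - c| ^+ k.+1 = `|x - c| ^+ l * `|x - c| ^+ (k - l).+1.
  by rewrite -exprD; congr (_ ^+ _); have := ltn_ord l; lia.
rewrite mulrCA; apply: ler_pM; rewrite ?cmod_ge0//.
  rewrite normrM normrX -[leRHS]mulr1; apply: ler_pM; rewrite ?exprn_ge0//.
    by rewrite lerXn2r ?nnegrE.
  rewrite normfV ger0_norm// invf_le1 ?ltr0n ?fact_gt0// ler1n; exact: fact_gt0.
have [_ _ /(_ x xr)] := HP l; congr (cmod (_ - _) <= _).
rewrite /G scale0r addr0 -(mderiv_bump _ _ E b0) //.
Qed.

(** The moments allow subtracting the Taylor polynomial of phi at c; the remainder is of size S r^N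
    on the support, whose volume contributes r^n. *)
Lemma moment_pairing N : exists2 A : R, 0 <= A & forall phi a c (r S : R),
  (forall K, Ck K phi) -> 0 <= r -> cmeas a -> bsupp 1 c r a -> 0 <= S ->
  (forall be, (mdeg be < N)%N -> cintegral (fun x => (monom be x)%:C%C * a x) = 0) ->
  (forall be z, mdeg be = N -> `|z - c| <= r -> cmod (mderiv be phi z) <= S) ->
  cmod (cintegral (fun x => a x * phi x)) <= A * S * r ^+ (n + N).
Proof.
have [A A0 HA] := coord_taylor N (enum 'I_n).
exists (2 * (1 + A) * 2 ^+ n); first by rewrite mulr_ge0// mulr_ge0// addr_ge0.
move=> phi a c r S Cphi r0 ma [ba sa] S0 ka HS.
have z0 : mdeg (fun _ : 'I_n => 0%N) = 0%N by rewrite /mdeg big1.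
have d0 : mderiv (fun _ : 'I_n => 0%N) phi = phi.
  by rewrite /mderiv; elim: (enum 'I_n).
have mphi : cmeas phi.
  by have [H _] := Cphi 0%N [::] isT; exact: ccontinuous_cmeas.
suff [Q [mQ iQ HQ]] : exists Q : 'rV[R]_n -> R[i], [/\ cmeas Q,
    cintegrable (fun x => Q x * a x) /\ cintegral (fun x => Q x * a x) = 0 &
    forall x, `|x - c| <= r -> cmod (phi x - Q x) <= (1 + A) * S * r ^+ N].
  have bs : bsupp ((1 + A) * S * r ^+ N) c r (fun x => a x * (phi x - Q x)).
    split => x; last by move=> /sa ->; rewrite mul0r.
    have [xr|xr] := leP `|x - c| r; last first.
      by rewrite sa// mul0r cmod0 !mulr_ge0 ?exprn_ge0// addr_ge0.
    rewrite cmodM -[leRHS]mul1r; apply: ler_pM; rewrite ?cmod_ge0//.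
    exact: HQ.
  have mD : cmeas (fun x => a x * (phi x - Q x)).
    apply: cmeasM => //; under eq_fun do rewrite -mulN1r.
    by apply: cmeasD => //; apply: cmeasM => //; exact: cmeas_cst.
  have [iD le] := bsupp_cintegrable r0 mD bs.
  have -> : (fun x => a x * phi x) = (fun x => a x * (phi x - Q x) + Q x * a x).
    by apply/funext => x; ring.
  rewrite cintegralD//; last by case: iQ.
  rewrite iQ.2 addr0; apply: le_trans le _.
  by rewrite exprMn exprD le_eqVlt; apply/orP; left; apply/eqP; ring.
(* Without moments nothing is subtracted, and phi itself is bounded by S; this is the 1 in 1 + A. *)
case: N ka HS A A0 HA => [|k] ka HS A A0 HA.
  exists (fun=> 0); split; first exact: cmeas_cst.
    under eq_fun do rewrite mul0r; split.
      by split; under eq_fun do rewrite /=; exact: integrable0.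
    by rewrite /cintegral /= /Rintegral integral0.
  move=> x xr; rewrite subr0 expr0 mulr1 -d0 (le_trans (HS _ _ z0 xr))//.
  by rewrite ler_peMl// lerDl.
have [P1 [P2 [p1 p2 HP]]] := HA [::] phi c r S (fun=> 0%N) k (esym (cats0 _)) (fun _ _ => erefl)
   (congr1 (addn^~ k.+1) z0) Cphi S0 HS.
have [j1 e1] := polyfun_killed r0 ma (conj ba sa) ka (leqnn _) p1.
have [j2 e2] := polyfun_killed r0 ma (conj ba sa) ka (leqnn _) p2.
have mP (P : 'rV[R]_n -> R) d : polyfun d P -> cmeas (fun x => (P x)%:C%C).
  move=> [t _ Pt]; have -> : P = (fun x => \sum_(u <- t) u.1 * monom u.2 x) by exact/funext.
  apply: cmeas_real.
  apply: measurable_sum => u; apply: measurable_funM => //; rewrite /monom.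
  apply: measurable_prod => l _; apply: measurable_funX; exact: measurable_coord.
exists (fun x => (P1 x)%:C%C + 'i%C * (P2 x)%:C%C); split.
- apply: cmeasD; first exact: mP p1.
  by apply: cmeasM; [exact: cmeas_cst|exact: mP p2].
- have j2' := cintegrableZ 'i%C j2.
  have -> : (fun x => ((P1 x)%:C%C + 'i%C * (P2 x)%:C%C) * a x) =
      (fun x => (P1 x)%:C%C * a x + 'i%C * ((P2 x)%:C%C * a x)).
    by apply/funext => x; ring.
  split; first exact: cintegrableD.
  by rewrite cintegralD// cintegralZ// e1 e2 mulr0 addr0.
- move=> x xr; have := HP x xr; rewrite d0.
  have -> : freeze c (enum 'I_n) x = x by apply/rowP => l; rewrite mxE mem_enum.
  move=> /le_trans; apply; rewrite -!mulrA; apply: ler_pM => //.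
  - by rewrite mulr_ge0 ?exprn_ge0.
  - by rewrite lerDr.
  - by rewrite ler_wpM2l// lerXn2r ?nnegrE.
Qed.

End taylor.

(** * Schwartz seminorms *)

Section schwartz_bounds.
Context {R : realType} {n : nat}.
Local Notation Re := complex.Re.
Local Notation Im := complex.Im.
Local Notation mu := (lebesgue_rV n : {measure set 'rV[R]_n -> \bar R}).
Implicit Types (f g a phi psi : 'rV[R]_n -> R[i]) (x y z c v : 'rV[R]_n) (i : 'I_n)
  (be : 'I_n -> nat).

Lemma pderivs_sub K f g w : Ck K f -> Ck K g -> (size w <= K)%N ->
  pderivs w (fun x => f x - g x) = (fun x => pderivs w f x - pderivs w g x).
Proof.
move=> Cf Cg; elim: w => [//|i w IH] wK /=; rewrite IH; last exact: ltnW.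
have [_ /(_ wK i) df] := Cf w (ltnW wK); have [_ /(_ wK i) dg] := Cg w (ltnW wK).
apply/funext => x; have [fr fi] := df x; have [gr gi] := dg x.
apply: complex_eqP; rewrite ?cReB ?cImB /pderiv /=.
  under eq_fun do rewrite cReB; exact: deriveB.
by under eq_fun do rewrite cImB; exact: deriveB.
Qed.

Lemma Ck_sub K f g : Ck K f -> Ck K g -> Ck K (fun x => f x - g x).
Proof.
move=> Cf Cg w wK; have [[cfr cfi] df] := Cf w wK; have [[cgr cgi] dg] := Cg w wK.
rewrite (pderivs_sub Cf Cg wK); split.
  split.
    under eq_fun do rewrite cReB; move=> x; exact: cvgB (cfr x) (cgr x).
  under eq_fun do rewrite cImB; move=> x; exact: cvgB (cfi x) (cgi x).
move=> wK' i x; have [fr fi] := df wK' i x; have [gr gi] := dg wK' i x; split.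
  by under eq_fun do rewrite cReB; exact: derivableB.
by under eq_fun do rewrite cImB; exact: derivableB.
Qed.

Lemma seminorm_ge0 al be phi : (0 <= schwartz_seminorm al be phi)%E.
Proof.
apply: le_trans (ereal_sup_ubound (imageT _ 0)).
by rewrite lee_fin mulr_ge0// cmod_ge0.
Qed.

Lemma seminorm_le al be phi x : (schwartz_seminorm al be phi < +oo)%E ->
  `|monom al x| * cmod (mderiv be phi x) <= fine (schwartz_seminorm al be phi).
Proof.
move=> fin; rewrite -lee_fin fineK; last by rewrite ge0_fin_numE// seminorm_ge0.
by apply: ereal_sup_ubound; exists x.
Qed.

Lemma schwartz_sub phi psi : schwartz phi -> schwartz psi -> schwartz (fun x => phi x - psi x).
Proof.
move=> [C1 S1] [C2 S2]; split; first by move=> K; exact: Ck_sub.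
move=> al be; apply: (@le_lt_trans _ _
   (fine (schwartz_seminorm al be phi) + fine (schwartz_seminorm al be psi))%:E); last exact: ltry.
apply: ge_ereal_sup => _ [x _ <-]; rewrite lee_fin.
rewrite [mderiv be _](pderivs_sub (C1 _) (C2 _) (leqnn _)).
apply: le_trans (ler_wpM2l _ (cmodB _ _)) _ => //; rewrite mulrDr.
by apply: lerD; exact: seminorm_le.
Qed.

(** The weights 1 and |x_i|^M together dominate (1 + |x|)^M up to 2^M. *)
Definition wnorm M be phi : R := fine (schwartz_seminorm (fun=> 0%N) be phi) +
  \sum_i fine (schwartz_seminorm (pure i M) be phi).

Lemma fine_seminorm_ge0 al be phi : 0 <= fine (schwartz_seminorm al be phi).
Proof. exact/fine_ge0/seminorm_ge0. Qed.

Lemma wnorm_ge0 M be phi : 0 <= wnorm M be phi.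
Proof. by rewrite addr_ge0 ?sumr_ge0 ?fine_seminorm_ge0// => i _; exact: fine_seminorm_ge0. Qed.

Lemma monom_pure i M x : monom (pure i M) x = x ord0 i ^+ M.
Proof.
rewrite /monom (bigD1 i)//= /pure eqxx big1 ?mulr1// => l /negbTE ->.
by rewrite expr0.
Qed.

Lemma schwartz_decay (n_gt0 : (0 < n)%N) M be phi z : schwartz phi ->
  cmod (mderiv be phi z) <= 2 ^+ M * wnorm M be phi * (1 + `|z|) ^- M.
Proof.
move=> [_ S]; have z1 : 0 < 1 + `|z| by rewrite ltr_wpDr.
rewrite ler_pdivlMr ?exprn_gt0// mulrC.
have [i zi] := norm_attained n_gt0 z.
have h0 := seminorm_le z (S (fun=> 0%N) be).
have h1 := seminorm_le z (S (pure i M) be).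
rewrite monom_pure normrX -zi in h1.
rewrite /monom big1 ?normr1 ?mul1r in h0; last by move=> l _; rewrite expr0.
have w1 : fine (schwartz_seminorm (pure i M) be phi) <= \sum_i fine (schwartz_seminorm (pure i M) be phi).
  by rewrite (bigD1 i)//= lerDl sumr_ge0// => l _; exact: fine_seminorm_ge0.
have hM : (1 + `|z|) ^+ M <= 2 ^+ M * (1 + `|z| ^+ M).
  have [zl|zl] := leP `|z| 1.
    apply: (@le_trans _ _ (2 ^+ M * 1)); last by rewrite ler_wpM2l ?exprn_ge0// lerDl exprn_ge0.
    by rewrite mulr1 lerXn2r ?nnegrE ?(ltW z1)//; lra.
  apply: (@le_trans _ _ (2 ^+ M * `|z| ^+ M)); last by rewrite ler_wpM2l ?exprn_ge0// lerDr.
  by rewrite -exprMn lerXn2r ?nnegrE ?(ltW z1) ?mulr_ge0//; lra.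
apply: le_trans (ler_wpM2r (cmod_ge0 _) hM) _.
rewrite -mulrA ler_wpM2l ?exprn_ge0// mulrDl mul1r /wnorm; apply: lerD => //.
exact: le_trans w1.
Qed.

(** Summing over a finite type of multi-indices, which contains all those of degree at most N, gives
    one quantity that tends to 0 along convergent sequences. *)
Definition snorm M N phi : R :=
  \sum_(be : {ffun 'I_n -> 'I_N.+1}) wnorm M (fun i => be i) phi.

Lemma snorm_ge0 M N phi : 0 <= snorm M N phi.
Proof. by apply: sumr_ge0 => be _; exact: wnorm_ge0. Qed.

Lemma wnorm_le_snorm M N be phi : (mdeg be <= N)%N -> wnorm M be phi <= snorm M N phi.
Proof.
move=> bN; have bi i : (be i < N.+1)%N.
  by rewrite ltnS (leq_trans _ bN)// /mdeg (bigD1 i)//= leq_addr.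
rewrite /snorm (bigD1 [ffun i => Ordinal (bi i)])//=.
have -> : (fun i => nat_of_ord ([ffun i => Ordinal (bi i)] i)) = be.
  by apply/funext => i; rewrite ffunE.
by rewrite lerDl; apply: sumr_ge0 => l _; exact: wnorm_ge0.
Qed.

Lemma sum_cvg0 I (r : seq I) (F : I -> nat -> R) : (forall j, F j k @[k --> \oo] --> (0 : R)) ->
  \sum_(j <- r) F j k @[k --> \oo] --> (0 : R).
Proof.
move=> H; elim: r => [|i r IH]; first by under eq_fun do rewrite big_nil; exact: cvg_cst.
have -> : (fun k => \sum_(j <- i :: r) F j k) = (fun k => F i k) \+ (fun k => \sum_(j <- r) F j k).
  by apply/funext => k; rewrite big_cons.
have := cvgD (H i) IH; rewrite addr0; exact.
Qed.

Lemma snorm_cvg0 M N (u : nat -> 'rV[R]_n -> R[i]) :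
  (forall al be, schwartz_seminorm al be (u k) @[k --> \oo] --> 0%E) ->
  snorm M N (u k) @[k --> \oo] --> (0 : R).
Proof.
move=> H; have h al be : fine (schwartz_seminorm al be (u k)) @[k --> \oo] --> (0 : R).
  exact: (fine_cvg (H al be)).
apply: sum_cvg0 => be; rewrite -[X in _ --> X]addr0; apply: cvgD; first exact: h.
by apply: sum_cvg0 => i; exact: h.
Qed.

Lemma mderiv0 phi : mderiv (fun=> 0%N) phi = phi.
Proof. by rewrite /mderiv; elim: (enum 'I_n). Qed.

Lemma schwartz_cmeas phi : schwartz phi -> cmeas phi.
Proof. by move=> [C _]; have [H _] := C 0%N [::] isT; exact: ccontinuous_cmeas. Qed.

Lemma schwartz_integrable (n_gt0 : (0 < n)%N) phi : schwartz phi ->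
  exists2 A, mu.-integrable setT (EFin \o A) & forall x, cmod (phi x) <= A x.
Proof.
move=> sp; have := fun z => schwartz_decay n_gt0 (2 * n) (fun=> 0%N) z sp.
set K := 2 ^+ _ * _ => H; rewrite mderiv0 in H.
have K0 : 0 <= K by rewrite mulr_ge0 ?exprn_ge0// wnorm_ge0.
exists (fun z => K * Wt (2 ^+ 0 *: (z - 0))).
  under [X in _.-integrable _ X]eq_fun do rewrite /= EFinM.
  apply: integrableZl => //; apply: (rintegrable_ge0 (A := fun x => Wt (2 ^+ 0 *: (x - 0)))).
  - by under eq_fun do rewrite scalerBr; exact: measurable_Wt.
  - by move=> x; exact: Wt_ge0.
  - by apply: le_lt_trans (integral_Wt _ _) _; rewrite ltry.
move=> z; apply: le_trans (H z) _; rewrite ler_wpM2l//.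
by rewrite expr0 scale1r subr0 decay_Wt.
Qed.

Lemma schwartz_cintegrable (n_gt0 : (0 < n)%N) phi : schwartz phi -> cintegrable phi.
Proof.
move=> sp; have [A iA HA] := schwartz_integrable n_gt0 sp.
exact: cintegrable_le (schwartz_cmeas sp) iA HA.
Qed.

End schwartz_bounds.

(** * Elementary bounds for atoms *)

Section atoms.
Context {R : realType} {n : nat} (n_gt0 : (0 < n)%N).
Implicit Types (a phi psi : 'rV[R]_n -> R[i]) (x y z c : 'rV[R]_n) (m : 'rV[int]_n).

Definition ccenter (nu : nat) m : 'rV[R]_n := \row_i (2 ^- nu * ((m ord0 i)%:~R + 2^-1)).

Lemma ccenter_cube nu m : cube nu m (ccenter nu m).
Proof.
have p : (0 : R) < 2 ^- nu by rewrite invr_gt0 exprn_gt0.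
by move=> i; rewrite mxE ler_pM2l// ltr_pM2l//; lra.
Qed.

Lemma dilated_cube_le (gam : R) nu m x : 0 <= gam -> dilated_cube gam nu m x ->
  `|x - ccenter nu m| <= gam * 2 ^- nu.
Proof.
move=> g0 [y yc <-]; rewrite -/(ccenter nu m) addrC addKr normrZ ger0_norm// ler_wpM2l//.
exact: cube_dist yc (ccenter_cube nu m).
Qed.

(* The atom cancels monomials of degree < atom_order. *)
Definition atom_order (nu : nat) (L : int) : nat :=
  if nu is 0%N then 0%N else if (L + 1)%R is Posz N then N else 0%N.

Lemma atom_moments (gam : R) K L nu m a : is_atom gam K L nu m a ->
  forall be, (mdeg be < atom_order nu L)%N -> cintegral (fun x => (monom be x)%:C%C * a x) = 0.
Proof.
case=> _ _ _ H be; rewrite /atom_order; case: nu H => [//|nu] H.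
case E : (L + 1) => [N|//] bN; apply: H => //.
by rewrite -ltzD1 E ltz_nat.
Qed.

Variables (gam : R) (K : nat) (L : int) (nu : nat) (m : 'rV[int]_n) (a : 'rV[R]_n -> R[i]).
Hypothesis (g0 : 0 <= gam) (aP : is_atom gam K L nu m a).

Lemma atom_derivs i l : (l <= K)%N -> cmeas (pderivs (nseq l i) a) /\
  bsupp (2 ^+ (nu * l)) (ccenter nu m) (gam * 2 ^- nu) (pderivs (nseq l i) a).
Proof.
case: aP => Ca sa ba _ lK; split.
  have [|H _] := Ca (nseq l i); first by rewrite size_nseq.
  exact: ccontinuous_cmeas.
split => x.
  by have := ba (pure i l); rewrite mdeg_pure mderiv_pure; apply.
move=> xr; apply: pderivs_out => /sa /(dilated_cube_le g0).
by rewrite leNgt xr.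
Qed.

Lemma atom_pd i l : (l < K)%N -> pd i (pderivs (nseq l i) a) (pderivs (nseq l.+1 i) a).
Proof.
case: aP => Ca _ _ _ lK; apply: pderivable_pd.
have [|_ H] := Ca (nseq l i); first by rewrite size_nseq ltnW.
by apply: H; rewrite size_nseq.
Qed.

Lemma atom_cmeas : cmeas a.
Proof. by case: aP => Ca _ _ _; have [H _] := Ca [::] isT; exact: ccontinuous_cmeas. Qed.

Lemma atom_bsupp : bsupp 1 (ccenter nu m) (gam * 2 ^- nu) a.
Proof.
have i : 'I_n by exact: Ordinal n_gt0.
by have [_] := atom_derivs i (leq0n K); rewrite muln0 expr0.
Qed.

Lemma atom_radius_ge0 : 0 <= gam * 2 ^- nu.
Proof. by rewrite mulr_ge0// invr_ge0 exprn_ge0. Qed.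

Lemma atom_cintegrable : cintegrable a.
Proof. exact: (bsupp_cintegrable atom_radius_ge0 atom_cmeas atom_bsupp).1. Qed.

Lemma atom_cintegrable_schwartz phi : schwartz phi -> cintegrable (fun x => a x * phi x).
Proof.
move=> sp; have [b1 s1] := atom_bsupp; have [A iA HA] := schwartz_integrable n_gt0 sp.
apply: (cintegrable_le _ iA); first exact: cmeasM atom_cmeas (schwartz_cmeas sp).
move=> x; rewrite cmodM -[leRHS]mul1r; apply: ler_pM; rewrite ?cmod_ge0//.
Qed.

End atoms.

(** The moments yield the power of 2^-nu, and the Schwartz decay, transferred from the support to
    the centre of the cube, makes the pairings summable in m. *)
Lemma atom_pairing {R : realType} {n : nat} (n_gt0 : (0 < n)%N) (gam : R) (M N : nat) : 0 <= gam ->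
  exists2 C : R, 0 <= C & forall K L nu (m : 'rV[int]_n) (a phi : 'rV[R]_n -> R[i]),
  is_atom gam K L nu m a -> atom_order nu L = N -> schwartz phi ->
  cmod (cintegral (fun x => a x * phi x)) <=
    C * snorm M N phi * (2 ^- nu) ^+ (n + N) * (1 + `|ccenter nu m : 'rV[R]_n|) ^- M.
Proof.
move=> g0; have [A A0 HA] := @moment_pairing R n N.
exists (A * 2 ^+ M * (1 + gam) ^+ M * gam ^+ (n + N)).
  by rewrite !mulr_ge0 ?exprn_ge0// addr_ge0.
move=> K L nu m a phi aP oN sp; set c : 'rV[R]_n := ccenter nu m.
have c1 : 0 < 1 + `|c| by rewrite ltr_wpDr.
pose S := 2 ^+ M * snorm M N phi * ((1 + gam) ^+ M * (1 + `|c|) ^- M).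
have S0 : 0 <= S.
  by rewrite !mulr_ge0 ?exprn_ge0 ?snorm_ge0// ?addr_ge0// invr_ge0 exprn_ge0// ltW.
apply: le_trans (HA phi a c (gam * 2 ^- nu) S sp.1 _ _ _ S0 _ _) _.
- exact: atom_radius_ge0.
- exact: atom_cmeas aP.
- exact: (atom_bsupp n_gt0 g0 aP).
- by move=> be; rewrite -oN; exact: (atom_moments aP).
- move=> be z bN zr; apply: le_trans (schwartz_decay n_gt0 M be z sp) _.
  apply: ler_pM; rewrite ?mulr_ge0 ?exprn_ge0 ?wnorm_ge0// ?invr_ge0 ?exprn_ge0//.
    by rewrite ler_wpM2l ?exprn_ge0// wnorm_le_snorm ?bN.
  have z1 : 0 < 1 + `|z| by rewrite ltr_wpDr.
  rewrite ler_pdivlMr ?exprn_gt0// mulrC ler_pdivrMr ?exprn_gt0// -exprMn.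
  rewrite lerXn2r ?nnegrE ?mulr_ge0 ?(ltW c1) ?(ltW z1) ?addr_ge0//.
  have d1 : `|c| <= `|z| + `|z - c|.
    by rewrite distrC -{1}(subrK z c) addrC; exact: ler_normD.
  have d2 : `|z - c| <= gam.
    apply: le_trans zr _; rewrite ler_piMr// invf_le1 ?exprn_gt0// exprn_ege1// ler1n//.
  have : gam <= gam * (1 + `|z|) by rewrite ler_peMr// lerDl.
  by rewrite mulrDl mul1r; lra.
rewrite /S exprMn le_eqVlt; apply/orP; left; apply/eqP; ring.
Qed.

(** * Log-Hoelder exponents *)

Section log_hoelder.
Context {R : realType} {n : nat} (n_gt0 : (0 < n)%N).
Local Notation mu := (lebesgue_rV n : {measure set 'rV[R]_n -> \bar R}).
Implicit Types (g h : 'rV[R]_n -> R) (x y z : 'rV[R]_n).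

Lemma powR_expR (v a : R) : 0 < v -> v `^ a = expR (a * ln v).
Proof. by move=> v0; rewrite /powR gt_eqF. Qed.

Lemma ln2_bounds : 0 < ln (2 : R) <= 1.
Proof.
rewrite ln_gt0 ?ltr1n//=; have := @le_ln1Dx R 1; rewrite -[1 + 1]/(2 : R); apply; lra.
Qed.

(* The form in which log-Hoelder continuity is used: at scale 2^-i it controls the
   oscillation against the number of digits of i and |x|. *)
Definition log_osc g := exists2 C : R, 0 <= C & forall (i : nat) x y,
  (1 + i%:R + ln (1 + `|x|)) * `|g x - g y| <= C * (1 + ln (1 + 2 ^+ i * `|x - y|)).

Lemma ln1D_ge0 (t : R) : 0 <= t -> 0 <= ln (1 + t).
Proof. by move=> t0; apply: ln_ge0; rewrite lerDl. Qed.

(** If x and y are at distance d, then i ln 2 is at most ln n + ln(1 + 2^i d) plus the logarithm in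
    the local condition, so that condition handles the term i. The term ln(1 + |x|) is handled by
    the condition at infinity, since 1 + |x| <= (1 + |y|)(1 + 2^i d). *)
Lemma Clog_log_osc g : Clog g -> log_osc g.
Proof.
case=> C0 [poo [C00 H1 H2]]; have /andP[l20 l21] := ln2_bounds.
have nR : (1 : R) <= n%:R by rewrite ler1n.
have ln0 : 0 <= ln (n%:R : R) by apply: ln_ge0.
exists (C0 * (1 + (ln n%:R + 1) / ln 2) + 2 * C0).
  by rewrite addr_ge0 ?mulr_ge0 ?addr_ge0 ?divr_ge0 ?(ltW C00) ?(ltW l20)//; lra.
move=> i x y; have [<-|xy] := eqVneq x y.
  rewrite subrr normr0 mulr0 mulr_ge0//; last by rewrite addr_ge0// ln1D_ge0// mulr_ge0// exprn_ge0.
  by rewrite addr_ge0 ?mulr_ge0 ?addr_ge0 ?divr_ge0 ?(ltW C00) ?(ltW l20)//; lra.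
set d := `|x - y|; set W := ln (1 + 2 ^+ i * d).
have d0 : 0 < d by rewrite normr_gt0 subr_eq0.
have p2 : (1 : R) <= 2 ^+ i by rewrite exprn_ege1// ler1n.
have td0 : 0 <= 2 ^+ i * d by rewrite mulr_ge0 ?ltW//; lra.
have W0 : 0 <= W by apply: ln1D_ge0.
set del := `|g x - g y|; have del0 : 0 <= del by exact: normr_ge0.
have e1 : (1 : R) <= expR 1 by apply: le_trans (expR_ge1Dx 1); lra.
have eL (t : R) : 0 <= t -> 1 <= ln (expR 1 + t).
  by move=> t0; rewrite -{1}(expRK (1 : R)) ler_ln ?posrE ?expR_gt0//; lra.
have E0 : d <= enorm (x - y) := norm_le_enorm (x - y).
have Ei : 0 <= (enorm (x - y))^-1 by rewrite invr_ge0 enorm_ge0.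
set Lc := ln (expR 1 + (enorm (x - y))^-1).
have Lc1 : 1 <= Lc by apply: eL.
have h1 : del * Lc <= C0 by rewrite -ler_pdivlMr; [exact: H1|lra].
have dC : del <= C0 by apply: le_trans h1; rewrite ler_peMr.
have hi : i%:R * ln 2 <= ln n%:R + W + Lc.
  rewrite mulr_natl -lnXn// -!lnM ?posrE; try lra; last first.
    by rewrite mulr_gt0; lra.
  rewrite ler_ln ?posrE ?mulr_gt0//; try lra.
  have h : d^-1 <= n%:R * (enorm (x - y))^-1.
    have := enorm_le_norm (x - y); rewrite -/d => h.
    by rewrite ler_pdivlMr ?(lt_le_trans d0)// mulrC ler_pdivrMr.
  have h' : 2 ^+ i = 2 ^+ i * d * d^-1 by rewrite mulfK// gt_eqF.
  rewrite {1}h'; apply: (@le_trans _ _ ((1 + 2 ^+ i * d) * (n%:R * (enorm (x - y))^-1))).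
    by apply: ler_pM => //; [rewrite invr_ge0 ltW|lra].
  rewrite mulrA [_ * n%:R]mulrC ler_wpM2l//; last lra.
  by rewrite mulr_ge0//; lra.
have A : (1 + i%:R) * del <= C0 * (1 + (ln n%:R + 1) / ln 2) * (1 + W).
  have hid : i%:R * del <= C0 * (ln n%:R + W + 1) / ln 2.
    rewrite ler_pdivlMr//; have : i%:R * ln 2 * del <= (ln n%:R + W + Lc) * del by rewrite ler_wpM2r.
    have : (ln n%:R + W) * del <= (ln n%:R + W) * C0 by rewrite ler_wpM2l// addr_ge0.
    move: h1; clear; move: (ln 2) => l2; move: (ln _) => ln_; lra.
  have : C0 * (ln n%:R + W + 1) / ln 2 <= C0 * ((ln n%:R + 1) / ln 2) * (1 + W).
    rewrite -!mulrA ler_pM2l// [_^-1 * _]mulrC mulrA ler_pM2r ?invr_gt0//.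
    have : 0 <= ln n%:R * W by rewrite mulr_ge0. lra.
  have : C0 <= C0 * (1 + W) by rewrite ler_peMr; lra.
  rewrite mulrDl mul1r; lra.
have B : ln (1 + `|x|) * del <= 2 * C0 * (1 + W).
  have N0 := normr_ge0 x; have N1 := normr_ge0 y.
  have lx0 := ln1D_ge0 N0; have ly0 := ln1D_ge0 N1.
  set lx := ln (1 + `|x|) in lx0 *; set ly := ln (1 + `|y|) in ly0 *.
  have lxy : lx <= ly + W.
    rewrite /lx /ly /W -lnM ?posrE; try lra.
    rewrite ler_ln ?posrE ?mulr_gt0//; try lra.
    have : `|x| <= `|y| + d by rewrite -{1}(subrK y x) addrC; exact: ler_normD.
    have : d <= 2 ^+ i * d by rewrite ler_peMl// ltW.
    have : 0 <= `|y| * (2 ^+ i * d) by rewrite mulr_ge0. lra.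
  have hL z : `|g z - poo| * ln (expR 1 + enorm z) <= C0.
    by rewrite -ler_pdivlMr; [exact: H2|rewrite (lt_le_trans ltr01)// eL// enorm_ge0].
  have lL z : ln (1 + `|z|) <= ln (expR 1 + enorm z).
    by rewrite ler_ln ?posrE//; have := norm_le_enorm z; have := normr_ge0 z; have := enorm_ge0 z; lra.
  have gx : `|g x - poo| * lx <= C0 by apply: le_trans (hL x); rewrite ler_wpM2l//; exact: lL.
  have gy : `|g y - poo| * ly <= C0 by apply: le_trans (hL y); rewrite ler_wpM2l//; exact: lL.
  have gy' : `|g y - poo| <= C0.
    by apply: le_trans (hL y); rewrite ler_peMr// eL// enorm_ge0.
  have hd : del <= `|g x - poo| + `|g y - poo|.
    by rewrite [X in _ + X]distrC; exact: ler_distD.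
  have : lx * del <= lx * (`|g x - poo| + `|g y - poo|) by rewrite ler_wpM2l.
  have : lx * `|g y - poo| <= (ly + W) * `|g y - poo| by rewrite ler_wpM2r.
  have : W * `|g y - poo| <= W * C0 by rewrite ler_wpM2l.
  have : 0 <= C0 * W by rewrite mulr_ge0// ltW.
  lra.
rewrite mulrDl [leRHS]mulrDl; exact: lerD.
Qed.

Lemma log_osc_lip g h (B : R) : 0 <= B -> log_osc g ->
  (forall x y, `|h x - h y| <= B * `|g x - g y|) -> log_osc h.
Proof.
move=> B0 [C C0 H] hg; exists (B * C) => [|i x y]; first exact: mulr_ge0.
apply: le_trans (ler_wpM2l _ (hg x y)) _; last by rewrite mulrCA -mulrA ler_wpM2l.
by rewrite !addr_ge0// ln1D_ge0.
Qed.

Lemma log_oscD g h : log_osc g -> log_osc h -> log_osc (fun x => g x + h x).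
Proof.
move=> [C C0 H] [D D0 G]; exists (C + D) => [|i x y]; first exact: addr_ge0.
apply: (@le_trans _ _ ((1 + i%:R + ln (1 + `|x|)) * (`|g x - g y| + `|h x - h y|))).
  rewrite ler_wpM2l//; first by rewrite !addr_ge0// ln1D_ge0.
  by rewrite opprD addrACA ler_normD.
by rewrite mulrDr [leRHS]mulrDl; apply: lerD.
Qed.

Lemma log_osc_local g : log_osc g -> exists2 C, 0 <= C & forall (i : nat) x y,
  `|x - y| <= 2 ^- i -> `|g x - g y| <= C / (i%:R + 1).
Proof.
move=> [C C0 H]; have /andP[l20 l21] := ln2_bounds; exists (2 * C); first exact: mulr_ge0.
move=> i x y xy; have i1 : (0 : R) < i%:R + 1 by rewrite ltr_wpDl.
rewrite ler_pdivlMr// mulrC.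
have lx := ln1D_ge0 (normr_ge0 x).
have h : (i%:R + 1) * `|g x - g y| <= (1 + i%:R + ln (1 + `|x|)) * `|g x - g y|.
  by rewrite ler_wpM2r//; lra.
apply: le_trans h (le_trans (H i x y) _).
have : ln (1 + 2 ^+ i * `|x - y|) <= 1.
  apply: le_trans l21; rewrite ler_ln ?posrE//.
    have : 2 ^+ i * `|x - y| <= 1 by rewrite mulrC -ler_pdivlMr ?exprn_gt0// mul1r.
    by lra.
by move=> h1; rewrite [2 * C]mulrC ler_wpM2l//; lra.
Qed.

Lemma log_osc_bounded g : log_osc g -> exists2 C, 0 <= C & forall x y, `|g x - g y| <= C.
Proof.
move=> [C C0 H]; have D x : `|g x - g 0| <= C.
  have lx := ln1D_ge0 (normr_ge0 x).
  have := H 0%N x 0; rewrite subr0 expr0 mul1r mulr0n addr0 mulrC ler_pM2r//; lra.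
exists (C + C); first exact: addr_ge0.
move=> x y; apply: le_trans (ler_distD (g 0) _ _) _; apply: lerD => //.
by rewrite distrC.
Qed.

Lemma log_osc_continuous g : log_osc g -> continuous g.
Proof.
move=> /log_osc_local[C C0 H] x; rewrite /continuous_at.
apply/(@cvgrPdist_le _ R^o _ _ (@nbhs_filter 'rV[R]_n x)) => e e0.
have [i Hi] : exists i : nat, C / (i%:R + 1) <= e.
  have Hi := archi_boundP (divr_ge0 C0 (ltW e0)); exists (Num.bound (C / e)).
  rewrite ler_pdivrMr; last by rewrite ltr_wpDl.
  by move: Hi; rewrite ltr_pdivrMr//; move: (Num.bound _)%:R => b; lra.
have : \forall y \near x, `|x - y| < 2 ^- i.
  have F := @nbhs_filter 'rV[R]_n x; have p : (0 : R) < 2 ^- i by rewrite invr_gt0 exprn_gt0.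
  exact: (@cvgr_dist_lt _ _ _ _ F (id : 'rV[R]_n -> 'rV[R]_n) x (@cvg_id _ _) _ p).
apply: (@filterS _ _ (@nbhs_filter 'rV[R]_n x)) => y xy; apply: le_trans Hi; apply: H; exact: ltW.
Qed.

(* Powers with log-Hoelder exponents may be moved from x to y at polynomial cost. *)
Lemma log_osc_transport g (A : R) : log_osc g -> 0 <= A ->
  exists E : nat, forall (i : nat) x y (v : R), 0 < v ->
  `|ln v| <= A * (1 + i%:R + ln (1 + `|x|)) ->
  v `^ g x <= expR E%:R * (1 + 2 ^+ i * `|x - y|) ^+ E * v `^ g y /\
  v `^ g y <= expR E%:R * (1 + 2 ^+ i * `|x - y|) ^+ E * v `^ g x.
Proof.
move=> [C C0 H] A0; have AC : 0 <= A * C by exact: mulr_ge0.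
exists (Num.bound (A * C)); set E := Num.bound _.
have EE : A * C <= E%:R by apply/ltW; exact: archi_boundP.
move=> i x y v v0 Hv; rewrite !powR_expR//.
set W := 1 + 2 ^+ i * `|x - y|; have W0 : 0 < W by rewrite ltr_pwDl// mulr_ge0// exprn_ge0.
have lW : 0 <= ln W by apply: ln1D_ge0; rewrite mulr_ge0// exprn_ge0.
have -> : W ^+ E = expR (E%:R * ln W) by rewrite expRM_natl lnK.
have key : `|g x - g y| * `|ln v| <= E%:R * (1 + ln W).
  apply: le_trans (ler_wpM2l (normr_ge0 _) Hv) _; rewrite mulrCA [X in A * X]mulrC.
  apply: le_trans (ler_wpM2l A0 (H i x y)) _; rewrite mulrA ler_wpM2r//; lra.
rewrite -!expRD !ler_expR.
have : `|(g x - g y) * ln v| <= E%:R * (1 + ln W) by rewrite normrM.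
rewrite ler_norml mulrBl => /andP[]; move: (g x * ln v) (g y * ln v) => a b; lra.
Qed.

Lemma cube_of_nbhs x (P : set 'rV[R]_n) : (\forall y \near x, P y) ->
  exists nu m, cube nu m `<=` P.
Proof.
move=> /nbhs_ballP[e e0 xP].
have [i Hi] : exists i : nat, 2 ^- i < e.
  have e1 : 0 <= e^-1 by rewrite invr_ge0 ltW.
  have Hk := archi_boundP e1; exists (Num.bound e^-1).
  rewrite invf_plt ?posrE ?exprn_gt0//; apply: lt_trans Hk _.
  by rewrite -natrX ltr_nat ltn_expl.
exists i, (cube_index i x) => y yc; apply: xP; rewrite -ball_normE /=.
by apply: le_lt_trans Hi; apply: cube_dist yc; apply/cubeE.
Qed.

(** Where g > b near x, it is so on a whole dyadic cube, which has positive measure. Thus essential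
    bounds of the exponents become bounds at every point. *)
Lemma ae_continuous_le g (b : R) x : continuous g -> {ae mu, forall x, g x <= b} -> g x <= b.
Proof.
move=> cg [N [mN N0 HN]]; rewrite leNgt; apply/negP => bx.
have := @cvgr_gt _ _ _ (@nbhs_filter 'rV[R]_n x) _ _ (cg x) _ bx.
move=> /cube_of_nbhs[nu [m Hc]].
have : (mu (cube nu m) <= mu N)%E.
  apply: le_measure; rewrite ?inE//; first exact: measurable_cube.
  by move=> y yc; apply: HN => /=; apply/negP; rewrite -ltNge; exact: Hc.
by rewrite N0 lebesgue_cube lee_fin leNgt invr_gt0 exprn_gt0.
Qed.

Lemma le_ess_sup_continuous g x : continuous g -> ((g x)%:E <= ess_sup mu (EFin \o g))%E.
Proof.
move=> cg; apply: le_ereal_inf_tmp => t; case: t => [b|_|] /=; last 1 first.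
- move=> H; exfalso; have := @ae_continuous_le g (g x - 1) x cg.
  have : {ae mu, forall x0, g x0 <= g x - 1} by move: H; apply: filterS => y.
  by move=> H' /(_ H'); lra.
- by move=> H; rewrite lee_fin; apply: ae_continuous_le => //.
- by rewrite leey.
Qed.

Lemma ess_inf_le_continuous g x : continuous g -> (ess_inf mu (EFin \o g) <= (g x)%:E)%E.
Proof.
move=> cg; rewrite ess_infEN leeNl.
have := @le_ess_sup_continuous (fun y => - g y) x.
by move=> /(_ _); apply => y; exact: cvgN (cg y).
Qed.

Lemma P0_lower g : P0 g -> log_osc g -> exists2 b, 0 < b & forall x, b <= g x.
Proof.
move=> [_ _ i0 _] /log_osc_continuous cg.
move: i0 (fun x => ess_inf_le_continuous x cg); case: (ess_inf _ _) => [b b0 H|_ H|//].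
  by exists b => // x; rewrite -lee_fin.
by have := H 0.
Qed.

Lemma ess_sup_lt_gap g (K : R) : log_osc g -> (ess_sup mu (EFin \o g) < K%:E)%E ->
  exists2 e, 0 < e & forall x, g x <= K - e.
Proof.
move=> /log_osc_continuous cg.
move: (fun x => le_ess_sup_continuous x cg); case: (ess_sup _ _) => [b H bK|H|H _].
- by exists (K - b) => [|x]; [move: bK; rewrite lte_fin subr_gt0|rewrite opprB addrC subrK -lee_fin].
- by [].
- by have := H 0.
Qed.

(** On a cube of side 2^-nu the exponent oscillates by O(1/(nu + 1)), and the essential infimum is
    at most the value at some point of the cube because the cube is not a null set. *)
Lemma ess_inf_cube_near (L : 'rV[R]_n -> R) : log_osc L -> exists2 C, 0 <= C &
  forall nu (m : 'rV[int]_n) y, cube nu m y ->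
  L y - C / (nu%:R + 1) <= fine (ess_inf_cube L nu m) <= L y + C / (nu%:R + 1).
Proof.
move=> oL; have [C C0 H] := log_osc_local oL; exists C => // nu m y ym.
have cl z : cube nu m z -> `|L y - L z| <= C / (nu%:R + 1).
  by move=> zm; apply: H; exact: cube_dist ym zm.
pose nm := [the {measure set _ -> \bar R} of mrestr (lebesgue_rV n) (measurable_cube (R := R) nu m)].
have lo : ((L y - C / (nu%:R + 1))%:E <= ess_inf nm (EFin \o L))%E.
  apply/ess_infP; exists (~` cube nu m); split.
  - by apply: measurableC; exact: measurable_cube.
  - by rewrite /nm /= /mrestr setICl measure0.
  - move=> z /= Hz zm; apply: Hz; rewrite lee_fin.
    by have := cl z zm; rewrite ler_norml => /andP[_]; lra.
have [z zm Hz] : exists2 z, cube nu m z & (ess_inf nm (EFin \o L) <= (L z)%:E)%E.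
  have [N [mN N0 HN]] := ess_inf_le nm (EFin \o L); apply: contrapT => nz.
  have : (mu (cube nu m) <= nm N)%E.
    rewrite /nm /= /mrestr; apply: le_measure; rewrite ?inE.
    - exact: measurable_cube.
    - by apply: measurableI => //; exact: measurable_cube.
    - by move=> z zm; split => //; apply: HN => /= Hz; apply: nz; exists z.
  by rewrite N0 lebesgue_cube lee_fin leNgt invr_gt0 exprn_gt0.
have := cl z zm; rewrite ler_norml => /andP[lz _].
rewrite /ess_inf_cube -/nm; move: lo Hz; case: (ess_inf nm _) => [r| |] //=.
by rewrite !lee_fin => -> /=; move: (C / _) lz => b; lra.
Qed.

End log_hoelder.

(** * Power inequalities and geometric sums *)

Section power_splitting.
Context {R : realType}.
Implicit Types w S T p : R.

(* Replaces Hoelder's inequality for p >= 1 and the embedding l^p in l^1 for p < 1. *)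
Lemma split_power w S T p : 0 < p -> 0 <= w -> 0 <= S -> 0 < T -> w * S <= T ->
  w `^ (Num.min 1 p)^-1 * S `^ p^-1 <= T `^ p^-1 * (w + w * S / T).
Proof.
move=> p0 w0 S0 T0 wS; have pi0 : 0 < p^-1 by rewrite invr_gt0.
have [->|wn0] := eqVneq w 0.
  rewrite powR0 ?mul0r ?addr0 ?mulr0//.
  by rewrite invr_eq0; have [_|] := leP 1 p; [exact: oner_neq0|rewrite gt_eqF].
have {}w0 : 0 < w by rewrite lt_neqAle eq_sym wn0.
(* Divided by T^(1/p), the claim reads w (B/w)^(1/p) <= w + B for p >= 1, and B^(1/p) <= w + B for p
   < 1, where B <= 1 is used. *)
set B := w * S / T; have B0 : 0 <= B by rewrite !mulr_ge0// ?invr_ge0 ltW.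
have B1 : B <= 1 by rewrite ler_pdivrMr// mul1r.
have SE : S = T * (B / w).
  have Tn : T != 0 by rewrite gt_eqF.
  by rewrite /B mulrA [T * _]mulrC mulfVK// mulrC mulrA mulVf// mul1r.
have BT : 0 <= B / w by rewrite divr_ge0// ltW.
have [p1|p1] := leP 1 p.
  rewrite invr1 powRr1 ?(ltW w0)// SE powRM ?(ltW T0)// mulrCA ler_wpM2l ?powR_ge0//.
  have : (B / w) `^ p^-1 <= 1 + B / w.
    have [b1|b1] := leP (B / w) 1.
      apply: (@le_trans _ _ 1); last by rewrite lerDl.
      have e1 : (1 : R) `^ p^-1 = 1 by rewrite powR1.
      by rewrite -[leRHS]e1; apply: ge0_ler_powR => //; rewrite ?nnegrE// ltW.
    apply: (@le_trans _ _ (B / w)); last by rewrite lerDr.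
    rewrite -[leRHS]powRr1//; apply: ler_powR; first exact: ltW.
    by rewrite invf_le1.
  move=> /(ler_wpM2l (ltW w0)) /le_trans; apply; rewrite mulrDr mulr1 lerD2l.
  by rewrite mulrCA divff// mulr1.
rewrite -powRM ?(ltW w0)//.
have -> : w * S = T * B by rewrite /B mulrCA divff ?mulr1// gt_eqF.
rewrite powRM ?(ltW T0)// ler_wpM2l ?powR_ge0//.
apply: (@le_trans _ _ B); last by rewrite lerDr ltW.
have [->|Bn] := eqVneq B 0; first by rewrite powR0// gt_eqF.
have Bp : 0 < B by rewrite lt_neqAle eq_sym Bn.
rewrite -[leRHS]powRr1//; rewrite !powR_expR// ler_expR ler_wnM2r ?ln_le0//.
by rewrite invf_ge1// ltW.
Qed.

Lemma powR2D (a b : R) : 2 `^ (a + b) = 2 `^ a * 2 `^ b.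
Proof. by apply: powRD; rewrite pnatr_eq0 implybT. Qed.

Lemma powR2_nat (a : nat) (b : R) : 2 `^ (a%:R * b) = (2 ^+ a) `^ b.
Proof. by rewrite powRrM powR_mulrn. Qed.

Lemma ler_powR2 (a b : R) : a <= b -> 2 `^ a <= 2 `^ b.
Proof. by move=> ab; apply: ler_powR => //; rewrite ler1n. Qed.

Lemma powR2Xn (a : R) k : (2 `^ a) ^+ k = 2 `^ (a * k%:R).
Proof. by rewrite -powR_mulrn ?powR_ge0// -powRrM. Qed.

Lemma exprV2_powR (k : nat) : 2 ^- k = 2 `^ (- k%:R) :> R.
Proof. by rewrite powRN powR_mulrn. Qed.

Lemma powRV (v a : R) : 0 < v -> v^-1 `^ a = v `^ (- a).
Proof. by move=> v0; rewrite -powR_inv1 ?ltW// -powRrM mulN1r. Qed.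

Definition gap (j nu : nat) : nat := (j - nu + (nu - j))%N.

Lemma gapC j nu : gap j nu = gap nu j.
Proof. by rewrite /gap addnC. Qed.

Lemma sum_gap (z : R) nu N : 0 < z < 1 -> \sum_(j < N) z ^+ gap j nu <= 2 / (1 - z).
Proof.
move=> /andP[z0 z1]; have z1' : 0 < 1 - z by rewrite subr_gt0.
have zn : 1 - z != 0 by rewrite gt_eqF.
have up k : (k <= nu.+1)%N -> \sum_(j < k) z ^+ gap j nu <= z ^+ (nu.+1 - k) / (1 - z).
  elim: k => [|k IH] kn; first by rewrite big_ord0 divr_ge0 ?exprn_ge0// ltW.
  rewrite big_ord_recr /=; apply: le_trans (lerD (IH (ltnW kn)) (lexx _)) _.
  have -> : gap k nu = (nu.+1 - k.+1)%N by rewrite /gap; lia.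
  have -> : (nu.+1 - k = (nu.+1 - k.+1).+1)%N by lia.
  rewrite exprS ler_pdivlMr// mulrDl divfK//.
  by rewrite mulrC -mulrDr addrC subrK mulr1.
(* The subtracted z^a carries the induction, whose step amounts to (1 - z)^2 >= 0. *)
have down a : \sum_(j < nu.+1 + a) z ^+ gap j nu <= (2 - z ^+ a) / (1 - z).
  elim: a => [|a IH]; first by rewrite addn0 expr0 (le_trans (up _ (leqnn _)))// subnn expr0 -[2 - 1]/(1 + 1 - 1 : R) addrK.
  rewrite addnS big_ord_recr /=; apply: le_trans (lerD IH (lexx _)) _.
  have -> : gap (nu.+1 + a) nu = a.+1 by rewrite /gap; lia.
  rewrite ler_pdivlMr// mulrDl divfK// exprS.
  have za : 0 <= z ^+ a by rewrite exprn_ge0// ltW.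
  have : 0 <= z ^+ a * (1 - z) * (1 - z) by rewrite !mulr_ge0// ltW.
  by move: (z ^+ a) => t; lra.
have [Nn|nN] := leqP N nu.+1.
  apply: le_trans (up N Nn) _; rewrite ler_pM2r ?invr_gt0//.
  by apply: (@le_trans _ _ 1); [rewrite exprn_ile1// ltW|rewrite ler1n].
have -> : N = (nu.+1 + (N - nu.+1))%N by lia.
by apply: le_trans (down _) _; rewrite ler_pM2r ?invr_gt0// gerBl exprn_ge0// ltW.
Qed.

End power_splitting.

(** * The discrete convolution estimate *)

Section core_term.
Context {R : realType} {n : nat} (n_gt0 : (0 < n)%N).
Variables (p q s : 'rV[R]_n -> R) (N : nat -> 'rV[int]_n -> nat) (K : nat) (eps qm CN : R).
Hypotheses (op : log_osc p) (oq : log_osc q) (os : log_osc s).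
Hypotheses (eps0 : 0 < eps) (qm0 : 0 < qm) (qmq : forall x, qm <= q x).
Hypothesis sK : forall x, s x <= K%:R - eps.
Hypothesis CN0 : 0 <= CN.
Hypothesis NE : forall nu m (y : 'rV[R]_n), (0 < nu)%N -> cube nu m y ->
  n%:R / Num.min 1 (p y) - s y + eps - CN / (nu%:R + 1) <= (n + N nu m)%:R.
Implicit Types (x y z : 'rV[R]_n) (m : 'rV[int]_n).

(** The bounds of [conv_moments] and [conv_smooth] without their constants. *)
Definition decay (M j nu : nat) m x : R :=
  if (j <= nu)%N then (2 ^+ j * 2 ^- nu) ^+ (n + N nu m) * (1 + 2 ^+ j * `|x - ccenter nu m|) ^- M
  else (2 ^+ nu * 2 ^- j) ^+ K * (1 + 2 ^+ nu * `|x - ccenter nu m|) ^- M.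

(** Chosen so that 2^(delta |j-nu|) raised to a power 1/q <= 1/qm is at most 2^((eps/2) |j-nu|). *)
Let delta := eps * qm / 2.

Lemma log_osc_inv (g : 'rV[R]_n -> R) (b : R) : 0 < b -> (forall x, b <= g x) -> log_osc g ->
  log_osc (fun x => (g x)^-1).
Proof.
move=> b0 bg og; apply: (@log_osc_lip _ _ g _ (b^-1 * b^-1)) => //.
  by rewrite mulr_ge0 ?invr_ge0 ?ltW.
move=> x y; have gx := lt_le_trans b0 (bg x); have gy := lt_le_trans b0 (bg y).
have -> : (g x)^-1 - (g y)^-1 = (g x)^-1 * (g y)^-1 * (g y - g x).
  by field; rewrite !gt_eqF.
have i0 : 0 <= (g x)^-1 * (g y)^-1 by rewrite mulr_ge0 ?invr_ge0 ?(ltW gx) ?(ltW gy).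
rewrite normrM distrC ler_wpM2r// ger0_norm//.
by apply: ler_pM; rewrite ?invr_ge0 ?(ltW gx) ?(ltW gy)// lef_pV2 ?posrE.
Qed.

Lemma center_dist i nu m x y : (i <= nu)%N -> cube nu m y ->
  1 + 2 ^+ i * `|x - y| <= 2 * (1 + 2 ^+ i * `|x - ccenter nu m|).
Proof.
move=> inu ym; have h := cube_dist (ccenter_cube nu m) ym.
have p2 : (0 : R) < 2 ^+ i by rewrite exprn_gt0.
have h1 : 2 ^+ i * `|ccenter nu m - y| <= 1.
  apply: le_trans (ler_wpM2l (ltW p2) h) _.
  by rewrite ler_pdivrMr ?exprn_gt0// mul1r ler_weXn2l// ler1n.
have h2 : `|x - y| <= `|x - ccenter nu m| + `|ccenter nu m - y|.
  by rewrite -{1}(subrKA (ccenter nu m) x) ; exact: ler_normD.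
have := ler_wpM2l (ltW p2) h2; have : 0 <= 2 ^+ i * `|x - ccenter nu m| by rewrite mulr_ge0// ltW.
rewrite mulrDr; lra.
Qed.

Lemma center_decay i nu m x y M : (i <= nu)%N -> cube nu m y ->
  (1 + 2 ^+ i * `|x - ccenter nu m|) ^- M <= 2 ^+ M * (1 + 2 ^+ i * `|x - y|) ^- M.
Proof.
move=> inu ym; have h := center_dist x inu ym.
have p2 : (0 : R) < 2 ^+ i by rewrite exprn_gt0.
have a0 : 0 < 1 + 2 ^+ i * `|x - ccenter nu m| by rewrite ltr_pwDl// mulr_ge0// ltW.
have b0 : 0 < 1 + 2 ^+ i * `|x - y| by rewrite ltr_pwDl// mulr_ge0// ltW.
rewrite ler_pdivlMr ?exprn_gt0// mulrC ler_pdivrMr ?exprn_gt0// -exprMn.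
by rewrite lerXn2r ?nnegrE ?mulr_ge0 ?(ltW a0) ?(ltW b0).
Qed.

Lemma ln_exp2_le (k : nat) : `|ln (2 ^+ k : R)| <= k%:R.
Proof.
have /andP[l0 l1] := @ln2_bounds R.
rewrite lnXn// ger0_norm; last by rewrite mulrn_wge0// ltW.
by rewrite -[leLHS]mulr_natl ler_piMr.
Qed.

Lemma decay_ge0 M j nu m x : 0 <= decay M j nu m x.
Proof.
have p2 k : (0 : R) <= 2 ^+ k by rewrite exprn_ge0.
by rewrite /decay; case: ifP => _; rewrite mulr_ge0 ?exprn_ge0 ?invr_ge0 ?exprn_ge0 ?addr_ge0 ?mulr_ge0 ?invr_ge0.
Qed.

(** The exponents at x are exchanged for those at a point y of the cube; the resulting powers of W
    are absorbed by taking the decay M = M0 + E1 + E2. For j <= nu the n + N moments turn 2^(js(y))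
    into 2^(nu s(y)) and leave 2^(-(nu-j)(n/min(1,p) + eps)). For j > nu the K derivatives outweigh
    2^((j-nu)s(x)). In both cases half of eps is spent on t/tau. *)
Lemma core_term (c0 : R) (M0 : nat) : 0 < c0 <= 1 -> exists (M : nat) (C : R), 0 <= C /\
  forall (j nu : nat) m x y (t tau l : R), cube nu m y -> 0 <= l ->
  2 ^- nu <= t -> t <= 3 -> c0 * 2 ^- j <= tau -> tau <= 1 ->
  c0 * (2 `^ (- delta)) ^+ gap j nu * t <= tau ->
  2 `^ (j%:R * s x) * tau `^ (- (q x)^-1) * (l * decay M j nu m x) <=
  C * (2 `^ (- (eps / 2))) ^+ gap j nu * (1 + 2 ^+ minn j nu * `|x - y|) ^- M0 *
    (2 ^- (nu - j)) `^ (n%:R / Num.min 1 (p y)) *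
    (2 `^ (nu%:R * s y) * t `^ (- (q y)^-1) * l).
Proof.
move=> /andP[c00 c01]; have oqi := log_osc_inv qm0 qmq oq.
pose A := 3 + `|ln c0|; have A0 : 0 <= A by rewrite addr_ge0.
have [E1 H1] := log_osc_transport os A0.
have [E2 H2] := log_osc_transport oqi A0.
pose M := (M0 + E1 + E2)%N.
pose C1 := expR E1%:R * expR E2%:R * (c0^-1 `^ qm^-1) * (2 `^ CN) * 2 ^+ M.
exists M, C1; split; first by rewrite !mulr_ge0 ?expR_ge0 ?powR_ge0 ?exprn_ge0.
move=> j nu m x y t tau l ym l0 t0 t3 tau0 tau1 tt.
have p2 k : (0 : R) < 2 ^+ k by rewrite exprn_gt0.
have tp : 0 < t by rewrite (lt_le_trans _ t0)// invr_gt0.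
have taup : 0 < tau by rewrite (lt_le_trans _ tau0)// mulr_gt0// invr_gt0.
have qp z : 0 < q z := lt_le_trans qm0 (qmq z).
have c0i : 1 <= c0^-1 by rewrite invf_ge1.
set i := minn j nu; set W := 1 + 2 ^+ i * `|x - y|.
have W1 : 1 <= W by rewrite lerDl mulr_ge0// ltW.
have Wp : 0 < W by lra.
have lx := ln1D_ge0 (normr_ge0 x).
(* The base is enlarged to a number at least 1 before 1/q is replaced by the larger 1/qm. *)
have ratio z : (t / tau) `^ (q z)^-1 <= c0^-1 `^ qm^-1 * (2 `^ (eps / 2)) ^+ gap j nu.
  have h : t / tau <= c0^-1 * (2 `^ delta) ^+ gap j nu.
    rewrite ler_pdivrMr// mulrAC -ler_pdivrMr; last by rewrite exprn_gt0// powR_gt0.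
    by rewrite ler_pdivlMl// -exprVn -powRN mulrA mulrAC.
  have h0 : 1 <= c0^-1 * (2 `^ delta) ^+ gap j nu.
    rewrite -[leLHS]mulr1; apply: ler_pM => //; apply: exprn_ege1.
    by rewrite -[leLHS](powRr0 2) ler_powR2// /delta divr_ge0 ?mulr_ge0// ltW.
  apply: (@le_trans _ _ ((c0^-1 * (2 `^ delta) ^+ gap j nu) `^ qm^-1)); last first.
    rewrite powRM ?exprn_ge0 ?powR_ge0 ?invr_ge0 ?(ltW c00)// !powR2Xn -powRrM.
    rewrite ler_wpM2l ?powR_ge0// ler_powR2// /delta.
    by rewrite le_eqVlt; apply/orP; left; apply/eqP; field; rewrite gt_eqF.
  apply: (@le_trans _ _ ((c0^-1 * (2 `^ delta) ^+ gap j nu) `^ (q z)^-1)).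
    apply: ge0_ler_powR; rewrite ?nnegrE ?invr_ge0 ?(ltW (qp z))//.
      by rewrite divr_ge0 ?(ltW tp) ?(ltW taup).
    by rewrite (le_trans _ h0).
  by apply: ler_powR => //; rewrite lef_pV2 ?posrE ?(lt_le_trans qm0 (qmq z)).
have key : 2 `^ (j%:R * s x) * tau `^ (- (q x)^-1) * decay M j nu m x <=
   C1 * (2 `^ (- (eps / 2))) ^+ gap j nu * W ^- M0 * (2 ^- (nu - j)) `^ (n%:R / Num.min 1 (p y)) *
   (2 `^ (nu%:R * s y) * t `^ (- (q y)^-1)).
  have [jnu|nuj] := leqP j nu.
    have ij : i = j by exact/minn_idPl.
    set D := (nu - j)%N; have gD : gap j nu = D by rewrite /gap; move/eqP : jnu => ->.
    have nuE : nu%:R = j%:R + D%:R :> R by rewrite -natrD subnKC.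
    have ltau : `|ln (2 ^+ j : R)| <= A * (1 + j%:R + ln (1 + `|x|)).
      have := ln_exp2_le j; have Aj : 3 * (1 + j%:R + ln (1 + `|x|)) <= A * (1 + j%:R + ln (1 + `|x|)).
        by rewrite ler_wpM2r ?addr_ge0// lerDl.
      by have := ler0n R j; lra.
    have lt2 : `|ln tau^-1| <= A * (1 + j%:R + ln (1 + `|x|)).
      rewrite lnV ?posrE// normrN ler0_norm ?ln_le0//.
      have : ln (c0 * 2 ^- j) <= ln tau by rewrite ler_ln ?posrE// mulr_gt0// invr_gt0.
      rewrite lnM ?posrE ?invr_gt0// lnV ?posrE//.
      have := ln_exp2_le j; have := ler_norm (- ln c0); rewrite normrN.
      have := ler_norm (ln (2 ^+ j : R)).
      have : 0 <= `|ln c0| * (j%:R + ln (1 + `|x|)) by rewrite mulr_ge0// addr_ge0.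
      have := ler0n R j; rewrite /A; lra.
    have [ha _] := H1 j x y _ (p2 j) ltau.
    have taui : 0 < tau^-1 by rewrite invr_gt0.
    have [hb _] := H2 j x y _ taui lt2.
    have WE : 1 + 2 ^+ j * `|x - y| = W by rewrite /W ij.
    rewrite -!powR2_nat WE in ha; rewrite WE in hb.
    have hb' : tau `^ (- (q x)^-1) <= expR E2%:R * W ^+ E2 *
        (c0^-1 `^ qm^-1 * (2 `^ (eps / 2)) ^+ D * t `^ (- (q y)^-1)).
      rewrite -powRV//; apply: le_trans hb _; rewrite ler_wpM2l ?mulr_ge0 ?expR_ge0 ?exprn_ge0 ?(ltW Wp)//.
      have -> : tau^-1 = t / tau * t^-1 by rewrite mulrAC divff ?mul1r// gt_eqF.
      rewrite powRM ?divr_ge0 ?invr_ge0 ?(ltW tp) ?(ltW taup)// powRV// ler_wpM2r ?powR_ge0//.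
      by rewrite -gD ratio.
    have hc : decay M j nu m x <= 2 `^ (- D%:R * (n%:R / Num.min 1 (p y) - s y + eps) + CN) * (2 ^+ M * W ^- M).
      rewrite /decay jnu; apply: ler_pM.
      - by rewrite exprn_ge0// mulr_ge0 ?invr_ge0// ltW.
      - by rewrite invr_ge0 exprn_ge0// addr_ge0// mulr_ge0// ltW.
      - have -> : 2 ^+ j * 2 ^- nu = 2 `^ (- D%:R) :> R.
          by rewrite -[in LHS](subnKC jnu) exprD invfM mulrA divff ?mul1r ?exprV2_powR// gt_eqF.
        (* For D = 0 there is nothing to gain; otherwise nu > 0, so the lower bound for the moment
           order is at hand. *)
        rewrite powR2Xn ler_powR2//; case: (posnP D) => [->|D0].
          by rewrite oppr0 !mul0r add0r.
        have nu0 : (0 < nu)%N by rewrite (leq_trans D0)// leq_subr.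
        have := ler_wpM2l (ler0n R D) (NE nu0 ym).
        (* Since D <= nu, the error O(1/nu) in the moment order costs only the factor 2^CN. *)
        have : D%:R * (CN / (nu%:R + 1)) <= CN.
          rewrite mulrCA ler_piMr// ler_pdivrMr ?ltr_wpDl// mul1r.
          by rewrite -[1]/(1%:R) -natrD ler_nat addn1 ltnW// ltnS leq_subr.
        move: (n%:R / _) (CN / _) => a1 a2; lra.
      - by rewrite /W ij; apply: center_decay.
    apply: le_trans (ler_pM _ _ (ler_pM _ _ ha hb') hc) _.
    - by rewrite mulr_ge0 ?powR_ge0.
    - exact: decay_ge0.
    - exact: powR_ge0.
    - exact: powR_ge0.
    have pe : 2 `^ (j%:R * s y) * (2 `^ (eps / 2)) ^+ D *
          2 `^ (- D%:R * (n%:R / Num.min 1 (p y) - s y + eps) + CN) =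
        2 `^ CN * (2 `^ (- (eps / 2))) ^+ D * (2 ^- D) `^ (n%:R / Num.min 1 (p y)) * 2 `^ (nu%:R * s y).
      rewrite !powR2Xn exprV2_powR -powRrM -!powR2D nuE; congr (2 `^ _).
      by move: (n%:R / _) => a1; field.
    have we : W ^+ E1 * W ^+ E2 * W ^- M = W ^- M0.
      rewrite -exprD /M -addnA [W ^+ (M0 + _)]exprD invfM mulrC -mulrA mulVf ?mulr1//.
      by rewrite expf_neq0// gt_eqF.
    rewrite gD -we le_eqVlt; apply/orP; left; apply/eqP.
    transitivity ((2 `^ (j%:R * s y) * (2 `^ (eps / 2)) ^+ D *
          2 `^ (- D%:R * (n%:R / Num.min 1 (p y) - s y + eps) + CN)) *
        (expR E1%:R * expR E2%:R * c0^-1 `^ qm^-1 * 2 ^+ M * t `^ (- (q y)^-1) *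
         (W ^+ E1 * W ^+ E2 * W ^- M))); first ring.
    rewrite pe /C1; ring.
  have ij : i = nu by apply/minn_idPr; exact: ltnW.
  set d := (j - nu)%N; have gd : gap j nu = d.
    by rewrite /gap -/d (eqP (ltnW nuj : nu - j == 0)%N) addn0.
  have jE : j%:R = nu%:R + d%:R :> R by rewrite -natrD subnKC// ltnW.
  have ltau : `|ln (2 ^+ nu : R)| <= A * (1 + nu%:R + ln (1 + `|x|)).
    have := ln_exp2_le nu; have Aj : 3 * (1 + nu%:R + ln (1 + `|x|)) <= A * (1 + nu%:R + ln (1 + `|x|)).
      by rewrite ler_wpM2r ?addr_ge0// lerDl.
    by have := ler0n R nu; lra.
  (* Here t and not tau is transported: the scale is 2^-nu, whereas |ln tau| may be of order j >
     nu. *)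
  have lt2 : `|ln t^-1| <= A * (1 + nu%:R + ln (1 + `|x|)).
    rewrite lnV ?posrE// normrN.
    have l3 : ln t <= 2.
      apply: (@le_trans _ _ (ln 3)); first by rewrite ler_ln ?posrE.
      have -> : (3 : R) = 1 + 2 by lra.
      by apply: le_ln1Dx; lra.
    have : ln (2 ^- nu) <= ln t by rewrite ler_ln ?posrE// invr_gt0.
    rewrite lnV ?posrE//; have := ln_exp2_le nu.
    have := ler_norm (ln (2 ^+ nu : R)).
    have Aj : 3 * (1 + nu%:R + ln (1 + `|x|)) <= A * (1 + nu%:R + ln (1 + `|x|)).
      by rewrite ler_wpM2r ?addr_ge0// lerDl.
    have := ler0n R nu => h0 h1 h2 h3; rewrite ler_norml; apply/andP; split; lra.
  have [ha _] := H1 nu x y _ (p2 nu) ltau.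
  have ti : 0 < t^-1 by rewrite invr_gt0.
  have [hb _] := H2 nu x y _ ti lt2.
  have WE : 1 + 2 ^+ nu * `|x - y| = W by rewrite /W ij.
  rewrite -!powR2_nat WE in ha; rewrite WE in hb.
  have hb' : tau `^ (- (q x)^-1) <= c0^-1 `^ qm^-1 * (2 `^ (eps / 2)) ^+ d *
      (expR E2%:R * W ^+ E2 * t `^ (- (q y)^-1)).
    rewrite -!powRV//; have -> : tau^-1 = t / tau * t^-1 by rewrite mulrAC divff ?mul1r// gt_eqF.
    rewrite powRM ?divr_ge0 ?invr_ge0 ?(ltW tp) ?(ltW taup)//.
    by apply: ler_pM; rewrite ?powR_ge0// -gd.
  have hc : decay M j nu m x <= 2 `^ (- d%:R * K%:R) * (2 ^+ M * W ^- M).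
    rewrite /decay leqNgt nuj /=; apply: ler_pM.
    - by rewrite exprn_ge0// mulr_ge0 ?invr_ge0// ltW.
    - by rewrite invr_ge0 exprn_ge0// addr_ge0// mulr_ge0// ltW.
    - have -> : 2 ^+ nu * 2 ^- j = 2 `^ (- d%:R) :> R.
        by rewrite -[in LHS](subnKC (ltnW nuj)) exprD invfM mulrA divff ?mul1r ?exprV2_powR// gt_eqF.
      by rewrite powR2Xn.
    - by rewrite /W ij; apply: center_decay.
  (* Only 2^(nu s(x)) is moved to y; the excess 2^((j-nu)s(x)) is bounded at x itself by s <= K -
     eps. *)
  have ha' : 2 `^ (j%:R * s x) <= expR E1%:R * W ^+ E1 * 2 `^ (nu%:R * s y) * 2 `^ (d%:R * (K%:R - eps)).
    rewrite jE mulrDl powR2D; apply: ler_pM; rewrite ?powR_ge0//.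
    by rewrite ler_powR2// ler_wpM2l.
  apply: le_trans (ler_pM _ _ (ler_pM _ _ ha' hb') hc) _.
  - by rewrite mulr_ge0 ?powR_ge0.
  - exact: decay_ge0.
  - exact: powR_ge0.
  - exact: powR_ge0.
  have pe : 2 `^ (d%:R * (K%:R - eps)) * (2 `^ (eps / 2)) ^+ d * 2 `^ (- d%:R * K%:R) =
      (2 `^ (- (eps / 2))) ^+ d.
    by rewrite !powR2Xn -!powR2D; congr (2 `^ _); field.
  have we : W ^+ E1 * W ^+ E2 * W ^- M = W ^- M0.
    rewrite -exprD /M -addnA [W ^+ (M0 + _)]exprD invfM mulrC -mulrA mulVf ?mulr1//.
    by rewrite expf_neq0// gt_eqF.
  have -> : (nu - j)%N = 0%N by apply/eqP; exact: ltnW.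
  have CN1 : 1 <= 2 `^ CN by rewrite -[leLHS](powRr0 2) ler_powR2.
  rewrite expr0 invr1 powR1 mulr1 gd -we.
  have -> : expR E1%:R * W ^+ E1 * 2 `^ (nu%:R * s y) * 2 `^ (d%:R * (K%:R - eps)) *
     (c0^-1 `^ qm^-1 * (2 `^ (eps / 2)) ^+ d * (expR E2%:R * W ^+ E2 * t `^ (- (q y)^-1))) *
     (2 `^ (- d%:R * K%:R) * (2 ^+ M * W ^- M)) =
     (2 `^ (d%:R * (K%:R - eps)) * (2 `^ (eps / 2)) ^+ d * 2 `^ (- d%:R * K%:R)) *
     (expR E1%:R * expR E2%:R * c0^-1 `^ qm^-1 * 2 ^+ M * (2 `^ (nu%:R * s y) * t `^ (- (q y)^-1)) *
         (W ^+ E1 * W ^+ E2 * W ^- M)) by ring.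
  rewrite pe we /C1; set X := 2 `^ (nu%:R * s y) * _.
  have X0 : 0 <= X by rewrite mulr_ge0 ?powR_ge0.
  set Y := (2 `^ (- (eps / 2))) ^+ d; have Y0 : 0 <= Y by rewrite exprn_ge0// powR_ge0.
  set Z := Y * _; have Z0 : 0 <= Z.
    by rewrite /Z !mulr_ge0 ?expR_ge0 ?powR_ge0 ?exprn_ge0 ?invr_ge0 ?exprn_ge0 ?(ltW Wp).
  apply: (@le_trans _ _ (Z * 2 `^ CN)); first by rewrite ler_peMr.
  by rewrite /Z le_eqVlt; apply/orP; left; apply/eqP; ring.
by have := ler_wpM2r l0 key; congr (_ <= _); ring.
Qed.

End core_term.

Section weighted_averages.
Context {R : realType} {n : nat} (n_gt0 : (0 < n)%N).
Local Notation mu := (lebesgue_rV n : {measure set 'rV[R]_n -> \bar R}).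
Implicit Types (x y z : 'rV[R]_n) (m : 'rV[int]_n) (F g : 'rV[R]_n -> R).

Lemma Wt_opp z : Wt (- z) = Wt z.
Proof. by apply: eq_bigr => l _; rewrite mxE normrN. Qed.

Lemma measurable_Wt_sub (a : R) x : measurable_fun setT (fun y => Wt (a *: (y - x))).
Proof. by under eq_fun do rewrite scalerBr; exact: measurable_Wt. Qed.

Lemma measurable_cube_index nu (l : 'rV[int]_n -> R) :
  measurable_fun setT (fun y : 'rV[R]_n => l (cube_index nu y)).
Proof.
move=> _ B mB; rewrite setTI.
have -> : (fun y : 'rV[R]_n => l (cube_index nu y)) @^-1` B =
    \bigcup_(m in [set m | B (l m)]) cube nu m.
  apply/seteqP; split => [y /= By|y [m /= Bm /cubeE mE]].
    by exists (cube_index nu y) => //; apply/cubeE.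
  by rewrite /= -mE.
rewrite bigcup_mkcond; apply: countable_bigcupT_measurable; first exact: countableP.
move=> m; case: ifP => _ //; exact: measurable_cube.
Qed.

(** As i <= nu, the weight at scale 2^-i varies on the cube by a factor of at most 4^n. *)
Lemma cube_weight i nu m x y g : (i <= nu)%N -> cube nu m y -> measurable_fun setT g ->
  (forall z, 0 <= g z) ->
  ((Wt (2 ^+ i *: (y - x)))%:E * \int[mu]_(z in cube nu m) (g z)%:E <=
   (4 ^+ n)%:E * \int[mu]_(z in cube nu m) (Wt (2 ^+ i *: (z - x)) * g z)%:E)%E.
Proof.
move=> inu ym mg g0; have mQ := @measurable_cube R n nu m.
have mgE : measurable_fun (cube nu m) (fun z => (g z)%:E).
  by apply/measurable_EFinP; exact: measurable_funS mg.
have mWg : measurable_fun (cube nu m) (fun z => (Wt (2 ^+ i *: (z - x)) * g z)%:E).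
  apply/measurable_EFinP; apply: (@measurable_funS _ _ _ _ setT) => //.
  by apply: measurable_funM => //; exact: measurable_Wt_sub.
have W0 z : 0 <= Wt (2 ^+ i *: (z - x)) by exact: Wt_ge0.
rewrite -ge0_integralZl//; last 2 first.
- by move=> z _; rewrite lee_fin.
- by rewrite lee_fin.
rewrite -ge0_integralZl//; last 1 first.
- by move=> z _; rewrite lee_fin mulr_ge0.
apply: ge0_le_integral => //.
- by move=> z _; rewrite mule_ge0 ?lee_fin.
- by apply: measurable_funeM.
- by apply: measurable_funeM.
move=> z zm; rewrite -!EFinM lee_fin mulrA ler_wpM2r//; apply: Wt_near => l.
rewrite !mxE -mulrBr normrM ger0_norm ?exprn_ge0// opprD addrACA subrr addr0.
have h := le_trans (coord_le_norm (y - z) l) (cube_dist ym zm).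
rewrite !mxE in h; have p2 : (0 : R) < 2 ^+ i by rewrite exprn_gt0.
apply: le_trans (ler_wpM2l (ltW p2) h) _.
by rewrite ler_pdivrMr ?exprn_gt0// mul1r ler_weXn2l// ler1n.
Qed.

(** Otherwise F would exceed its mean by more than b on the whole cube. Evaluating the exponents at
    such a y replaces a pointwise bound on F by its mean. *)
Lemma small_point nu m F (Fa b : R) : measurable_fun setT F -> (forall z, 0 <= F z) ->
  (\int[mu]_(z in cube nu m) (F z)%:E = Fa%:E)%E -> 0 < b ->
  exists2 y, cube nu m y & F y <= 2 ^+ (nu * n) * Fa + b.
Proof.
move=> mF F0 E b0; apply: contrapT => H; have mQ := @measurable_cube R n nu m.
have Fa0 : 0 <= Fa by rewrite -lee_fin -E; apply: integral_ge0 => z _; rewrite lee_fin.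
have p2 : (0 : R) < 2 ^+ (nu * n) by rewrite exprn_gt0.
have : ((2 ^+ (nu * n) * Fa + b)%:E * mu (cube nu m) <= Fa%:E)%E.
  rewrite -E -integral_cst//; apply: ge0_le_integral => //.
  - by move=> z _; rewrite lee_fin addr_ge0 ?(ltW b0)// mulr_ge0// ltW.
  - by apply/measurable_EFinP; exact: measurable_funS mF.
  - move=> z zm; rewrite lee_fin leNgt; apply/negP => h; apply: H; exists z => //; exact: ltW.
rewrite lebesgue_cube -EFinM lee_fin mulrDl mulrC mulrA mulVf ?gt_eqF// mul1r.
by rewrite gerDl leNgt mulr_gt0// invr_gt0.
Qed.

(** The added [Wt x] keeps the average above (1 + |x|)^(-2n), so its logarithm is of the size that
    [log_osc_transport] admits; being integrable, it does not spoil the integral. *)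
Definition wavg (i : nat) F x : \bar R :=
  ((2 ^+ (i * n))%:E * \int[mu]_y (Wt (2 ^+ i *: (y - x)) * F y)%:E + (Wt x)%:E)%E.

Lemma wavg_ge i F x : (forall z, 0 <= F z) -> ((Wt x)%:E <= wavg i F x)%E.
Proof.
move=> F0; rewrite leeDr// mule_ge0 ?lee_fin ?exprn_ge0// integral_ge0// => z _.
by rewrite lee_fin mulr_ge0// Wt_ge0.
Qed.

Lemma wavg_le i F x : measurable_fun setT F -> (forall z, 0 <= F z) ->
  (\int[mu]_z (F z)%:E <= 1)%E -> (wavg i F x <= (2 * 2 ^+ (i * n))%:E)%E.
Proof.
move=> mF F0 F1; have p2 : (1 : R) <= 2 ^+ (i * n) by rewrite exprn_ege1// ler1n.
have -> : 2 * 2 ^+ (i * n) = 2 ^+ (i * n) * 1 + 2 ^+ (i * n) :> R by ring.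
rewrite EFinD EFinM; apply: leeD; last by rewrite lee_fin (le_trans (Wt_le1 x)).
rewrite lee_wpmul2l ?lee_fin ?exprn_ge0//; apply: le_trans F1.
apply: ge0_le_integral => //.
- by move=> z _; rewrite lee_fin mulr_ge0// Wt_ge0.
- by apply/measurable_EFinP; apply: measurable_funM => //; exact: measurable_Wt_sub.
- by exact/measurable_EFinP.
- by move=> z _; rewrite lee_fin ler_piMl// Wt_le1.
Qed.

(** By Tonelli the kernel is integrated first; kernel and added weight contribute 64^n each. *)
Lemma integral_wavg i F : measurable_fun setT F -> (forall z, 0 <= F z) ->
  (\int[mu]_z (F z)%:E <= 1)%E ->
  measurable_fun setT (wavg i F) /\ (\int[mu]_x wavg i F x <= (2 * 64 ^+ n)%:E)%E.
Proof.
move=> mF F0 F1; have p2 : (0 : R) < 2 ^+ (i * n) by rewrite exprn_gt0.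
pose f (z : 'rV[R]_n * 'rV[R]_n) : \bar R := (Wt (2 ^+ i *: (z.2 - z.1)) * F z.2)%:E.
have mf : measurable_fun setT f.
  apply/measurable_EFinP; apply: measurable_funM; last exact: (measurableT_comp mF measurable_snd).
  apply: (@measurableT_comp _ _ _ _ _ _ (@Wt R n) _ (fun z : 'rV[R]_n * 'rV[R]_n => 2 ^+ i *: (z.2 - z.1))).
    by have := measurable_Wt (1 : R) (0 : 'rV[R]_n); under eq_fun do rewrite scale1r addr0.
  apply: measurable_fun_rV => l; under eq_fun do rewrite !mxE.
  apply: measurable_funM => //; apply: measurable_funB.
    exact: (measurableT_comp (measurable_coord l) measurable_snd).
  exact: (measurableT_comp (measurable_coord l) measurable_fst).
have f0 (z : 'rV[R]_n * 'rV[R]_n) : (0 <= f z)%E by rewrite lee_fin mulr_ge0// Wt_ge0.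
have mG : measurable_fun setT (fun x => \int[mu]_y f (x, y))%E.
  exact: (measurable_fun_fubini_tonelli_F (m2 := lebesgue_rV n) f mf f0).
have mW : measurable_fun setT (fun x : 'rV[R]_n => (Wt x)%:E).
  apply/measurable_EFinP.
  by have := measurable_Wt (1 : R) (0 : 'rV[R]_n); under eq_fun do rewrite scale1r addr0.
split.
  by apply: emeasurable_funD => //; apply: measurable_funeM.
rewrite ge0_integralD//; last 3 first.
- by move=> x _; rewrite mule_ge0 ?lee_fin ?(ltW p2)// integral_ge0// => y _; exact: (f0 (x, y)).
- by apply: measurable_funeM.
- by move=> x _; rewrite lee_fin Wt_ge0.
have -> : 2 * 64 ^+ n = 2 ^+ (i * n) * (64 ^+ n * 2 ^- (i * n)) + 64 ^+ n * 2 ^- (0 * n) :> R.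
  by rewrite mulrCA divff ?gt_eqF// mul0n expr0 invr1 !mulr1; ring.
rewrite EFinD; apply: leeD; last first.
  apply: le_trans (integral_Wt 0 0); rewrite le_eqVlt; apply/orP; left; apply/eqP.
  by apply: eq_integral => x _; rewrite expr0 scale1r subr0.
rewrite ge0_integralZl//; last 1 first.
- by move=> x _; rewrite integral_ge0// => y _; exact: (f0 (x, y)).
rewrite EFinM lee_wpmul2l ?lee_fin ?(ltW p2)//.
have -> : (\int[mu]_x \int[mu]_y (Wt (2 ^+ i *: (y - x)) * F y)%:E =
    \int[mu]_y \int[mu]_x f (x, y))%E.
  have := fubini_tonelli (m1 := lebesgue_rV n) (m2 := lebesgue_rV n) f mf f0; exact.
apply: (@le_trans _ _ (\int[mu]_y ((64 ^+ n * 2 ^- (i * n))%:E * (F y)%:E))%E); last first.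
  rewrite ge0_integralZl//; last 2 first.
  - by exact/measurable_EFinP.
  - by move=> y _; rewrite lee_fin.
  by rewrite -[leRHS]mule1 lee_wpmul2l// lee_fin mulr_ge0 ?exprn_ge0// invr_ge0 ltW.
apply: ge0_le_integral => //.
- by move=> y _; rewrite integral_ge0// => x _; exact: (f0 (x, y)).
- exact: (measurable_fun_fubini_tonelli_G (m1 := lebesgue_rV n) f mf f0).
- by apply: measurable_funeM; exact/measurable_EFinP.
move=> y _; rewrite /f /=.
have -> : (\int[mu]_x (Wt (2 ^+ i *: (y - x)) * F y)%:E = (F y)%:E * \int[mu]_x (Wt (2 ^+ i *: (x - y)))%:E)%E.
  rewrite -ge0_integralZl//.
  - by apply: eq_integral => x _; rewrite -EFinM mulrC -Wt_opp -scalerN opprB.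
  - by apply/measurable_EFinP; exact: measurable_Wt_sub.
  - by move=> x _; rewrite lee_fin Wt_ge0.
  - by rewrite lee_fin.
by rewrite muleC lee_wpmul2r ?lee_fin// integral_Wt.
Qed.

End weighted_averages.

Lemma minn_addn_subn j nu : (minn j nu + (nu - j) = nu)%N.
Proof. lia. Qed.

Lemma digits_bound (R : realType) (i n : nat) (a b : R) : 0 <= a ->
  b <= (1 + i * n + 2 * n)%:R -> - ((2 * n)%:R * a) <= b ->
  `|b| <= (2 * n + 2)%:R * (1 + i%:R + a).
Proof.
move=> a0; rewrite !natrD !natrM ler_norml => h1 h2.
have : 0 <= n%:R * a by rewrite mulr_ge0.
have : 0 <= n%:R * i%:R :> R by rewrite mulr_ge0.
have := ler0n R i; have := ler0n R n; move: (n%:R) (i%:R) h1 h2 => c d h1 h2 h3 h4 h5 h6.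
by apply/andP; split; lra.
Qed.

Lemma measurable_powR2 (R : realType) d (T : measurableType d) (g h : T -> R) :
  measurable_fun setT g -> measurable_fun setT h -> measurable_fun setT (fun y => g y `^ h y).
Proof.
move=> mg mh; apply: measurable_fun_ifT => //.
- by apply: measurable_fun_eqr.
- apply: (measurableT_comp (f := fun b : bool => b%:R : R)) => //.
  by apply: measurable_fun_eqr.
- apply: measurableT_comp => //; apply: measurable_funM => //.
  exact: (measurableT_comp (@measurable_ln R) mg).
Qed.

Section core_sum.
Context {R : realType} {n : nat} (n_gt0 : (0 < n)%N).
Local Notation mu := (lebesgue_rV n : {measure set 'rV[R]_n -> \bar R}).
Variables (p q s : 'rV[R]_n -> R) (N : nat -> 'rV[int]_n -> nat) (K : nat) (eps pm qm CN : R).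
Hypotheses (op : log_osc p) (oq : log_osc q) (os : log_osc s).
Hypotheses (eps0 : 0 < eps) (pm0 : 0 < pm) (pmp : forall x, pm <= p x).
Hypotheses (qm0 : 0 < qm) (qmq : forall x, qm <= q x).
Hypothesis sK : forall x, s x <= K%:R - eps.
Hypothesis CN0 : 0 <= CN.
Hypothesis NE : forall nu m (y : 'rV[R]_n), (0 < nu)%N -> cube nu m y ->
  n%:R / Num.min 1 (p y) - s y + eps - CN / (nu%:R + 1) <= (n + N nu m)%:R.
Implicit Types (x y z : 'rV[R]_n) (m : 'rV[int]_n) (l : 'rV[int]_n -> R).

(** The integrand F_nu of the modular at t; l is the sequence of moduli of the coefficients at level
    nu, already divided by the trial value of the norm. *)
Definition density nu (t : R) l y : R :=
  (2 `^ (nu%:R * s y) * t `^ (- (q y)^-1) * l (cube_index nu y)) `^ p y.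

Lemma density_ge0 nu t l y : 0 <= density nu t l y.
Proof. exact: powR_ge0. Qed.

Lemma measurable_density nu t l : measurable_fun setT (density nu t l).
Proof.
have c (g : 'rV[R]_n -> R) : log_osc g -> measurable_fun setT g.
  by move=> /log_osc_continuous cg; exact: continuous_measurable_rV.
have qp z : 0 < q z := lt_le_trans qm0 (qmq z).
apply: measurable_powR2; last exact: c.
apply: measurable_funM; last exact: measurable_cube_index.
apply: measurable_funM; apply: measurable_powR2 => //.
  by apply: measurable_funM => //; exact: c.
apply: measurable_funN; apply: measurable_inv_ge0 => [x|]; first exact: ltW.
exact: c.
Qed.

Lemma wavg_fin i nu t l x : (\int[mu]_y (density nu t l y)%:E <= 1)%E ->
  [/\ wavg i (density nu t l) x = (fine (wavg i (density nu t l) x))%:E,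
    Wt x <= fine (wavg i (density nu t l) x) &
    fine (wavg i (density nu t l) x) <= 2 * 2 ^+ (i * n)].
Proof.
move=> F1; have mF := measurable_density nu t l; have F0 := density_ge0 nu t l.
have lo := wavg_ge i x F0; have hi := wavg_le i x mF F0 F1.
have fin : wavg i (density nu t l) x \is a fin_num.
  rewrite ge0_fin_numE; first by rewrite (le_lt_trans hi)// ltry.
  by apply: le_trans lo; rewrite lee_fin Wt_ge0.
by split; rewrite ?fineK// -lee_fin fineK.
Qed.

(** With w the volume factor times the kernel at y, [split_power] bounds w^(1/min(1,p)) F(y)^(1/p)
    at p = p(y) by T^(1/p) (w + w F/T). The power T^(1/p(y)) is moved to x, and the bracket is
    linear in F, so its sum over the cubes is an integral against the kernel. *)
Lemma core_cubes (c0 : R) : 0 < c0 <= 1 -> exists (M : nat) (C : R), 0 <= C /\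
  forall (j nu : nat) (t tau : R) l x, (forall m, 0 <= l m) ->
  2 ^- nu <= t -> t <= 3 -> c0 * 2 ^- j <= tau -> tau <= 1 ->
  c0 * (2 `^ (- (eps * qm / 2))) ^+ gap j nu * t <= tau ->
  (\int[mu]_y (density nu t l y)%:E <= 1)%E ->
  (\esum_(m in [set: 'rV[int]_n]) (2 `^ (j%:R * s x) * tau `^ (- (q x)^-1) *
      (l m * decay (R := R) N K M j nu m x))%:E <=
    (C * (2 `^ (- (eps / 2))) ^+ gap j nu *
      fine (wavg (minn j nu) (density nu t l) x) `^ (p x)^-1)%:E)%E.
Proof.
move=> c01; have opi := log_osc_inv pm0 pmp op.
(* The number T below lies between (1 + |x|)^(-2n) and 2^(1 + in + 2n). *)
pose A : R := (2 * n + 2)%:R; have A0 : 0 <= A by exact: ler0n.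
have [E3 H3] := log_osc_transport opi A0.
pose rm : R := Num.min 1 pm.
have rm0 : 0 < rm by rewrite lt_min ltr01 pm0.
(* Decay of order M1 dominates the kernel to the power 1/min(1,p(y)), uniformly in y; a further E3
   pays for moving 1/p. *)
pose M1 := Num.bound ((2 * n)%:R / rm).
have M1b : (2 * n)%:R / rm <= M1%:R by apply/ltW/archi_boundP; rewrite divr_ge0// ltW.
have [M [C1 [C10 H]]] := core_term (N := N) oq os eps0 qm0 qmq sK CN0 NE (E3 + M1) c01.
pose Cm := C1 * expR E3%:R * (4 ^+ n) `^ pm^-1.
have Cm0 : 0 <= Cm by rewrite !mulr_ge0 ?expR_ge0 ?powR_ge0.
exists M, (Cm * (2 * 4 ^+ n) * (64 ^+ n + 1)); split.
  by rewrite !mulr_ge0 ?exprn_ge0 ?addr_ge0 ?exprn_ge0.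
move=> j nu t tau l x l0 t0 t3 tau0 tau1 tt F1.
set F := density nu t l in F1 *; set i := minn j nu.
have inu : (i <= nu)%N by exact: geq_minr.
have [uE u1 u2] := wavg_fin i x F1; rewrite -/F in uE u1 u2.
set u := fine (wavg i F x) in uE u1 u2 *.
have F0 y : 0 <= F y by exact: density_ge0.
have mF : measurable_fun setT F by exact: measurable_density.
have mFE : measurable_fun setT (EFin \o F) by exact/measurable_EFinP.
have Wx := Wt_gt0 x; have up : 0 < u := lt_le_trans Wx u1.
have p2 k : (0 : R) < 2 ^+ k by rewrite exprn_gt0.
have p4 : (1 : R) <= 4 ^+ n by rewrite exprn_ege1// ler1n.
set z := 2 `^ (- (eps / 2)); have z0 : 0 <= z by exact: powR_ge0.
pose Wy y := Wt (2 ^+ i *: (y - x)).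
have Wy0 y : 0 <= Wy y by exact: Wt_ge0.
have mWy : measurable_fun setT Wy by exact: measurable_Wt_sub.
(* Its integral over a cube, times 2^(in), controls the bracket from [split_power] for that cube. *)
pose h y := Wy y * (1 + F y / u).
have h0 y : 0 <= h y by rewrite mulr_ge0// addr_ge0// divr_ge0// ltW.
have mg : measurable_fun setT (fun y => 1 + F y / u).
  by apply: measurable_funD => //; apply: measurable_funM.
have mh : measurable_fun setT (EFin \o h).
  by apply/measurable_EFinP; apply: measurable_funM.
have [I IE uI] : exists2 I : R, (\int[mu]_y (Wy y * F y)%:E = I%:E)%E & u = 2 ^+ (i * n) * I + Wt x.
  have fin : (\int[mu]_y (Wy y * F y)%:E \is a fin_num)%E.
    rewrite ge0_fin_numE; last by apply: integral_ge0 => y _; rewrite lee_fin mulr_ge0.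
    apply: (@le_lt_trans _ _ 1%E); last exact: ltry.
    apply: le_trans F1; apply: ge0_le_integral => //.
    - by move=> y _; rewrite lee_fin mulr_ge0.
    - by apply/measurable_EFinP; apply: measurable_funM.
    - by move=> y _; rewrite lee_fin ler_piMl// Wt_le1.
  exists (fine (\int[mu]_y (Wy y * F y)%:E)%E); first by rewrite fineK.
  by apply: EFin_inj; rewrite -uE /wavg EFinD EFinM fineK.
have cubes m : ((2 `^ (j%:R * s x) * tau `^ (- (q x)^-1) *
      (l m * decay (R := R) N K M j nu m x))%:E <=
    (Cm * z ^+ gap j nu * u `^ (p x)^-1 * (2 * 4 ^+ n * 2 ^+ (i * n)))%:E *
    \int[mu]_(y in cube nu m) (h y)%:E)%E.
  have mQ := @measurable_cube R n nu m.
  have [Fa FaE Fa0] : exists2 Fa : R, (\int[mu]_(y in cube nu m) (F y)%:E = Fa%:E)%E & 0 <= Fa.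
    have ge : (0 <= \int[mu]_(y in cube nu m) (F y)%:E)%E by apply: integral_ge0 => y _; rewrite lee_fin.
    have fin : (\int[mu]_(y in cube nu m) (F y)%:E \is a fin_num)%E.
      rewrite ge0_fin_numE//; apply: (@le_lt_trans _ _ 1%E); last exact: ltry.
      by apply: le_trans F1; apply: ge0_subset_integral => // y _; rewrite lee_fin.
    by exists (fine (\int[mu]_(y in cube nu m) (F y)%:E)%E); rewrite ?fineK// fine_ge0.
  (* The slack is [Wt x], which is already a summand of the average u. *)
  have [y ym Fy] := small_point mF F0 FaE Wx.
  have hF := cube_weight x inu ym mF F0.
  have hg := cube_weight x inu ym mg (fun y => addr_ge0 ler01 (divr_ge0 (F0 y) (ltW up))).
  rewrite -!/(Wy _) in hF hg.
  have gE : (\int[mu]_(y in cube nu m) (1 + F y / u)%:E = (2 ^- (nu * n) + Fa / u)%:E)%E.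
    under eq_integral do rewrite EFinD EFinM muleC.
    rewrite ge0_integralD//; last 2 first.
    - by move=> y' _; rewrite mule_ge0 ?lee_fin// invr_ge0 ltW.
    - by apply: measurable_funeM; exact: measurable_funS mFE.
    rewrite integral_cst// mul1e ge0_integralZl//; last 3 first.
    - exact: measurable_funS mFE.
    - by move=> y' _; rewrite lee_fin.
    - by rewrite lee_fin invr_ge0 ltW.
    by rewrite FaE lebesgue_cube -EFinM -EFinD [u^-1 * _]mulrC.
  (* The truncated difference covers both cases: for j > nu there is no volume factor and i = nu. *)
  set D := (nu - j)%N; have nuD : (nu * n = i * n + D * n)%N.
    by rewrite -mulnDl /i /D minn_addn_subn.
  set w := (2 ^- D) ^+ n * Wy y; have w0 : 0 <= w by rewrite mulr_ge0// exprn_ge0// invr_ge0 ltW.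
  have D1 : (2 ^- D) ^+ n <= 1 :> R.
    by rewrite exprn_ile1 ?invr_ge0 ?(ltW (p2 _))// invf_le1// exprn_ege1// ler1n.
  have w1 : w <= 1.
    by rewrite -[leRHS]mulr1; apply: ler_pM => //; exact: Wt_le1.
  have wn : w * 2 ^+ (nu * n) = 2 ^+ (i * n) * Wy y.
    rewrite /w nuD exprD exprVn -exprM; have := lt0r_neq0 (p2 (D * n)%N).
    move: (2 ^+ (D * n)) => a a0; by field.
  have wF : w * F y <= 2 ^+ (i * n) * (Wy y * Fa) + w * Wt x.
    apply: le_trans (ler_wpM2l w0 Fy) _; by rewrite mulrDr !mulrA wn.
  have hI : Wy y * Fa <= 4 ^+ n * I.
    rewrite -lee_fin !EFinM -IE -FaE; apply: le_trans hF _.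
    rewrite lee_wpmul2l ?lee_fin ?exprn_ge0//; apply: ge0_subset_integral => //.
    - by apply/measurable_EFinP; apply: measurable_funM.
    - by move=> y' _; rewrite lee_fin mulr_ge0// Wt_ge0.
  (* The factor 4^n pays for the variation of the kernel on the cube, so that w F(y) <= T, as
     [split_power] demands. *)
  set T := 4 ^+ n * u; have Tp : 0 < T by rewrite mulr_gt0// (lt_le_trans ltr01).
  have uT : u <= T by rewrite ler_peMl// ltW.
  have wWx : w * Wt x <= Wt x by rewrite ler_piMl// ltW.
  have wFT : w * F y <= T.
    apply: le_trans wF _; rewrite /T uI mulrDr; apply: lerD.
      by rewrite [leRHS]mulrCA ler_wpM2l// ltW.
    by apply: le_trans wWx _; rewrite ler_peMl// ltW.
  have py : 0 < p y := lt_le_trans pm0 (pmp y).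
  have px : 0 < p x := lt_le_trans pm0 (pmp x).
  have sp := split_power py w0 (F0 y) Tp wFT.
  have wG : w + w * F y / T <= 2 * 2 ^+ (i * n) * (Wy y * (2 ^- (nu * n) + Fa / u)).
    have e1 : w = 2 ^+ (i * n) * (Wy y * 2 ^- (nu * n)).
      rewrite mulrA -wn mulfK// gt_eqF//.
    have : w * F y / T <= w * F y / u.
      by rewrite ler_wpM2l ?mulr_ge0// lef_pV2 ?posrE.
    have : w * F y / u <= (2 ^+ (i * n) * (Wy y * Fa) + w * Wt x) / u.
      by rewrite ler_wpM2r// invr_ge0 ltW.
    have : w * Wt x / u <= w by rewrite -mulrA ler_piMr// ler_pdivrMr// mul1r.
    have -> : 2 * 2 ^+ (i * n) * (Wy y * (2 ^- (nu * n) + Fa / u)) =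
       2 * w + 2 * (2 ^+ (i * n) * (Wy y * Fa) / u) by rewrite e1; ring.
    have : 0 <= 2 ^+ (i * n) * (Wy y * Fa) / u by rewrite !mulr_ge0// ?invr_ge0 ltW.
    rewrite [(_ + _) / u]mulrDl; lra.
  have rle : rm <= Num.min 1 (p y) by rewrite le_min ge_min lexx /= ge_min pmp orbT.
  have rp : 0 < Num.min 1 (p y) := lt_le_trans rm0 rle.
  set r := Num.min 1 (p y) in sp rle rp *.
  set W := 1 + 2 ^+ i * `|x - y|.
  have W1 : 1 <= W by rewrite lerDl mulr_ge0// ltW.
  have Wp : 0 < W by lra.
  have WM : W ^- M1 <= Wy y `^ r^-1.
    have dW : W ^- (2 * n) <= Wy y.
      have := decay_Wt (2 ^+ i *: (y - x)).
      by rewrite normrZ ger0_norm ?(ltW (p2 _))// distrC.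
    apply: (@le_trans _ _ ((W ^- (2 * n)) `^ r^-1)); last first.
      apply: ge0_ler_powR => //; rewrite ?nnegrE ?invr_ge0 ?exprn_ge0 ?(ltW rp) ?(ltW Wp)//.
    rewrite -!powR_invn ?(ltW Wp)// -powRrM; apply: ler_powR => //.
    rewrite mulNr lerN2; apply: le_trans M1b.
    by rewrite ler_wpM2l// lef_pV2 ?posrE.
  have lT : `|ln T| <= A * (1 + i%:R + ln (1 + `|x|)).
    have /andP[l20 l21] := @ln2_bounds R.
    have lx := ln1D_ge0 (normr_ge0 x).
    have Ti : 2 * 2 ^+ (i * n) * 4 ^+ n = 2 ^+ (1 + i * n + 2 * n) :> R.
      have -> : (4 : R) = 2 ^+ 2 by rewrite -natrX.
      by rewrite -exprM !exprD expr1.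
    have h1 : ln T <= (1 + i * n + 2 * n)%:R.
      apply: (@le_trans _ _ (ln (2 ^+ (1 + i * n + 2 * n)))).
        rewrite ler_ln ?posrE// -Ti /T mulrC; apply: ler_wpM2r u2; exact: le_trans ler01 p4.
      by apply: le_trans (ler_norm _) (ln_exp2_le _).
    have h2 : - ((2 * n)%:R * ln (1 + `|x|)) <= ln T.
      have Wl := decay_Wt x.
      apply: (@le_trans _ _ (ln ((1 + `|x|) ^- (2 * n)))).
        by rewrite lnV ?posrE ?exprn_gt0 ?ltr_pwDl// lnXn ?ltr_pwDl// mulr_natl.
      rewrite ler_ln ?posrE ?invr_gt0 ?exprn_gt0 ?ltr_pwDl//.
      by apply: le_trans Wl (le_trans u1 uT).
    exact: digits_bound lx h1 h2.
  have [_ hT] := H3 i x y T Tp lT; rewrite -/W in hT.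
  have FE : 2 `^ (nu%:R * s y) * t `^ (- (q y)^-1) * l m = F y `^ (p y)^-1.
    rewrite /F /density -powRrM divff ?gt_eqF// powRr1.
      by move/cubeE : (ym) => <-.
    by rewrite !mulr_ge0 ?powR_ge0.
  have HT := H j nu m x y t tau (l m) ym (l0 m) t0 t3 tau0 tau1 tt.
  rewrite -/z -/i -/W -/D -/r FE in HT.
  have TX : T `^ (p x)^-1 <= (4 ^+ n) `^ pm^-1 * u `^ (p x)^-1.
    rewrite /T powRM ?(ltW up) ?(le_trans ler01)// ler_wpM2r ?powR_ge0//.
    by apply: ler_powR => //; rewrite lef_pV2 ?posrE.
  have fin : 2 `^ (j%:R * s x) * tau `^ (- (q x)^-1) * (l m * decay (R := R) N K M j nu m x) <=
     Cm * z ^+ gap j nu * u `^ (p x)^-1 * (w + w * F y / T).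
    apply: le_trans HT _.
    have -> : (2 ^- D) `^ (n%:R / r) = ((2 ^- D) ^+ n) `^ r^-1.
      by rewrite powRrM powR_mulrn// invr_ge0 ltW.
    have wp : ((2 ^- D) ^+ n) `^ r^-1 * Wy y `^ r^-1 = w `^ r^-1.
      by rewrite -powRM// exprn_ge0// invr_ge0 ltW.
    have a1 : W ^- (E3 + M1) * ((2 ^- D) ^+ n) `^ r^-1 * F y `^ (p y)^-1 <=
        expR E3%:R * (4 ^+ n) `^ pm^-1 * u `^ (p x)^-1 * (w + w * F y / T).
      apply: (@le_trans _ _ (W ^- E3 * (w `^ r^-1 * F y `^ (p y)^-1))).
        rewrite -wp exprD invfM -!mulrA ler_wpM2l ?invr_ge0 ?exprn_ge0 ?(ltW Wp)//.
        rewrite mulrCA ler_wpM2l ?powR_ge0// ler_wpM2r ?powR_ge0//.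
      apply: (@le_trans _ _ (W ^- E3 * (T `^ (p y)^-1 * (w + w * F y / T)))).
        by rewrite ler_wpM2l// ?invr_ge0 ?exprn_ge0 ?(ltW Wp).
      have wT0 : 0 <= w + w * F y / T by rewrite addr_ge0// divr_ge0 ?(ltW Tp)// mulr_ge0.
      rewrite mulrA; apply: ler_wpM2r wT0 _ _ _.
      rewrite mulrC ler_pdivrMr ?exprn_gt0//; apply: le_trans hT _.
      rewrite -!mulrA ler_wpM2l ?expR_ge0// mulrC.
      by rewrite mulrA ler_wpM2r ?exprn_ge0 ?(ltW Wp).
    have := ler_wpM2l (mulr_ge0 C10 (exprn_ge0 (gap j nu) z0)) a1.
    by rewrite /Cm; congr (_ <= _); ring.
  apply: (@le_trans _ _ (Cm * z ^+ gap j nu * u `^ (p x)^-1 * (2 * 2 ^+ (i * n)) *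
       (Wy y * (2 ^- (nu * n) + Fa / u)))%:E).
    rewrite lee_fin; apply: le_trans fin _; rewrite -[leRHS]mulrA ler_wpM2l//.
    by rewrite !mulr_ge0 ?exprn_ge0 ?powR_ge0.
  rewrite [X in (X <= _)%E]EFinM.
  have -> : Cm * z ^+ gap j nu * u `^ (p x)^-1 * (2 * 4 ^+ n * 2 ^+ (i * n)) =
     Cm * z ^+ gap j nu * u `^ (p x)^-1 * (2 * 2 ^+ (i * n)) * 4 ^+ n by ring.
  rewrite [X in (_ <= X * _)%E]EFinM -muleA lee_wpmul2l//.
    by rewrite lee_fin !mulr_ge0 ?exprn_ge0 ?powR_ge0.
  by rewrite EFinM -gE.
apply: le_trans (le_esum _) _; first by move=> m _; exact: cubes.
rewrite esumZ; last 2 first.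
- by rewrite !mulr_ge0 ?exprn_ge0 ?powR_ge0.
- by move=> m; apply: integral_ge0 => y _; rewrite lee_fin.
rewrite -(integral_cubes nu mh) //.
(* The kernel alone contributes 64^n; the part with F contributes at most 1, because u contains
   exactly this integral. *)
have hI : ((2 ^+ (i * n))%:E * \int[mu]_y (h y)%:E <= (64 ^+ n + 1)%:E)%E.
  have -> : (\int[mu]_y (h y)%:E = \int[mu]_y (Wy y)%:E + (u^-1)%:E * \int[mu]_y (Wy y * F y)%:E)%E.
    rewrite -ge0_integralZl//; last 3 first.
    - by apply/measurable_EFinP; apply: measurable_funM.
    - by move=> y _; rewrite lee_fin mulr_ge0.
    - by rewrite lee_fin invr_ge0 ltW.
    rewrite -ge0_integralD//; last 4 first.
    - by move=> y _; rewrite lee_fin.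
    - exact/measurable_EFinP.
    - by move=> y _; rewrite -EFinM lee_fin !mulr_ge0// invr_ge0 ltW.
    - by apply: measurable_funeM; apply/measurable_EFinP; apply: measurable_funM.
    apply: eq_integral => y _; rewrite -EFinM -EFinD /h; congr EFin; ring.
  have hW := integral_Wt i x.
  have {}hW : ((2 ^+ (i * n))%:E * \int[mu]_y (Wy y)%:E <= (64 ^+ n)%:E)%E.
    have : ((2 ^+ (i * n))%:E * \int[mu]_y (Wy y)%:E <=
        (2 ^+ (i * n))%:E * (64 ^+ n * 2 ^- (i * n))%:E)%E.
      by rewrite lee_wpmul2l// lee_fin ltW.
    by rewrite -EFinM mulrCA divff ?mulr1// gt_eqF.
  rewrite ge0_muleDr; last 2 first.
  - by apply: integral_ge0 => y _; rewrite lee_fin.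
  - by rewrite mule_ge0 ?lee_fin ?invr_ge0 ?(ltW up)//; apply: integral_ge0 => y _; rewrite lee_fin mulr_ge0.
  rewrite EFinD; apply: leeD => //; rewrite IE -!EFinM lee_fin mulrCA mulrC.
  by rewrite ler_pdivrMr// mul1r uI lerDl ltW.
have -> : Cm * z ^+ gap j nu * u `^ (p x)^-1 * (2 * 4 ^+ n * 2 ^+ (i * n)) =
   Cm * (2 * 4 ^+ n) * (z ^+ gap j nu * u `^ (p x)^-1) * 2 ^+ (i * n) by ring.
rewrite [X in (X * _ <= _)%E]EFinM -muleA.
have -> : Cm * (2 * 4 ^+ n) * (64 ^+ n + 1) * z ^+ gap j nu * u `^ (p x)^-1 =
   Cm * (2 * 4 ^+ n) * (z ^+ gap j nu * u `^ (p x)^-1) * (64 ^+ n + 1) by ring.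
rewrite [X in (_ <= X)%E]EFinM lee_wpmul2l//.
by rewrite lee_fin !mulr_ge0 ?exprn_ge0 ?powR_ge0.
Qed.

End core_sum.

Lemma esum_gap (R : realType) (z : R) j : 0 < z < 1 ->
  (\esum_(nu in [set: nat]) (z ^+ gap j nu)%:E <= (2 / (1 - z))%:E)%E.
Proof.
move=> z01; have z0 k : (0 <= (z ^+ k)%:E)%E by rewrite lee_fin exprn_ge0// ltW//; case/andP: z01.
rewrite -nneseries_esumT//; apply: lime_le; first by apply: is_cvg_nneseries => k _ _.
apply: nearW => k; rewrite sumEFin lee_fin big_mkord.
by under eq_bigr do rewrite gapC; exact: sum_gap.
Qed.

Lemma esum_prod (R : realType) (I J : choiceType) (a : I -> J -> \bar R) :
  (forall i j, 0 <= a i j)%E ->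
  \esum_(k in [set: I * J]) a k.1 k.2 = \esum_(i in [set: I]) \esum_(j in [set: J]) a i j.
Proof.
move=> a0; rewrite esum_esum//; congr esum.
by apply/seteqP; split.
Qed.

Section core_bound.
Context {R : realType} {n : nat} (n_gt0 : (0 < n)%N).
Local Notation mu := (lebesgue_rV n : {measure set 'rV[R]_n -> \bar R}).
Variables (p q s : 'rV[R]_n -> R) (N : nat -> 'rV[int]_n -> nat) (K : nat) (eps pm qm CN : R).
Hypotheses (op : log_osc p) (oq : log_osc q) (os : log_osc s).
Hypotheses (eps0 : 0 < eps) (pm0 : 0 < pm) (pmp : forall x, pm <= p x).
Hypotheses (qm0 : 0 < qm) (qmq : forall x, qm <= q x).
Hypothesis sK : forall x, s x <= K%:R - eps.
Hypothesis CN0 : 0 <= CN.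
Hypothesis NE : forall nu m (y : 'rV[R]_n), (0 < nu)%N -> cube nu m y ->
  n%:R / Num.min 1 (p y) - s y + eps - CN / (nu%:R + 1) <= (n + N nu m)%:R.
Implicit Types (x y z : 'rV[R]_n) (m : 'rV[int]_n) (l : nat -> 'rV[int]_n -> R).

(** The sum over nu is again handled by [split_power], at x, with weights zeta^|j-nu| and T the
    weighted sum of all averages. The bound b on T, which depends on j, serves the convergence of
    the series. *)
Lemma core_bound (c0 : R) : 0 < c0 <= 1 -> exists (M : nat) (C : R), 0 < C /\
  forall (t tau : nat -> R) l, (forall nu m, 0 <= l nu m) ->
  (forall nu, 2 ^- nu <= t nu) -> (forall nu, t nu <= 3) ->
  (forall j, c0 * 2 ^- j <= tau j) -> (forall j, tau j <= 1) ->
  (forall j nu, c0 * (2 `^ (- (eps * qm / 2))) ^+ gap j nu * t nu <= tau j) ->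
  (forall nu, \int[mu]_y (density p q s nu (t nu) (l nu) y)%:E <= 1)%E ->
  forall j, exists T : 'rV[R]_n -> R, [/\ measurable_fun setT T, forall x, 0 <= T x,
    exists b, forall x, T x <= b, (\int[mu]_x (T x)%:E <= 1)%E &
    forall x, (\esum_(k in [set: nat * 'rV[int]_n])
      (2 `^ (j%:R * s x) * tau j `^ (- (q x)^-1) *
       (l k.1 k.2 * decay (R := R) N K M j k.1 k.2 x))%:E <= (C * T x `^ (p x)^-1)%:E)%E].
Proof.
move=> c01.
have [M [C [C0 H]]] := core_cubes (N := N) op oq os eps0 pm0 pmp qm0 qmq sK CN0 NE c01.
pose rm : R := Num.min 1 pm; have rm0 : 0 < rm by rewrite lt_min ltr01 pm0.
(* The factor rm ensures zeta^(1/min(1,p)) >= 2^(-eps/2) for every p >= pm, so the available decay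
   is enough for [split_power]. *)
pose zeta : R := 2 `^ (- (eps / 2) * rm).
have zeta0 : 0 < zeta by exact: powR_gt0.
have zeta1 : zeta < 1.
  have /andP[l20 _] := @ln2_bounds R.
  rewrite /zeta powR_expR// -[ltRHS]expR0 ltr_expR !mulNr oppr_lt0.
  by rewrite !mulr_gt0// invr_gt0.
pose B := 2 / (1 - zeta); have B0 : 0 < B by rewrite divr_gt0// subr_gt0.
(* Normalises the integral of T to at most 1; the summand 1 makes CT >= 1, so that CT^(1/p) <=
   CT^(1/pm). *)
pose CT := 2 * 64 ^+ n * B + 1.
have CT0 : 0 <= 2 * 64 ^+ n * B by rewrite mulr_ge0 ?(ltW B0)// mulr_ge0// exprn_ge0.
have CT1 : 1 <= CT by rewrite /CT lerDr.
have CTp : 0 < CT by rewrite (lt_le_trans ltr01).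
pose C' := C * (B + 1) * CT `^ pm^-1 + 1.
have C'0 : 0 <= C * (B + 1) * CT `^ pm^-1 by rewrite !mulr_ge0 ?powR_ge0// addr_ge0// ltW.
exists M, C'; split; first by rewrite /C' ltr_wpDl.
move=> t tau l l0 t0 t3 tau0 tau1 tt F1 j.
pose F nu := density p q s nu (t nu) (l nu).
pose u nu x := fine (wavg (minn j nu) (F nu) x).
have uP nu x : [/\ wavg (minn j nu) (F nu) x = (u nu x)%:E, Wt x <= u nu x &
    u nu x <= 2 * 2 ^+ (minn j nu * n)].
  exact: (wavg_fin op oq os qm0 qmq _ x (F1 nu)).
have u0 nu x : 0 < u nu x by have [_ h _] := uP nu x; exact: lt_le_trans (Wt_gt0 x) h.
pose a nu x : R := zeta ^+ gap j nu * u nu x.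
have za nu : 0 < zeta ^+ gap j nu by rewrite exprn_gt0.
have a0 nu x : 0 < a nu x by rewrite mulr_gt0.
have aE nu x : (a nu x)%:E = ((zeta ^+ gap j nu)%:E * wavg (minn j nu) (F nu) x)%E.
  by have [-> _ _] := uP nu x; rewrite -EFinM.
have mF nu : measurable_fun setT (F nu) := measurable_density op oq os qm0 qmq nu (t nu) (l nu).
have F0 nu y : 0 <= F nu y by exact: density_ge0.
have ma nu : measurable_fun setT (fun x => (a nu x)%:E).
  under eq_fun do rewrite aE; apply: measurable_funeM.
  exact: (integral_wavg (minn j nu) (mF nu) (F0 nu) (F1 nu)).1.
have a0E nu x : (0 <= (a nu x)%:E)%E by rewrite lee_fin ltW.
have [mT iT] := integral_esum mu ma a0E.
have z01 : 0 < zeta < 1 by rewrite zeta0.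
have sumB (c : R) : 0 <= c -> (\esum_(nu in [set: nat]) (c * zeta ^+ gap j nu)%:E <= (c * B)%:E)%E.
  move=> c0'; under eq_esum do rewrite EFinM.
  rewrite esumZ//; last by move=> nu; rewrite lee_fin ltW.
  by rewrite EFinM lee_wpmul2l ?lee_fin//; exact: esum_gap.
have Tle x : (\esum_(nu in [set: nat]) (a nu x)%:E <= (2 * 2 ^+ (j * n) * B)%:E)%E.
  apply: le_trans (sumB _ _); last by rewrite mulr_ge0// exprn_ge0.
  apply: le_esum => nu _; rewrite lee_fin /a mulrC ler_wpM2r ?(ltW (za nu))//.
  have [_ _ h] := uP nu x; apply: le_trans h _.
  by rewrite ler_wpM2l// ler_weXn2l ?ler1n// leq_mul2r geq_minl orbT.
have Tfin x : (\esum_(nu in [set: nat]) (a nu x)%:E)%E \is a fin_num.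
  rewrite ge0_fin_numE; last by apply: esum_ge0.
  exact: le_lt_trans (Tle x) (ltry _).
pose fT x := fine (\esum_(nu in [set: nat]) (a nu x)%:E)%E.
have TE x : (\esum_(nu in [set: nat]) (a nu x)%:E)%E = (fT x)%:E by rewrite fineK.
have aT nu x : a nu x <= fT x.
  have := le_esum_seq (a := fun nu => a nu x) (s := [:: nu]) isT (fun nu => ltW (a0 nu x)).
  by rewrite big_seq1 TE lee_fin.
have fT0 x : 0 < fT x := lt_le_trans (a0 0%N x) (aT 0%N x).
have mfT : measurable_fun setT fT.
  by apply/measurable_EFinP; move: mT; congr measurable_fun; apply/funext => x; exact: TE.
exists (fun x => fT x / CT); split.
- by apply: measurable_funM.
- by move=> x; rewrite divr_ge0// ltW.
- exists (2 * 2 ^+ (j * n) * B / CT) => x; rewrite ler_wpM2r ?invr_ge0 ?(ltW CTp)//.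
  by rewrite -lee_fin -TE.
- have -> : (\int[mu]_x (fT x / CT)%:E = (CT^-1)%:E * \int[mu]_x (fT x)%:E)%E.
    rewrite -ge0_integralZl//.
    + by apply: eq_integral => x _; rewrite -EFinM mulrC.
    + exact/measurable_EFinP.
    + by move=> x _; rewrite lee_fin ltW.
    + by rewrite lee_fin invr_ge0 ltW.
  have -> : (\int[mu]_x (fT x)%:E = \esum_(nu in [set: nat]) \int[mu]_x (a nu x)%:E)%E.
    by rewrite -iT; apply: eq_integral => x _; rewrite TE.
  have h : (\esum_(nu in [set: nat]) \int[mu]_x (a nu x)%:E <= (2 * 64 ^+ n * B)%:E)%E.
    apply: le_trans (sumB _ _); last by rewrite mulr_ge0// exprn_ge0.
    apply: le_esum => nu _; under eq_integral do rewrite aE.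
    have [mw iw] := integral_wavg (minn j nu) (mF nu) (F0 nu) (F1 nu).
    rewrite ge0_integralZl//; last 2 first.
    + by move=> x _; apply: le_trans (wavg_ge _ _ (F0 nu)); rewrite lee_fin Wt_ge0.
    + by rewrite lee_fin ltW.
    by rewrite mulrC EFinM lee_wpmul2l// lee_fin ltW.
  apply: (@le_trans _ _ ((CT^-1)%:E * (2 * 64 ^+ n * B)%:E)%E).
    by rewrite lee_wpmul2l// lee_fin invr_ge0 ltW.
  by rewrite -EFinM lee_fin mulrC ler_pdivrMr// mul1r lerDl.
move=> x; have px : 0 < p x := lt_le_trans pm0 (pmp x).
have tau_gt j' : 0 <= 2 `^ (j'%:R * s x) * tau j' `^ (- (q x)^-1) by rewrite mulr_ge0 ?powR_ge0.
rewrite (esum_prod (a := fun nu m => (2 `^ (j%:R * s x) * tau j `^ (- (q x)^-1) *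
       (l nu m * decay (R := R) N K M j nu m x))%:E)); last first.
  by move=> nu m; rewrite lee_fin mulr_ge0// mulr_ge0// decay_ge0.
apply: (@le_trans _ _ (C * (B + 1) * fT x `^ (p x)^-1)%:E); last first.
  rewrite lee_fin powRM ?invr_ge0 ?(ltW CTp) ?(ltW (fT0 x))//.
  rewrite mulrA [leRHS]mulrAC ler_wpM2r ?powR_ge0//.
  have c1 : CT `^ (p x)^-1 <= CT `^ pm^-1 by apply: ler_powR => //; rewrite lef_pV2 ?posrE.
  have c2 : CT `^ (p x)^-1 * CT^-1 `^ (p x)^-1 = 1.
    by rewrite -powRM ?invr_ge0 ?(ltW CTp)// divff ?powR1// gt_eqF.
  have CB : 0 <= C * (B + 1) by rewrite mulr_ge0// addr_ge0// ltW.
  apply: (@le_trans _ _ (C * (B + 1) * CT `^ pm^-1 * CT^-1 `^ (p x)^-1)); last first.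
    by rewrite ler_wpM2r ?powR_ge0// /C' lerDl.
  rewrite -mulrA ler_peMr// -c2 ler_wpM2r ?powR_ge0//.
have inner nu : (\esum_(m in [set: 'rV[int]_n]) (2 `^ (j%:R * s x) * tau j `^ (- (q x)^-1) *
       (l nu m * decay (R := R) N K M j nu m x))%:E <=
    (C * fT x `^ (p x)^-1 * (zeta ^+ gap j nu + a nu x / fT x))%:E)%E.
  apply: le_trans (H j nu (t nu) (tau j) (l nu) x (l0 nu) (t0 nu) (t3 nu) (tau0 j) (tau1 j) (tt j nu) (F1 nu)) _.
  rewrite -/(u nu x) lee_fin -[leLHS]mulrA -[leRHS]mulrA ler_wpM2l//.
  have r0 : 0 < Num.min 1 (p x) by rewrite lt_min ltr01 px.
  have rr : rm <= Num.min 1 (p x) by rewrite le_min ge_min lexx /= ge_min pmp orbT.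
  apply: le_trans (split_power px (ltW (za nu)) (ltW (u0 nu x)) (fT0 x) (aT nu x)).
  rewrite ler_wpM2r ?powR_ge0// /zeta !powR2Xn -powRrM ler_powR2//.
  set g := gap j nu; have : rm / Num.min 1 (p x) <= 1 by rewrite ler_pdivrMr// mul1r.
  have : 0 <= eps / 2 * g%:R by rewrite mulr_ge0// divr_ge0// ltW.
  have -> : - (eps / 2) * rm * g%:R / Num.min 1 (p x) = - (eps / 2 * g%:R * (rm / Num.min 1 (p x))) by ring.
  rewrite mulNr lerN2 => e0 r1; exact: ler_piMr.
apply: le_trans (le_esum (fun nu _ => inner nu)) _.
apply: esum_le => sq usq; rewrite -mulr_sumr.
(* The weights sum to at most B, and the quotients a / T to at most 1. *)
have -> : C * (B + 1) * fT x `^ (p x)^-1 = C * fT x `^ (p x)^-1 * (B + 1) by ring.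
rewrite ler_wpM2l ?mulr_ge0 ?powR_ge0// big_split /=; apply: lerD.
  rewrite -lee_fin; apply: le_trans (esum_gap j z01).
  by apply: le_esum_seq => // nu; exact: ltW.
rewrite -mulr_suml ler_pdivrMr// mul1r -lee_fin -TE.
by apply: (le_esum_seq (a := fun nu => a nu x)) => // nu; exact: ltW.
Qed.

End core_bound.

(** * Convergence of the atomic series *)

Section unordered_sums.
Context {R : realType}.
Local Notation Re := complex.Re.
Local Notation Im := complex.Im.

Definition csummable (I : eqType) (u : I -> R[i]) (B : R) :=
  forall s : seq I, uniq s -> \sum_(k <- s) cmod (u k) <= B.

(** Convergence along the net of finite subsets, represented by duplicate-free lists. *)
Definition hsum (I : eqType) (u : I -> R[i]) (z : R[i]) := forall e : R, 0 < e ->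
  exists A0 : seq I, forall A, uniq A -> {subset A0 <= A} -> cmod (\sum_(k <- A) u k - z) <= e.

Section general.
Context {I : eqType}.
Implicit Types (u v : I -> R[i]) (z w : R[i]) (A : seq I).

Lemma hsum_witness u z (e : R) A1 : hsum u z -> 0 < e ->
  exists A, [/\ uniq A, {subset A1 <= A} & cmod (\sum_(k <- A) u k - z) <= e].
Proof.
move=> H e0; have [A0 HA] := H e e0; exists (undup (A0 ++ A1)); split.
- exact: undup_uniq.
- by move=> k kA; rewrite mem_undup mem_cat kA orbT.
- by apply: HA; [exact: undup_uniq|move=> k kA; rewrite mem_undup mem_cat kA].
Qed.

Lemma hsum_le u z B : hsum u z -> csummable u B -> cmod z <= B.
Proof.
move=> H sB; apply/ler_addgt0Pr => e e0.
have [A [uA _ HA]] := hsum_witness [::] H e0.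
have -> : z = \sum_(k <- A) u k - (\sum_(k <- A) u k - z) by ring.
apply: le_trans (cmodB _ _) (lerD _ HA).
by apply: le_trans (cmod_sum _ _ _) _; exact: sB.
Qed.

Lemma hsum_unique u z w : hsum u z -> hsum u w -> z = w.
Proof.
move=> Hz Hw; apply/eqP; rewrite -subr_eq0; apply/eqP; apply: cmod_eq0.
apply/eqP; rewrite eq_le cmod_ge0 andbT; apply/ler_addgt0Pr => e e0; rewrite add0r.
have e2 : 0 < e / 2 by rewrite divr_gt0.
have [A0 HA0] := Hz _ e2; have [A [uA sA HA]] := hsum_witness A0 Hw e2.
have -> : z - w = (\sum_(k <- A) u k - w) - (\sum_(k <- A) u k - z) by ring.
apply: le_trans (cmodB _ _) _; rewrite [leRHS](splitr e); apply: lerD => //.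
exact: HA0.
Qed.

Lemma hsum_linear u v z w (c : R[i]) : hsum u z -> hsum v w ->
  hsum (fun k => c * u k + v k) (c * z + w).
Proof.
move=> Hz Hw e e0; have c1 : 0 < cmod c + 1 by rewrite ltr_wpDl// cmod_ge0.
have e1 : 0 < e / 2 / (cmod c + 1) by rewrite !divr_gt0.
have e2 : 0 < e / 2 by rewrite divr_gt0.
have [A0 HA0] := Hz _ e1; have [A1 HA1] := Hw _ e2.
exists (A0 ++ A1) => A uA sA.
have h0 : cmod (\sum_(k <- A) u k - z) <= e / 2 / (cmod c + 1).
  by apply: HA0 => // k kA; apply: sA; rewrite mem_cat kA.
have h1 : cmod (\sum_(k <- A) v k - w) <= e / 2.
  by apply: HA1 => // k kA; apply: sA; rewrite mem_cat kA orbT.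
have -> : \sum_(k <- A) (c * u k + v k) - (c * z + w) =
    c * (\sum_(k <- A) u k - z) + (\sum_(k <- A) v k - w).
  by rewrite big_split -mulr_sumr /=; ring.
apply: le_trans (cmodD _ _) _; rewrite [leRHS](splitr e); apply: lerD => //.
rewrite cmodM; move: h0; rewrite ler_pdivlMr//; apply: le_trans.
by rewrite mulrC ler_wpM2l ?cmod_ge0// lerDl.
Qed.

End general.

(* Fubini for the iterated sum: only boxes exhausting the index set are compared. *)
Lemma hsum_iterated (J : eqType) (u : nat * J -> R[i]) (zs : nat -> R[i]) z :
  hsum u z -> (forall nu, hsum (fun m => u (nu, m)) (zs nu)) ->
  cmod (\sum_(nu < k) zs nu - z) @[k --> \oo] --> (0 : R).
Proof.
move=> Hz Hs; apply/cvgrPdist_le => e e0.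
have e2 : 0 < e / 2 by rewrite divr_gt0.
have [A0 HA0] := Hz _ e2; pose N := (\max_(k <- A0) k.1).+1.
exists N => // k /= Nk; rewrite sub0r normrN ger0_norm ?cmod_ge0//.
have d0 : 0 < e / 2 / k.+1%:R by rewrite !divr_gt0.
have /choice[As HAs] : forall nu : nat, exists A : seq J, [/\ uniq A,
    {subset [seq m.2 | m <- A0 & m.1 == nu] <= A} &
    cmod (\sum_(m <- A) u (nu, m) - zs nu) <= e / 2 / k.+1%:R].
  by move=> nu; exact: hsum_witness.
pose A := [seq (nu, m) | nu <- iota 0 k, m <- As nu].
have uA : uniq A.
  apply: allpairs_uniq_dep; first exact: iota_uniq.
    by move=> nu _; have [] := HAs nu.
  by move=> [a b] [c d] _ _ /= [-> ->].
have sA : {subset A0 <= A}.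
  move=> [nu m] kA; apply/allpairsPdep; exists nu, m; split => //.
    rewrite mem_iota /= add0n; apply: leq_trans Nk; rewrite /N ltnS.
    exact: (leq_bigmax_seq (F := fun k : nat * J => k.1) _ kA).
  have [_ + _] := HAs nu; apply; apply/mapP; exists (nu, m) => //.
  by rewrite mem_filter /= eqxx kA.
have SA : \sum_(x <- A) u x = \sum_(nu < k) \sum_(m <- As nu) u (nat_of_ord nu, m).
  by rewrite big_allpairs_dep /= -(big_mkord xpredT (fun nu => \sum_(m <- As nu) u (nu, m))) /index_iota subn0.
have -> : \sum_(nu < k) zs nu - z = (\sum_(x <- A) u x - z) -
    \sum_(nu < k) (\sum_(m <- As nu) u (nat_of_ord nu, m) - zs nu).
  by rewrite sumrB SA; ring.
apply: le_trans (cmodB _ _) _; rewrite [leRHS](splitr e); apply: lerD; first exact: HA0.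
apply: le_trans (cmod_sum _ _ _) _.
apply: (@le_trans _ _ (\sum_(nu < k) e / 2 / k.+1%:R)).
  by apply: ler_sum => nu _; have [] := HAs nu.
rewrite sumr_const card_ord -[leLHS]mulr_natl mulrCA ler_piMr ?(ltW e2)//.
by rewrite ler_pdivrMr// mul1r ler_nat.
Qed.

Lemma hsum_totally (I : choiceType) (u : I -> R[i]) z : hsum u z ->
  (fun A : {fset I} => cmod (\sum_(m <- A) u m - z)) @ totally --> (0 : R).
Proof.
have FF := @totally_filter I.
move=> H; apply/cvgrPdist_le => e e0; have [A0 HA0] := H e e0.
exists [fset k in A0]%fset => // A /= A0A.
rewrite sub0r normrN ger0_norm ?cmod_ge0//; apply: HA0; first exact: fset_uniq.
by move=> k kA; apply: (fsubsetP A0A); rewrite !inE.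
Qed.

Section countable.
Context {I : countType}.
Implicit Types (u v : I -> R[i]).

Definition first_terms N : seq I := pmap (@pickle_inv I) (iota 0 N).

Lemma first_terms_uniq N : uniq (first_terms N).
Proof. by apply: pmap_uniq (iota_uniq 0 N); exact: pickle_invK. Qed.

Lemma mem_first_terms N k : (choice.pickle k < N)%N -> k \in first_terms N.
Proof.
move=> kN; rewrite mem_pmap; apply/mapP; exists (choice.pickle k).
  by rewrite mem_iota.
by rewrite pickleK_inv.
Qed.

Lemma hsum_first_terms u z : hsum u z ->
  cmod (\sum_(k <- first_terms N) u k - z) @[N --> \oo] --> (0 : R).
Proof.
move=> H; apply/cvgrPdist_le => e e0; have [A0 HA0] := H e e0.
exists (\max_(k <- A0) choice.pickle k).+1 => // N /= HN.
rewrite sub0r normrN ger0_norm ?cmod_ge0//; apply: HA0; first exact: first_terms_uniq.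
move=> k kA; apply: mem_first_terms; apply: leq_trans HN; rewrite ltnS.
exact: (leq_bigmax_seq (F := fun k : I => choice.pickle k) _ kA).
Qed.

Lemma sum_first_terms (V : nmodType) (F : I -> V) N :
  \sum_(k <- first_terms N) F k = \sum_(0 <= j < N) oapp F 0 (@pickle_inv I j).
Proof. by rewrite big_pmap /index_iota subn0. Qed.

(** The limit is found along the enumeration, where real and imaginary parts converge absolutely; it
    is the unordered sum because the moduli outside a finite set have small sums. *)
Lemma csummable_hsum u B : csummable u B -> exists z, hsum u z.
Proof.
move=> sB; pose a j := oapp u 0 (@pickle_inv I j).
have real (g : R[i] -> R) : {morph g : x y / x + y} -> g 0 = 0 -> (forall z, `|g z| <= cmod z) ->
    exists w : R, g (\sum_(k <- first_terms N) u k) @[N --> \oo] --> w.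
  move=> gD g0 gle.
  have ga : cvgn (series (fun j => g (a j))).
    apply: (@normed_cvg R R^o); apply: nondecreasing_is_cvgn.
      apply/nondecreasing_seqP => N; rewrite /normed_series_of /series /=.
      by rewrite big_nat_recr //= lerDl.
    exists B => _ [N _ <-]; rewrite /normed_series_of /series /=.
    apply: (@le_trans _ _ (\sum_(k <- first_terms N) cmod (u k))); last exact/sB/first_terms_uniq.
    rewrite sum_first_terms; apply: ler_sum => j _; rewrite /a.
    by case: pickle_inv => [k|] /=; rewrite ?g0 ?normr0.
  have E : series (fun j => g (a j)) = (fun N => g (\sum_(k <- first_terms N) u k)).
    by apply/funext => N; rewrite /series /= sum_first_terms (big_morph g gD g0).
  by move: ga; rewrite E => /cvg_ex.
have [x Hx] := real (@complex.Re R) (@cReD R) erefl (@Re_le_cmod R).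
have [y Hy] := real (@complex.Im R) (@cImD R) erefl (@Im_le_cmod R).
pose z := (x +i* y)%C.
have Hz : cmod (\sum_(k <- first_terms N) u k - z) @[N --> \oo] --> (0 : R).
  by apply/ccvg_cmod; split.
exists z => e e0; have e4 : 0 < e / 4 by rewrite divr_gt0.
(* a finite set carrying the sum of moduli up to e/4 *)
have [A1 [uA1 HA1]] : exists A1, uniq A1 /\ forall A, uniq A ->
    \sum_(k <- A | k \notin A1) cmod (u k) <= e / 4.
  apply: contrapT => nH; pose S := [set r : R | exists2 A, uniq A & r = \sum_(k <- A) cmod (u k)].
  have supS : has_sup S.
    split; first by exists 0; exists [::] => //; rewrite big_nil.
    by exists B => _ [A uA ->]; exact: sB.
  have [_ [A1 uA1 ->] HA1] := sup_adherent e4 supS.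
  apply: nH; exists A1; split => // A uA.
  have uA2 : uniq (A1 ++ [seq k <- A | k \notin A1]).
    rewrite cat_uniq uA1 filter_uniq// andbT /=; apply/hasPn => k.
    by rewrite mem_filter => /andP[].
  have : \sum_(k <- A1 ++ [seq k <- A | k \notin A1]) cmod (u k) <= sup S.
    by apply: sup_upper_bound => //; exists (A1 ++ [seq k <- A | k \notin A1]).
  rewrite big_cat big_filter /=; move: HA1; lra.
have [N0 _ HN0] : \forall N \near \oo, cmod (\sum_(k <- first_terms N) u k - z) <= e / 2.
  have e2 : 0 < e / 2 by rewrite divr_gt0.
  move/cvgrPdist_le : Hz => /(_ _ e2); apply: filterS => N.
  by rewrite sub0r normrN ger0_norm ?cmod_ge0.
pose N := maxn N0 (\max_(k <- A1) choice.pickle k).+1.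
have hN : cmod (\sum_(k <- first_terms N) u k - z) <= e / 2 by apply: HN0; exact: leq_maxl.
have sN : {subset A1 <= first_terms N}.
  move=> k kA; apply: mem_first_terms; apply: leq_trans (leq_maxr _ _); rewrite ltnS.
  exact: (leq_bigmax_seq (F := fun k : I => choice.pickle k) _ kA).
have near A : uniq A -> {subset A1 <= A} ->
    cmod (\sum_(k <- A) u k - \sum_(k <- A1) u k) <= e / 4.
  move=> uA sA; rewrite (bigID (mem A1)) /=.
  have -> : \sum_(k <- A | k \in A1) u k = \sum_(k <- A1) u k.
    rewrite -big_filter; apply: perm_big; apply: uniq_perm => //; first exact: filter_uniq.
    by move=> k; rewrite mem_filter; case: (boolP (k \in A1)) => //= kA; rewrite sA.
  by rewrite addrAC subrr add0r; apply: le_trans (cmod_sum _ _ _) _; exact: HA1.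
exists A1 => A uA sA.
have -> : \sum_(k <- A) u k - z = (\sum_(k <- A) u k - \sum_(k <- A1) u k) -
   (\sum_(k <- first_terms N) u k - \sum_(k <- A1) u k) + (\sum_(k <- first_terms N) u k - z) by ring.
apply: le_trans (cmodD _ _) _; have := near A uA sA; have := near _ (first_terms_uniq N) sN.
have := cmodB (\sum_(k <- A) u k - \sum_(k <- A1) u k) (\sum_(k <- first_terms N) u k - \sum_(k <- A1) u k).
lra.
Qed.

End countable.

End unordered_sums.

(** * Modulars of the mixed norm *)

Section modulars.
Context {R : realType} {n : nat} (n_gt0 : (0 < n)%N).
Local Notation mu := (lebesgue_rV n : {measure set 'rV[R]_n -> \bar R}).
Implicit Types (x y : 'rV[R]_n) (m : 'rV[int]_n) (lam : nat -> 'rV[int]_n -> R[i]).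

(** Pulls the scaling of |f|^q in L^(p/q) inside the power: dividing by l there is multiplying f by
    l^(-1/q) in L^p. *)
Lemma power_modular (A l p q : R) : 0 <= A -> 0 < l -> 0 < q ->
  ((A `^ q) / l) `^ (p / q) = (A * l `^ (- q^-1)) `^ p.
Proof.
move=> A0 l0 q0; rewrite !powRM ?powR_ge0 ?invr_ge0 ?(ltW l0)// -!powRrM.
rewrite mulrCA divff ?gt_eqF// mulr1; congr (_ * _).
by rewrite powRV// mulNr [p / q]mulrC.
Qed.

Lemma vLp_norm_le (p : 'rV[R]_n -> R) (f : 'rV[R]_n -> R[i]) (t : R) : 0 < t ->
  (\int[mu]_x ((cmod (f x) / t) `^ p x)%:E <= 1)%E -> (vLp_norm p f <= t%:E)%E.
Proof. by move=> t0 H; apply: ereal_inf_lbound; exists t. Qed.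

Lemma vLp_norm_lt (p : 'rV[R]_n -> R) (f : 'rV[R]_n -> R[i]) (t : R) : (vLp_norm p f < t%:E)%E ->
  exists l : R, [/\ 0 < l, l < t & (\int[mu]_x ((cmod (f x) / l) `^ p x)%:E <= 1)%E].
Proof. by move=> /ereal_inf_lt[_ [l [l0 H] <-]]; rewrite lte_fin => lt; exists l. Qed.

Lemma vLp_norm_ge0 (p : 'rV[R]_n -> R) (f : 'rV[R]_n -> R[i]) : (0 <= vLp_norm p f)%E.
Proof. by apply: le_ereal_inf_tmp => _ [l [l0 _] <-]; rewrite lee_fin ltW. Qed.

Lemma cube_sum lam nu x :
  \sum_(m \in [set: 'rV[int]_n]) (lam nu m * (\1_(cube nu m) x)%:C%C) = lam nu (cube_index nu x).
Proof.
rewrite -(fsbig_widen [set cube_index nu x]) //; last first.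
  move=> m [_ /= mx]; rewrite indicE memNset ?mulr0// => /cubeE mE; exact: mx.
by rewrite fsbig_set1 indicE mem_set ?mulr1//; apply/cubeE.
Qed.

Lemma nneseries_term (a : nat -> \bar R) k : (forall j, 0 <= a j)%E ->
  (a k <= \sum_(0 <= j <oo) a j)%E.
Proof.
move=> a0; rewrite (nneseriesD1 (n := k))// leeDl//.
by apply: nneseries_ge0 => j _ _.
Qed.

Lemma nneseries_gap (z : R) nu : 0 < z < 1 ->
  (\sum_(0 <= j <oo) (z ^+ gap j nu)%:E <= (2 / (1 - z))%:E)%E.
Proof.
move=> z01; have z0 k : (0 <= (z ^+ k)%:E)%E by rewrite lee_fin exprn_ge0// ltW//; case/andP: z01.
apply: lime_le; first by apply: is_cvg_nneseries => k _ _.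
by apply: nearW => k; rewrite sumEFin lee_fin big_mkord; exact: sum_gap.
Qed.

(* Replacing t by its exponentially weighted averages keeps the sum finite and makes
   neighbouring scales comparable. *)
Lemma averaged_weights (z : R) : 0 < z < 1 -> exists2 c0 : R, 0 < c0 <= 1 &
  forall t : nat -> R, (forall nu, 2 ^- nu <= t nu) ->
  (\sum_(0 <= nu <oo) (t nu)%:E <= 5%:E)%E ->
  exists tau : nat -> R, [/\ forall j nu, c0 * z ^+ gap j nu * t nu <= tau j,
    forall j, c0 * 2 ^- j <= tau j, forall j, tau j <= 1 & (\sum_(0 <= j <oo) (tau j)%:E <= 1)%E].
Proof.
move=> z01; have /andP[z0 z1] := z01; pose B := 2 / (1 - z).
have z1' : 0 < 1 - z by rewrite subr_gt0.
have B2 : 1 <= B by rewrite /B ler_pdivlMr// mul1r; lra.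
have Bp : 0 < B := lt_le_trans ltr01 B2.
have B5 : 0 < 5 * B by rewrite mulr_gt0.
(* The t_nu sum to at most 5 and the weights over j to at most B; this constant gives both tau_j <=
   1 and a total of at most 1. *)
exists (5 * B)^-1.
  by rewrite invr_gt0 B5 /= invf_le1//; lra.
move=> t t0 St; have tp nu : 0 < t nu by apply: lt_le_trans (t0 nu); rewrite invr_gt0 exprn_gt0.
pose a j nu : R := z ^+ gap j nu * t nu.
have zg j nu : 0 < z ^+ gap j nu by rewrite exprn_gt0.
have a0 j nu : (0 <= (a j nu)%:E)%E by rewrite lee_fin mulr_ge0// ltW.
have le5 j : (\sum_(0 <= nu <oo) (a j nu)%:E <= 5%:E)%E.
  apply: le_trans St; apply: lee_nneseries => // nu _; rewrite lee_fin /a.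
  by rewrite ler_piMl ?(ltW (tp nu))// exprn_ile1 ?(ltW z0) ?(ltW z1).
have afin j : (\sum_(0 <= nu <oo) (a j nu)%:E)%E \is a fin_num.
  rewrite ge0_fin_numE; last by apply: nneseries_ge0 => nu _ _.
  by apply: le_lt_trans (le5 j) (ltry _).
pose S j := fine (\sum_(0 <= nu <oo) (a j nu)%:E)%E.
have SE j : (\sum_(0 <= nu <oo) (a j nu)%:E = (S j)%:E)%E by rewrite fineK.
have aS j nu : a j nu <= S j by rewrite -lee_fin -SE; exact: (nneseries_term (a := fun nu => (a j nu)%:E)).
have c0 : 0 < (5 * B)^-1 by rewrite invr_gt0.
exists (fun j => (5 * B)^-1 * S j); split.
- by move=> j nu; rewrite -mulrA ler_pM2l// aS.
- move=> j; rewrite ler_pM2l//; apply: le_trans (aS j j).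
  by rewrite /a /gap subnn expr0 mul1r.
- move=> j; have : S j <= 5 by rewrite -lee_fin -SE.
  move=> S5; rewrite mulrC ler_pdivrMr// mul1r; apply: le_trans S5 _.
  by rewrite ler_peMr.
- under eq_eseriesr do rewrite EFinM -SE.
  rewrite nneseriesZl; last by move=> j _; apply: nneseries_ge0 => nu _ _.
  rewrite nneseries_interchange//.
  have h : (\sum_(0 <= nu <oo) \sum_(0 <= j <oo) (a j nu)%:E <= (5 * B)%:E)%E.
    apply: (@le_trans _ _ (\sum_(0 <= nu <oo) (B%:E * (t nu)%:E)))%E.
      apply: lee_nneseries => nu _; first by move=> _; apply: nneseries_ge0 => j _ _.
      under eq_eseriesr do rewrite /a mulrC EFinM.
      rewrite nneseriesZl; last by move=> j _; rewrite lee_fin ltW.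
      rewrite muleC lee_wpmul2r ?lee_fin ?(ltW (tp nu))//; exact: nneseries_gap.
    rewrite nneseriesZl; last by move=> nu _; rewrite lee_fin ltW.
    by rewrite [5 * B]mulrC [leRHS]EFinM lee_wpmul2l// lee_fin ltW.
  apply: le_trans (lee_wpmul2l _ h) _; first by rewrite lee_fin ltW.
  by rewrite -EFinM mulVf// gt_eqF.
Qed.

Section synthesis.
Variables (p q s : 'rV[R]_n -> R) (N : nat -> 'rV[int]_n -> nat) (K : nat) (eps pm qm CN : R).
Hypotheses (op : log_osc p) (oq : log_osc q) (os : log_osc s).
Hypotheses (eps0 : 0 < eps) (pm0 : 0 < pm) (pmp : forall x, pm <= p x).
Hypotheses (qm0 : 0 < qm) (qmq : forall x, qm <= q x).
Hypothesis sK : forall x, s x <= K%:R - eps.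
Hypothesis CN0 : 0 <= CN.
Hypothesis NE : forall nu m (y : 'rV[R]_n), (0 < nu)%N -> cube nu m y ->
  n%:R / Num.min 1 (p y) - s y + eps - CN / (nu%:R + 1) <= (n + N nu m)%:R.

Lemma log_osc_measurable (g : 'rV[R]_n -> R) : log_osc g -> measurable_fun setT g.
Proof. by move=> /log_osc_continuous cg; exact: continuous_measurable_rV. Qed.

Definition b_fun lam nu x : R[i] := (2 `^ (nu%:R * s x))%:C%C *
    \sum_(m \in [set: 'rV[int]_n]) (lam nu m * (\1_(cube nu m) x)%:C%C).

Definition lq_modular (f : nat -> 'rV[R]_n -> R[i]) (a : R) : \bar R :=
  \sum_(0 <= j <oo) vLp_norm (fun x => (p x / q x)%R)
       (fun x => ((cmod (f j x) / a) `^ q x)%R%:C%C).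

(** Stated for every admissible value a in the infimum defining the norm of lambda, since the
    infimum itself need not be admissible. The weights tau and majorants T depend on a, the
    constants M and C do not. *)
Lemma synthesis_bound : exists (M : nat) (C : R), 0 < C /\
  forall lam (a : R), 0 < a -> (lq_modular (b_fun lam) a <= 1)%E ->
  exists (tau : nat -> R) (T : nat -> 'rV[R]_n -> R),
  [/\ forall j, 0 < tau j <= 1, (\sum_(0 <= j <oo) (tau j)%:E <= 1)%E,
     forall j, [/\ measurable_fun setT (T j), forall x, 0 <= T j x,
       exists b, forall x, T j x <= b & (\int[mu]_x (T j x)%:E <= 1)%E] &
     forall j x, (\esum_(k in [set: nat * 'rV[int]_n])
      (2 `^ (j%:R * s x) * tau j `^ (- (q x)^-1) *
       (cmod (lam k.1 k.2) / a * decay (R := R) N K M j k.1 k.2 x))%:E <=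
        (C * T j x `^ (p x)^-1)%:E)%E].
Proof.
have dl0 : 0 < eps * qm / 2 by rewrite divr_gt0// mulr_gt0.
have z01 : 0 < 2 `^ (- (eps * qm / 2)) < (1 : R).
  rewrite powR_gt0//=; have /andP[l20 _] := @ln2_bounds R.
  by rewrite powR_expR// -[ltRHS]expR0 ltr_expR mulNr oppr_lt0 mulr_gt0.
have [c0 c01 Hw] := averaged_weights z01.
have [M [C [C0 H]]] := core_bound (N := N) op oq os eps0 pm0 pmp qm0 qmq sK CN0 NE c01.
exists M, C; split => // lam a a0 La.
pose v nu := vLp_norm (fun x => (p x / q x)%R)
       (fun x => ((cmod (b_fun lam nu x) / a) `^ q x)%R%:C%C).
have v0 nu : (0 <= v nu)%E by exact: vLp_norm_ge0.
have v1 nu : (v nu <= 1)%E by apply: le_trans La; exact: (nneseries_term (a := v)).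
have vfin nu : v nu \is a fin_num by rewrite ge0_fin_numE// (le_lt_trans (v1 nu))// ltry.
(* The summand makes t_nu exceed the norm strictly, so that some smaller value is admissible and the
   modular at t_nu is at most 1; it also bounds t_nu from below. *)
pose t nu : R := fine (v nu) + 2 ^- nu.
have p2 k : (0 : R) < 2 ^- k by rewrite invr_gt0 exprn_gt0.
have t0 nu : 2 ^- nu <= t nu by rewrite lerDr fine_ge0.
have t3 nu : t nu <= 3.
  have h1 : fine (v nu) <= 1 by rewrite -lee_fin fineK.
  have h2 : 2 ^- nu <= 1 :> R by rewrite invf_le1 ?exprn_gt0// exprn_ege1// ler1n.
  by rewrite /t; lra.
have vt nu : (v nu < (t nu)%:E)%E by rewrite -[X in (X < _)%E]fineK// lte_fin ltrDl.
have St : (\sum_(0 <= nu <oo) (t nu)%:E <= 5%:E)%E.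
  under eq_eseriesr do rewrite EFinD fineK//.
  rewrite nneseriesD//.
  (* At most 1 from the norms and at most 4 from the powers 2^-nu, by the geometric bound with ratio
     1/2. *)
  have -> : (5%:E = 1 + (4%:R)%:E :> \bar R)%E.
    by rewrite -EFinD; congr EFin; ring.
  apply: leeD => //.
  have h01 : 0 < (2^-1 : R) < 1 by rewrite invr_gt0 ltr0n /= invf_lt1 ?ltr1n.
  have -> : (4%:R : R) = 2 / (1 - 2^-1) by field.
  apply: le_trans (nneseries_gap 0 h01); apply: lee_nneseries => [nu _ _|nu _].
    by rewrite lee_fin ltW.
  by rewrite /gap sub0n subn0 addn0 exprVn.
have [tau [tt tau0 tau1 Stau]] := Hw t t0 St.
pose l nu m : R := cmod (lam nu m) / a.
have l0 nu m : 0 <= l nu m by rewrite divr_ge0 ?cmod_ge0// ltW.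
have qp x : 0 < q x := lt_le_trans qm0 (qmq x).
have px x : 0 < p x := lt_le_trans pm0 (pmp x).
have tp nu : 0 < t nu := lt_le_trans (p2 nu) (t0 nu).
have F1 nu : (\int[mu]_y (density p q s nu (t nu) (l nu) y)%:E <= 1)%E.
  have [b [b0 bt Hb]] := vLp_norm_lt (vt nu).
  apply: le_trans Hb.
  pose X y : R := 2 `^ (nu%:R * s y) * l nu (cube_index nu y).
  have X0 y : 0 <= X y by rewrite mulr_ge0// powR_ge0.
  have XE y : cmod (b_fun lam nu y) / a = X y.
    by rewrite /b_fun cube_sum cmodM cmod_real ger0_norm ?powR_ge0// /X /l mulrA.
  have bE y : (cmod ((cmod (b_fun lam nu y) / a) `^ q y)%:C%C / b) `^ (p y / q y) =
      (X y * b `^ (- (q y)^-1)) `^ p y.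
    by rewrite XE cmod_real ger0_norm ?powR_ge0// power_modular.
  under [leRHS]eq_integral do rewrite bE.
  have mX : measurable_fun setT X.
    apply: measurable_funM; last exact: measurable_cube_index.
    by apply: measurable_powR2 => //; apply: measurable_funM => //; exact: log_osc_measurable.
  apply: ge0_le_integral => //.
  - by move=> y _; rewrite lee_fin powR_ge0.
  - by apply/measurable_EFinP; exact: (measurable_density op oq os qm0 qmq).
  - apply/measurable_EFinP; apply: measurable_powR2; last exact: log_osc_measurable.
    apply: measurable_funM => //; apply: measurable_powR2 => //; apply: measurable_funN.
    by apply: measurable_inv_ge0 => [x|]; [exact: ltW|exact: log_osc_measurable].
  move=> y _; rewrite lee_fin /density mulrAC -/(X y).
  have Xp (r : R) : X y * r `^ (- (q y)^-1) \is Num.nneg.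
    by rewrite nnegrE; exact: mulr_ge0 (X0 y) (powR_ge0 _ _).
  apply: ge0_ler_powR (ltW (px y)) _ _ (Xp _) (Xp _) _.
  rewrite ler_wpM2l// !powRN lef_pV2 ?posrE ?powR_gt0//.
  by apply: ge0_ler_powR; rewrite ?nnegrE ?invr_ge0 ?(ltW (qp y)) ?(ltW b0) ?(ltW (tp nu)) ?(ltW bt).
have HT := H t tau l l0 t0 t3 tau0 tau1 tt F1.
have /choice[T HT'] := HT.
exists tau, T; split => //.
- move=> j; rewrite tau1 andbT; apply: lt_le_trans (tau0 j).
  by rewrite mulr_gt0//; case/andP: c01.
- by move=> j; have [] := HT' j.
- by move=> j x; have [_ _ _ _] := HT' j; apply.
Qed.

(** For the scaling C a the modular of the j-th function at tau_j is at most the integral of T_j, so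
    tau_j bounds its inner norm, and the tau_j sum to at most 1. *)
Lemma lqLp_norm_le (G : nat -> 'rV[R]_n -> R[i]) (a C : R) (tau : nat -> R) (T : nat -> 'rV[R]_n -> R) :
  0 < a -> 0 < C -> (forall j, 0 < tau j) -> (\sum_(0 <= j <oo) (tau j)%:E <= 1)%E ->
  (forall j, [/\ measurable_fun setT (T j), forall x, 0 <= T j x,
    exists b, forall x, T j x <= b & (\int[mu]_x (T j x)%:E <= 1)%E]) ->
  (forall j, cmeas (G j)) ->
  (forall j x, tau j `^ (- (q x)^-1) * (cmod (G j x) / a) <= C * T j x `^ (p x)^-1) ->
  (lqLp_norm q p G <= (C * a)%:E)%E.
Proof.
move=> a0 C0 tau0 Stau HT mG H; apply: ereal_inf_lbound; exists (C * a) => //; split.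
  exact: mulr_gt0.
apply: le_trans Stau; apply: lee_nneseries => [j _ _|j _]; first exact: vLp_norm_ge0.
have [mT T0 _ T1] := HT j; apply: vLp_norm_le => //; apply: le_trans T1.
have qp x : 0 < q x := lt_le_trans qm0 (qmq x).
have px x : 0 < p x := lt_le_trans pm0 (pmp x).
have Ca : 0 < C * a by exact: mulr_gt0.
have A0 x : 0 <= cmod (G j x) / (C * a) by rewrite divr_ge0 ?cmod_ge0// ltW.
have E x : (cmod ((cmod (G j x) / (C * a)) `^ q x)%:C%C / tau j) `^ (p x / q x) =
   (cmod (G j x) / (C * a) * tau j `^ (- (q x)^-1)) `^ p x.
  by rewrite cmod_real ger0_norm ?powR_ge0// power_modular.
under eq_integral do rewrite E.
apply: ge0_le_integral => //.
- by move=> x _; rewrite lee_fin powR_ge0.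
- apply/measurable_EFinP; apply: measurable_powR2; last exact: log_osc_measurable.
  apply: measurable_funM.
    by apply: measurable_funM => //; exact: measurable_cmod.
  apply: measurable_powR2 => //; apply: measurable_funN.
  by apply: measurable_inv_ge0 => [x|]; [exact: ltW|exact: log_osc_measurable].
- by apply/measurable_EFinP.
move=> x _; rewrite lee_fin.
have h : cmod (G j x) / (C * a) * tau j `^ (- (q x)^-1) <= T j x `^ (p x)^-1.
  have -> : cmod (G j x) / (C * a) * tau j `^ (- (q x)^-1) =
      tau j `^ (- (q x)^-1) * (cmod (G j x) / a) / C by rewrite invfM; ring.
  by rewrite ler_pdivrMr// [leRHS]mulrC.
have TE : T j x = (T j x `^ (p x)^-1) `^ p x by rewrite -powRrM mulVf ?powRr1// gt_eqF.
rewrite [leRHS]TE; apply: ge0_ler_powR; rewrite ?nnegrE ?(ltW (px x)) ?powR_ge0//.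
by rewrite mulr_ge0 ?powR_ge0.
Qed.

End synthesis.

End modulars.

(** * Absolutely convergent series of distributions *)

Section dist_series.
Context {R : realType} {n : nat} (n_gt0 : (0 < n)%N).
Variables (I : countType) (A : I -> 'rV[R]_n -> R[i]) (lam : I -> R[i]) (w : I -> R)
  (S : ('rV[R]_n -> R[i]) -> R) (B : R).
Hypothesis iA : forall k psi, schwartz psi -> cintegrable (fun x => A k x * psi x).
Hypothesis bA : forall k psi, schwartz psi ->
  cmod (cintegral (fun x => A k x * psi x)) <= S psi * w k.
Hypothesis S0 : forall psi, 0 <= S psi.
Hypothesis Scvg : forall (u : nat -> 'rV[R]_n -> R[i]),
  (forall al be, schwartz_seminorm al be (u k) @[k --> \oo] --> 0%E) -> S (u k) @[k --> \oo] --> (0 : R).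
Hypothesis sB : forall s : seq I, uniq s -> \sum_(k <- s) cmod (lam k) * w k <= B.
Implicit Types (phi psi : 'rV[R]_n -> R[i]).

Definition series_term psi (k : I) : R[i] := dist_of_fun (fun x => lam k * A k x) psi.

(** Defined on all functions, with value 0 where the unordered sum does not exist; on Schwartz
    functions it always exists. *)
Definition dist_series psi : R[i] := xget 0 [set z | hsum (series_term psi) z].

Lemma dist_seriesE psi z : hsum (series_term psi) z -> dist_series psi = z.
Proof.
move=> H; have ex : exists w, [set z | hsum (series_term psi) z] w by exists z.
exact: hsum_unique (xgetPex 0 ex) H.
Qed.

Lemma series_termE psi k : schwartz psi ->
  series_term psi k = lam k * cintegral (fun x => A k x * psi x).
Proof.
move=> sp; rewrite /series_term /dist_of_fun; under eq_fun do rewrite -mulrA.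
by rewrite cintegralZ//; exact: iA.
Qed.

Lemma series_term_summable psi : schwartz psi -> csummable (series_term psi) (S psi * B).
Proof.
move=> sp s us; apply: le_trans (ler_wpM2l (S0 psi) (sB us)); rewrite mulr_sumr.
apply: ler_sum => k _; rewrite series_termE// cmodM mulrCA ler_wpM2l ?cmod_ge0//.
exact: bA.
Qed.

Lemma hsum_dist_series psi : schwartz psi -> hsum (series_term psi) (dist_series psi).
Proof.
move=> sp; have [z Hz] := csummable_hsum (series_term_summable sp).
by rewrite (dist_seriesE Hz).
Qed.

Lemma dist_series_le psi : schwartz psi -> cmod (dist_series psi) <= S psi * B.
Proof. by move=> sp; exact: hsum_le (hsum_dist_series sp) (series_term_summable sp). Qed.

Lemma dist_series_linear (c : R[i]) phi psi : schwartz phi -> schwartz psi ->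
  dist_series (fun x => c * phi x + psi x) = c * dist_series phi + dist_series psi.
Proof.
move=> sp ss; apply: dist_seriesE.
have := hsum_linear c (hsum_dist_series sp) (hsum_dist_series ss); congr hsum.
apply/funext => k; rewrite (series_termE k sp) (series_termE k ss) /series_term /dist_of_fun.
have -> : (fun x => lam k * A k x * (c * phi x + psi x)) =
    (fun x => (c * lam k) * (A k x * phi x) + lam k * (A k x * psi x)).
  by apply/funext => x; ring.
rewrite cintegralD; last 2 first.
- by apply: cintegrableZ; exact: iA.
- by apply: cintegrableZ; exact: iA.
by rewrite !cintegralZ ?mulrA//; exact: iA.
Qed.

(** Continuity follows from |T psi| <= S psi B applied to the differences, with S tending to 0 along
    Schwartz convergence. *)
Lemma tempered_dist_series : tempered dist_series.
Proof.
split; first exact: dist_series_linear.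
move=> u phi su sp H.
have E k : dist_series (u k) - dist_series phi = dist_series (fun x => u k x - phi x).
  have := dist_series_linear (-1) sp (su k).
  have -> : (fun x => -1 * phi x + u k x) = (fun x => u k x - phi x).
    by apply/funext => x; ring.
  by move=> ->; ring.
have Sc := Scvg H.
apply: (@squeeze_cvgr _ _ _ _ (fun=> 0) (fun k => S (fun x => u k x - phi x) * B)).
- apply: nearW => k; rewrite cmod_ge0/= E; apply: dist_series_le.
  exact: schwartz_sub (su k) sp.
- exact: cvg_cst.
- by rewrite -[X in _ --> X](mul0r B); apply: cvgM => //; exact: cvg_cst.
Qed.

End dist_series.

(** * Fourier multipliers by transposition *)

Section fourier_pairing.
Context {R : realType} {n : nat} (n_gt0 : (0 < n)%N).
Local Notation mu := (lebesgue_rV n : {measure set 'rV[R]_n -> \bar R}).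
Local Notation rint A := (mu.-integrable setT (EFin \o A)).
Implicit Types (x y z xi : 'rV[R]_n) (a th phi : 'rV[R]_n -> R[i]).

Lemma Wt_integrable : rint (@Wt R n).
Proof.
have E : (@Wt R n) = (fun y => Wt (2 ^+ 0 *: (y - 0))).
  by apply/funext => y; rewrite expr0 scale1r subr0.
rewrite E; apply: rintegrable_ge0.
- exact: measurable_Wt_sub.
- by move=> x; exact: Wt_ge0.
- by apply: le_lt_trans (integral_Wt _ _) _; rewrite ltry.
Qed.

Lemma FT_bounded th : cintegrable th -> exists2 B : R, 0 <= B & forall z, cmod (FT th z) <= B.
Proof.
move=> ith; have [mth iA] := (cintegrableP th).1 ith.
exists (2 * \int[mu]_x cmod (th x)).
  by rewrite mulr_ge0// Rintegral_ge0// => x _; exact: cmod_ge0.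
move=> z; apply: cmod_cintegral => //; first exact: cmeas_expi_dot.
by move=> x; rewrite cmodM cmod_expi mul1r.
Qed.

(** The integrable weight [Wt] is inserted so that Fubini gives measurability, and divided out
    afterwards. *)
Lemma FT_cmeas th : cintegrable th -> cmeas (FT th).
Proof.
move=> ith; have [mth iA] := (cintegrableP th).1 ith.
pose F z xi := (Wt z)%:C%C * (expi (dot z xi) * th xi).
have mW : measurable_fun setT (@Wt R n).
  have := measurable_Wt_sub (1 : R) (0 : 'rV[R]_n); congr measurable_fun.
  by apply/funext => y; rewrite scale1r subr0.
have mF : cmeas (fun z : 'rV[R]_n * 'rV[R]_n => F z.1 z.2).
  apply: cmeasM; first by apply: cmeas_real; exact: measurableT_comp mW measurable_fst.
  apply: cmeasM; last exact: (cmeas_comp mth measurable_snd).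
  by apply: cmeas_expi; apply: measurable_dot.
have bF z xi : cmod (F z xi) <= Wt z * cmod (th xi).
  by rewrite !cmodM cmod_expi mul1r cmod_real ger0_norm ?Wt_ge0.
have [m1 _ _] := cfubini mF Wt_integrable iA bF.
have -> : FT th = (fun z => ((Wt z)^-1)%:C%C * cintegral (F z)).
  apply/funext => z; rewrite /F cintegralZ; last exact: cintegrable_expi.
  by rewrite mulrA -rmorphM mulVf ?mul1r// gt_eqF// Wt_gt0.
apply: cmeasM => //; apply: cmeas_real; apply: measurable_inv_ge0 => // z; exact: Wt_ge0.
Qed.

(** The function on the left is what theta(D) does to a test function by transposition; Fubini shows
    that it is phi convolved with the reflected kernel. The square collects the normalising
    constants of both transforms. *)
Lemma fourier_multiplier th phi x : cintegrable th -> cintegrable phi ->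
  fourier (fun xi => th xi * ifourier phi xi) x =
  ((2 * pi) `^ (- (n%:R / 2)))%:C%C ^+ 2 * cintegral (fun y => phi y * FT th (y - x)).
Proof.
move=> ith iphi; rewrite /fourier; set c := (_ %:C)%C.
have [mth iT] := (cintegrableP th).1 ith; have [mphi iP] := (cintegrableP phi).1 iphi.
pose F xi y := (expi (- dot xi x) * th xi) * (expi (dot xi y) * phi y).
have mF : cmeas (fun z : 'rV[R]_n * 'rV[R]_n => F z.1 z.2).
  apply: cmeasM; apply: cmeasM; try exact: (cmeas_comp mth measurable_fst).
  - by apply: cmeas_expi; apply: measurable_funN; apply: measurable_dot.
  - by apply: cmeas_expi; apply: measurable_dot.
  - exact: (cmeas_comp mphi measurable_snd).
have bF xi y : cmod (F xi y) <= cmod (th xi) * cmod (phi y).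
  by rewrite !cmodM !cmod_expi !mul1r.
have FE xi : cintegral (F xi) = expi (- dot xi x) * th xi * FT phi xi.
  by rewrite /F cintegralZ//; exact: cintegrable_expi.
have [B B0 HB] := FT_bounded iphi.
have i1 : cintegrable (fun xi => expi (- dot xi x) * th xi * FT phi xi).
  apply: (@cintegrable_le _ _ _ (fun xi => B * cmod (th xi))).
  - apply: cmeasM; last exact: FT_cmeas.
    by apply: cmeasM => //; apply: cmeas_expi; apply: measurable_funN; apply: measurable_dot.
  - under [X in _.-integrable _ X]eq_fun do rewrite /= EFinM; exact: integrableZl.
  - by move=> xi; rewrite !cmodM cmod_expi mul1r mulrC ler_wpM2r ?cmod_ge0.
rewrite expr2 -mulrA; congr (c * _).
transitivity (c * cintegral (fun xi => expi (- dot xi x) * th xi * FT phi xi)).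
  rewrite -cintegralZ//; congr cintegral; apply/funext => xi.
  by rewrite /ifourier -/c -/(FT phi xi); ring.
congr (c * _); transitivity (cintegral (fun xi => cintegral (F xi))).
  by congr cintegral; apply/funext => xi; rewrite FE.
have [_ _ ->] := cfubini mF iT iP bF; congr cintegral; apply/funext => y.
rewrite /FT -cintegralZ; last exact: cintegrable_expi.
congr cintegral; apply/funext => xi; rewrite /F.
have -> : dot (y - x) xi = - dot xi x + dot xi y by rewrite dotDl dotNl addrC !(dotC xi).
rewrite expiD; ring.
Qed.

(** Fubini moves the kernel from phi to a, which identifies theta(D) a with [atom_conv th a], up to
    the normalising constant. *)
Lemma multiplier_pairing a th phi : cintegrable a -> cintegrable th -> cintegrable phi ->
  [/\ cmeas (atom_conv th a),
    cintegrable (fun x => a x * fourier (fun xi => th xi * ifourier phi xi) x),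
    cintegrable (fun y => atom_conv th a y * phi y) &
    cintegral (fun x => a x * fourier (fun xi => th xi * ifourier phi xi) x) =
    ((2 * pi) `^ (- (n%:R / 2)))%:C%C ^+ 2 * cintegral (fun y => atom_conv th a y * phi y)].
Proof.
move=> ia ith iphi; set c2 := (_ ^+ 2).
have [mth iT] := (cintegrableP th).1 ith; have [mphi iP] := (cintegrableP phi).1 iphi.
have [ma iA] := (cintegrableP a).1 ia; have [B B0 HB] := FT_bounded ith.
have cE y : atom_conv th a y = cintegral (fun x => a x * FT th (y - x)).
  by have [_ _] := FT_swap y mth iT ma iA.
pose G y x := a x * FT th (y - x).
have mT : cmeas (fun z : 'rV[R]_n * 'rV[R]_n => FT th (z.1 - z.2)).
  apply: (cmeas_comp (FT_cmeas ith) (h := fun z : 'rV[R]_n * 'rV[R]_n => z.1 - z.2)).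
  apply: measurable_fun_rV => l; under eq_fun do rewrite !mxE.
  apply: measurable_funB.
    exact: (measurableT_comp (measurable_coord l) measurable_fst).
  exact: (measurableT_comp (measurable_coord l) measurable_snd).
have mconv : cmeas (atom_conv th a).
  pose F y x := (Wt y)%:C%C * G y x.
  have mW : measurable_fun setT (@Wt R n).
    have := measurable_Wt_sub (1 : R) (0 : 'rV[R]_n); congr measurable_fun.
    by apply/funext => y; rewrite scale1r subr0.
  have mF : cmeas (fun z : 'rV[R]_n * 'rV[R]_n => F z.1 z.2).
    apply: cmeasM; first by apply: cmeas_real; exact: measurableT_comp mW measurable_fst.
    by apply: cmeasM => //; exact: (cmeas_comp ma measurable_snd).
  have bF y x : cmod (F y x) <= Wt y * (B * cmod (a x)).
    rewrite !cmodM cmod_real ger0_norm ?Wt_ge0// ler_wpM2l ?Wt_ge0// mulrC.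
    by rewrite ler_wpM2r ?cmod_ge0.
  have iBA : rint (fun x => B * cmod (a x)).
    by under [X in _.-integrable _ X]eq_fun do rewrite /= EFinM; exact: integrableZl.
  have [m1 _ _] := cfubini mF Wt_integrable iBA bF.
  have iG y : cintegrable (G y).
    apply: (cintegrable_le _ iBA).
      apply: cmeasM => //; apply: (cmeas_comp (FT_cmeas ith)); exact: measurable_subl.
    by move=> x; rewrite cmodM mulrC ler_wpM2r ?cmod_ge0.
  have -> : atom_conv th a = (fun y => ((Wt y)^-1)%:C%C * cintegral (F y)).
    apply/funext => y; rewrite /F cintegralZ// cE.
    by rewrite mulrA -rmorphM mulVf ?mul1r// gt_eqF// Wt_gt0.
  apply: cmeasM => //; apply: cmeas_real; apply: measurable_inv_ge0 => // y; exact: Wt_ge0.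
have iBA : rint (fun x => B * cmod (a x)).
  by under [X in _.-integrable _ X]eq_fun do rewrite /= EFinM; exact: integrableZl.
have iaT y : cintegrable (fun x => a x * FT th (y - x)).
  apply: (cintegrable_le _ iBA).
    apply: cmeasM => //; apply: (cmeas_comp (FT_cmeas ith)); exact: measurable_subl.
  by move=> x; rewrite cmodM mulrC ler_wpM2r ?cmod_ge0.
have icp : cintegrable (fun y => atom_conv th a y * phi y).
  pose D := 2 * \int[mu]_x (B * cmod (a x)).
  apply: (@cintegrable_le _ _ _ (fun y => D * cmod (phi y))); first exact: cmeasM.
    by under [X in _.-integrable _ X]eq_fun do rewrite /= EFinM; exact: integrableZl.
  move=> y; rewrite cmodM ler_wpM2r ?cmod_ge0// cE; apply: cmod_cintegral => //.
    by have [] := (cintegrableP _).1 (iaT y).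
  by move=> x; rewrite cmodM mulrC ler_wpM2r ?cmod_ge0.
pose H x y := a x * (phi y * FT th (y - x)).
have mH : cmeas (fun z : 'rV[R]_n * 'rV[R]_n => H z.1 z.2).
  apply: cmeasM; first exact: (cmeas_comp ma measurable_fst).
  apply: cmeasM; first exact: (cmeas_comp mphi measurable_snd).
  apply: (cmeas_comp (FT_cmeas ith) (h := fun z : 'rV[R]_n * 'rV[R]_n => z.2 - z.1)).
  apply: measurable_fun_rV => l; under eq_fun do rewrite !mxE.
  apply: measurable_funB.
    exact: (measurableT_comp (measurable_coord l) measurable_snd).
  exact: (measurableT_comp (measurable_coord l) measurable_fst).
have iBP : rint (fun y => B * cmod (phi y)).
  by under [X in _.-integrable _ X]eq_fun do rewrite /= EFinM; exact: integrableZl.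
have bH x y : cmod (H x y) <= cmod (a x) * (B * cmod (phi y)).
  by rewrite !cmodM ler_wpM2l ?cmod_ge0// mulrC ler_wpM2r ?cmod_ge0.
have iK x : cintegrable (fun y => phi y * FT th (y - x)).
  apply: (cintegrable_le _ iBP).
    apply: cmeasM => //; apply: (cmeas_comp (FT_cmeas ith)); exact: (@measurable_translate _ _ (- x)).
  by move=> y; rewrite cmodM mulrC ler_wpM2r ?cmod_ge0.
have [m1 _ _] := cfubini mH iA iBP bH.
have i2 : cintegrable (fun x => cintegral (H x)).
  pose D := 2 * \int[mu]_y (B * cmod (phi y)).
  apply: (@cintegrable_le _ _ _ (fun x => D * cmod (a x))) => //.
    by under [X in _.-integrable _ X]eq_fun do rewrite /= EFinM; exact: integrableZl.
  move=> x; rewrite /H cintegralZ// cmodM mulrC ler_wpM2r ?cmod_ge0//.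
  apply: cmod_cintegral => //; first by have [] := (cintegrableP _).1 (iK x).
  by move=> y; rewrite cmodM mulrC ler_wpM2r ?cmod_ge0.
have -> : (fun x => a x * fourier (fun xi => th xi * ifourier phi xi) x) =
    (fun x => c2 * cintegral (H x)).
  by apply/funext => x; rewrite fourier_multiplier// -/c2 /H cintegralZ// mulrCA.
split => //; first exact: cintegrableZ.
rewrite cintegralZ//; congr (c2 * _); have [_ _ ->] := cfubini mH iA iBP bH; congr cintegral; apply/funext => y.
rewrite mulrC cE -cintegralZ//.
by congr cintegral; apply/funext => x; rewrite /H; ring.
Qed.

End fourier_pairing.

(** * Moment orders of the atoms *)

Section exponents.
Context {R : realType} {n : nat} (n_gt0 : (0 < n)%N).
Implicit Types (p s L : 'rV[R]_n -> R) (y : 'rV[R]_n).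

Lemma minr_lip (c a b : R) : `|Num.min c a - Num.min c b| <= `|a - b|.
Proof.
by have h := normr_ge0 (a - b); case: (leP c a) => ?; case: (leP c b) => ?; rewrite ler_norml;
  have := ler_norm (a - b); have := lerNnormlW (lexx `|a - b|); lra.
Qed.

Lemma log_osc_sigma p (b : R) : 0 < b -> (forall x, b <= p x) -> log_osc p -> log_osc (sigma p).
Proof.
move=> b0 bp op; have b1 : 0 < Num.min 1 b by rewrite lt_min ltr01.
have om : log_osc (fun x => Num.min 1 (p x)).
  by apply: (log_osc_lip ler01 op) => x y; rewrite mul1r; exact: minr_lip.
have bm x : Num.min 1 b <= Num.min 1 (p x) by rewrite le_min2.
have oi := log_osc_inv b1 bm om.
apply: (log_osc_lip (ler0n _ n) oi) => x y; rewrite /sigma -mulrBr normrM ger0_norm//.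
by rewrite (_ : _ - 1 - _ = (Num.min 1 (p x))^-1 - (Num.min 1 (p y))^-1)//; lra.
Qed.

(** The order is floor + 1, which exceeds the infimum; if floor + 1 is negative, the infimum is
    below the order 0. *)
Lemma atom_order_lower L nu (m : 'rV[int]_n) : (0 < nu)%N ->
  fine (ess_inf_cube L nu m) <= (atom_order nu (Num.floor (fine (ess_inf_cube L nu m))))%:R.
Proof.
case: nu => // nu _; set t := fine _; have := floorD1_gt t.
rewrite /atom_order; case: (Num.floor t + 1) => [N|N] h; first exact/ltW.
by apply/ltW/(lt_le_trans h); rewrite lerz0.
Qed.

(** L is bounded, so only finitely many orders occur, and constants that depend on the order can be
    replaced by their sum. *)
Lemma atom_order_upper L : log_osc L -> exists D : nat, forall nu (m : 'rV[int]_n),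
  (atom_order nu (Num.floor (fine (ess_inf_cube L nu m))) <= D)%N.
Proof.
move=> oL; have [C C0 HC] := ess_inf_cube_near oL; have [B B0 HB] := log_osc_bounded oL.
have D0 : 0 <= `|L 0| + B + C + 1 by rewrite !addr_ge0.
exists (Num.bound (`|L 0| + B + C + 1)) => nu m; rewrite /atom_order; case: nu => // nu.
set t := fine _; case E : (Num.floor t + 1) => [N|//].
have /andP[_ h] := HC nu.+1 m _ (ccenter_cube nu.+1 m); rewrite -/t in h.
have := HB (ccenter nu.+1 m) 0; rewrite ler_norml => /andP[_ h2].
have h3 : C / (nu.+1%:R + 1) <= C.
  by rewrite ler_pdivrMr ?ltr_wpDl// ler_peMr// lerDr.
have h4 : (N%:R : R) <= t + 1.
  have := ge_floor t; rewrite (_ : Num.floor t = N%:Z - 1); last by rewrite -E addrK.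
  by rewrite intrB lerBlDr.
rewrite -(ler_nat R); apply: le_trans h4 _; apply/ltW/(le_lt_trans _ (archi_boundP D0)).
have := ler_norm (L 0); lra.
Qed.

End exponents.

Section atoms_decay.
Context {R : realType} {n : nat} (n_gt0 : (0 < n)%N).
Variables (gam : R) (K D : nat) (L : 'rV[R]_n -> R) (theta : nat -> 'rV[R]_n -> R[i])
  (a : nat -> 'rV[int]_n -> 'rV[R]_n -> R[i]).
Hypotheses (g0 : 0 < gam) (theta_Phi : Phi theta) (aP : smooth_atoms gam K L a).
Local Notation N := (fun nu m => atom_order nu (Num.floor (fine (ess_inf_cube L nu m)))).
Hypothesis ND : forall nu m, (N nu m <= D)%N.
Implicit Types (m : 'rV[int]_n) (y : 'rV[R]_n).

Lemma ler_sum_term (F : nat -> R) d : (forall i, 0 <= F i) -> (d <= D)%N ->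
  F d <= \sum_(i < D.+1) F i.
Proof.
move=> F0 dD; have dD' : (d < D.+1)%N by [].
by rewrite (bigD1 (Ordinal dD'))//= lerDl; apply: sumr_ge0.
Qed.

Lemma conv_decay M : exists2 C : R, 0 <= C & forall j nu m y,
  cmod (atom_conv (theta j) (a nu m) y) <= C * decay (R := R) N K M j nu m y.
Proof.
have /choice[A HA] : forall d, exists C : R, 0 <= C /\ forall j nu c b y, (j <= nu)%N ->
    cmeas b -> bsupp 1 c (gam * 2 ^- nu) b ->
    (forall be, (mdeg be < d)%N -> cintegral (fun x => (monom be x)%:C%C * b x) = 0) ->
    cmod (atom_conv (theta j) b y) <=
      C * (2 ^+ j * 2 ^- nu) ^+ (n + d) * (1 + 2 ^+ j * `|y - c|) ^- M.
  by move=> d; have [C C0 H] := conv_moments n_gt0 theta_Phi d M g0; exists C.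
have [B B0 HB] := conv_smooth n_gt0 theta_Phi K M g0.
have A0 d : 0 <= A d by have [] := HA d.
have S0 : 0 <= \sum_(i < D.+1) A i by apply: sumr_ge0 => i _.
exists (\sum_(d < D.+1) A d + B) => [|j nu m y]; first exact: addr_ge0.
have := decay_ge0 N K M j nu m y; rewrite /decay; case: leqP => [jn|nj] d0.
- have [_ H] := HA (N nu m).
  apply: le_trans (H _ _ _ _ y jn (atom_cmeas (aP nu m))
    (atom_bsupp n_gt0 (ltW g0) (aP nu m)) (atom_moments (aP nu m))) _.
  rewrite -mulrA ler_wpM2r//; apply: le_trans (ler_sum_term A0 (ND nu m)) _.
  by rewrite lerDl.
- case: j nj d0 => // k nk d0; have nk' : (nu <= k)%N by [].
  apply: le_trans (HB _ _ _ _ y nk' (fun i l lK => atom_derivs (ltW g0) (aP nu m) i lK)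
    (fun i l lK => atom_pd (aP nu m) i lK)) _.
  by rewrite -mulrA ler_wpM2r// lerDr.
Qed.

(** The bound has the form of [decay] at j = 0 and x = 0, so the convergence of the atomic series is
    a case of the estimates made for the norm. *)
Lemma pair_decay M : exists2 C : R, 0 <= C & forall nu m (phi : 'rV[R]_n -> R[i]), schwartz phi ->
  cmod (cintegral (fun x => a nu m x * phi x)) <=
  (C * \sum_(i < D.+1) snorm M i phi) * decay (R := R) N K M 0 nu m 0.
Proof.
have /choice[A HA] : forall d, exists C : R, 0 <= C /\ forall k l nu m (b phi : 'rV[R]_n -> R[i]),
    is_atom gam k l nu m b -> atom_order nu l = d -> schwartz phi ->
    cmod (cintegral (fun x => b x * phi x)) <=
    C * snorm M d phi * (2 ^- nu) ^+ (n + d) * (1 + `|ccenter nu m : 'rV[R]_n|) ^- M.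
  by move=> d; have [C C0 H] := @atom_pairing R n n_gt0 gam M d (ltW g0); exists C.
have A0 d : 0 <= A d by have [] := HA d.
have S0 : 0 <= \sum_(i < D.+1) A i by apply: sumr_ge0 => i _.
exists (\sum_(d < D.+1) A d) => // nu m phi sp; have := decay_ge0 N K M 0 nu m (0 : 'rV[R]_n).
rewrite /decay leq0n sub0r normrN expr0 !mul1r => d0; have [_ H] := HA (N nu m).
apply: le_trans (H _ _ _ _ _ _ (aP nu m) erefl sp) _; rewrite -mulrA ler_wpM2r//.
apply: ler_pM; rewrite ?snorm_ge0//; first exact: ler_sum_term.
by apply: (ler_sum_term (F := fun i => snorm M i phi)) => // i; exact: snorm_ge0.
Qed.

End atoms_decay.

(** * Series of functions and their pairings *)

Section function_series.
Context {R : realType} {n : nat}.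
Local Notation mu := (lebesgue_rV n : {measure set 'rV[R]_n -> \bar R}).
Local Notation rint A := (mu.-integrable setT (EFin \o A)).
Variables (I : countType) (F : I -> 'rV[R]_n -> R[i]) (B : R).
Hypothesis mF : forall k, cmeas (F k).
Hypothesis sF : forall y, csummable (F ^~ y) B.
Implicit Types (phi : 'rV[R]_n -> R[i]) (y : 'rV[R]_n).

Definition fun_series y : R[i] := xget 0 [set z | hsum (F ^~ y) z].

Lemma hsum_fun_series y : hsum (F ^~ y) (fun_series y).
Proof. exact: (xgetPex 0 (csummable_hsum (sF y))). Qed.

Lemma fun_series_first_terms y :
  ccvg (fun k => \sum_(i <- first_terms k) F i y) (fun_series y).
Proof. by apply/ccvg_cmod; exact: hsum_first_terms (hsum_fun_series y). Qed.

Lemma cmeas_fun_series : cmeas fun_series.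
Proof.
apply: (@cmeas_cvg _ _ _ (fun k y => \sum_(i <- first_terms k) F i y)).
  by move=> k; exact: cmeas_sum.
exact: fun_series_first_terms.
Qed.

Lemma term_cintegrable phi k : cintegrable phi -> cintegrable (fun y => F k y * phi y).
Proof.
move=> /cintegrableP[mphi iP].
have iBP : rint (fun y => B * cmod (phi y)).
  by under [X in _.-integrable _ X]eq_fun do rewrite /= EFinM; exact: integrableZl.
apply: (cintegrable_le _ iBP); first exact: cmeasM.
move=> y; rewrite cmodM ler_wpM2r ?cmod_ge0//.
by have := sF y (s := [:: k]) isT; rewrite big_seq1.
Qed.

Lemma sum_cintegral_le phi (s : seq I) : cintegrable phi -> uniq s ->
  \sum_(k <- s) cmod (cintegral (fun y => F k y * phi y)) <= 2 * (B * \int[mu]_y cmod (phi y)).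
Proof.
move=> iphi us; have [mphi iP] := (cintegrableP phi).1 iphi.
pose A k y := cmod (F k y * phi y).
have iA k : rint (A k) by have [] := (cintegrableP _).1 (term_cintegrable k iphi).
have Ar k : cintegrable (fun y => (A k y)%:C%C).
  apply: (cintegrable_le _ (iA k)).
    by apply: cmeas_real; apply: measurable_cmod; exact: cmeasM.
  by move=> y; rewrite cmod_real ger0_norm// cmod_ge0.
have [iS eS] := @cintegral_sum _ _ _ s _ Ar.
apply: (@le_trans _ _ (2 * \sum_(k <- s) \int[mu]_y A k y)).
  rewrite mulr_sumr; apply: ler_sum => k _; apply: cmod_cintegral => //.
  by have [] := (cintegrableP _).1 (term_cintegrable k iphi).
rewrite ler_wpM2l//.
have -> : \sum_(k <- s) \int[mu]_y A k y = \int[mu]_y \sum_(k <- s) A k y.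
  have E (z : seq I) y : complex.Re (\sum_(k <- z) (A k y)%:C%C) = \sum_(k <- z) A k y.
    by rewrite (big_morph _ (@cReD R) (erefl : complex.Re 0 = 0)).
  have := congr1 (@complex.Re R) eS; rewrite (big_morph _ (@cReD R) (erefl : complex.Re 0 = 0)) /=.
  by move=> <-; congr (Rintegral _ _ _); apply/funext => y; rewrite E.
rewrite -RintegralZl//; apply: le_Rintegral => //.
- have := iS.1; congr (_.-integrable _ _); apply/funext => y; congr EFin.
  by rewrite (big_morph _ (@cReD R) (erefl : complex.Re 0 = 0)).
- by under [X in _.-integrable _ X]eq_fun do rewrite /= EFinM; exact: integrableZl.
move=> y _; rewrite /A; under eq_bigr do rewrite cmodM.
by rewrite -mulr_suml ler_wpM2r ?cmod_ge0//; exact: sF.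
Qed.

(** Dominated convergence along the enumeration gives the integral of the sum; the pairings are
    absolutely summable, so their unordered sum is the same limit. *)
Lemma fun_series_pairing phi : cintegrable phi ->
  cintegrable (fun y => fun_series y * phi y) /\
  hsum (fun k => cintegral (fun y => F k y * phi y)) (cintegral (fun y => fun_series y * phi y)).
Proof.
move=> iphi; have [mphi iP] := (cintegrableP phi).1 iphi.
have iBP : rint (fun y => B * cmod (phi y)).
  by under [X in _.-integrable _ X]eq_fun do rewrite /= EFinM; exact: integrableZl.
pose P k y := \sum_(i <- first_terms k) (F i y * phi y).
have mP k : cmeas (P k) by apply: cmeas_sum => i; exact: cmeasM.
have cP y : ccvg (P ^~ y) (fun_series y * phi y).
  apply/ccvg_cmod; have := (ccvg_cmod _ _).1 (fun_series_first_terms y) => H.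
  have -> : (fun k => cmod (P k y - fun_series y * phi y)) =
      (fun k => cmod (\sum_(i <- first_terms k) F i y - fun_series y) * cmod (phi y)).
    by apply/funext => k; rewrite -cmodM mulrBl mulr_suml.
  by rewrite -[X in _ --> X](mul0r (cmod (phi y))); apply: cvgM => //; exact: cvg_cst.
have bP k y : cmod (P k y) <= B * cmod (phi y).
  rewrite /P -mulr_suml cmodM ler_wpM2r ?cmod_ge0//.
  by apply: le_trans (cmod_sum _ _ _) _; exact: (sF y (first_terms_uniq k)).
have [iG cG] := cdominated mP cP iBP bP; split => //.
have [z Hz] := csummable_hsum (fun s us => sum_cintegral_le iphi us).
have := (ccvg_cmod _ _).2 (hsum_first_terms Hz).
have -> : (fun N => \sum_(k <- first_terms N) cintegral (fun y => F k y * phi y)) =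
    (fun N => cintegral (P N)).
  apply/funext => N; rewrite /P; symmetry.
  by have [] := @cintegral_sum _ _ _ (first_terms N) _ (fun k => term_cintegrable k iphi).
case=> [cR cI]; case: cG => [gR gI].
suff -> : cintegral (fun y => fun_series y * phi y) = z by [].
by apply: complex_eqP; [exact: (cvg_unique _ gR cR)|exact: (cvg_unique _ gI cI)].
Qed.

End function_series.

(** * The atomic sum and its Littlewood-Paley layers *)

Section atomic_sum.
Context {R : realType} {n : nat} (n_gt0 : (0 < n)%N).
Local Notation I := (nat * 'rV[int]_n)%type.
Variables (gam : R) (K D M : nat) (L : 'rV[R]_n -> R) (theta : nat -> 'rV[R]_n -> R[i])
  (a : nat -> 'rV[int]_n -> 'rV[R]_n -> R[i]) (lam : nat -> 'rV[int]_n -> R[i]).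
Variables (dec : nat -> I -> 'rV[R]_n -> R) (C1 C2 : R).
Hypotheses (g0 : 0 < gam) (theta_Phi : Phi theta) (aP : smooth_atoms gam K L a).
Hypotheses (C10 : 0 <= C1) (C20 : 0 <= C2).
Hypothesis conv_le : forall j (k : I) y,
  cmod (atom_conv (theta j) (a k.1 k.2) y) <= C1 * dec j k y.
Hypothesis pair_le : forall (k : I) phi, schwartz phi ->
  cmod (cintegral (fun x => a k.1 k.2 x * phi x)) <=
  (C2 * \sum_(i < D.+1) snorm M i phi) * dec 0%N k 0.
Hypothesis lam_dec : forall j, exists B, forall y (r : seq I), uniq r ->
  \sum_(k <- r) cmod (lam k.1 k.2) * dec j k y <= B.
Implicit Types (phi psi : 'rV[R]_n -> R[i]) (y : 'rV[R]_n).

Let atom (k : I) := a k.1 k.2.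
Let coef (k : I) := lam k.1 k.2.
Let S phi := C2 * \sum_(i < D.+1) snorm M i phi.
Let c2 : R[i] := ((2 * pi) `^ (- (n%:R / 2)))%:C%C ^+ 2.

Definition atom_sum := dist_series atom coef.
Definition level_sum nu := dist_series (a nu) (lam nu).
Definition layer j : 'rV[R]_n -> R[i] :=
  fun_series (fun k y => coef k * (c2 * atom_conv (theta j) (atom k) y)).

Let iA (k : I) psi : schwartz psi -> cintegrable (fun x => atom k x * psi x).
Proof. exact: (atom_cintegrable_schwartz n_gt0 (ltW g0) (aP k.1 k.2)). Qed.

Let S0 psi : 0 <= S psi.
Proof. by rewrite mulr_ge0// sumr_ge0// => i _; exact: snorm_ge0. Qed.

Let Scvg (u : nat -> 'rV[R]_n -> R[i]) :
  (forall al be, schwartz_seminorm al be (u k) @[k --> \oo] --> 0%E) ->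
  S (u k) @[k --> \oo] --> (0 : R).
Proof.
move=> H; rewrite -[X in _ --> X](mulr0 C2); apply: cvgM; first exact: cvg_cst.
by apply: sum_cvg0 => i; exact: snorm_cvg0.
Qed.

Let pair_le' (k : I) psi : schwartz psi ->
  cmod (cintegral (fun x => atom k x * psi x)) <= S psi * dec 0%N k 0.
Proof. exact: pair_le. Qed.

Let level_le B nu : (forall y (r : seq I), uniq r ->
    \sum_(k <- r) cmod (lam k.1 k.2) * dec 0%N k y <= B) ->
  forall r : seq 'rV[int]_n, uniq r ->
  \sum_(m <- r) cmod (lam nu m) * dec 0%N (nu, m) 0 <= B.
Proof.
move=> H r ur; have := H 0 [seq (nu, m) | m <- r]; rewrite big_map; apply.
by rewrite map_inj_uniq// => m m' [].
Qed.

Lemma tempered_atom_sum : tempered atom_sum.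
Proof.
have [B HB] := lam_dec 0%N.
exact: tempered_dist_series iA pair_le' S0 Scvg (HB 0).
Qed.

Lemma double_sum_atom_sum : double_sum (atomic_series lam a) atom_sum.
Proof.
have [B HB] := lam_dec 0%N; exists level_sum; split.
- move=> nu; apply: (tempered_dist_series (w := fun m => dec 0%N (nu, m) 0) (S := S) (B := B)).
  + by move=> m psi; exact: (iA (nu, m)).
  + by move=> m psi; exact: (pair_le' (nu, m)).
  + exact: S0.
  + exact: Scvg.
  + exact: level_le.
- move=> nu phi sp; apply: hsum_totally.
  apply: (hsum_dist_series (w := fun m => dec 0%N (nu, m) 0) (S := S) (B := B)) => //.
  + by move=> m psi; exact: (iA (nu, m)).
  + by move=> m psi; exact: (pair_le' (nu, m)).
  + exact: level_le.
- move=> phi sp; refine (hsum_iterated (u := series_term atom coef phi) (zs := fun nu => level_sum nu phi) _ _).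
    exact: hsum_dist_series iA pair_le' S0 (HB 0) _ sp.
  move=> nu; apply: (hsum_dist_series (w := fun m => dec 0%N (nu, m) 0) (S := S) (B := B)) => //.
  + by move=> m psi; exact: (iA (nu, m)).
  + by move=> m psi; exact: (pair_le' (nu, m)).
  + exact: level_le.
Qed.

Let layer_term_le j y b : (forall r : seq I, uniq r ->
    \sum_(k <- r) cmod (lam k.1 k.2) * dec j k y <= b) ->
  csummable (fun k => coef k * (c2 * atom_conv (theta j) (atom k) y)) (cmod c2 * C1 * b).
Proof.
move=> H r ur; apply: le_trans (ler_wpM2l _ (H r ur)); last by rewrite mulr_ge0// cmod_ge0.
rewrite mulr_sumr; apply: ler_sum => k _; rewrite cmodM (cmodM c2).
rewrite [leRHS]mulrCA -[X in _ <= _ * X]mulrA; do 2 (rewrite ler_wpM2l ?cmod_ge0//).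
exact: conv_le.
Qed.

Lemma layer_le j y b : (forall r : seq I, uniq r ->
    \sum_(k <- r) cmod (lam k.1 k.2) * dec j k y <= b) ->
  cmod (layer j y) <= cmod c2 * C1 * b.
Proof.
move=> H; have [B HB] := lam_dec j.
exact: hsum_le (hsum_fun_series (fun y => layer_term_le (HB y)) y) (layer_term_le H).
Qed.

(** Both sides are unordered sums of the same terms, by [multiplier_pairing]. The transposed test
    function enters through [dist_seriesE], which evaluates the series at any function whose
    unordered sum is exhibited. *)
Lemma layer_represents j : represents (layer j) (multiplier (theta j) atom_sum).
Proof.
have [B HB] := lam_dec j.
have [Bt Bt0 HBt] := theta_bsupp theta_Phi.
have r0 : 0 <= 2 * 2 ^+ j :> R by rewrite mulr_ge0 ?exprn_ge0.
have ith := (bsupp_cintegrable r0 (theta_cmeas theta_Phi j) (HBt j)).1.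
have iat k : cintegrable (atom k) by exact: (atom_cintegrable n_gt0 (ltW g0) (aP k.1 k.2)).
have mF k : cmeas (fun y => coef k * (c2 * atom_conv (theta j) (atom k) y)).
  apply: cmeasM; first exact: cmeas_cst.
  apply: cmeasM; first exact: cmeas_cst.
  by have [] := multiplier_pairing (iat k) ith ith.
have sF y := layer_term_le (HB y).
split; first exact: cmeas_fun_series mF sF.
move=> phi sp; have iphi := schwartz_cintegrable n_gt0 sp.
have [i1 H1] := fun_series_pairing mF sF iphi; split => //.
rewrite /multiplier /difourier /dmul /dfourier; apply: dist_seriesE.
have := H1; congr (hsum _ _); apply/funext => k; symmetry.
have [_ i2 i3 E] := multiplier_pairing (iat k) ith iphi.
rewrite /series_term /dist_of_fun.
under eq_fun do rewrite -mulrA.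
rewrite cintegralZ// E -/c2 -!cintegralZ//; last exact: cintegrableZ.
by congr cintegral; apply/funext => y; ring.
Qed.

End atomic_sum.

(** * From the pointwise bounds to the norm estimate *)

Section synthesis_pointwise.
Context {R : realType} {n : nat}.
Local Notation I := (nat * 'rV[int]_n)%type.

Lemma esum_bound_seq (w E l : R) (u dec : I -> R) (r : seq I) : 0 < w -> 0 < l -> uniq r ->
  (forall k, 0 <= u k) -> (forall k, 0 <= dec k) ->
  (\esum_(k in [set: I]) (w * (u k / l * dec k))%:E <= E%:E)%E ->
  \sum_(k <- r) u k * dec k <= l * E / w.
Proof.
move=> w0 l0 ur u0 d0 H.
have t0 k : 0 <= w * (u k / l * dec k) by rewrite !mulr_ge0 ?invr_ge0// ltW.
have := le_trans (le_esum_seq ur t0) H; rewrite lee_fin => h.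
rewrite ler_pdivlMr// mulrC mulr_sumr -ler_pdivrMl//; apply: le_trans h.
rewrite mulr_sumr le_eqVlt; apply/orP; left; apply/eqP/eq_bigr => k _; ring.
Qed.

(** For fixed j the right side is the same for all x: T is bounded, s has bounded oscillation, and t
    <= 1 makes the factor in the denominator at least 1. *)
Lemma modular_weights_bounded (b C l Cs t pm : R) (j : nat) (qx px sx Tx s0 : R) :
  0 < C -> 0 < l -> 0 < qx -> 0 < pm -> pm <= px -> 0 < t <= 1 -> 0 <= Tx -> Tx <= b ->
  `|sx - s0| <= Cs ->
  l * (C * Tx `^ px^-1) / (2 `^ (j%:R * sx) * t `^ (- qx^-1)) <=
  l * (C * (1 + `|b|) `^ pm^-1) * 2 `^ (j%:R * (`|s0| + Cs)).
Proof.
move=> C0 l0 q0 pm0 pp /andP[t0 t1] T0 Tb sC.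
have px0 := lt_le_trans pm0 pp.
have hT : Tx `^ px^-1 <= (1 + `|b|) `^ pm^-1.
  have b1 : 1 <= 1 + `|b| by rewrite lerDl.
  apply: (@le_trans _ _ ((1 + `|b|) `^ px^-1)).
    apply: ge0_ler_powR; rewrite ?nnegrE ?invr_ge0 ?(ltW px0)//.
    by apply: le_trans Tb _; have := ler_norm b; lra.
  by apply: ler_powR => //; rewrite lef_pV2 ?posrE.
have ht : 1 <= t `^ (- qx^-1).
  rewrite powRN invf_ge1 ?powR_gt0//.
  have E1 : 1 `^ qx^-1 = 1 :> R by rewrite powR1.
  rewrite -[leRHS]E1; apply: ge0_ler_powR; rewrite ?nnegrE ?invr_ge0 ?(ltW q0) ?(ltW t0)//.
have h2 : (2 `^ (j%:R * sx))^-1 <= 2 `^ (j%:R * (`|s0| + Cs)).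
  rewrite -powRN; apply: ler_powR; first by rewrite ler1n.
  rewrite -mulrN ler_wpM2l//; move: sC; rewrite ler_norml => /andP[h _].
  have := ler_norm (- s0); rewrite normrN; lra.
rewrite invfM [leLHS]mulrA; apply: (@le_trans _ _ (l * (C * Tx `^ px^-1) * (2 `^ (j%:R * sx))^-1)).
  by rewrite ler_piMr ?invf_le1 ?powR_gt0// !mulr_ge0 ?powR_ge0 ?invr_ge0 ?powR_ge0 ?(ltW l0) ?(ltW C0).
apply: ler_pM; rewrite ?mulr_ge0 ?powR_ge0 ?invr_ge0 ?powR_ge0 ?(ltW l0) ?(ltW C0)//.
by rewrite ler_wpM2l ?(ltW l0)// ler_wpM2l ?(ltW C0).
Qed.

End synthesis_pointwise.

Theorem theorem4p7 (R : realType) (n : nat) (n_gt0 : (0 < n)%N)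
    (p q s : 'rV[R]_n -> R)
    (p_P0 : P0 p) (p_log : Clog p) (q_P0 : P0 q) (q_log : Clog q)
    (s_log : Clog s)
    (theta : nat -> 'rV[R]_n -> R[i]) (theta_Phi : Phi theta)
    (gamma : R) (gamma_gt1 : 1 < gamma)
    (a : nat -> 'rV[int]_n -> 'rV[R]_n -> R[i])
    (a_atoms : besov_atoms gamma s p a) :
  exists2 C : R, 0 < C &
    forall lam : nat -> 'rV[int]_n -> R[i],
      (b_norm s p q lam < +oo)%E ->
      exists f : ('rV[R]_n -> R[i]) -> R[i],
        [/\ tempered f,
            double_sum (atomic_series lam a) f &
            (besov_norm theta s p q f <= C%:E * b_norm s p q lam)%E].
Proof.
have g0 : 0 < gamma := lt_trans ltr01 gamma_gt1.
have [K [eps0 [eps00 sK0 aP]]] := a_atoms.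
have op := Clog_log_osc n_gt0 p_log; have oq := Clog_log_osc n_gt0 q_log.
have os := Clog_log_osc n_gt0 s_log.
have [pm pm0 pmp] := P0_lower p_P0 op; have [qm qm0 qmq] := P0_lower q_P0 oq.
have [e1 e10 sK1] := ess_sup_lt_gap os sK0.
(* One margin for both the moments and the smoothness K > s. *)
pose eps := Num.min eps0 e1.
have eps_gt0 : 0 < eps by rewrite lt_min eps00.
have sK x : s x <= K%:R - eps.
  by apply: le_trans (sK1 x) _; rewrite lerD2l lerN2 ge_min lexx orbT.
pose L x := sigma p x - s x + eps0.
have oL : log_osc L.
  apply: log_oscD; last by exists 0 => // i x y; rewrite subrr normr0 mulr0 mul0r.
  apply: log_oscD; first exact: log_osc_sigma pm0 pmp op.
  by apply: (log_osc_lip ler01 os) => x y; rewrite -opprD normrN mul1r.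
have [D ND] := atom_order_upper oL.
have [CN CN0 HCN] := ess_inf_cube_near oL.
(* Here n + sigma_p = n / min(1, p), so the order at least L turns into the exponent required by
   [core_term]. *)
have NE nu m (y : 'rV[R]_n) : (0 < nu)%N -> cube nu m y ->
    n%:R / Num.min 1 (p y) - s y + eps - CN / (nu%:R + 1) <=
    (n + atom_order nu (Num.floor (fine (ess_inf_cube L nu m))))%:R.
  move=> nu0 ym; have := atom_order_lower L m nu0; have /andP[+ _] := HCN nu m y ym.
  have : eps <= eps0 by rewrite ge_min lexx.
  rewrite natrD /L /sigma; lra.
have [M [C [C0 HC]]] := synthesis_bound op oq os eps_gt0 pm0 pmp qm0 qmq sK CN0 NE.
have [C1 C10 HC1] := conv_decay n_gt0 g0 theta_Phi aP ND M.
have [C2 C20 HC2] := pair_decay n_gt0 g0 aP ND M.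
pose dec j (k : nat * 'rV[int]_n) (y : 'rV[R]_n) := decay (fun nu m =>
  atom_order nu (Num.floor (fine (ess_inf_cube L nu m)))) K M j k.1 k.2 y.
pose c2 : R[i] := ((2 * pi) `^ (- (n%:R / 2)))%:C%C ^+ 2.
(* The added 1 makes the constant positive even if C1 = 0. *)
have Cf0 : 0 < cmod c2 * C1 * C + 1.
  have : 0 <= cmod c2 * C1 * C by rewrite !mulr_ge0 ?cmod_ge0// ltW.
  lra.
exists (cmod c2 * C1 * C + 1) => // lam lam_fin.
have weight0 j x (t : R) : 0 < t -> 0 < 2 `^ (j%:R * s x) * t `^ (- (q x)^-1).
  by move=> t0; rewrite mulr_gt0 ?powR_gt0.
(* Finiteness of the norm yields one admissible l, which suffices for absolute convergence with a
   bound uniform in y. *)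
have lam_dec j : exists B, forall y (r : seq (nat * 'rV[int]_n)), uniq r ->
    \sum_(k <- r) cmod (lam k.1 k.2) * dec j k y <= B.
  have [_ [l [l0 Hl] <-] _] := ereal_inf_lt lam_fin.
  have [tau [T [tau01 _ HT HE]]] := HC lam l l0 Hl.
  have [_ T0 [b Tb] _] := HT j; have [Cs _ HCs] := log_osc_bounded os.
  have /andP[t0 _] := tau01 j.
  exists (l * (C * (1 + `|b|) `^ pm^-1) * 2 `^ (j%:R * (`|s 0| + Cs))) => y r ur.
  apply: le_trans (esum_bound_seq (weight0 j y _ t0) l0 ur
    (fun k => cmod_ge0 _) (fun k => decay_ge0 _ _ _ _ _ _ _) (HE j y)) _.
  apply: modular_weights_bounded => //; exact: lt_le_trans (qmq y).
have conv_le j (k : nat * 'rV[int]_n) y :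
    cmod (atom_conv (theta j) (a k.1 k.2) y) <= C1 * dec j k y by exact: HC1.
exists (atom_sum a lam); split.
- exact: (tempered_atom_sum n_gt0 g0 aP C20 (fun k => HC2 k.1 k.2) lam_dec).
- exact: (double_sum_atom_sum n_gt0 g0 aP C20 (fun k => HC2 k.1 k.2) lam_dec).
have rep := layer_represents n_gt0 g0 theta_Phi aP C10 conv_le lam_dec.
(* The estimate is proved with each admissible l in place of the norm of lambda; the distribution is
   fixed, while tau and T change with l. *)
rewrite -lee_pdivrMl//; apply: le_ereal_inf_tmp => _ [l [l0 Hl] <-].
rewrite lee_pdivrMl// -EFinM.
have [tau [T [tau01 Stau HT HE]]] := HC lam l l0 Hl.
have tau0 j : 0 < tau j by have /andP[] := tau01 j.
apply: (@le_trans _ _ (lqLp_norm q p (fun j x => (2 `^ (j%:R * s x))%:C%C * layer theta a lam j x))).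
  by apply: ereal_inf_lbound; exists (layer theta a lam).
apply: (lqLp_norm_le op oq pm0 pmp qm0 qmq l0 Cf0 tau0 Stau HT) => [j|j x].
  apply: cmeasM; last by have [] := rep j.
  apply: cmeas_real; apply: measurable_powR2 => //; apply: measurable_funM => //.
  exact: log_osc_measurable.
have qx0 : 0 < q x := lt_le_trans qm0 (qmq x).
have w0 := weight0 j x _ (tau0 j).
have := layer_le C10 conv_le lam_dec (fun r ur => esum_bound_seq w0 l0 ur
    (fun k => cmod_ge0 _) (fun k => decay_ge0 _ _ _ _ _ _ _) (HE j x)).
rewrite -/c2 cmodM cmod_real ger0_norm ?powR_ge0// => h.
have -> : tau j `^ (- (q x)^-1) * (2 `^ (j%:R * s x) * cmod (layer theta a lam j x) / l) =
    cmod (layer theta a lam j x) * (2 `^ (j%:R * s x) * tau j `^ (- (q x)^-1)) / l by ring.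
rewrite ler_pdivrMr//; apply: le_trans (ler_wpM2r (ltW w0) h) _.
rewrite [leLHS](_ : _ = cmod c2 * C1 * (l * (C * T j x `^ (p x)^-1))); last first.
  by rewrite -[LHS]mulrA divfK// gt_eqF.
have : 0 <= l * T j x `^ (p x)^-1 by rewrite mulr_ge0 ?powR_ge0// ltW.
move: (T j x `^ _) (cmod c2) => u v; clear; lra.
Qed.
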